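(* Let $f:\mathbb{C}\to S^{2n}_1$ be a superconformal harmonic map such that the elements $f_1,\ldots,f_n$ of the harmonic sequence of $f$ are everywhere defined, and such that the root space coefficients $c_j$ of a cyclic primitive frame of $f$ are such that $c_0c_1^2c_2^2\cdots c_{n-1}^2c_n$ is constant. Then $f$ has a lift $\psi:\mathbb{C}\to SO(2n,1)/T$ possessing a Toda frame with respect to any appropriately normalised cyclic element $W$. If $f$ is doubly periodic with respect to some lattice $\Lambda\subset\mathbb{C}$, then the condition that $c_0c_1^2\cdots c_{n-1}^2c_n$ is constant is automatically satisfied, and furthermore the lift $\psi$ is periodic with respect to $\Lambda$.
   Context: **De Sitter space.** $\mathbb{R}^{2n,1}$ is $\mathbb{R}^{2n+1}$ with inner product $x^t\upsilon y$, $\upsilon=\mathrm{diag}(1,\ldots,1,-1)$, and $S^{2n}_1=\{x: x^t\upsilon x=1\}$. $\langle\cdot,\cdot\rangle$ denotes the complex bilinear extension to $\mathbb{C}^{2n+1}$, and $\|v\|^2=\langle v,\bar v\rangle$. $e_1,\ldots,e_{2n+1}$ is the standard basis. A smooth map $f:\mathbb{C}\to S^{2n}_1$ (coordinate $z$) is harmonic iff $\partial_z\partial_{\bar z}f$ is everywhere a multiple of $f$. **Superconformal; harmonic sequence.** The isotropy order of a harmonic $f$ is the integer $r\ge0$ with $\langle\partial_z^af,\partial_z^bf\rangle\equiv0$ for all $a,b\ge0$ with $1\le a+b\le2r+1$ and $\langle\partial_z^{r+1}f,\partial_z^{r+1}f\rangle\not\equiv0$; $f$ is superconformal if $r=n-1$.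 The harmonic sequence is $f_0=f$, $f_{j+1}=\partial_zf_j-\frac{\langle\partial_zf_j,\overline{f_j}\rangle}{\|f_j\|^2}f_j$ wherever $\|f_j\|^2\ne0$, extended by continuity to points where $f_j=0$; ''$f_1,\ldots,f_n$ everywhere defined'' means that for $0\le j\le n-1$ there is no point with $f_j\ne0$ and $\|f_j\|^2=0$. **Lie-theoretic notation.** $SO(2n,1)=\{g\in GL(2n+1,\mathbb{R}): g^t\upsilon g=\upsilon,\ \det g=1\}$, and $T=\mathrm{diag}(1,SO(2),\ldots,SO(2),SO(1,1))$ (with $n-1$ factors $SO(2)$), with Lie algebra $\mathfrak t$. The projection $SO(2n,1)/T\to S^{2n}_1$ is $gT\mapsto ge_1$; a lift of $f$ is a map $\psi$ to $SO(2n,1)/T$ projecting to $f$, and a frame of $\psi$ is a smooth $F:\mathbb{C}\to SO(2n,1)$ with $FT=\psi$. For $j<k$ let $[j,k]=E_{kj}-E_{jk}$ if $k\ne2n+1$ and $[j,k]=E_{kj}+E_{jk}$ if $k=2n+1$, with $E_{jk}$ the elementary matrices. For $n\ge2$ set $R_1=[1,2]+i[1,3]$; $R_k=[2k-2,2k]+i[2k-2,2k+1]-i[2k-1,2k]+[2k-1,2k+1]$ for $1<k<n$; $R_n=[2n-2,2n]-[2n-2,2n+1]-i[2n-1,2n]+i[2n-1,2n+1]$; $R_0=[2n-2,2n]+[2n-2,2n+1]-i[2n-1,2n]-i[2n-1,2n+1]$. For $n=1$ set $R_1=[1,2]+[1,3]$, $R_0=[1,2]-[1,3]$. These are root vectors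 with respect to $\mathfrak t^{\mathbb{C}}$ for a set of simple roots and the lowest root of $\mathfrak{so}(2n+1,\mathbb{C})$. Put $\mathfrak g_1=\bigoplus_{k=0}^n\mathbb{C}R_k$. **Primitive.** For $n\ge2$, $\psi:\mathbb{C}\to SO(2n,1)/T$ is primitive if for some (equivalently any) frame $F$ of $\psi$, $F^{-1}F_z$ takes values in $\mathfrak t^{\mathbb{C}}\oplus\mathfrak g_1$; for $n=1$ primitive means harmonic. An element of $\mathfrak g_1$ is cyclic if its component in each line $\mathbb{C}R_k$, $0\le k\le n$, is nonzero. $\psi$ is cyclic primitive if it is primitive and the $\mathfrak g_1$-component of $F^{-1}F_z$ is cyclic at some point; frames of cyclic primitive lifts of $f$ are called cyclic primitive frames of $f$. The root space coefficients $c_0,\ldots,c_n:\mathbb{C}\to\mathbb{C}$ of such $F$ are defined by: the $\mathfrak g_1$-component of $F^{-1}F_z$ is $\sum_{k=0}^nc_kR_k$. (Whether $c_0c_1^2\cdots c_{n-1}^2c_n$ is constant does not depend on the scaling of the root vectors.) **Toda frame.** Let $\pi$ be the permutation of $\{0,\ldots,n\}$ swapping $0$ and $n$ and fixing the other indices. Consider cyclic elements $W=\sum_{j=0}^nr_jR'_j\in\mathfrak g_1$, where $R'_j$ is any fixed nonzero element of $\mathbb{C}R_j$ and $r_{\pi(j)}=\overline{r_j}$. $W$ is (appropriately) normalised with respect to a cyclic primitive frame $\tilde F$ of $\psi$ if, writing the $\mathfrak g_1$-component of $\tilde F^{-1}\tilde F_z$ as $\sum_jc'_jR'_j$, one has $c'_0(c'_1)^2\cdots(c'_{n-1})^2c'_n=r_0r_1^2\cdots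 r_{n-1}^2r_n$. (This does not depend on the frame $\tilde F$ of $\psi$.) A frame $F:\mathbb{C}\to SO(2n,1)$ of $\psi$ is a Toda frame with respect to $W$ if there is a smooth map $\Omega:\mathbb{C}\to i\mathfrak t$ with $F^{-1}F_z=\Omega_z+\mathrm{Ad}_{\exp\Omega}W$. *)

(* Defs.v *)
From HB Require Import structures.
From mathcomp Require Import all_boot all_order all_algebra all_fingroup.
From mathcomp Require Import all_classical all_reals all_analysis.
From mathcomp Require Import complex.

Set Implicit Arguments.
Unset Strict Implicit.
Unset Printing Implicit Defensive.

Import Order.TTheory GRing.Theory Num.Theory.
Import numFieldNormedType.Exports.

Local Open Scope classical_set_scope.
Local Open Scope ring_scope.

(* The domain C is R * R, the point (x, y) being z = x + iy; only its real
   differential structure and its translations are used.  Values that are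
   genuinely complex are in R[i]. *)

Section Calculus.
Variable R : realType.

Fixpoint Ck (k : nat) (g : R * R -> R) : Prop :=
  if k is k'.+1 then
    [/\ continuous g,
        forall z, derivable g z (1, 0) /\ derivable g z (0, 1),
        Ck k' ('D_(1, 0) g) & Ck k' ('D_(0, 1) g)]
  else continuous g.

Definition smooth (g : R * R -> R) : Prop := forall k, Ck k g.

Definition smooth_mx p q (G : R * R -> 'M[R]_(p, q)) : Prop :=
  forall a b, smooth (fun z => G z a b).

Definition smooth_cmx p q (G : R * R -> 'M[R[i]]_(p, q)) : Prop :=
  smooth_mx (fun z => map_mx (@complex.Re R) (G z)) /\
  smooth_mx (fun z => map_mx (@complex.Im R) (G z)).

Definition cmx p q (A : 'M[R]_(p, q)) : 'M[R[i]]_(p, q) :=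
  map_mx (fun x => x%:C%C) A.

Definition conj_cmx p q (A : 'M[R[i]]_(p, q)) : 'M[R[i]]_(p, q) :=
  map_mx (fun x => x^*%C) A.

Definition partialC (v : R * R) (g : R * R -> R[i]) (z : R * R) : R[i] :=
  ('D_v (fun w => complex.Re (g w)) z +i* 'D_v (fun w => complex.Im (g w)) z)%C.

Definition dz p q (G : R * R -> 'M[R[i]]_(p, q)) (z : R * R) :
    'M[R[i]]_(p, q) :=
  \matrix_(a, b) (2^-1 * (partialC (1, 0) (fun w => G w a b) z
                          - 'i%C * partialC (0, 1) (fun w => G w a b) z)).

Definition dzbar p q (G : R * R -> 'M[R[i]]_(p, q)) (z : R * R) :
    'M[R[i]]_(p, q) :=
  \matrix_(a, b) (2^-1 * (partialC (1, 0) (fun w => G w a b) z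
                          + 'i%C * partialC (0, 1) (fun w => G w a b) z)).

(* Matrix exponential: entrywise limit of the partial sums of its series. *)
Definition expmx m (A : 'M[R[i]]_m.+1) : 'M[R[i]]_m.+1 :=
  let S N := \sum_(k < N) (k`!%:R : R[i])^-1 *: A ^+ k in
  \matrix_(a, b) ((lim ((fun N => complex.Re (S N a b)) @ \oo))
                  +i* (lim ((fun N => complex.Im (S N a b)) @ \oo)))%C.

Definition is_lattice (L : set (R * R)) : Prop :=
  exists w1 w2 : R * R, w1.1 * w2.2 - w1.2 * w2.1 != 0 /\
    L = [set w | exists a b : int, w = w1 *~ a + w2 *~ b].

Definition lattice_periodic (T : Type) (L : set (R * R)) (g : R * R -> T) : Prop :=
  forall z w, L w -> g (z + w) = g z.

End Calculus.

Section Lorentz.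

Definition ups (K : comUnitRingType) m : 'M[K]_m.+1 :=
  diag_mx (\row_j (if j == ord_max then -1 else 1)).

Definition SO1 (K : comUnitRingType) m (g : 'M[K]_m.+1) : Prop :=
  g^T *m ups K m *m g = ups K m /\ \det g = 1.

Definition SO (K : comUnitRingType) m (g : 'M[K]_m) : Prop :=
  g^T *m g = 1%:M /\ \det g = 1.

Definition so1 (K : comUnitRingType) m (X : 'M[K]_m.+1) : Prop :=
  X^T *m ups K m + ups K m *m X = 0.

Definition so (K : comUnitRingType) m (X : 'M[K]_m) : Prop := X^T + X = 0.

End Lorentz.

(* Matrices have size 2n+1 = n.*2.+1.  Matrix indices are ordinals starting
   from 0, so the row or column j of the mathematics is the ordinal of value
   j - 1. *)
Section DeSitter.
Variables (R : realType) (n : nat).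

Notation C := R[i].
Notation vecR := 'cV[R]_(n.*2.+1).
Notation vecC := 'cV[C]_(n.*2.+1).
Notation matR := 'M[R]_(n.*2.+1).
Notation matC := 'M[C]_(n.*2.+1).

Definition ip (x y : vecC) : C := (x^T *m ups C n.*2 *m y) ord0 ord0.

Definition normsq (v : vecC) : C := ip v (conj_cmx v).

Definition deSitter (x : vecR) : Prop :=
  (x^T *m ups R n.*2 *m x) ord0 ord0 = 1.

Definition cplx (f : R * R -> vecR) : R * R -> vecC := fun z => cmx (f z).

Definition harmonic_map (f : R * R -> vecR) : Prop :=
  [/\ smooth_mx f, forall z, deSitter (f z) &
      forall z, exists l : C, dz (dzbar (cplx f)) z = l *: cplx f z].

Definition dzn (a : nat) (f : R * R -> vecR) : R * R -> vecC :=
  iter a (@dz R _ _) (cplx f).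

Definition isotropy_order (f : R * R -> vecR) (r : nat) : Prop :=
  (forall a b : nat, (1 <= a + b <= r.*2.+1)%N ->
     forall z, ip (dzn a f z) (dzn b f z) = 0) /\
  (exists z, ip (dzn r.+1 f z) (dzn r.+1 f z) <> 0).

Definition superconformal (f : R * R -> vecR) : Prop :=
  harmonic_map f /\ isotropy_order f n.-1.

(* fs 0, ..., fs n is the harmonic sequence of f.  The limit is along the
   points where fs j is not null, i.e. where fs j.+1 is given by the formula. *)
Definition harmonic_sequence (f : R * R -> vecR) (fs : nat -> R * R -> vecC) :
    Prop :=
  fs 0%N = cplx f /\
  forall j, (j < n)%N ->
    (forall z, normsq (fs j z) != 0 ->
       fs j.+1 z = dz (fs j) z
         - (ip (dz (fs j) z) (conj_cmx (fs j z)) / normsq (fs j z)) *: fs j z) /\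
    (forall z, fs j z = 0 -> forall a,
       let D := within [set w | normsq (fs j w) != 0] (nbhs z) in
       (fun w => complex.Re (fs j.+1 w a ord0)) @ D
         --> complex.Re (fs j.+1 z a ord0) /\
       (fun w => complex.Im (fs j.+1 w a ord0)) @ D
         --> complex.Im (fs j.+1 z a ord0)).

Definition sequence_everywhere_defined (f : R * R -> vecR) : Prop :=
  exists fs, harmonic_sequence f fs /\
    forall j z, (j < n)%N -> ~ (fs j z <> 0 /\ normsq (fs j z) = 0).

(* 2 x 2 diagonal block on the 1-based rows and columns 2k, 2k+1, 1 <= k <= n;
   uphalf sends a 0-based index to the number of its block (0 for the first
   row). *)
Definition block (k : nat) (A : matR) : 'M[R]_2 :=
  let idx := fun i : 'I_2 => inord (k.*2.-1 + i) : 'I_(n.*2.+1) in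
  mxsub idx idx A.

Definition block_diagonal (A : matR) : Prop :=
  forall a b : 'I_(n.*2.+1), uphalf a != uphalf b -> A a b = 0.

Definition torus (t : matR) : Prop :=
  [/\ block_diagonal t, t ord0 ord0 = 1,
      forall k, (1 <= k < n)%N -> SO (block k t) & SO1 (m := 1) (block n t)].

Definition Lie_t (X : matR) : Prop :=
  [/\ block_diagonal X, X ord0 ord0 = 0,
      forall k, (1 <= k < n)%N -> so (block k X) & so1 (m := 1) (block n X)].

Definition Lie_tC (H : matC) : Prop :=
  exists X Y : matR, [/\ Lie_t X, Lie_t Y & H = cmx X + 'i%C *: cmx Y].

Definition Lie_it (H : matC) : Prop :=
  exists2 X : matR, Lie_t X & H = 'i%C *: cmx X.

(* With T the torus, SO(2n,1)/T is the set of cosets gT, seen as subsets of the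
   matrices. *)
Definition coset (g : matR) : set matR :=
  [set h | exists2 t, torus t & h = g *m t].

Definition e1 : vecR := delta_mx ord0 ord0.

Definition is_lift (f : R * R -> vecR) (psi : R * R -> set matR) : Prop :=
  forall z, exists g, [/\ SO1 g, psi z = coset g & g *m e1 = f z].

Definition is_frame (psi : R * R -> set matR) (F : R * R -> matR) : Prop :=
  smooth_mx F /\ forall z, SO1 (F z) /\ psi z = coset (F z).

(* 1-based indices *)
Definition elem (j k : nat) : matC :=
  \matrix_(a, b) ((a.+1 == j) && (b.+1 == k))%:R.

Definition brk (j k : nat) : matC :=
  if k == n.*2.+1 then elem k j + elem j k else elem k j - elem j k.

Definition rootvec (k : 'I_n.+1) : matC :=
  let i := 'i%C : C in
  let a := (n.*2 - 2)%N in let a' := (n.*2 - 1)%N in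
  let b := n.*2 in let b' := n.*2.+1 in
  if n == 1%N then
    if k == 0%N :> nat then brk 1 2 - brk 1 3 else brk 1 2 + brk 1 3
  else if k == 0%N :> nat then
    brk a b + brk a b' - i *: brk a' b - i *: brk a' b'
  else if k == n :> nat then
    brk a b - brk a b' - i *: brk a' b + i *: brk a' b'
  else if k == 1%N :> nat then brk 1 2 + i *: brk 1 3
  else
    brk (k.*2 - 2) k.*2 + i *: brk (k.*2 - 2) k.*2.+1
    - i *: brk (k.*2 - 1) k.*2 + brk (k.*2 - 1) k.*2.+1.

Definition MC (F : R * R -> matR) (z : R * R) : matC :=
  invmx (cmx (F z)) *m dz (fun w => cmx (F w)) z.

(* F^-1 F_z takes values in t^C + g_1, and c gives the coefficients of its
   g_1-component in the basis rv of g_1. *)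
Definition root_coefs (rv : 'I_n.+1 -> matC) (F : R * R -> matR)
    (c : 'I_n.+1 -> R * R -> C) : Prop :=
  forall z, exists2 H, Lie_tC H & MC F z = H + \sum_k c k z *: rv k.

(* For n = 1 the projection identifies SO(2,1)/T with S^2_1 (the torus being
   the full stabiliser of e_1), so harmonicity of the lift is harmonicity of
   F e_1. *)
Definition primitive (psi : R * R -> set matR) : Prop :=
  exists2 F, is_frame psi F &
    if n == 1%N then harmonic_map (fun z => F z *m e1)
    else exists c, root_coefs rootvec F c.

Definition cyclic_primitive (psi : R * R -> set matR) : Prop :=
  primitive psi /\
  exists F c, [/\ is_frame psi F, root_coefs rootvec F c &
                  exists z, forall k, c k z <> 0].

Definition cyclic_primitive_frame (f : R * R -> vecR) (F : R * R -> matR) :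
    Prop :=
  exists psi, [/\ is_lift f psi, cyclic_primitive psi & is_frame psi F].

(* c_0 c_1^2 ... c_(n-1)^2 c_n *)
Definition root_product (c : 'I_n.+1 -> C) : C :=
  \prod_k c k ^+ (if (k == ord0) || (k == ord_max) then 1 else 2)%N.

Definition constant_root_product (F : R * R -> matR) : Prop :=
  exists2 c, root_coefs rootvec F c &
    exists K : C, forall z, root_product (c^~ z) = K.

(* rv k is a nonzero multiple R'_k of the root vector R_k, the weights satisfy
   r_(pi k) = conj r_k, and the element is W = sum_k r_k R'_k. *)
Definition cyclic_element (rv : 'I_n.+1 -> matC) (r : 'I_n.+1 -> C)
    (W : matC) : Prop :=
  [/\ forall k, exists2 s : C, s <> 0 & rv k = s *: rootvec k,
      forall k, r k <> 0,
      forall k, r (tperm ord0 ord_max k) = ((r k)^*)%C &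
      W = \sum_k r k *: rv k].

Definition normalised_element (psi : R * R -> set matR) (rv : 'I_n.+1 -> matC)
    (r : 'I_n.+1 -> C) : Prop :=
  cyclic_primitive psi /\
  exists F c, [/\ is_frame psi F, root_coefs rv F c &
                  forall z, root_product (c^~ z) = root_product r].

Definition Toda_frame (psi : R * R -> set matR) (W : matC)
    (F : R * R -> matR) : Prop :=
  is_frame psi F /\
  exists Omega : R * R -> matC,
    [/\ smooth_cmx Omega, forall z, Lie_it (Omega z) &
        forall z, MC F z = dz Omega z
          + expmx (Omega z) *m W *m invmx (expmx (Omega z))].

End DeSitter.

(* Main.v *)
Require Import Defs.
From HB Require Import structures.
From mathcomp Require Import all_boot all_order all_algebra all_fingroup.
From mathcomp Require Import all_classical all_reals all_analysis.
From mathcomp Require Import complex ring lra zify.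

(** Frames and degrees. Besides e_1, take the vectors e_j + i e_k and e_j - i
    e_k for each compact block of the torus and e_j + e_k, e_j - e_k for its
    last block. This null basis diagonalises the torus, and the indices carry
    degrees modulo 2n in which R_0, ..., R_n have degree 1. For n at least 2 a
    frame F is therefore primitive exactly when F^-1 F_z, written in the null
    basis, only has entries of degrees 0 and 1 ([degree01]): the first are the
    torus part, the second the root space coefficients c_k
    ([degree01_decomp]). For n = 1 this is no condition, and harmonicity is
    used in its place.

    The root product. In the null basis carried by a primitive frame the j-th
    derivative of f is supported in degrees 1 to j, and its coefficient in
    degree j is that of the preceding derivative times one c_k. Hence <d^n f,
    d^n f> is a nonzero constant times c_0 c_1^2 ... c_(n-1)^2 c_n
    ([top_ip_coef]). The root product thus depends on f alone, and if it is
    constant and the frame cyclic at one point, no c_k vanishes anywhere.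

    Toda frames. Let W have coefficients r_k, with the same product. Equality
    of the products is what is needed to solve c_k s(k) = s'(k) r_k for a
    nowhere vanishing function s with values in the complexified torus, s(k)
    and s'(k) being the characters of the two degrees joined by R_k
    ([root_gauge]). The structure equations of F, that is equality of mixed
    derivatives, say that the logarithmic dbar derivative of s is the
    conjugate of the torus part of F^-1 F_z, with the opposite sign in the
    last block, whose null vectors are real. The plane is simply connected, so
    s has a smooth logarithm; the part of that logarithm in the Lie algebra t
    gives the change of frame, the part in i t is Omega, and the structure
    equations turn the new torus part into Omega_z ([Toda_frame_exists]).

    Periodicity of the lift. The frames at z and z + w express the same
    derivatives of f, so the real isometry between them preserves two opposite
    flags of null vectors and fixes e_1; such an isometry lies in T
    ([flags_torus]).

    Periodic maps. By harmonicity and isotropy <d^n f, d^n f> is holomorphic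
    ([top_ip_holomorphic]); it is doubly periodic, hence constant by a maximum
    principle ([periodic_harmonic_cst]), and nonzero by the isotropy order. So
    the root product is constant as soon as a cyclic primitive frame exists.
    For the existence, <d^j f, d^(2n-j) f> is up to sign the same nonzero
    constant, so no f_j vanishes and the recursion defining the harmonic
    sequence holds everywhere; the f_j are mutually orthogonal for both
    products and dbar f_j is a multiple of f_(j-1) ([hermitian_steps]). The
    normalised real and imaginary parts of f_1, ..., f_(n-1), which are
    spacelike because the signature allows only one timelike direction,
    together with f, a timelike vector and the unit normal to all of these,
    form a smooth frame ([adapted_frame]). It is primitive
    ([adapted_frame_degree01]), and cyclic by the formula for the root
    product. *)

Set Implicit Arguments.
Unset Strict Implicit.
Unset Printing Implicit Defensive.

Import Order.TTheory GRing.Theory Num.Theory.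
Import numFieldNormedType.Exports.

Local Open Scope classical_set_scope.
Local Open Scope ring_scope.

(** * Smooth real functions on the plane *)

Module Import SmoothCalculus.

Section RealCalculus.
Variable R : realType.
Implicit Types (g h w : R * R -> R) (z v : R * R).

Lemma CkW k g : Ck k.+1 g -> Ck k g.
Proof.
elim: k g => [|k IH] g; first by case.
case=> cg dg g1 g2; split; [exact: cg | exact: dg | exact: (IH _ g1) |].
exact: (IH _ g2).
Qed.

Lemma smooth_continuous g : smooth g -> continuous g.
Proof. by move=> sg; exact: (sg 0%N). Qed.

Lemma smooth_derivable g z : smooth g ->
  derivable g z (1, 0) /\ derivable g z (0, 1).
Proof. by move=> sg; case: (sg 1%N) => _ d _ _; exact: d. Qed.

Lemma smooth_derive1 g : smooth g -> smooth ('D_(1, 0) g).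
Proof. by move=> sg k; case: (sg k.+1). Qed.

Lemma smooth_derive2 g : smooth g -> smooth ('D_(0, 1) g).
Proof. by move=> sg k; case: (sg k.+1). Qed.

Lemma is_derive_line g z v (h : R) :
  derivable g (h *: v + z) v ->
  is_derive h 1 (fun t : R => g (t *: v + z)) ('D_v g (h *: v + z)).
Proof.
move=> dg.
have E : (fun t : R => t^-1 *: ((g \o shift (h *: v + z)) (t *: v) - g (h *: v + z)))
  = (fun t : R => t^-1 *: (((fun t : R => g (t *: v + z)) \o shift h) (t *: 1)
       - g (h *: v + z))).
  apply/funext => t /=; congr (_ *: (g _ - _)).
  by rewrite addrA -scalerDl [t *: 1]mulr1.
apply: DeriveDef; first by rewrite /derivable -E.
by rewrite /derive -E.
Qed.

Lemma is_derive_comp1 (phi : R -> R) g z v (dphi : R) :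
  derivable g z v -> is_derive (g z) 1 phi dphi ->
  is_derive z v (phi \o g) (dphi * 'D_v g z).
Proof.
move=> dg dphi1.
have dgl := is_derive_line (h := 0) (g := g) (z := z) (v := v).
rewrite scale0r add0r in dgl; have {dgl} := dgl dg => dgl.
have dphi2 : is_derive ((fun t : R => g (t *: v + z)) 0) 1 phi dphi.
  by rewrite /= scale0r add0r.
have dc := is_derive1_comp dphi2 dgl.
have E : (fun t : R => t^-1 *: (((phi \o g) \o shift z) (t *: v) - (phi \o g) z))
  = (fun t : R => t^-1 *: (((phi \o (fun t : R => g (t *: v + z))) \o shift 0) (t *: 1)
       - (phi \o (fun t : R => g (t *: v + z))) 0)).
  by apply/funext => t /=; rewrite scale0r add0r addr0 [t *: 1]mulr1.
case: dc => dc1 dc2; apply: DeriveDef; first by rewrite /derivable E.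
by rewrite /derive E; exact: dc2.
Qed.

Lemma derive_cst_pw (c : R) v z : 'D_v (cst c : R * R -> R) z = 0.
Proof. exact: derive_cst. Qed.

Lemma deriveD_pw g h v z : derivable g z v -> derivable h z v ->
  'D_v (g \+ h) z = 'D_v g z + 'D_v h z.
Proof. exact: deriveD. Qed.

Lemma deriveM_pw g h v z : derivable g z v -> derivable h z v ->
  'D_v (g \* h) z = 'D_v g z * h z + g z * 'D_v h z.
Proof.
move=> gz hz; rewrite addrC (mulrC _ (h z)).
exact: (deriveM gz hz).
Qed.

Lemma derivableD_pw g h v z : derivable g z v -> derivable h z v ->
  derivable (g \+ h) z v.
Proof. exact: derivableD. Qed.

Lemma derivableM_pw g h v z : derivable g z v -> derivable h z v ->
  derivable (g \* h) z v.
Proof. exact: derivableM. Qed.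

Lemma is_deriveV_pw g v z : g z != 0 -> derivable g z v ->
  is_derive z v (fun y => (g y)^-1) (- ((g z)^-1 * (g z)^-1) * 'D_v g z).
Proof.
move=> g0 dg; apply: DeriveDef; first exact: derivableV.
transitivity (- (g z) ^- 2 *: 'D_v g z); first exact: deriveV.
by rewrite -exprVn expr2.
Qed.

Local Opaque derive derivable.

Local Notation v1 := ((1, 0) : R * R).
Local Notation v2 := ((0, 1) : R * R).

Lemma Ck_cst k (c : R) : Ck k (cst c).
Proof.
elim: k c => [|k IH] c /=; first by move=> z; exact: cvg_cst.
have E v : 'D_v (cst c : R * R -> R) = cst 0.
  by apply/funext => z; exact: derive_cst_pw.
split; first by move=> z; exact: cvg_cst.
- by move=> z; split; exact: derivable_cst.
- by rewrite E; exact: IH.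
- by rewrite E; exact: IH.
Qed.

Lemma derive_funD g h v : (forall z, derivable g z v) ->
  (forall z, derivable h z v) -> 'D_v (g \+ h) = 'D_v g \+ 'D_v h.
Proof.
by move=> dg dh; apply/funext => z; exact: (deriveD_pw (dg z) (dh z)).
Qed.

Lemma derive_funM g h v : (forall z, derivable g z v) ->
  (forall z, derivable h z v) ->
  'D_v (g \* h) = ('D_v g \* h) \+ (g \* 'D_v h).
Proof.
by move=> dg dh; apply/funext => z; exact: (deriveM_pw (dg z) (dh z)).
Qed.

Lemma CkD k g h : Ck k g -> Ck k h -> Ck k (g \+ h).
Proof.
elim: k g h => [|k IH] g h.
  by move=> cg ch z; apply: cvgD; [exact: cg|exact: ch].
case=> cg dg g1 g2 [ch dh h1 h2].
have dg1 z := (dg z).1; have dg2 z := (dg z).2.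
have dh1 z := (dh z).1; have dh2 z := (dh z).2.
split.
- by move=> z; apply: cvgD; [exact: cg|exact: ch].
- move=> z; split; first exact: (derivableD_pw (dg1 z) (dh1 z)).
  exact: (derivableD_pw (dg2 z) (dh2 z)).
- by rewrite (derive_funD dg1 dh1); exact: (IH _ _ g1 h1).
- by rewrite (derive_funD dg2 dh2); exact: (IH _ _ g2 h2).
Qed.

Lemma CkM k g h : Ck k g -> Ck k h -> Ck k (g \* h).
Proof.
elim: k g h => [|k IH] g h.
  by move=> cg ch z; apply: cvgM; [exact: cg|exact: ch].
move=> Cg Ch; have [cg dg g1 g2] := Cg; have [ch dh h1 h2] := Ch.
have {}Cg := CkW Cg; have {}Ch := CkW Ch.
have dg1 z := (dg z).1; have dg2 z := (dg z).2.
have dh1 z := (dh z).1; have dh2 z := (dh z).2.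
split.
- by move=> z; apply: cvgM; [exact: cg|exact: ch].
- move=> z; split; first exact: (derivableM_pw (dg1 z) (dh1 z)).
  exact: (derivableM_pw (dg2 z) (dh2 z)).
- rewrite (derive_funM dg1 dh1).
  exact: (CkD (IH _ _ g1 Ch) (IH _ _ Cg h1)).
- rewrite (derive_funM dg2 dh2).
  exact: (CkD (IH _ _ g2 Ch) (IH _ _ Cg h2)).
Qed.

Lemma smooth_cst (c : R) : smooth (cst c : R * R -> R).
Proof. by move=> k; exact: Ck_cst. Qed.

Lemma smoothD g h : smooth g -> smooth h -> smooth (g \+ h).
Proof. by move=> sg sh k; exact: (CkD (sg k) (sh k)). Qed.

Lemma smoothM g h : smooth g -> smooth h -> smooth (g \* h).
Proof. by move=> sg sh k; exact: (CkM (sg k) (sh k)). Qed.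

Lemma smoothN g : smooth g -> smooth (fun z => - g z).
Proof.
move=> sg; have E : (fun z => - g z) = cst (-1) \* g.
  by apply/funext => z /=; rewrite mulN1r.
by rewrite E; exact: (smoothM (smooth_cst (-1)) sg).
Qed.

(** A function whose partial derivatives are as regular as itself is smooth:
    each order of differentiability feeds the next. *)
Lemma smooth_boot w (p1 p2 : R * R -> R) : continuous w ->
  (forall z, is_derive z v1 w (p1 z)) -> (forall z, is_derive z v2 w (p2 z)) ->
  (forall k, Ck k w -> Ck k p1 /\ Ck k p2) -> smooth w.
Proof.
move=> cw d1 d2 Hk k.
have E1 : 'D_v1 w = p1 by apply/funext => z; case: (d1 z).
have E2 : 'D_v2 w = p2 by apply/funext => z; case: (d2 z).
elim: k => [|k IH]; first exact: cw.
split; first exact: cw.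
- by move=> z; split; [case: (d1 z)|case: (d2 z)].
- by rewrite E1; case: (Hk _ IH).
- by rewrite E2; case: (Hk _ IH).
Qed.

Lemma smoothV g : smooth g -> (forall z, g z != 0) ->
  smooth (fun z => (g z)^-1).
Proof.
move=> sg g0.
pose p v z := - ((g z)^-1 * (g z)^-1) * 'D_v g z.
have dp v z : derivable g z v -> is_derive z v (fun y => (g y)^-1) (p v z).
  by move=> dg; exact: (is_deriveV_pw (g0 z) dg).
apply: (@smooth_boot _ (p v1) (p v2)).
- by move=> z; apply: cvgV; [exact: g0|exact: (smooth_continuous sg)].
- by move=> z; exact: (dp _ _ (smooth_derivable z sg).1).
- by move=> z; exact: (dp _ _ (smooth_derivable z sg).2).
move=> k Ckw.
have Cq := CkM (Ck_cst k (-1)) (CkM Ckw Ckw).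
have E v : p v = (cst (-1) \* ((fun z => (g z)^-1) \* (fun z => (g z)^-1)))
    \* 'D_v g by apply/funext => z; rewrite /p /= mulN1r.
split; rewrite E; first exact: (CkM Cq (smooth_derive1 sg k)).
exact: (CkM Cq (smooth_derive2 sg k)).
Qed.

Lemma smooth_comp1 (phi psi : R -> R) g : smooth g ->
  (forall z, is_derive (g z) 1 phi (psi (g z))) ->
  (forall z, {for g z, continuous phi}) ->
  (forall k, Ck k (phi \o g) -> Ck k (psi \o g)) -> smooth (phi \o g).
Proof.
move=> sg dphi cphi Hk.
apply: (@smooth_boot _ ((psi \o g) \* 'D_v1 g) ((psi \o g) \* 'D_v2 g)).
- by move=> z; apply: continuous_comp; [exact: (smooth_continuous sg)|exact: cphi].
- by move=> z; exact: (is_derive_comp1 (smooth_derivable z sg).1 (dphi z)).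
- by move=> z; exact: (is_derive_comp1 (smooth_derivable z sg).2 (dphi z)).
move=> k /Hk Ckw; split; first exact: (CkM Ckw (smooth_derive1 sg k)).
exact: (CkM Ckw (smooth_derive2 sg k)).
Qed.

Lemma smooth_expR g : smooth g -> smooth (expR \o g).
Proof.
move=> sg; apply: (smooth_comp1 (psi := expR) sg) => // z.
exact: continuous_expR.
Qed.

Lemma smooth_ln g : smooth g -> (forall z, 0 < g z) -> smooth (@ln R \o g).
Proof.
move=> sg g0; apply: (smooth_comp1 (psi := fun x : R => x^-1) sg) => [z|z|k _].
- exact: is_derive1_ln.
- exact: continuous_ln.
by apply: smoothV => // z; rewrite gt_eqF.
Qed.

Lemma smooth_sqrt g : smooth g -> (forall z, 0 < g z) ->
  smooth (@Num.sqrt R \o g).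
Proof.
move=> sg g0.
have E : @Num.sqrt R \o g = expR \o (cst (2^-1) \* (@ln R \o g)).
  apply/funext => z /=; have {1}-> : g z = expR (2^-1 * ln (g z)) ^+ 2.
    rewrite expr2 -expRD -mulrDl [2^-1 + _](_ : _ = 1); last by lra.
    by rewrite mul1r lnK// posrE.
  by rewrite sqrtr_sqr ger0_norm ?expR_ge0.
rewrite E; apply: smooth_expR.
exact: (smoothM (smooth_cst _) (smooth_ln sg g0)).
Qed.

(** The two are bootstrapped together, each being the derivative of the other. *)
Lemma smooth_sincos g : smooth g ->
  smooth (@sin R \o g) /\ smooth (@cos R \o g).
Proof.
move=> sg.
have csin : continuous (@sin R \o g).
  move=> z; apply: continuous_comp; first exact: (smooth_continuous sg).
  exact: continuous_sin.
have ccos : continuous (@cos R \o g).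
  move=> z; apply: continuous_comp; first exact: (smooth_continuous sg).
  exact: continuous_cos.
have dsin v z (dg : derivable g z v) := is_derive_comp1 dg (is_derive_sin (g z)).
have dcos v z (dg : derivable g z v) := is_derive_comp1 dg (is_derive_cos (g z)).
have dg1 z := (smooth_derivable z sg).1.
have dg2 z := (smooth_derivable z sg).2.
suff H k : Ck k (@sin R \o g) /\ Ck k (@cos R \o g).
  by split => k; case: (H k).
elim: k => [//|k [IHs IHc]].
have Es v : (forall z, derivable g z v) ->
    'D_v (@sin R \o g) = (@cos R \o g) \* 'D_v g.
  by move=> dg; apply/funext => z; case: (dsin _ _ (dg z)).
have Ec v : (forall z, derivable g z v) ->
    'D_v (@cos R \o g) = (cst (-1) \* (@sin R \o g)) \* 'D_v g.
  move=> dg; apply/funext => z; case: (dcos _ _ (dg z)) => _ -> /=.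
  by rewrite mulN1r.
have IHs' := CkM (Ck_cst k (-1)) IHs.
split; split => //.
- move=> z; split; first by case: (dsin _ _ (dg1 z)).
  by case: (dsin _ _ (dg2 z)).
- by rewrite (Es _ dg1); exact: (CkM IHc (smooth_derive1 sg k)).
- by rewrite (Es _ dg2); exact: (CkM IHc (smooth_derive2 sg k)).
- move=> z; split; first by case: (dcos _ _ (dg1 z)).
  by case: (dcos _ _ (dg2 z)).
- by rewrite (Ec _ dg1); exact: (CkM IHs' (smooth_derive1 sg k)).
- by rewrite (Ec _ dg2); exact: (CkM IHs' (smooth_derive2 sg k)).
Qed.

End RealCalculus.

End SmoothCalculus.

(** * Second derivatives: symmetry, maxima *)

Module Import SecondDerivatives.

Section MeanValue.
Variable R : realType.
Implicit Types (g h : R * R -> R) (z v w : R * R).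

Lemma is_derive_shift_pw g v u y : derivable g (u + y) v ->
  is_derive y v (fun y => g (u + y)) ('D_v g (u + y)).
Proof.
move=> dg.
have E : (fun s : R => s^-1 *: (((fun y => g (u + y)) \o shift y) (s *: v) -
    g (u + y))) =
  (fun s : R => s^-1 *: ((g \o shift (u + y)) (s *: v) - g (u + y))).
  by apply/funext => s /=; rewrite addrCA.
apply: DeriveDef; first by rewrite /derivable E.
by rewrite /derive E.
Qed.

Local Opaque derive derivable.

Lemma mvt_line g v z (t : R) : (forall z, derivable g z v) -> 0 < t ->
  exists2 c, 0 < c < t & g (t *: v + z) - g z = t * 'D_v g (c *: v + z).
Proof.
move=> dg t0.
have dl (c : R) : is_derive c 1 (fun t : R => g (t *: v + z)) ('D_v g (c *: v + z)).
  exact: (is_derive_line (dg _)).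
have cl : {within `[0, t], continuous (fun t : R => g (t *: v + z))}.
  apply: continuous_subspaceT => x; apply: differentiable_continuous.
  by apply/derivable1_diffP; case: (dl x).
have [c ct E] := MVT t0 (fun x _ => dl x) cl.
exists c; first by move: ct; rewrite in_itv.
by move: E; rewrite scale0r add0r subr0 mulrC.
Qed.

(** The second difference of g along v and w is an intermediate value of the
    iterated derivative; being symmetric in v and w, it compares the two orders
    of differentiation. *)
Lemma second_difference g v w z (t : R) : (forall z, derivable g z v) ->
  (forall z, derivable ('D_v g) z w) -> 0 < t ->
  exists c d, [/\ 0 < c < t, 0 < d < t &
   g (t *: v + (t *: w + z)) - g (t *: v + z) - (g (t *: w + z) - g z)
   = t * (t * 'D_w ('D_v g) (d *: w + (c *: v + z)))].
Proof.
move=> dg ddg t0.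
pose phi := (fun y => g (t *: w + y)) \+ (fun y => - g y).
have dshift y := is_derive_shift_pw (dg (t *: w + y)).
have dN y : is_derive y v (fun y => - g y) (- 'D_v g y).
  have dgy := derivableP (dg y); exact: is_deriveN.
have dphi y : is_derive y v phi ('D_v g (t *: w + y) - 'D_v g y).
  have d1 := dshift y; have d2 := dN y; exact: is_deriveD.
have dphi' y : derivable phi y v by case: (dphi y).
(* the mean value theorem, along v for the difference phi, then along w *)
have [c ct E1] := mvt_line z dphi' t0.
have [d dt E2] := mvt_line (c *: v + z) ddg t0.
exists c, d; split=> //.
have Edphi : 'D_v phi (c *: v + z) =
    'D_v g (t *: w + (c *: v + z)) - 'D_v g (c *: v + z).
  by case: (dphi (c *: v + z)).
rewrite -E2 -Edphi -E1 /phi /= [t *: w + (t *: v + z)]addrCA; ring.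
Qed.

Lemma near_segment2 (P : R * R -> Prop) v w z :
  (\forall y \near z, P y) ->
  exists2 t : R, 0 < t & forall c d, `|c| <= t -> `|d| <= t ->
    P (d *: w + (c *: v + z)).
Proof.
move=> /nbhs_ballP [e /= e0 He].
pose m := `|v| + `|w| + 1.
have m0 : 0 < m by rewrite ltr_wpDl// addr_ge0.
exists (e / 2 / m); first by rewrite !divr_gt0.
move=> c d ct dt; apply: He.
rewrite -ball_normE /= addrA opprD addrCA subrr addr0 normrN.
have : `|d *: w + c *: v| <= e / 2 / m * (`|v| + `|w|).
  apply: le_trans (ler_normD _ _) _; rewrite !normrZ mulrDr addrC.
  by apply: lerD; apply: ler_wpM2r.
move=> /le_lt_trans; apply.
have : e / 2 / m * (`|v| + `|w|) <= e / 2 / m * m.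
  by apply: ler_wpM2l; [rewrite !divr_ge0// ?ltW// | rewrite lerDl].
move=> /le_lt_trans; apply.
by rewrite divfK ?gt_eqF//; lra.
Qed.

Lemma continuous_agree (A B : R * R -> R) v w z :
  {for z, continuous A} -> {for z, continuous B} ->
  (forall t : R, 0 < t -> exists c d c' d', [/\ 0 < c < t, 0 < d < t,
     0 < c' < t, 0 < d' < t &
     A (d *: w + (c *: v + z)) = B (d' *: v + (c' *: w + z))]) -> A z = B z.
Proof.
move=> cA cB H; apply/eqP; rewrite -subr_eq0 -normr_eq0.
rewrite eq_le normr_ge0 andbT; apply/ler_addgt0Pr => e e0; rewrite add0r.
have e20 : 0 < e / 2 by rewrite divr_gt0.
have /cvgrPdist_lt/(_ _ e20) n1 := cA.
have /cvgrPdist_lt/(_ _ e20) n2 := cB.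
have [t1 t10 H1] := near_segment2 v w n1.
have [t2 t20 H2] := near_segment2 w v n2.
have t0 : 0 < Num.min t1 t2 by rewrite lt_min t10.
have [c [d [c' [d' [cb db c'b d'b E]]]]] := H _ t0.
have bnd x : 0 < x < Num.min t1 t2 -> `|x| <= t1 /\ `|x| <= t2.
  move=> /andP[x0]; rewrite lt_min gtr0_norm// => /andP[/ltW -> /ltW ->].
  by [].
have {}H1 := H1 c d (bnd _ cb).1 (bnd _ db).1.
have {}H2 := H2 c' d' (bnd _ c'b).2 (bnd _ d'b).2.
rewrite E in H1; move: H1 H2; move: (B (_ + _)) (A z) (B z) => x y u H1 H2.
have -> : y - u = (y - x) - (u - x) by ring.
by apply: le_trans (ler_normB _ _) _; lra.
Qed.

(** Both orders of differentiation are limits of the same second difference. *)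
Lemma derive_swap g v w z : (forall z, derivable g z v) ->
  (forall z, derivable g z w) ->
  (forall z, derivable ('D_v g) z w) -> (forall z, derivable ('D_w g) z v) ->
  {for z, continuous ('D_w ('D_v g))} -> {for z, continuous ('D_v ('D_w g))} ->
  'D_w ('D_v g) z = 'D_v ('D_w g) z.
Proof.
move=> dv dw dvw dwv c1 c2.
apply: (continuous_agree (v := v) (w := w) c1 c2) => t t0.
have [c [d [cb db E]]] := second_difference z dv dvw t0.
have [c' [d' [cb' db' E']]] := second_difference z dw dwv t0.
exists c, d, c', d'; split; [exact: cb|exact: db|exact: cb'|exact: db'|].
apply: (mulfI (lt0r_neq0 t0)); apply: (mulfI (lt0r_neq0 t0)).
apply: (etrans (esym E)); apply: etrans E'; rewrite (addrCA (t *: w)).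
move: (g _) (g _) (g _) (g _) => a1 a2 a3 a4; ring.
Qed.

(** Otherwise the second derivative would be positive near the maximum, and so
    would be the second difference centred there; but that is the sum of two
    nonpositive increments. *)
Lemma derive2_at_max g v z : (forall z, derivable g z v) ->
  (forall z, derivable ('D_v g) z v) -> {for z, continuous ('D_v ('D_v g))} ->
  (forall y, g y <= g z) -> 'D_v ('D_v g) z <= 0.
Proof.
move=> dg ddg cg gmax; rewrite leNgt; apply/negP => pos.
have n1 : \forall y \near z, 0 < 'D_v ('D_v g) y.
  have /cvgrPdist_lt/(_ _ pos) := cg.
  apply: filterS => y; move: ('D_v _ y) ('D_v _ z) => a b.
  by rewrite ltr_norml => /andP[_]; rewrite ltrBlDr ltrDl.
have [t t0 H] := near_segment2 v v n1.
have t20 : 0 < t / 2 by rewrite divr_gt0.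
(* the base point z - (t / 2) v centres the second difference at z *)
have [c [d [cb db E]]] := second_difference (- (t / 2) *: v + z) dg ddg t20.
have {}H : 0 < 'D_v ('D_v g) ((c - t / 2) *: v + (d *: v + z)).
  have [Hd Hc] : `|d| <= t /\ `|c - t / 2| <= t.
    move: cb db t0; clear => /andP[c0 ct] /andP[d0 dt] t0.
    by split; [rewrite gtr0_norm//|rewrite ler_norml; apply/andP; split]; lra.
  exact: H d (c - t / 2) Hd Hc.
have Ez : (c - t / 2) *: v + (d *: v + z) = d *: v + (c *: v + (- (t / 2) *: v + z)).
  by rewrite scalerBl scaleNr addrCA; congr (_ + _); rewrite addrA.
rewrite Ez in H.
have {Ez} E0 : t / 2 *: v + (- (t / 2) *: v + z) = z.
  by rewrite addrA -scalerDl subrr scale0r add0r.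
rewrite !E0 in E.
have := gmax (t / 2 *: v + z); have := gmax (- (t / 2) *: v + z).
have := mulr_gt0 t20 (mulr_gt0 t20 H); rewrite -E.
move: (g _) (g _) (g _); clear=> x y u; lra.
Qed.

Lemma derive0_cst g v : (forall z, derivable g z v) ->
  (forall z, 'D_v g z = 0) -> forall z (t : R), g (t *: v + z) = g z.
Proof.
move=> dg dg0.
have pos z (t : R) : 0 < t -> g (t *: v + z) = g z.
  move=> t0; have [c _ /eqP] := mvt_line z dg t0.
  by rewrite dg0 mulr0 subr_eq0 => /eqP.
move=> z t; case: (ltrgtP t 0) => [tn|/pos//|->]; last by rewrite scale0r add0r.
have := pos (t *: v + z) (- t); rewrite oppr_gt0 => /(_ tn) <-.
by rewrite scaleNr addKr.
Qed.

Local Notation v1 := ((1, 0) : R * R).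
Local Notation v2 := ((0, 1) : R * R).

Lemma gradient0_cst g : smooth g -> (forall z, 'D_v1 g z = 0) ->
  (forall z, 'D_v2 g z = 0) -> forall z, g z = g 0.
Proof.
move=> sg g1 g2 z.
have E : z = z.1 *: v1 + (z.2 *: v2 + 0).
  case: z => x y; rewrite addr0; apply/eqP; rewrite xpair_eqE /=.
  rewrite -[x *: 1]/(x * 1) -[x *: 0]/(x * 0) -[y *: 1]/(y * 1) -[y *: 0]/(y * 0).
  by rewrite !mulr1 !mulr0 addr0 add0r !eqxx.
rewrite E.
rewrite (derive0_cst (fun z => (smooth_derivable z sg).1) g1).
by rewrite (derive0_cst (fun z => (smooth_derivable z sg).2) g2).
Qed.

Lemma smooth_derive_swap g z : smooth g -> 'D_v2 ('D_v1 g) z = 'D_v1 ('D_v2 g) z.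
Proof.
move=> sg; have s1 := smooth_derive1 sg; have s2 := smooth_derive2 sg.
apply: derive_swap.
- by move=> y; exact: (smooth_derivable y sg).1.
- by move=> y; exact: (smooth_derivable y sg).2.
- by move=> y; exact: (smooth_derivable y s1).2.
- by move=> y; exact: (smooth_derivable y s2).1.
- exact: (smooth_continuous (smooth_derive2 s1)).
- exact: (smooth_continuous (smooth_derive1 s2)).
Qed.

End MeanValue.

End SecondDerivatives.

(** * Doubly periodic harmonic functions *)

Module Import PeriodicHarmonic.

Section Liouville.
Variable R : realType.
Implicit Types (g h : R * R -> R) (z v w : R * R) (L : set (R * R)).

Local Opaque derive derivable.
Local Notation v1 := ((1, 0) : R * R).
Local Notation v2 := ((0, 1) : R * R).

Lemma scaleRE (a b : R) : a *: b = a * b. Proof. by []. Qed.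

(** The coefficients s and t come from Cramer's rule; their fractional parts
    locate the point in the fundamental parallelogram. *)
Lemma lattice_reduce L : is_lattice L -> exists w1 w2 : R * R,
  forall z, exists s t : R, [/\ 0 <= s <= 1, 0 <= t <= 1 &
    exists2 w, L w & s *: w1 + t *: w2 + w = z].
Proof.
move=> [w1 [w2 [d0 ->]]]; exists w1, w2 => z.
pose d := w1.1 * w2.2 - w1.2 * w2.1.
pose s := (z.1 * w2.2 - z.2 * w2.1) / d.
pose t := (w1.1 * z.2 - w1.2 * z.1) / d.
have zE : z = s *: w1 + t *: w2.
  rewrite [LHS]surjective_pairing; apply/eqP; rewrite xpair_eqE /= !scaleRE.
  rewrite /s /t /d; apply/andP; split; apply/eqP; field; exact: d0.
have fl (x : R) : 0 <= x - (Num.floor x)%:~R <= 1.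
  rewrite subr_ge0 floor_le_tmp /= lerBlDl.
  have := lt_succ_floor x; rewrite intrD => /ltW; by rewrite addrC.
exists (s - (Num.floor s)%:~R), (t - (Num.floor t)%:~R); split; [exact: fl|exact: fl|].
exists (w1 *~ Num.floor s + w2 *~ Num.floor t).
  by exists (Num.floor s), (Num.floor t).
by rewrite zE -[w1 *~ _]scaler_int -[w2 *~ _]scaler_int addrACA -!scalerDl !subrK.
Qed.

(** The fundamental parallelogram is the continuous image of a compact square. *)
Lemma periodic_max L g : is_lattice L -> lattice_periodic L g -> continuous g ->
  exists z0, forall z, g z <= g z0.
Proof.
move=> /lattice_reduce[w1 [w2 H]] gL cg.
pose lin (p : R * R) := p.1 *: w1 + p.2 *: w2.
have clin : continuous lin.
  move=> p; apply: cvgD; apply: cvgZl; [exact: cvg_fst|exact: cvg_snd].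
pose A : set (R * R) := `[0, 1] `*` `[0, 1].
have cA : compact A by apply: compact_setX; exact: segment_compact.
have A0 : A !=set0 by exists (0, 0); split; rewrite /= in_itv /= lexx ler01.
have cgl : {within A, continuous (g \o lin)}.
  apply: continuous_subspaceT => p; apply: continuous_comp; [exact: clin|exact: cg].
have [c _ Hc] := compact_EVT_max A0 cA cgl.
exists (lin c) => z; have [s [t [sb tb [w Lw <-]]]] := H z.
rewrite gL//; apply: (Hc (s, t)); rewrite inE.
by split; rewrite /= in_itv.
Qed.

Definition laplacian g z := 'D_v1 ('D_v1 g) z + 'D_v2 ('D_v2 g) z.

Lemma derive2_sq g v z : (forall z, derivable g z v) ->
  (forall z, derivable ('D_v g) z v) ->
  'D_v ('D_v (g \* g)) z = 2 * ('D_v g z) ^+ 2 + 2 * (g z * 'D_v ('D_v g) z).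
Proof.
move=> dg ddg; rewrite (derive_funM dg dg).
rewrite deriveD_pw; [|exact: derivableM_pw|exact: derivableM_pw].
rewrite !deriveM_pw//; move: (g z) ('D_v g z) ('D_v ('D_v g) z) => a b c; ring.
Qed.

Lemma laplacian_sq g z : smooth g -> laplacian (g \* g) z =
  2 * (('D_v1 g z) ^+ 2 + ('D_v2 g z) ^+ 2) + 2 * (g z * laplacian g z).
Proof.
move=> sg; have s1 := smooth_derive1 sg; have s2 := smooth_derive2 sg.
rewrite /laplacian.
rewrite (derive2_sq (v := v1) z (fun z => (smooth_derivable z sg).1) (fun z => (smooth_derivable z s1).1)).
rewrite (derive2_sq (v := v2) z (fun z => (smooth_derivable z sg).2) (fun z => (smooth_derivable z s2).2)).
have alg (a b c d e : R) : 2 * a ^+ 2 + 2 * (e * c) + (2 * b ^+ 2 + 2 * (e * d))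
    = 2 * (a ^+ 2 + b ^+ 2) + 2 * (e * (c + d)) by ring.
exact: alg.
Qed.

Lemma laplacianD g h z : smooth g -> smooth h ->
  laplacian (g \+ h) z = laplacian g z + laplacian h z.
Proof.
move=> sg sh.
have g1 := smooth_derive1 sg; have g2 := smooth_derive2 sg.
have h1 := smooth_derive1 sh; have h2 := smooth_derive2 sh.
rewrite /laplacian.
rewrite (derive_funD (v := v1) (fun z => (smooth_derivable z sg).1) (fun z => (smooth_derivable z sh).1)).
rewrite (derive_funD (v := v2) (fun z => (smooth_derivable z sg).2) (fun z => (smooth_derivable z sh).2)).
rewrite (deriveD_pw (v := v1) (smooth_derivable z g1).1 (smooth_derivable z h1).1).
rewrite (deriveD_pw (v := v2) (smooth_derivable z g2).2 (smooth_derivable z h2).2).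
exact: addrACA.
Qed.

Lemma deriveZ_pw (c : R) g v z : derivable g z v ->
  'D_v (cst c \* g) z = c * 'D_v g z.
Proof.
move=> dg; rewrite (deriveM_pw (v := v) (derivable_cst c z v) dg) derive_cst_pw.
by rewrite mul0r add0r.
Qed.

Lemma derive_funZ (c : R) g v : (forall z, derivable g z v) ->
  'D_v (cst c \* g) = cst c \* 'D_v g.
Proof. by move=> dg; apply/funext => z; exact: (deriveZ_pw c (dg z)). Qed.

Lemma laplacianZ (c : R) g z : smooth g ->
  laplacian (cst c \* g) z = c * laplacian g z.
Proof.
move=> sg.
have g1 := smooth_derive1 sg; have g2 := smooth_derive2 sg.
rewrite /laplacian.
rewrite (derive_funZ c (v := v1) (fun z => (smooth_derivable z sg).1)).
rewrite (derive_funZ c (v := v2) (fun z => (smooth_derivable z sg).2)).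
rewrite (deriveZ_pw c (smooth_derivable z g1).1).
rewrite (deriveZ_pw c (smooth_derivable z g2).2).
exact: (esym (mulrDr _ _ _)).
Qed.

Lemma laplacian_max g z : smooth g -> (forall y, g y <= g z) -> laplacian g z <= 0.
Proof.
move=> sg gz.
have g1 := smooth_derive1 sg; have g2 := smooth_derive2 sg.
have H1 := derive2_at_max (v := v1) (fun z => (smooth_derivable z sg).1)
  (fun z => (smooth_derivable z g1).1) (smooth_continuous (smooth_derive1 g1) (x := z)) gz.
have H2 := derive2_at_max (v := v2) (fun z => (smooth_derivable z sg).2)
  (fun z => (smooth_derivable z g2).2) (smooth_continuous (smooth_derive2 g2) (x := z)) gz.
by have := lerD H1 H2; rewrite addr0.
Qed.

Lemma periodic_derive L g v : lattice_periodic L g -> (forall z, derivable g z v) ->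
  lattice_periodic L ('D_v g).
Proof.
move=> gL dg z w Lw; rewrite addrC.
case: (is_derive_shift_pw (dg (w + z))) => _ <-.
have -> // : (fun y => g (w + y)) = g.
by apply/funext => y; rewrite addrC gL.
Qed.

Lemma laplacian_derive g : smooth g -> (forall z, laplacian g z = 0) ->
  (forall z, laplacian ('D_v1 g) z = 0) /\ (forall z, laplacian ('D_v2 g) z = 0).
Proof.
move=> sg g0.
have g1 := smooth_derive1 sg; have g2 := smooth_derive2 sg.
have g11 := smooth_derive1 g1; have g22 := smooth_derive2 g2.
have sw : 'D_v2 ('D_v1 g) = 'D_v1 ('D_v2 g).
  by apply/funext => y; exact: smooth_derive_swap.
have E : 'D_v1 ('D_v1 g) \+ 'D_v2 ('D_v2 g) = cst 0 by apply/funext => y; exact: g0.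
have D1 z := deriveD_pw (smooth_derivable z g11).1 (smooth_derivable z g22).1.
have D2 z := deriveD_pw (smooth_derivable z g11).2 (smooth_derivable z g22).2.
have E0 v z := etrans (congr1 (fun h : R * R -> R => 'D_v h z) E)
  (derive_cst_pw 0 v z).
split=> z.
- have A1 := congr1 (fun h : R * R -> R => 'D_v2 h z) sw.
  have A2 := congr1 (fun x => 'D_v1 ('D_v1 ('D_v1 g)) z + x)
    (etrans A1 (smooth_derive_swap z g2)).
  have A3 := etrans A2 (etrans (esym (D1 z)) (E0 v1 z)).
  exact A3.
- have A1 := congr1 (fun h : R * R -> R => 'D_v1 h z) (esym sw).
  have A2 := congr1 (fun x => x + 'D_v2 ('D_v2 ('D_v2 g)) z)
    (etrans A1 (esym (smooth_derive_swap z g1))).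
  have A3 := etrans A2 (etrans (esym (D2 z)) (E0 v2 z)).
  exact A3.
Qed.

(** Where [u ^ 2 + N |grad u| ^ 2] is maximal its Laplacian, a sum of squares,
    is nonpositive, so the gradient vanishes there and the maximal value is at
    most [max u ^ 2]; as N is arbitrary the gradient vanishes everywhere. *)
Lemma periodic_harmonic_cst L g : is_lattice L -> lattice_periodic L g ->
  smooth g -> (forall z, laplacian g z = 0) -> forall z, g z = g 0.
Proof.
move=> Llat gL sg g0.
have g1 := smooth_derive1 sg; have g2 := smooth_derive2 sg.
have [h1 h2] := laplacian_derive sg g0.
pose E := ('D_v1 g \* 'D_v1 g) \+ ('D_v2 g \* 'D_v2 g).
have sE : smooth E by exact: (smoothD (smoothM g1 g1) (smoothM g2 g2)).
have EL : lattice_periodic L E.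
  move=> z w Lw; rewrite /E /=.
  rewrite (periodic_derive gL (fun z => (smooth_derivable z sg).1) z Lw).
  by rewrite (periodic_derive gL (fun z => (smooth_derivable z sg).2) z Lw).
have E0 z : 0 <= E z by rewrite /E /=; apply: addr_ge0; rewrite -expr2 sqr_ge0.
have sgg := smoothM sg sg.
have [zm Hm] : exists z0, forall z, (g \* g) z <= (g \* g) z0.
  apply: (periodic_max Llat _ (smooth_continuous sgg)) => z w Lw /=.
  by rewrite gL.
have key (N : R) z : 0 < N -> N * E z <= (g \* g) zm.
  move=> N0.
  have sNE := smoothM (smooth_cst N) sE.
  have sQ := smoothD sgg sNE.
  have [y Hy] : exists z0, forall z, ((g \* g) \+ (cst N \* E)) z <= ((g \* g) \+ (cst N \* E)) z0.
    apply: (periodic_max Llat _ (smooth_continuous sQ)) => x w Lw.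
    by rewrite /= gL// EL.
  have L0 := laplacian_sq y sg; rewrite (g0 y) mulr0 mulr0 addr0 in L0.
  have L1 := laplacian_sq y g1; rewrite (h1 y) mulr0 mulr0 addr0 in L1.
  have L2 := laplacian_sq y g2; rewrite (h2 y) mulr0 mulr0 addr0 in L2.
  have LE := laplacianD y (smoothM g1 g1) (smoothM g2 g2).
  rewrite L1 L2 in LE.
  have LQ := laplacianD y sgg sNE.
  rewrite L0 (laplacianZ N y sE) LE in LQ.
  have Hl := laplacian_max sQ Hy; rewrite LQ in Hl.
  have Ey : E y = 0.
    apply/eqP; rewrite eq_le E0 andbT.
    have alg (p a b c d : R) : 2 * p + N * (2 * (a ^+ 2 + b ^+ 2)
        + 2 * (c ^+ 2 + d ^+ 2)) <= 0 -> p <= 0.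
      have sq : 0 <= N * (2 * (a ^+ 2 + b ^+ 2) + 2 * (c ^+ 2 + d ^+ 2)).
        apply: mulr_ge0; first exact: ltW.
        by rewrite addr_ge0// mulr_ge0// addr_ge0// sqr_ge0.
      by move=> H; clear - sq H; lra.
    have := alg _ _ _ _ _ Hl; by rewrite /E /= -!expr2.
  have := Hy z; rewrite /= Ey mulr0 addr0 => Hz.
  have gg0 : 0 <= g z * g z by rewrite -expr2 sqr_ge0.
  have := Hm y => /= Hmy.
  by apply: le_trans Hmy; apply: le_trans Hz; rewrite lerDr.
(* take N so large that N E z would exceed the bound max g ^ 2 *)
have {}E0 z : E z = 0.
  apply/eqP; rewrite eq_le E0 andbT leNgt; apply/negP => pos.
  have := key (((g \* g) zm + 1) / E z) z.
  rewrite divfK ?gt_eqF// => H.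
  have : (g \* g) zm + 1 <= (g \* g) zm.
    apply: H; rewrite divr_gt0// ltr_wpDl//= -expr2 sqr_ge0//.
  by rewrite gerDl ler10.
apply: (gradient0_cst sg) => z; apply/eqP; move: (E0 z) => /eqP;
  rewrite /E /= -!expr2 paddr_eq0 ?sqr_ge0// => /andP[]; by rewrite !sqrf_eq0.
Qed.

End Liouville.

End PeriodicHarmonic.

(** * Integrals depending on a parameter *)

Module Import Primitives.

Section Poincare.
Variable R : realType.
Implicit Types (g h : R * R -> R) (z v w : R * R).

Local Notation v1 := ((1, 0) : R * R).
Local Notation v2 := ((0, 1) : R * R).
Local Notation mu := (@lebesgue_measure R).
Local Notation I01 := (`[0, 1]%classic : set R).

Lemma integrable_I01 (f : R -> R) : continuous f -> mu.-integrable I01 (EFin \o f).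
Proof.
move=> cf; apply: continuous_compact_integrable; first exact: segment_compact.
exact: continuous_subspaceT.
Qed.

Lemma continuous_pair1 g (x : R) : continuous g -> continuous (fun t => g (x, t)).
Proof.
move=> cg t; have c1 : (fun t : R => (x, t)) @ t --> (x, t).
  by apply: (@cvg_pair _ _ _ (nbhs t) (nbhs x) (nbhs t)); [exact: cvg_cst|exact: cvg_id].
exact: (cvg_comp _ _ c1 (cg (x, t))).
Qed.

Lemma integral_derivative (F f : R -> R) : continuous f ->
  (forall t : R, is_derive t 1 F (f t)) ->
  (\int[mu]_(t in I01) f t)%R = F 1 - F 0.
Proof.
move=> cf dF; have cF : continuous F.
  by move=> t; apply/differentiable_continuous/derivable1_diffP; case: (dF t).
rewrite /Rintegral (@continuous_FTC2 _ f F 0 1)//.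
- exact: continuous_subspaceT.
- split; first by move=> t _; case: (dF t).
    by apply: cvg_at_right_filter; exact: cF.
  by apply: cvg_at_left_filter; exact: cF.
- by move=> t _; rewrite derive1E; case: (dF t).
Qed.

(** On a compact rectangle around the parameter the derivative of the integrand
    is bounded by a constant, which is a dominating function. *)
Lemma derive_integral (phi psi : R -> R -> R) (x : R) :
  (forall y, continuous (phi y)) -> continuous (fun p : R * R => psi p.1 p.2) ->
  (forall y t : R, is_derive y 1 (phi^~ t) (psi y t)) ->
  is_derive x 1 (fun y => \int[mu]_(t in I01) phi y t)%R
    (\int[mu]_(t in I01) psi x t)%R.
Proof.
move=> cphi cpsi dphi.
pose A : set (R * R) := `[x - 1, x + 1] `*` `[0, 1].
have cA : compact A by apply: compact_setX; exact: segment_compact.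
have A0 : A !=set0.
  by exists (x, 0); split; rewrite /= in_itv /= ?lexx ?ler01//; lra.
have cn : {within A, continuous (fun p : R * R => `|psi p.1 p.2|)}.
  apply: continuous_subspaceT => p.
  exact: (cvg_comp _ _ (cpsi p) (@norm_continuous _ _ (psi p.1 p.2))).
have [c _ Hc] := compact_EVT_max A0 cA cn.
set M := `|psi c.1 c.2| in Hc.
have xI : `]x - 1, x + 1[%classic x by rewrite /= in_itv /=; lra.
have h1 y : `]x - 1, x + 1[%classic y -> mu.-integrable I01 (EFin \o phi y).
  by move=> _; apply: integrable_I01; exact: cphi.
have h2 y t : `]x - 1, x + 1[%classic y -> I01 t -> derivable (phi^~ t) y 1.
  by move=> _ _; case: (dphi y t).
have h3 : mu.-integrable I01 (EFin \o (fun _ : R => M)).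
  by apply: integrable_I01 => t; exact: cvg_cst.
have E y t : partial1of2 phi y t = psi y t.
  by rewrite partial1of2E; case: (dphi y t).
have h4 y t : `]x - 1, x + 1[%classic y -> I01 t -> `|partial1of2 phi y t| <= M.
  move=> yI tI; rewrite E; apply: (Hc (y, t)); rewrite inE; split => //=.
  by move: yI; rewrite /= !in_itv /= => /andP[/ltW -> /ltW ->].
have M0 (t : R) : 0 <= M by exact: normr_ge0.
have d1 := @derivable_under_integral R _ _ mu phi I01 (measurable_itv _) x (x - 1) (x + 1) xI h1 h2 (fun=> M) M0 h3 h4.
have d2 := @differentiation_under_integral R _ _ mu phi I01 (measurable_itv _) x (x - 1) (x + 1) xI h1 h2 (fun=> M) M0 h3 h4.
apply: DeriveDef; first exact: d1.
rewrite -derive1E d2; apply: eq_Rintegral => t _; exact: E.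
Qed.

Lemma scale_v1 (t x y : R) : t *: v1 + (x, y) = (t + x, y).
Proof.
apply/eqP; rewrite xpair_eqE /= -[t *: 1]/(t * 1) -[t *: 0]/(t * 0).
by rewrite mulr1 mulr0 add0r !eqxx.
Qed.

Lemma scale_v2 (t x y : R) : t *: v2 + (x, y) = (x, t + y).
Proof.
apply/eqP; rewrite xpair_eqE /= -[t *: 1]/(t * 1) -[t *: 0]/(t * 0).
by rewrite mulr1 mulr0 add0r !eqxx.
Qed.

Lemma derive_v1 g (x y c : R) :
  is_derive (x, y) v1 g c <-> is_derive x 1 (fun t => g (t, y)) c.
Proof.
have E : (fun s : R => s^-1 *: ((g \o shift (x, y)) (s *: v1) - g (x, y)))
  = (fun s : R => s^-1 *: (((fun t => g (t, y)) \o shift x) (s *: 1) - g (x, y))).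
  by apply/funext => s /=; rewrite scale_v1 [s *: 1]mulr1.
by split; case=> d1 d2; (apply: DeriveDef;
  [move: d1; rewrite /derivable E|move: d2; rewrite /derive E]).
Qed.

Lemma derive_v2 g (x y c : R) :
  is_derive (x, y) v2 g c <-> is_derive y 1 (fun t => g (x, t)) c.
Proof.
have E : (fun s : R => s^-1 *: ((g \o shift (x, y)) (s *: v2) - g (x, y)))
  = (fun s : R => s^-1 *: (((fun t => g (x, t)) \o shift y) (s *: 1) - g (x, y))).
  by apply/funext => s /=; rewrite scale_v2 [s *: 1]mulr1.
by split; case=> d1 d2; (apply: DeriveDef;
  [move: d1; rewrite /derivable E|move: d2; rewrite /derive E]).
Qed.

(** Substituting [s = y t] writes the primitive over the fixed interval [0, 1],
    where it can be differentiated under the integral sign. *)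
Lemma antiderivative (G G' : R -> R) (y : R) : continuous G' ->
  (forall t : R, is_derive t 1 G (G' t)) ->
  is_derive y 1 (fun y => \int[mu]_(t in I01) (y * G (y * t)))%R (G y).
Proof.
move=> cG' dG; have cG : continuous G.
  by move=> t; apply/differentiable_continuous/derivable1_diffP; case: (dG t).
pose psi (y t : R) := G (y * t) + y * (t * G' (y * t)).
have dl (c t : R) : is_derive t 1 (fun t => c * t) c.
  have d1 := is_deriveZ c (is_derive_id t (1 : R)).
  by rewrite -[X in is_derive _ _ _ X]mulr1; exact: d1.
have dr (c t : R) : is_derive t 1 (fun t => t * c) c.
  rewrite (_ : (fun t => t * c) = (fun t => c * t)); first exact: dl.
  by apply/funext => s; rewrite mulrC.
have H : is_derive y 1 (fun y => \int[mu]_(t in I01) (y * G (y * t)))%R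
    (\int[mu]_(t in I01) psi y t)%R.
  apply: derive_integral.
  - move=> x t; apply: cvgMr; apply: (continuous_comp (f := fun t => x * t)).
      by apply: cvgMr; exact: cvg_id.
    exact: cG.
  - have cyt : continuous (fun p : R * R => p.1 * p.2).
      by move=> p; apply: cvgM; [exact: cvg_fst|exact: cvg_snd].
    have cGG (K : R -> R) : continuous K -> continuous (fun p : R * R => K (p.1 * p.2)).
      by move=> cK p; exact: (cvg_comp _ _ (cyt p) (cK _)).
    move=> p; apply: cvgD; first exact: (cGG _ cG).
    apply: cvgM; first exact: cvg_fst.
    by apply: cvgM; [exact: cvg_snd|exact: (cGG _ cG')].
  - move=> x t; have d1 := is_derive1_comp (f := G) (g := fun x => x * t) (dG (x * t)) (dr t x).
    have d2 := is_deriveM (is_derive_id x (1 : R)) d1.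
    apply: (is_derive_eq d2); rewrite /psi /= -[_ *: _]/(_ * _).
    by rewrite -[_ *: 1]/(_ * 1) mulr1 [in RHS]addrC [t * _]mulrC.
rewrite (_ : G y = (\int[mu]_(t in I01) psi y t)%R)//.
have c1 : continuous (psi y).
  move=> t; apply: cvgD; first last.
    apply: cvgMr; apply: cvgM; first exact: cvg_id.
    apply: (continuous_comp (f := fun t => y * t)); last exact: cG'.
    by apply: cvgMr; exact: cvg_id.
  apply: (continuous_comp (f := fun t => y * t)); last exact: cG.
  by apply: cvgMr; exact: cvg_id.
have d1 (t : R) : is_derive t 1 (fun t => t * G (y * t)) (psi y t).
  have d1 := is_derive1_comp (f := G) (g := fun t => y * t) (dG (y * t)) (dl y t).
  have d2 := is_deriveM (is_derive_id t (1 : R)) d1.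
  apply: (is_derive_eq d2); rewrite /psi /= -[_ *: _]/(_ * _).
  rewrite -[_ *: 1]/(_ * 1) mulr1 addrC; congr (_ + _); ring.
by rewrite (integral_derivative c1 d1) !mul1r mulr1 mul0r subr0.
Qed.

(** Needed because smoothness asks for joint continuity, while a potential
    built by integration is at first only known through its two partial
    derivatives. *)
Lemma partials_continuous g : (forall z, derivable g z v1) ->
  (forall z, derivable g z v2) -> continuous ('D_v1 g) -> continuous ('D_v2 g) ->
  continuous g.
Proof.
move=> d1 d2 c1 c2 [x y].
have bnd h z : continuous h -> exists2 K : R, 0 < K & \forall w \near z, `|h w| <= K.
  move=> ch; exists (`|h z| + 1); first by rewrite ltr_wpDl.
  have /cvgrPdist_le/(_ _ ltr01) := ch z; apply: filterS => w.
  have := ler_normD (h z - h w) (- h z); rewrite addrAC subrr add0r !normrN.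
  move: (`|h w|) (`|h z|) (`|h z - h w|) => p q r; lra.
have [K1 K10 N1] := bnd _ (x, y) c1.
have [K2 K20 N2] := bnd _ (x, y) c2.
have seg v K z w (t : R) : (forall z, derivable g z v) -> 0 <= K ->
    (forall c, `|c| <= `|t| -> `|'D_v g (c *: v + z)| <= K) -> w = t *: v + z ->
    `|g w - g z| <= K * `|t|.
  move=> dg K0 HK ->; case: (ltrgtP t 0) => [tn|tp|->]; last first.
  - by rewrite scale0r add0r subrr normr0 mulr0.
  - have [c /andP[c0 ct] ->] := mvt_line z dg tp.
    rewrite normrM mulrC; apply: ler_wpM2r => //; apply: HK.
    by rewrite !gtr0_norm// ltW.
  - have tn' : 0 < - t by rewrite oppr_gt0.
    have [c /andP[c0 ct]] := mvt_line (t *: v + z) dg tn'.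
    rewrite scaleNr addKr distrC => ->; rewrite normrM mulrC normrN.
    apply: ler_wpM2r => //; rewrite addrA -scalerDl; apply: HK.
    by rewrite !ltr0_norm//; lra.
apply/cvgrPdist_le => e e0.
have /nbhs_ballP[r1 /= r10 B1] := N1.
have /nbhs_ballP[r2 /= r20 B2] := N2.
have D1 : 0 < K1 + K2 by rewrite addr_gt0.
have rr0 : 0 < Num.min (Num.min r1 r2) (e / (K1 + K2)).
  by rewrite !lt_min r10 r20 /= divr_gt0.
suff : nbhs ((x, y) : R * R) [set w | `|g (x, y) - g w| <= e] by [].
apply/nbhs_ballP; exists (Num.min (Num.min r1 r2) (e / (K1 + K2))) => // -[x' y'].
rewrite -ball_normE /= /ball_ /= prod_normE /= gt_max !lt_min.
move=> /andP[/andP[/andP[xr1 xr2] xe] /andP[/andP[yr1 yr2] ye]].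
have Ey : `|g (x, y') - g (x, y)| <= K2 * `|y' - y|.
  apply: (seg v2 K2 (x, y) (x, y') (y' - y) d2 (ltW K20)); last first.
    by rewrite scale_v2 subrK.
  move=> c cb; apply: B2; rewrite -ball_normE /= scale_v2 prod_normE /= gt_max.
  rewrite subrr normr0 r20 /= opprD addrCA subrr addr0 normrN.
  by apply: le_lt_trans cb _; rewrite distrC.
have Ex : `|g (x', y') - g (x, y')| <= K1 * `|x' - x|.
  apply: (seg v1 K1 (x, y') (x', y') (x' - x) d1 (ltW K10)); last first.
    by rewrite scale_v1 subrK.
  move=> c cb; apply: B1; rewrite -ball_normE /= scale_v1 prod_normE /= gt_max.
  rewrite yr1 andbT opprD addrCA subrr addr0 normrN.
  by apply: le_lt_trans cb _; rewrite distrC.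
have -> : g (x, y) - g (x', y') = - ((g (x', y') - g (x, y')) + (g (x, y') - g (x, y))).
  by ring.
rewrite normrN; apply: le_trans (ler_normD _ _) _.
have Ee : e = (K1 + K2) * (e / (K1 + K2)) by rewrite mulrC divfK// gt_eqF.
rewrite Ee mulrDl; apply: lerD.
  apply: le_trans Ex _; apply: ler_wpM2l; first exact: ltW.
  by rewrite distrC ltW.
apply: le_trans Ey _; apply: ler_wpM2l; first exact: ltW.
by rewrite distrC ltW.
Qed.

End Poincare.

End Primitives.

(** * Potentials of closed forms and smooth arguments *)

Module Import ArgumentFunction.

Section Argument.
Variable R : realType.
Implicit Types (g h : R * R -> R) (z v w : R * R).

Local Notation v1 := ((1, 0) : R * R).
Local Notation v2 := ((0, 1) : R * R).
Local Notation mu := (@lebesgue_measure R).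
Local Notation I01 := (`[0, 1]%classic : set R).

(** The potential integrates the form along the horizontal axis and then
    vertically; closedness enters when the second integral is differentiated
    in the horizontal direction. *)
Lemma poincare a b : smooth a -> smooth b ->
  (forall z, 'D_v2 a z = 'D_v1 b z) ->
  exists2 t : R * R -> R, smooth t & forall z,
    'D_v1 t z = a z /\ 'D_v2 t z = b z.
Proof.
move=> sa sb ab.
pose P (x : R) := (\int[mu]_(s in I01) (x * a (x * s, 0)))%R.
pose Q (x y : R) := (\int[mu]_(s in I01) (y * b (x, y * s)))%R.
have da1 (x y : R) : is_derive x 1 (fun t => a (t, y)) ('D_v1 a (x, y)).
  apply/derive_v1; exact: derivableP (smooth_derivable (x, y) sa).1.
have da2 (x y : R) : is_derive y 1 (fun t => a (x, t)) ('D_v2 a (x, y)).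
  apply/derive_v2; exact: derivableP (smooth_derivable (x, y) sa).2.
have db1 (x y : R) : is_derive x 1 (fun t => b (t, y)) ('D_v1 b (x, y)).
  apply/derive_v1; exact: derivableP (smooth_derivable (x, y) sb).1.
have db2 (x y : R) : is_derive y 1 (fun t => b (x, t)) ('D_v2 b (x, y)).
  apply/derive_v2; exact: derivableP (smooth_derivable (x, y) sb).2.
have csw g (y : R) : continuous g -> continuous (fun x => g (x, y)).
  move=> cg t; have c1 : (fun t : R => (t, y)) @ t --> (t, y).
    by apply: (@cvg_pair _ _ _ (nbhs t) (nbhs t) (nbhs y)); [exact: cvg_id|exact: cvg_cst].
  exact: (cvg_comp _ _ c1 (cg (t, y))).
have ca1 := smooth_continuous (smooth_derive1 sa).
have ca2 := smooth_continuous (smooth_derive2 sa).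
have cb1 := smooth_continuous (smooth_derive1 sb).
have cb2 := smooth_continuous (smooth_derive2 sb).
have dP (x : R) : is_derive x 1 P (a (x, 0)).
  exact: (antiderivative (G := fun x => a (x, 0)) x (csw _ 0 ca1) (fun t => da1 t 0)).
have dQ2 (x y : R) : is_derive y 1 (Q x) (b (x, y)).
  exact: (antiderivative (G := fun y => b (x, y)) y (continuous_pair1 (x := x) cb2) (fun t => db2 x t)).
(* closedness replaces the derivative of b along x by that of a along y *)
have dQ1 (x y : R) : is_derive x 1 (Q^~ y) (a (x, y) - a (x, 0)).
  have cy K : continuous K -> continuous (fun p : R * R => y * K (p.1, y * p.2)).
    move=> cK p.
    have c2 : (fun p : R * R => y * p.2) @ p --> y * p.2.
      by apply: cvgMr; exact: cvg_snd.
    have c1 : (fun p : R * R => (p.1, y * p.2)) @ p --> (p.1, y * p.2).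
      by apply: (@cvg_pair _ _ _ (nbhs p) (nbhs p.1) (nbhs (y * p.2))); [exact: cvg_fst|exact: c2].
    have c3 := cvg_comp _ _ c1 (cK (p.1, y * p.2)).
    exact: (cvgM (cvg_cst y) c3).
  have H : is_derive x 1 (Q^~ y) (\int[mu]_(s in I01) (y * 'D_v1 b (x, y * s)))%R.
    have c1 (u : R) : continuous (fun s => y * b (u, y * s)).
      exact: (continuous_pair1 (x := u) (cy _ (smooth_continuous sb))).
    have d1 (u s : R) : is_derive u 1 (fun u => y * b (u, y * s)) (y * 'D_v1 b (u, y * s)).
      by have d1 := is_deriveZ y (db1 u (y * s)); exact: d1.
    exact: (derive_integral x c1 (cy _ cb1) d1).
  have dl (c t : R) : is_derive t 1 (fun t => c * t) c.
    have d1 := is_deriveZ c (is_derive_id t (1 : R)).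
    by rewrite -[X in is_derive _ _ _ X]mulr1; exact: d1.
  have d1 (t : R) : is_derive t 1 (fun t => a (x, y * t)) (y * 'D_v1 b (x, y * t)).
    have d1 := is_derive1_comp (f := fun t => a (x, t)) (g := fun t => y * t)
      (da2 x (y * t)) (dl y t).
    by apply: (is_derive_eq d1); rewrite ab mulrC.
  have E := integral_derivative (continuous_pair1 (x := x) (cy _ cb1)) d1.
  by rewrite /= mulr1 mulr0 in E; rewrite -E.
pose t z := P z.1 + Q z.1 z.2.
have dt1 z : is_derive z v1 t (a z).
  case: z => x y; apply/derive_v1.
  have d1 := dP x; have d2 := dQ1 x y; have d3 := is_deriveD d1 d2.
  by apply: (is_derive_eq d3); rewrite addrC subrK.
have dt2 z : is_derive z v2 t (b z).
  case: z => x y; apply/derive_v2.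
  have d1 := is_derive_cst (P x) y (1 : R); have d2 := dQ2 x y.
  have d3 := is_deriveD d1 d2.
  by apply: (is_derive_eq d3); rewrite add0r.
have E1 : 'D_v1 t = a by apply/funext => z; case: (dt1 z).
have E2 : 'D_v2 t = b by apply/funext => z; case: (dt2 z).
exists t; last by move=> z; split; [case: (dt1 z)|case: (dt2 z)].
have ct : continuous t.
  apply: partials_continuous.
  + by move=> z; case: (dt1 z).
  + by move=> z; case: (dt2 z).
  + by rewrite E1; exact: smooth_continuous.
  + by rewrite E2; exact: smooth_continuous.
by apply: (smooth_boot ct dt1 dt2) => k _; split; [exact: sa|exact: sb].
Qed.

Lemma unit_circle_angle (x y : R) : x ^+ 2 + y ^+ 2 = 1 ->
  exists t, cos t = x /\ sin t = y.
Proof.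
move=> xy.
have xb : -1 <= x <= 1 by have y0 := sqr_ge0 y; apply/andP; split; nra.
have sxy : Num.sqrt (1 - x ^+ 2) = `|y|.
  by rewrite -xy addrC addKr sqrtr_sqr.
have [y0|y0] := leP 0 y.
- exists (acos x); rewrite acosK// sin_acos// sxy ger0_norm//.
- exists (- acos x); rewrite cosN sinN acosK// sin_acos// sxy ltr0_norm//.
  by rewrite opprK.
Qed.

Local Opaque derive derivable.

(** The form p dq - q dp is closed, since the gradients of p and q are both
    multiples of it. Let t be its potential, normalised at the origin: rotating
    (p, q) by the angle -t gives a pair with zero gradient. *)
Lemma smooth_argument p q : smooth p -> smooth q ->
  (forall z, p z ^+ 2 + q z ^+ 2 = 1) ->
  exists2 t : R * R -> R, smooth t & forall z, p z = cos (t z) /\ q z = sin (t z).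
Proof.
move=> sp sq pq.
pose a v z := p z * 'D_v q z + - q z * 'D_v p z.
have snq := smoothN sq.
have sa1 : smooth (a v1).
  exact: (smoothD (smoothM sp (smooth_derive1 sq)) (smoothM snq (smooth_derive1 sp))).
have sa2 : smooth (a v2).
  exact: (smoothD (smoothM sp (smooth_derive2 sq)) (smoothM snq (smooth_derive2 sp))).
have pqE : (p \* p) \+ (q \* q) = cst 1.
  by apply/funext => z; rewrite /= -!expr2.
have orth v z : derivable p z v -> derivable q z v ->
    'D_v p z = - (a v z * q z) /\ 'D_v q z = a v z * p z.
  move=> dp dq.
  have A1 := deriveD_pw (derivableM_pw dp dp) (derivableM_pw dq dq).
  rewrite pqE derive_cst_pw (deriveM_pw dp dp) (deriveM_pw dq dq) in A1.
  move: A1 (pq z); rewrite /a; move: (p z) (q z) ('D_v p z) ('D_v q z).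
  clear => x y dx dy A1 A2.
  have A3 : x * dx + y * dy = 0 by lra.
  split.
    rewrite -[LHS]mul1r -A2; have -> : - ((x * dy + - y * dx) * y) =
      (x ^+ 2 + y ^+ 2) * dx - x * (x * dx + y * dy) by ring.
    by rewrite A3; ring.
  rewrite -[LHS]mul1r -A2; have -> : ((x * dy + - y * dx) * x) =
    (x ^+ 2 + y ^+ 2) * dy - y * (x * dx + y * dy) by ring.
  by rewrite A3; ring.
have dp1 z := (smooth_derivable z sp).1; have dp2 z := (smooth_derivable z sp).2.
have dq1 z := (smooth_derivable z sq).1; have dq2 z := (smooth_derivable z sq).2.
have closed z : 'D_v2 (a v1) z = 'D_v1 (a v2) z.
  have sp1 := smooth_derive1 sp; have sp2 := smooth_derive2 sp.
  have sq1 := smooth_derive1 sq; have sq2 := smooth_derive2 sq.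
  have da v w : derivable p z w -> derivable q z w -> derivable ('D_v p) z w ->
      derivable ('D_v q) z w -> derivable (fun z => - q z) z w ->
      'D_w (fun z => - q z) z = - 'D_w q z ->
      'D_w (a v) z = 'D_w p z * 'D_v q z + p z * 'D_w ('D_v q) z
        + (- 'D_w q z * 'D_v p z + - q z * 'D_w ('D_v p) z).
    move=> x1 x2 x3 x4 x5 x6.
    have A1 := deriveM_pw x1 x4; have A2 := deriveM_pw x5 x3.
    rewrite x6 in A2.
    have A3 := deriveD_pw (derivableM_pw x1 x4) (derivableM_pw x5 x3).
    by rewrite A1 A2 in A3; exact: A3.
  have dNq v : derivable q z v -> 'D_v (fun z => - q z) z = - 'D_v q z.
    by move=> dq; exact: deriveN.
  have B1 := da v1 v2 (dp2 z) (dq2 z) (smooth_derivable z sp1).2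
    (smooth_derivable z sq1).2 (smooth_derivable z snq).2 (dNq _ (dq2 z)).
  have B2 := da v2 v1 (dp1 z) (dq1 z) (smooth_derivable z sp2).1
    (smooth_derivable z sq2).1 (smooth_derivable z snq).1 (dNq _ (dq1 z)).
  have [C1 C2] := orth _ _ (dp1 z) (dq1 z).
  have [C3 C4] := orth _ _ (dp2 z) (dq2 z).
  rewrite (smooth_derive_swap z sp) (smooth_derive_swap z sq) C1 C2 C3 C4 in B1.
  rewrite C1 C2 C3 C4 in B2.
  rewrite B1 B2.
  have alg (x y A B C D : R) : - (B * y) * (A * x) + C + (- (B * x) * - (A * y) + D)
     = - (A * y) * (B * x) + C + (- (A * x) * - (B * y) + D) by ring.
  exact: alg.
have [t0 st0 Ht0] := poincare sa1 sa2 closed.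
(* the constant of integration is chosen so that the formula holds at 0 *)
have [c [cx cy]] := unit_circle_angle (pq 0).
pose t z := t0 z + (c - t0 0).
have st : smooth t by exact: (smoothD st0 (smooth_cst _)).
have dt v z : derivable t0 z v -> 'D_v t z = 'D_v t0 z.
  move=> d; have A := deriveD_pw d (derivable_cst (c - t0 0) z v).
  rewrite derive_cst_pw addr0 in A; exact: A.
have [ssin scos] := smooth_sincos st.
(* A + i B is the product of p + i q and exp (- i t) *)
pose A := (p \* (@cos R \o t)) \+ (q \* (@sin R \o t)).
pose B := (q \* (@cos R \o t)) \+ ((fun z => - p z) \* (@sin R \o t)).
have sA : smooth A by exact: (smoothD (smoothM sp scos) (smoothM sq ssin)).
have sB : smooth B by exact: (smoothD (smoothM sq scos) (smoothM (smoothN sp) ssin)).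
have dAB v z : derivable p z v -> derivable q z v -> derivable t z v ->
    'D_v t z = a v z -> 'D_v A z = 0 /\ 'D_v B z = 0.
  move=> d1 d2 d3 E; have [C1 C2] := orth _ _ d1 d2.
  have [es1 es2] := is_derive_comp1 d3 (is_derive_sin (t z)).
  have [ec1 ec2] := is_derive_comp1 d3 (is_derive_cos (t z)).
  have d1N : derivable (fun z => - p z) z v by exact: derivableN.
  have E1 : 'D_v (fun z => - p z) z = - 'D_v p z by exact: deriveN.
  have A1 := deriveM_pw d1 ec1; have A2 := deriveM_pw d2 es1.
  have A3 := deriveD_pw (derivableM_pw d1 ec1) (derivableM_pw d2 es1).
  rewrite A1 A2 ec2 es2 C1 C2 E /= in A3.
  have B1 := deriveM_pw d2 ec1; have B2 := deriveM_pw d1N es1.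
  have B3 := deriveD_pw (derivableM_pw d2 ec1) (derivableM_pw d1N es1).
  rewrite B1 B2 ec2 es2 E1 C1 C2 E /= in B3.
  split; first by apply: etrans A3 _; ring.
  by apply: etrans B3 _; ring.
have dA1 z := dAB v1 z (dp1 z) (dq1 z) (smooth_derivable z st).1
   (etrans (dt v1 z (smooth_derivable z st0).1) (Ht0 z).1).
have dA2 z := dAB v2 z (dp2 z) (dq2 z) (smooth_derivable z st).2
   (etrans (dt v2 z (smooth_derivable z st0).2) (Ht0 z).2).
have cA z := gradient0_cst sA (fun z => (dA1 z).1) (fun z => (dA2 z).1) z.
have cB z := gradient0_cst sB (fun z => (dA1 z).2) (fun z => (dA2 z).2) z.
have t00 : t 0 = c by rewrite /t addrCA subrr addr0.
exists t => // z; have := cA z; have := cB z.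
rewrite /A /B /= !t00 -cx -cy => H1 H2.
have := cos2Dsin2 (t z); have := cos2Dsin2 c.
have := H1; have := H2; move: (p z) (q z) (cos (t z)) (sin (t z)) (cos c) (sin c).
clear => x y C S u w H2 H1 uw CS.
have {}H1 : y * C - x * S = 0 by lra.
have {}H2 : x * C + y * S = 1 by rewrite -uw; lra.
split.
  have -> : x = C * (x * C + y * S) - S * (y * C - x * S)
      + x * (1 - (C ^+ 2 + S ^+ 2)) by ring.
  by rewrite H1 H2 CS; ring.
have -> : y = S * (x * C + y * S) + C * (y * C - x * S)
    + y * (1 - (C ^+ 2 + S ^+ 2)) by ring.
by rewrite H1 H2 CS; ring.
Qed.

End Argument.

End ArgumentFunction.

(** * Wirtinger derivatives of complex functions *)

Module Import ComplexFunctions.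

Section ComplexFunctions.
Variable R : realType.
Notation C := R[i].
Implicit Types (g h : R * R -> C) (u : R * R -> R) (z v w : R * R).

Local Opaque derive derivable.
Local Notation v1 := ((1, 0) : R * R).
Local Notation v2 := ((0, 1) : R * R).

Definition smoothC g :=
  smooth (fun z => complex.Re (g z)) /\ smooth (fun z => complex.Im (g z)).

Lemma smooth_ext u u' : u =1 u' -> smooth u -> smooth u'.
Proof. by move=> /funext ->. Qed.

Lemma complex_ReM (x y : C) : complex.Re (x * y) =
  complex.Re x * complex.Re y + - (complex.Im x * complex.Im y).
Proof. by case: x y => [a b] [c d]. Qed.

Lemma complex_ImM (x y : C) : complex.Im (x * y) =
  complex.Re x * complex.Im y + complex.Im x * complex.Re y.
Proof. by case: x y => [a b] [c d]. Qed.

Lemma complex_ReD (x y : C) : complex.Re (x + y) = complex.Re x + complex.Re y.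
Proof. by case: x y => [a b] [c d]. Qed.

Lemma complex_ImD (x y : C) : complex.Im (x + y) = complex.Im x + complex.Im y.
Proof. by case: x y => [a b] [c d]. Qed.

Lemma complex_ext (x y : C) : complex.Re x = complex.Re y ->
  complex.Im x = complex.Im y -> x = y.
Proof. by case: x y => [a b] [c d] /= -> ->. Qed.

Lemma smoothC_cst (c : C) : smoothC (cst c).
Proof. by split; exact: smooth_cst. Qed.

Lemma smoothC_real u : smooth u -> smoothC (fun z => (u z)%:C%C).
Proof. by move=> su; split; [exact: su|exact: smooth_cst]. Qed.

Lemma smoothCD g h : smoothC g -> smoothC h -> smoothC (fun z => g z + h z).
Proof.
move=> [g1 g2] [h1 h2]; split.
  by apply: smooth_ext (smoothD g1 h1) => z; rewrite complex_ReD.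
by apply: smooth_ext (smoothD g2 h2) => z; rewrite complex_ImD.
Qed.

Lemma smoothCM g h : smoothC g -> smoothC h -> smoothC (fun z => g z * h z).
Proof.
move=> [g1 g2] [h1 h2]; split.
  by apply: smooth_ext (smoothD (smoothM g1 h1) (smoothN (smoothM g2 h2))) => z; rewrite complex_ReM.
by apply: smooth_ext (smoothD (smoothM g1 h2) (smoothM g2 h1)) => z; rewrite complex_ImM.
Qed.

Lemma smoothCN g : smoothC g -> smoothC (fun z => - g z).
Proof.
move=> sg; have := smoothCM (smoothC_cst (-1)) sg.
by congr smoothC; apply/funext => z; rewrite mulN1r.
Qed.

Lemma smoothCB g h : smoothC g -> smoothC h -> smoothC (fun z => g z - h z).
Proof. by move=> sg sh; exact: (smoothCD sg (smoothCN sh)). Qed.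

Lemma smoothCJ g : smoothC g -> smoothC (fun z => ((g z)^*)%C).
Proof.
move=> [g1 g2]; split; first by apply: smooth_ext g1 => z; case: (g z).
by apply: smooth_ext (smoothN g2) => z; case: (g z).
Qed.

Lemma smoothC_sum (I : Type) (s : seq I) (P : pred I) (G : I -> R * R -> C) :
  (forall i, smoothC (G i)) -> smoothC (fun z => \sum_(i <- s | P i) G i z).
Proof.
move=> sG; elim: s => [|i s IH].
  have -> : (fun z => \sum_(i <- [::] | P i) G i z) = cst 0.
    by apply/funext => z; rewrite big_nil.
  exact: smoothC_cst.
have -> : (fun z => \sum_(i <- i :: s | P i) G i z) =
    (fun z => (if P i then G i z else 0) + \sum_(i <- s | P i) G i z).
  by apply/funext => z; rewrite big_cons; case: (P i); rewrite ?add0r.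
apply: smoothCD => //; case: (P i) => //; exact: smoothC_cst.
Qed.

Lemma smoothC_prod (I : Type) (s : seq I) (P : pred I) (G : I -> R * R -> C) :
  (forall i, smoothC (G i)) -> smoothC (fun z => \prod_(i <- s | P i) G i z).
Proof.
move=> sG; elim: s => [|i s IH].
  have -> : (fun z => \prod_(i <- [::] | P i) G i z) = cst 1.
    by apply/funext => z; rewrite big_nil.
  exact: smoothC_cst.
have -> : (fun z => \prod_(i <- i :: s | P i) G i z) =
    (fun z => (if P i then G i z else 1) * \prod_(i <- s | P i) G i z).
  by apply/funext => z; rewrite big_cons; case: (P i); rewrite ?mul1r.
apply: smoothCM => //; case: (P i) => //; exact: smoothC_cst.
Qed.

Lemma smoothCV g : smoothC g -> (forall z, g z != 0) -> smoothC (fun z => (g z)^-1).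
Proof.
move=> [g1 g2] g0.
have sn := smoothD (smoothM g1 g1) (smoothM g2 g2).
have n0 z : complex.Re (g z) * complex.Re (g z) +
    complex.Im (g z) * complex.Im (g z) != 0.
  apply: contra (g0 z); rewrite -!expr2 paddr_eq0 ?sqr_ge0// !sqrf_eq0.
  by case: (g z) => a b /= /andP[/eqP -> /eqP ->].
have sv := smoothV sn n0.
split.
  apply: smooth_ext (smoothM g1 sv) => z /=.
  by case: (g z) => a b /=; rewrite -!expr2.
apply: smooth_ext (smoothN (smoothM g2 sv)) => z /=.
by case: (g z) => a b /=; rewrite -!expr2.
Qed.

Definition dC g z : C := 2^-1 * (partialC v1 g z - 'i%C * partialC v2 g z).
Definition dbC g z : C := 2^-1 * (partialC v1 g z + 'i%C * partialC v2 g z).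

(** The two coordinate directions are treated together: this is all that the
    product rule needs to know of a direction. *)
Definition partC_ok v := forall u z, smooth u -> derivable u z v.

Lemma partC_ok1 : partC_ok v1. Proof. by move=> u z su; exact: (smooth_derivable z su).1. Qed.
Lemma partC_ok2 : partC_ok v2. Proof. by move=> u z su; exact: (smooth_derivable z su).2. Qed.

Lemma partialCD v g h z : partC_ok v -> smoothC g -> smoothC h ->
  partialC v (fun z => g z + h z) z = partialC v g z + partialC v h z.
Proof.
move=> ok [g1 g2] [h1 h2]; have A1 := deriveD_pw (ok _ z g1) (ok _ z h1).
have A2 := deriveD_pw (ok _ z g2) (ok _ z h2).
have E1 : (fun z => complex.Re (g z + h z)) =
    (fun z => complex.Re (g z)) \+ (fun z => complex.Re (h z)).
  by apply/funext => y; exact: complex_ReD.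
have E2 : (fun z => complex.Im (g z + h z)) =
    (fun z => complex.Im (g z)) \+ (fun z => complex.Im (h z)).
  by apply/funext => y; exact: complex_ImD.
by rewrite /partialC E1 E2 A1 A2.
Qed.

Lemma partialCM v g h z : partC_ok v -> smoothC g -> smoothC h ->
  partialC v (fun z => g z * h z) z = partialC v g z * h z + g z * partialC v h z.
Proof.
move=> ok [g1 g2] [h1 h2].
have dN u : smooth u -> 'D_v (fun z => - u z) z = - 'D_v u z.
  by move=> su; have := ok _ z su => du; exact: deriveN.
have E1 : (fun z => complex.Re (g z * h z)) =
    ((fun z => complex.Re (g z)) \* (fun z => complex.Re (h z))) \+
    (fun z => - ((fun z => complex.Im (g z)) \* (fun z => complex.Im (h z))) z).
  by apply/funext => y; exact: complex_ReM.
have E2 : (fun z => complex.Im (g z * h z)) =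
    ((fun z => complex.Re (g z)) \* (fun z => complex.Im (h z))) \+
    ((fun z => complex.Im (g z)) \* (fun z => complex.Re (h z))).
  by apply/funext => y; exact: complex_ImM.
have A1 := deriveD_pw (ok _ z (smoothM g1 h1)) (ok _ z (smoothN (smoothM g2 h2))).
have A2 := deriveD_pw (ok _ z (smoothM g1 h2)) (ok _ z (smoothM g2 h1)).
rewrite (dN _ (smoothM g2 h2)) in A1.
rewrite (deriveM_pw (ok _ z g1) (ok _ z h1)) (deriveM_pw (ok _ z g2) (ok _ z h2)) in A1.
rewrite (deriveM_pw (ok _ z g1) (ok _ z h2)) (deriveM_pw (ok _ z g2) (ok _ z h1)) in A2.
rewrite /partialC E1 E2 A1 A2.
move: ('D_v (fun w => complex.Re (g w)) z) ('D_v (fun w => complex.Im (g w)) z).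
move: ('D_v (fun w => complex.Re (h w)) z) ('D_v (fun w => complex.Im (h w)) z).
clear; case: (g z) (h z) => [a b] [c d] p q r s.
by apply: complex_ext => /=; ring.
Qed.

Lemma partialC_cst v (c : C) z : partialC v (cst c) z = 0.
Proof. by apply: complex_ext; rewrite /= derive_cst_pw. Qed.

Lemma partialCJ v g z : partC_ok v -> smoothC g ->
  partialC v (fun z => ((g z)^*)%C) z = ((partialC v g z)^*)%C.
Proof.
move=> ok [g1 g2].
have dN : 'D_v (fun z => - complex.Im (g z)) z = - 'D_v (fun z => complex.Im (g z)) z.
  by have := ok _ z g2 => du; exact: deriveN.
have E1 : (fun z => complex.Re ((g z)^*)%C) = (fun z => complex.Re (g z)).
  by apply/funext => y; case: (g y).
have E2 : (fun z => complex.Im ((g z)^*)%C) = (fun z => - complex.Im (g z)).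
  by apply/funext => y; case: (g y).
by rewrite /partialC E1 E2 dN.
Qed.

Lemma smooth_partialC g : smoothC g ->
  smoothC (partialC v1 g) /\ smoothC (partialC v2 g).
Proof.
move=> [g1 g2]; split; split.
- exact: (smooth_derive1 g1).
- exact: (smooth_derive1 g2).
- exact: (smooth_derive2 g1).
- exact: (smooth_derive2 g2).
Qed.

Lemma partialC_swap g z : smoothC g ->
  partialC v2 (partialC v1 g) z = partialC v1 (partialC v2 g) z.
Proof.
move=> [g1 g2]; have A1 := smooth_derive_swap z g1; have A2 := smooth_derive_swap z g2.
by apply: complex_ext; [exact: A1|exact: A2].
Qed.

Lemma smooth_dC g : smoothC g -> smoothC (dC g).
Proof.
move=> sg; have [s1 s2] := smooth_partialC sg.
apply: smoothCM; first exact: smoothC_cst.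
by apply: smoothCB => //; apply: smoothCM => //; exact: smoothC_cst.
Qed.

Lemma smooth_dbC g : smoothC g -> smoothC (dbC g).
Proof.
move=> sg; have [s1 s2] := smooth_partialC sg.
apply: smoothCM; first exact: smoothC_cst.
by apply: smoothCD => //; apply: smoothCM => //; exact: smoothC_cst.
Qed.

Lemma dCD g h z : smoothC g -> smoothC h ->
  dC (fun z => g z + h z) z = dC g z + dC h z.
Proof.
move=> sg sh; rewrite /dC (partialCD z partC_ok1 sg sh) (partialCD z partC_ok2 sg sh).
move: (partialC _ _ _) (partialC _ _ _) (partialC _ _ _) (partialC _ _ _) => a b c d.
ring.
Qed.

Lemma dbCD g h z : smoothC g -> smoothC h ->
  dbC (fun z => g z + h z) z = dbC g z + dbC h z.
Proof.
move=> sg sh; rewrite /dbC (partialCD z partC_ok1 sg sh) (partialCD z partC_ok2 sg sh).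
move: (partialC _ _ _) (partialC _ _ _) (partialC _ _ _) (partialC _ _ _) => a b c d.
ring.
Qed.

Lemma dCM g h z : smoothC g -> smoothC h ->
  dC (fun z => g z * h z) z = dC g z * h z + g z * dC h z.
Proof.
move=> sg sh; rewrite /dC (partialCM z partC_ok1 sg sh) (partialCM z partC_ok2 sg sh).
move: (partialC _ _ _) (partialC _ _ _) (partialC _ _ _) (partialC _ _ _) => a b c d.
ring.
Qed.

Lemma dbCM g h z : smoothC g -> smoothC h ->
  dbC (fun z => g z * h z) z = dbC g z * h z + g z * dbC h z.
Proof.
move=> sg sh; rewrite /dbC (partialCM z partC_ok1 sg sh) (partialCM z partC_ok2 sg sh).
move: (partialC _ _ _) (partialC _ _ _) (partialC _ _ _) (partialC _ _ _) => a b c d.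
ring.
Qed.

Lemma dC_cst (c : C) z : dC (cst c) z = 0.
Proof. by rewrite /dC !partialC_cst; ring. Qed.

Lemma dbC_cst (c : C) z : dbC (cst c) z = 0.
Proof. by rewrite /dbC !partialC_cst; ring. Qed.

Lemma conjC_half : ((2^-1 : C)^*)%C = 2^-1.
Proof. by rewrite conjc_inv conjc_nat. Qed.

Lemma dCJ g z : smoothC g -> dC (fun z => ((g z)^*)%C) z = ((dbC g z)^*)%C.
Proof.
move=> sg; rewrite /dC /dbC (partialCJ z partC_ok1 sg) (partialCJ z partC_ok2 sg).
have alg (x y c : C) : (c^*)%C = c ->
    c * ((x^*)%C - 'i%C * (y^*)%C) = ((c * (x + 'i%C * y))^*)%C.
  case: x y c => [a b] [a' b'] [c d] [] d0.
  have {}d0 : d = 0 by lra.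
  by rewrite d0; apply: complex_ext => /=; ring.
exact: alg _ _ _ conjC_half.
Qed.

Lemma dbCJ g z : smoothC g -> dbC (fun z => ((g z)^*)%C) z = ((dC g z)^*)%C.
Proof.
move=> sg; have A := dCJ z (smoothCJ sg).
have E : (fun z => ((((g z)^*)%C)^*)%C) = g by apply/funext => y; rewrite conjcK.
by rewrite E in A; rewrite A conjcK.
Qed.

Lemma dC_swap g z : smoothC g -> dbC (dC g) z = dC (dbC g) z.
Proof.
move=> sg; have [s1 s2] := smooth_partialC sg.
have si := smoothC_cst 'i%C.
have sNi := smoothC_cst (- 'i%C).
have h2 := smoothC_cst 2^-1.
have E1 : dC g = (fun z => cst (2^-1) z * (partialC v1 g z + cst (- 'i%C) z * partialC v2 g z)).
  by apply/funext => y; rewrite /dC /= mulNr.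
have E2 : dbC g = (fun z => cst (2^-1) z * (partialC v1 g z + cst ('i%C) z * partialC v2 g z)).
  by [].
have L1 := dbCM z h2 (smoothCD s1 (smoothCM sNi s2)).
rewrite (dbCD z s1 (smoothCM sNi s2)) (dbCM z sNi s2) !dbC_cst in L1.
have L2 := dCM z h2 (smoothCD s1 (smoothCM si s2)).
rewrite (dCD z s1 (smoothCM si s2)) (dCM z si s2) !dC_cst in L2.
have A1 := congr1 (fun f => dbC f z) E1.
have A2 := congr1 (fun f => dC f z) E2.
have L3 := etrans A1 L1; have L4 := etrans A2 L2.
have sw := partialC_swap z sg.
have alg (h i a b c d p q r s : C) : b = c ->
    0 * p + h * (h * (a + i * b) + (0 * q + (- i) * (h * (c + i * d)))) =
    0 * r + h * (h * (a - i * b) + (0 * s + i * (h * (c - i * d)))).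
  by move=> ->; ring.
have L5 := alg 2^-1 'i%C (partialC v1 (partialC v1 g) z) _ _
  (partialC v2 (partialC v2 g) z)
  (partialC v1 g z + cst (- 'i%C) z * partialC v2 g z) (partialC v2 g z)
  (partialC v1 g z + cst 'i%C z * partialC v2 g z) (partialC v2 g z) sw.
exact (etrans L3 (etrans L5 (esym L4))).
Qed.

End ComplexFunctions.

End ComplexFunctions.

(** * Matrix-valued functions and derivations *)

Module Import MatrixFunctions.

Section MatrixFunctions.
Variable R : realType.
Notation C := R[i].
Implicit Types (g h : R * R -> C) (z : R * R).

(** Shared interface of the two Wirtinger derivatives, so that the matrix
    calculus is developed once for both. *)
Record derivation (D : (R * R -> C) -> R * R -> C) : Prop := Derivation {
  derD : forall g h z, smoothC g -> smoothC h ->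
    D (fun z => g z + h z) z = D g z + D h z;
  derM : forall g h z, smoothC g -> smoothC h ->
    D (fun z => g z * h z) z = D g z * h z + g z * D h z;
  der_cst : forall (c : C) z, D (cst c) z = 0;
  der_smooth : forall g, smoothC g -> smoothC (D g) }.

Lemma derivation_dC : derivation (@dC R).
Proof.
split; [exact: dCD|exact: dCM|exact: dC_cst|exact: smooth_dC].
Qed.

Lemma derivation_dbC : derivation (@dbC R).
Proof.
split; [exact: dbCD|exact: dbCM|exact: dbC_cst|exact: smooth_dbC].
Qed.

Definition smooth_cmat p q (G : R * R -> 'M[C]_(p, q)) :=
  forall a b, smoothC (fun z => G z a b).

Definition mx_der (D : (R * R -> C) -> R * R -> C) p q
    (G : R * R -> 'M[C]_(p, q)) z : 'M[C]_(p, q) :=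
  \matrix_(a, b) D (fun w => G w a b) z.

Lemma smooth_cmat_ext p q (G H : R * R -> 'M[C]_(p, q)) : G =1 H -> smooth_cmat G -> smooth_cmat H.
Proof. by move=> /funext ->. Qed.

Lemma smooth_cmat_intro p q (G : R * R -> 'M[C]_(p, q)) (e : 'I_p -> 'I_q -> R * R -> C) :
  (forall a b z, G z a b = e a b z) -> (forall a b, smoothC (e a b)) -> smooth_cmat G.
Proof.
move=> E H a b; have -> : (fun z => G z a b) = e a b by apply/funext => z.
exact: H.
Qed.

Lemma smooth_cmat_cst p q (A : 'M[C]_(p, q)) : smooth_cmat (cst A).
Proof. by move=> a b; exact: smoothC_cst. Qed.

Lemma smooth_cmat_add p q (G H : R * R -> 'M[C]_(p, q)) : smooth_cmat G -> smooth_cmat H ->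
  smooth_cmat (fun z => G z + H z).
Proof.
move=> sG sH; apply: (smooth_cmat_intro (e := fun a b z => G z a b + H z a b)).
  by move=> a b z; rewrite mxE.
by move=> a b; exact: smoothCD.
Qed.

Lemma smooth_cmat_opp p q (G : R * R -> 'M[C]_(p, q)) : smooth_cmat G -> smooth_cmat (fun z => - G z).
Proof.
move=> sG; apply: (smooth_cmat_intro (e := fun a b z => - G z a b)).
  by move=> a b z; rewrite mxE.
by move=> a b; exact: smoothCN.
Qed.

Lemma smooth_cmat_mul p q r (G : R * R -> 'M[C]_(p, q)) (H : R * R -> 'M[C]_(q, r)) :
  smooth_cmat G -> smooth_cmat H -> smooth_cmat (fun z => G z *m H z).
Proof.
move=> sG sH; apply: (smooth_cmat_intro (e := fun a b z => \sum_k G z a k * H z k b)).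
  by move=> a b z; rewrite mxE.
move=> a b; apply: (smoothC_sum _ _ (G := fun k z => G z a k * H z k b)) => k.
exact: smoothCM.
Qed.

Lemma smooth_cmat_scale p q (c : R * R -> C) (G : R * R -> 'M[C]_(p, q)) :
  smoothC c -> smooth_cmat G -> smooth_cmat (fun z => c z *: G z).
Proof.
move=> sc sG; apply: (smooth_cmat_intro (e := fun a b z => c z * G z a b)).
  by move=> a b z; rewrite mxE.
by move=> a b; exact: smoothCM.
Qed.

Lemma smooth_cmat_tr p q (G : R * R -> 'M[C]_(p, q)) : smooth_cmat G -> smooth_cmat (fun z => (G z)^T).
Proof.
move=> sG; apply: (smooth_cmat_intro (e := fun a b z => G z b a)) => // a b z.
by rewrite mxE.
Qed.

Lemma smooth_cmat_conj p q (G : R * R -> 'M[C]_(p, q)) : smooth_cmat G ->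
  smooth_cmat (fun z => conj_cmx (G z)).
Proof.
move=> sG; apply: (smooth_cmat_intro (e := fun a b z => ((G z a b)^*)%C)).
  by move=> a b z; rewrite mxE.
by move=> a b; exact: smoothCJ.
Qed.

Lemma smooth_cmat_cmx p q (G : R * R -> 'M[R]_(p, q)) : smooth_mx G ->
  smooth_cmat (fun z => cmx (G z)).
Proof.
move=> sG; apply: (smooth_cmat_intro (e := fun a b z => (G z a b)%:C%C)).
  by move=> a b z; rewrite mxE.
by move=> a b; apply: smoothC_real; exact: sG.
Qed.

Lemma smooth_cmat_smooth_cmx p q (G : R * R -> 'M[C]_(p, q)) : smooth_cmat G -> smooth_cmx G.
Proof.
move=> sG; split=> a b.
  by apply: smooth_ext (sG a b).1 => z; rewrite mxE.
by apply: smooth_ext (sG a b).2 => z; rewrite mxE.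
Qed.

Lemma smooth_cmat_Re p q (G : R * R -> 'M[C]_(p, q)) : smooth_cmat G ->
  smooth_mx (fun z => map_mx (@complex.Re R) (G z)).
Proof. by case/smooth_cmat_smooth_cmx. Qed.

Lemma smooth_cmat_Im p q (G : R * R -> 'M[C]_(p, q)) : smooth_cmat G ->
  smooth_mx (fun z => map_mx (@complex.Im R) (G z)).
Proof. by case/smooth_cmat_smooth_cmx. Qed.

Section Derivation.
Variables (D : (R * R -> C) -> R * R -> C) (der : derivation D).

Lemma der_ext g h z : g =1 h -> D g z = D h z.
Proof. by move=> /funext ->. Qed.

Lemma derN g z : smoothC g -> D (fun z => - g z) z = - D g z.
Proof.
move=> sg; have H := derM der z (smoothC_cst (-1)) sg.
rewrite (der_cst der) mul0r add0r mulN1r in H; rewrite -H.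
by apply: der_ext => y; rewrite /= mulN1r.
Qed.

Lemma der_sum (I : Type) (s : seq I) (G : I -> R * R -> C) z :
  (forall i, smoothC (G i)) ->
  D (fun z => \sum_(i <- s) G i z) z = \sum_(i <- s) D (G i) z.
Proof.
move=> sG; elim: s => [|i s IH].
  have E : (fun z => \sum_(i <- [::]) G i z) = cst 0.
    by apply/funext => y; rewrite big_nil.
  by rewrite big_nil E (der_cst der).
rewrite big_cons -IH -(derD der z (sG i) (smoothC_sum s xpredT sG)).
by apply: der_ext => y; rewrite big_cons.
Qed.

Lemma smooth_cmat_mx_der p q (G : R * R -> 'M[C]_(p, q)) : smooth_cmat G -> smooth_cmat (mx_der D G).
Proof.
move=> sG; apply: (smooth_cmat_intro (e := fun a b => D (fun w => G w a b))).
  by move=> a b z; rewrite mxE.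
move=> a b; exact: (der_smooth der (sG a b)).
Qed.

Lemma mx_der_entry p q (G : R * R -> 'M[C]_(p, q)) (f : R * R -> C) z a b :
  (forall z, G z a b = f z) -> mx_der D G z a b = D f z.
Proof. by move=> E; rewrite mxE; apply: der_ext => y; rewrite E. Qed.

Lemma mx_der_mul p q r (G : R * R -> 'M[C]_(p, q)) (H : R * R -> 'M[C]_(q, r)) z :
  smooth_cmat G -> smooth_cmat H ->
  mx_der D (fun z => G z *m H z) z = mx_der D G z *m H z + G z *m mx_der D H z.
Proof.
move=> sG sH; apply/matrixP => a b.
rewrite (mx_der_entry (f := fun z => \sum_k G z a k * H z k b)); last by move=> y; rewrite mxE.
rewrite (der_sum _ (G := fun k z => G z a k * H z k b)); last by move=> k; exact: smoothCM.
rewrite !mxE -big_split /=; apply: eq_bigr => k _.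
by rewrite !mxE; exact: (derM der z (sG a k) (sH k b)).
Qed.

Lemma mx_der_add p q (G H : R * R -> 'M[C]_(p, q)) z : smooth_cmat G -> smooth_cmat H ->
  mx_der D (fun z => G z + H z) z = mx_der D G z + mx_der D H z.
Proof.
move=> sG sH; apply/matrixP => a b.
rewrite (mx_der_entry (f := fun z => G z a b + H z a b)); last by move=> y; rewrite mxE.
by rewrite !mxE (derD der).
Qed.

Lemma mx_der_opp p q (G : R * R -> 'M[C]_(p, q)) z : smooth_cmat G ->
  mx_der D (fun z => - G z) z = - mx_der D G z.
Proof.
move=> sG; apply/matrixP => a b.
rewrite (mx_der_entry (f := fun z => - G z a b)); last by move=> y; rewrite mxE.
by rewrite !mxE derN.
Qed.

Lemma mx_der_sub p q (G H : R * R -> 'M[C]_(p, q)) z : smooth_cmat G -> smooth_cmat H ->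
  mx_der D (fun z => G z - H z) z = mx_der D G z - mx_der D H z.
Proof.
by move=> sG sH; rewrite (mx_der_add z sG (smooth_cmat_opp sH)) mx_der_opp.
Qed.

Lemma mx_der_cst p q (A : 'M[C]_(p, q)) z : mx_der D (cst A) z = 0.
Proof. by apply/matrixP => a b; rewrite !mxE; exact: (der_cst der). Qed.

Lemma mx_der_mull p q r (A : 'M[C]_(p, q)) (H : R * R -> 'M[C]_(q, r)) z :
  smooth_cmat H -> mx_der D (fun z => A *m H z) z = A *m mx_der D H z.
Proof.
by move=> sH; rewrite (mx_der_mul z (smooth_cmat_cst A) sH) mx_der_cst mul0mx add0r.
Qed.

Lemma mx_der_mulr p q r (G : R * R -> 'M[C]_(p, q)) (A : 'M[C]_(q, r)) z :
  smooth_cmat G -> mx_der D (fun z => G z *m A) z = mx_der D G z *m A.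
Proof.
by move=> sG; rewrite (mx_der_mul z sG (smooth_cmat_cst A)) mx_der_cst mulmx0 addr0.
Qed.

Lemma mx_der_scale p q (c : R * R -> C) (G : R * R -> 'M[C]_(p, q)) z :
  smoothC c -> smooth_cmat G ->
  mx_der D (fun z => c z *: G z) z = D c z *: G z + c z *: mx_der D G z.
Proof.
move=> sc sG; apply/matrixP => a b.
rewrite (mx_der_entry (f := fun z => c z * G z a b)); last by move=> y; rewrite mxE.
by rewrite !mxE (derM der).
Qed.

Lemma mx_der_tr p q (G : R * R -> 'M[C]_(p, q)) z :
  mx_der D (fun z => (G z)^T) z = (mx_der D G z)^T.
Proof.
apply/matrixP => a b; rewrite (mx_der_entry (f := fun z => G z b a)) ?mxE// => y.
by rewrite mxE.
Qed.

End Derivation.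

Lemma mx_der_conj p q (G : R * R -> 'M[C]_(p, q)) z : smooth_cmat G ->
  mx_der (@dC R) (fun z => conj_cmx (G z)) z = conj_cmx (mx_der (@dbC R) G z) /\
  mx_der (@dbC R) (fun z => conj_cmx (G z)) z = conj_cmx (mx_der (@dC R) G z).
Proof.
move=> sG.
have E a b y : conj_cmx (G y) a b = ((G y a b)^*)%C by rewrite mxE.
split; apply/matrixP => a b; rewrite (mx_der_entry _ z (E a b)).
- by rewrite dCJ ?mxE//; exact: sG.
- by rewrite dbCJ ?mxE//; exact: sG.
Qed.

Lemma mx_der_swap p q (G : R * R -> 'M[C]_(p, q)) z : smooth_cmat G ->
  mx_der (@dbC R) (mx_der (@dC R) G) z = mx_der (@dC R) (mx_der (@dbC R) G) z.
Proof.
move=> sG; apply/matrixP => a b.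
have E1 y : mx_der (@dC R) G y a b = dC (fun z => G z a b) y by rewrite mxE.
have E2 y : mx_der (@dbC R) G y a b = dbC (fun z => G z a b) y by rewrite mxE.
rewrite (mx_der_entry _ z E1) (mx_der_entry _ z E2).
by apply: dC_swap; exact: sG.
Qed.

Lemma conj_cmxM p q r (A : 'M[C]_(p, q)) (B : 'M[C]_(q, r)) :
  conj_cmx (A *m B) = conj_cmx A *m conj_cmx B.
Proof. exact: (map_mxM (@conjc R)). Qed.

Lemma conj_cmxK p q : involutive (@conj_cmx R p q).
Proof. by move=> A; apply/matrixP => a b; rewrite !mxE conjcK. Qed.

Lemma conj_cmx_cmx p q (A : 'M[R]_(p, q)) : conj_cmx (cmx A) = cmx A.
Proof. by apply/matrixP => a b; rewrite !mxE conjc_real. Qed.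

Lemma cmxM p q r (A : 'M[R]_(p, q)) (B : 'M[R]_(q, r)) :
  cmx (A *m B) = cmx A *m cmx B.
Proof. exact: (map_mxM (real_complex R)). Qed.

End MatrixFunctions.

End MatrixFunctions.

(** * Indices, gradings and roots *)

Module Import RootIndices.

Ltac ifcase := match goal with |- context [if ?b then _ else _] =>
  lazymatch b with
  | context [if _ then _ else _] => fail
  | _ => case: (boolP b) => ?
  end end.

(** Innermost conditionals first, so that lia only meets linear conditions. *)
Ltac ilia := repeat ifcase; intros; lia.

Section Indices.
Variable n : nat.
Hypothesis hn : (1 <= n)%N.

(** Indices start from 0, and the k-th block consists of 2k-1 and 2k. The
    pairing [starn] exchanges the two null vectors of a block, [cjn] is the
    effect of complex conjugation on the null basis, whose last two vectors are
    real, and [grn] gives the degrees, from 1 to n on the first vectors of the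
    blocks and from 2n-1 down to n on the second ones. *)
Definition starn (a : nat) : nat :=
  if a == 0%N then 0%N else if odd a then a.+1 else a.-1.
Definition cjn (a : nat) : nat := if (a < n.*2.-1)%N then starn a else a.
Definition grn (a : nat) : nat :=
  if a == 0%N then 0%N else if odd a then uphalf a else (n.*2 - a./2)%N.

Lemma starnK a : starn (starn a) = a.
Proof. rewrite /starn; ilia. Qed.

Lemma starn_lt a : (a < n.*2.+1)%N -> (starn a < n.*2.+1)%N.
Proof. rewrite /starn; ilia. Qed.

Lemma cjn_lt a : (a < n.*2.+1)%N -> (cjn a < n.*2.+1)%N.
Proof. rewrite /cjn /starn; ilia. Qed.

Lemma cjnK a : cjn (cjn a) = a.
Proof. rewrite /cjn /starn; ilia. Qed.

Lemma star_cjn a : (a < n.*2.+1)%N -> cjn (starn a) = starn (cjn a).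
Proof. rewrite /cjn /starn; ilia. Qed.

Lemma grn_star_cjn a : (a < n.*2.+1)%N -> grn (cjn a) = grn (starn a).
Proof. rewrite /grn /cjn /starn; ilia. Qed.

Lemma grn_star a : (a < n.*2.+1)%N ->
  grn (starn a) = if grn a == 0%N then 0%N else (n.*2 - grn a)%N.
Proof. rewrite /grn /starn; ilia. Qed.

Lemma grn_lt a : (a < n.*2.+1)%N -> (grn a < n.*2)%N.
Proof. rewrite /grn; ilia. Qed.

Definition idx := 'I_(n.*2.+1).
Definition star (a : idx) : idx := Ordinal (starn_lt (ltn_ord a)).
Definition cj (a : idx) : idx := Ordinal (cjn_lt (ltn_ord a)).
Definition gr (a : idx) : nat := grn a.

Lemma starK : involutive star.
Proof. by move=> a; apply: val_inj; rewrite /= starnK. Qed.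

Lemma cjK : involutive cj.
Proof. by move=> a; apply: val_inj; rewrite /= cjnK. Qed.

Lemma star_cj a : cj (star a) = star (cj a).
Proof. by apply: val_inj; rewrite /= star_cjn. Qed.

Lemma star_eq0 (a : idx) : (star a == 0%N :> nat) = (a == 0%N :> nat).
Proof. rewrite /= /starn; ilia. Qed.

Lemma cj_eq0 (a : idx) : (cj a == 0%N :> nat) = (a == 0%N :> nat).
Proof. rewrite /= /cjn /starn; ilia. Qed.

(** The successor modulo 2n, on representatives. *)
Definition nextg (x : nat) : nat := if x == n.*2.-1 then 0%N else x.+1.
Definition grade1 (a b : idx) : bool := gr a == nextg (gr b).

Lemma grade1_star a b : grade1 (star b) (star a) = grade1 a b.
Proof.
rewrite /grade1 /nextg /gr /= !grn_star //.
have := grn_lt (ltn_ord a); have := grn_lt (ltn_ord b).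
move: (grn a) (grn b) => x y; ilia.
Qed.

Lemma gr_eq a b : gr a = gr b -> a = b \/ a = star b.
Proof.
rewrite /gr /grn => H.
have : (a = b :> nat) \/ (a = star b :> nat).
  move: H (ltn_ord a) (ltn_ord b); rewrite /= /starn; ilia.
by case=> ?; [left|right]; apply: val_inj.
Qed.

Lemma star_fix a : star a = a -> a = 0%N :> nat.
Proof. move=> /(congr1 val) /=; rewrite /starn; ilia. Qed.

(** The root vector R_k is the infinitesimal rotation in the plane of the null
    vectors of indices [pn k] and [qn k]. For n = 1 both root vectors involve
    e_1, and the order of the two real null vectors is the opposite one. *)
Definition pn (k : nat) : nat :=
  if n == 1%N then (if k == 0%N then 2%N else 1%N)
  else if k == 0%N then n.*2.-1 else if k == n then n.*2 else k.*2.-1.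
Definition qn (k : nat) : nat := if k == 0%N then n.*2.-2 else k.*2.-2.

Lemma pn_lt k : (k < n.+1)%N -> (pn k < n.*2.+1)%N.
Proof. rewrite /pn; case: eqP; ilia. Qed.
Lemma qn_lt k : (k < n.+1)%N -> (qn k < n.*2.+1)%N.
Proof. rewrite /qn; ilia. Qed.

Definition pk (k : 'I_n.+1) : idx := Ordinal (pn_lt (ltn_ord k)).
Definition qk (k : 'I_n.+1) : idx := Ordinal (qn_lt (ltn_ord k)).

Lemma pk_inj : injective pk.
Proof.
move=> k l /(congr1 val) /= H; apply: val_inj; move: H (ltn_ord k) (ltn_ord l).
rewrite /pn /=; ilia.
Qed.

Lemma pk_neq_qk k l : pk k <> qk l.
Proof.
move=> /(congr1 val) /=; move: (ltn_ord k) (ltn_ord l).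
rewrite /pn /qn /=; ilia.
Qed.

Lemma pk_neq0 k : (pk k == 0%N :> nat) = false.
Proof. rewrite /= /pn; case: eqP; ilia. Qed.

Lemma gr_low a : (gr a < n)%N -> a = (gr a).*2.-1 :> nat.
Proof. move: (ltn_ord a); rewrite /gr /grn; ilia. Qed.

Lemma gr_mid a : gr a = n -> a = n.*2.-1 :> nat \/ a = n.*2 :> nat.
Proof. move: (ltn_ord a); rewrite /gr /grn; ilia. Qed.

Lemma starn_qn x : starn x.*2 = x.*2.-1.
Proof. rewrite /starn; ilia. Qed.

Lemma pn_low x : (x.+1 < n)%N -> pn x.+1 = (x.+1).*2.-1.
Proof. rewrite /pn; ilia. Qed.

Lemma pn_mid : pn (n == 1%N) = n.*2.-1 /\ pn (if n == 1%N then 0%N else n) = n.*2.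
Proof. by rewrite /pn; case: (n =P 1%N) => [->|/=]; split=> //; ilia. Qed.

Lemma qn_mid : qn (n == 1%N) = n.-1.*2 /\ qn (if n == 1%N then 0%N else n) = n.-1.*2.
Proof. by rewrite /qn; case: (n =P 1%N) => [->|/=]; split=> //; ilia. Qed.

Lemma gr_qk_star k : gr (star (qk k)) = if k == 0%N :> nat then n.-1 else k.-1.
Proof.
rewrite /gr /=; have -> : qn k = (if k == 0%N :> nat then n.-1 else k.-1).*2.
  by rewrite /qn; case: eqP; lia.
by rewrite starn_qn /grn; move: (ltn_ord k); ilia.
Qed.

Lemma gr_pk k : gr (pk k) = if k == 0%N :> nat then n else k.
Proof. rewrite /gr /grn /= /pn; move: (ltn_ord k); ilia. Qed.

Lemma grade1_pk k : grade1 (pk k) (star (qk k)).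
Proof.
rewrite /grade1 gr_pk gr_qk_star /nextg; move: (ltn_ord k).
by ilia.
Qed.

Lemma grade1_form_low a b : grade1 a b -> (gr b < n)%N ->
  exists k, a = pk k /\ b = star (qk k).
Proof.
move=> H Hb; have Eb := gr_low Hb.
suff [k [kn E1 E2]] : exists k : nat, [/\ (k < n.+1)%N, nat_of_ord a = pn k &
    nat_of_ord b = starn (qn k)].
  by exists (Ordinal kn); split; apply: val_inj.
have {H} Ha : gr a = (gr b).+1.
  by move: H => /eqP ->; rewrite /nextg; case: eqP => //; lia.
have [Hn|Hn] := ltnP (gr b).+1 n.
  exists (gr b).+1; split; first by lia.
  - by rewrite pn_low// -Ha; apply: gr_low; lia.
  - have -> : qn (gr b).+1 = (gr b).*2 by rewrite /qn /=; lia.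
    by rewrite starn_qn.
have {}Hn : gr b = n.-1 by lia.
have Han : gr a = n by lia.
rewrite Hn in Eb; case: (gr_mid Han) => Ea.
  exists (n == 1%N); split; [by case: eqP; lia|by rewrite Ea pn_mid.1|].
  by rewrite qn_mid.1 starn_qn.
exists (if n == 1%N then 0%N else n); split; [by case: eqP; lia|by rewrite Ea pn_mid.2|].
by rewrite qn_mid.2 starn_qn.
Qed.

(** The degree 1 positions are exactly those occupied by the root vectors:
    below the middle degree by direct inspection, above it by the symmetry of
    the degrees under the pairing. *)
Lemma grade1_form a b : grade1 a b ->
  exists k, (a = pk k /\ b = star (qk k)) \/ (a = qk k /\ b = star (pk k)).
Proof.
move=> H; have [Hb|Hb] := ltnP (gr b) n.
  by have [k E] := grade1_form_low H Hb; exists k; left.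
have [||k [E1 E2]] := @grade1_form_low (star b) (star a).
- by rewrite grade1_star.
- move: H Hb; rewrite /grade1 /nextg /gr /= grn_star//.
  have := grn_lt (ltn_ord a); have := grn_lt (ltn_ord b).
  move: (grn a) (grn b) => x y; ilia.
exists k; right; split; last by rewrite -E1 starK.
by rewrite -[qk k]starK -E2 starK.
Qed.

End Indices.

End RootIndices.

(** * A null basis diagonalising the torus *)

Module Import NullBasis.

Section AdaptedBasis.
Variables (R : realType) (n : nat).
Hypothesis hn : (1 <= n)%N.
Notation C := R[i].
Notation I := 'I_(n.*2.+1).
Notation matC := 'M[C]_(n.*2.+1).
Notation star := (star hn).
Notation cj := (cj hn).
Notation Ups := (ups C n.*2).

(** The null vectors of block j are e_lo + u e_hi and e_lo - u e_hi, where u^2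
    is minus the sign of e_hi in the Lorentz form: u = i, except in the last
    block, where u = 1. *)
Definition null_unit (j : nat) : C := if j == n then 1 else 'i%C.
Definition null_sign (a : I) : C := if odd a then null_unit (uphalf a) else - null_unit (uphalf a).
Definition lo (a : I) : I := if odd a then a else star a.
Definition hi (a : I) : I := if odd a then star a else a.
Definition ups_sign (i : I) : C := if i == ord_max then -1 else 1.

(** The scalar product of a null vector with its partner. *)
Definition null_pair (a : I) : C := if a == ord0 then 1 else 2.

Definition null_mx : matC := \matrix_(i, a)
  if a == ord0 then (i == a)%:R else (i == lo a)%:R + null_sign a * (i == hi a)%:R.

Definition null_inv : matC := \matrix_(a, i) ((null_pair a)^-1 * null_mx i (star a) * ups_sign i).

Lemma upsE i j : Ups i j = ups_sign i *+ (i == j).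
Proof. by rewrite !mxE /ups_sign; case: eqP => [->|]. Qed.

Lemma mul_ups p (A : 'M[C]_(n.*2.+1, p)) i j : (Ups *m A) i j = ups_sign i * A i j.
Proof.
rewrite mxE (bigD1 i) //= big1 ?addr0 => [|k ki]; first by rewrite upsE eqxx.
by rewrite upsE eq_sym (negbTE ki) mul0r.
Qed.

Lemma mulr_ups p (A : 'M[C]_(p, n.*2.+1)) i j : (A *m Ups) i j = A i j * ups_sign j.
Proof.
rewrite mxE (bigD1 j) //= big1 ?addr0 => [|k kj]; first by rewrite upsE eqxx.
by rewrite upsE (negbTE kj) mulr0.
Qed.

Lemma ups_sign2 i : ups_sign i * ups_sign i = 1.
Proof. by rewrite /ups_sign; case: ifP => _; ring. Qed.

Lemma ups2 : Ups *m Ups = 1%:M.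
Proof.
apply/matrixP => i j; rewrite mul_ups upsE !mxE mulrnAr ups_sign2.
by case: eqP.
Qed.

Lemma null_pair_neq0 a : null_pair a != 0.
Proof. by rewrite /null_pair; case: ifP => _; rewrite ?oner_eq0 // pnatr_eq0. Qed.

Lemma sum_delta (k : I) (G : I -> C) : \sum_i (i == k)%:R * G i = G k.
Proof.
rewrite (bigD1 k) //= big1 ?addr0 ?eqxx ?mul1r// => i ik.
by rewrite (negbTE ik) mul0r.
Qed.

Lemma sum_null_mx (a : I) (G : I -> C) : \sum_i null_mx i a * G i =
  if a == ord0 then G a else G (lo a) + null_sign a * G (hi a).
Proof.
rewrite (eq_bigr (fun i => if a == ord0 then (i == a)%:R * G i else
  (i == lo a)%:R * G i + null_sign a * ((i == hi a)%:R * G i))); last first.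
  by move=> i _; rewrite mxE; case: ifP => _ //; rewrite mulrDl mulrA.
case: ifP => _; first exact: sum_delta.
by rewrite big_split /= -mulr_sumr !sum_delta.
Qed.

Lemma star_neq (a : I) : a != ord0 -> star a != a.
Proof. by apply: contra => /eqP/star_fix H; apply/eqP/val_inj. Qed.

Lemma star0 : star ord0 = ord0 :> I. Proof. exact: val_inj. Qed.

Lemma star_ord0 a : (star a == ord0) = (a == ord0).
Proof. by rewrite -val_eqE /= (star_eq0 hn a). Qed.

Lemma odd_star (a : I) : a != ord0 -> odd (star a) = ~~ odd a.
Proof. rewrite -val_eqE /= /starn; ilia. Qed.

Lemma uphalf_star (a : I) : uphalf (star a) = uphalf a.
Proof. rewrite /= /starn; ilia. Qed.

Lemma null_sign_star (a : I) : a != ord0 -> null_sign (star a) = - null_sign a.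
Proof.
by move=> a0; rewrite /null_sign odd_star// uphalf_star; case: (odd a); rewrite /= ?opprK.
Qed.

Lemma lo_star (a : I) : a != ord0 -> lo (star a) = lo a.
Proof. by move=> a0; rewrite /lo odd_star// starK; case: (odd a). Qed.

Lemma hi_star (a : I) : a != ord0 -> hi (star a) = hi a.
Proof. by move=> a0; rewrite /hi odd_star// starK; case: (odd a). Qed.

Lemma val_lo (a : I) : lo a = (if odd a then nat_of_ord a else starn a) :> nat.
Proof. by rewrite /lo; case: ifP. Qed.

Lemma val_hi (a : I) : hi a = (if odd a then starn a else nat_of_ord a) :> nat.
Proof. by rewrite /hi; case: ifP. Qed.

Lemma lo_eq (a b : I) : a != ord0 -> b != ord0 ->
  (lo a == lo b) = (a == b) || (a == star b).
Proof. rewrite -!val_eqE /= !val_lo /starn; ilia. Qed.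

Lemma hi_eq (a b : I) : a != ord0 -> b != ord0 ->
  (hi a == hi b) = (a == b) || (a == star b).
Proof. rewrite -!val_eqE /= !val_hi /starn; ilia. Qed.

Lemma lo_hi (a b : I) : a != ord0 -> b != ord0 -> (lo a == hi b) = false.
Proof. rewrite -!val_eqE /= val_lo val_hi /starn; ilia. Qed.

Lemma lo_neq0 (a : I) : a != ord0 -> lo a != ord0.
Proof. by move=> a0; rewrite /lo; case: ifP; rewrite ?star_ord0. Qed.
Lemma hi_neq0 (a : I) : a != ord0 -> hi a != ord0.
Proof. by move=> a0; rewrite /hi; case: ifP; rewrite ?star_ord0. Qed.

Lemma ups_sign_lo (a : I) : ups_sign (lo a) = 1.
Proof.
rewrite /ups_sign ifF //; apply/negbTE; rewrite -val_eqE /= val_lo.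
move: (ltn_ord a); rewrite /starn; ilia.
Qed.

Lemma ups_sign_hi (a : I) : a != ord0 -> ups_sign (hi a) = - null_sign a ^+ 2.
Proof.
move=> a0; have -> : null_sign a ^+ 2 = null_unit (uphalf a) ^+ 2.
  by rewrite /null_sign; case: ifP => _; rewrite ?sqrrN.
have E : (hi a == ord_max) = (uphalf a == n).
  rewrite -val_eqE /= val_hi; move: a0 (ltn_ord a); rewrite -val_eqE /=.
  by rewrite /starn; ilia.
rewrite /ups_sign E /null_unit; case: ifP => _; first by rewrite expr1n.
by rewrite sqr_i opprK.
Qed.

Lemma null_sign4 a : null_sign a ^+ 4 = 1.
Proof.
have -> : null_sign a ^+ 4 = (null_unit (uphalf a) ^+ 2) ^+ 2.
  by rewrite /null_sign -exprM; case: ifP => _ //; rewrite exprNn -signr_odd mul1r.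
by rewrite /null_unit; case: ifP => _; rewrite ?expr1n// sqr_i sqrrN expr1n.
Qed.

Definition null_gram : matC := \matrix_(a, b) (null_pair a *+ (b == star a)).

(** The vectors of distinct blocks are orthogonal and u^2 is chosen so that
    those of one block are null: the Lorentz form splits into a line and n
    hyperbolic planes. *)
Lemma gram_null_mx : null_mx^T *m Ups *m null_mx = null_gram.
Proof.
apply/matrixP => a b; rewrite -mulmxA mxE.
rewrite (eq_bigr (fun i => null_mx i a * (ups_sign i * null_mx i b))); last first.
  by move=> i _; rewrite mxE mul_ups.
rewrite sum_null_mx [RHS]mxE; case: (a =P ord0) => [->|/eqP a0].
  rewrite star0 /null_pair eqxx /ups_sign mxE; have -> : (ord0 == ord_max :> I) = false.
    by rewrite -val_eqE /=; lia.
  rewrite mul1r; case: (b =P ord0) => [->|/eqP b0]; first by rewrite eqxx.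
  rewrite eq_sym (negbTE (lo_neq0 b0)) eq_sym (negbTE (hi_neq0 b0)) mulr0 addr0.
  by [].
rewrite ups_sign_lo ups_sign_hi// /null_pair (negbTE a0) mul1r !mxE.
case: (b =P ord0) => [->|/eqP b0].
  rewrite (negbTE (lo_neq0 a0)) (negbTE (hi_neq0 a0)) !mulr0 addr0.
  by rewrite eq_sym star_ord0 (negbTE a0).
rewrite lo_eq// hi_eq// lo_hi// [hi a == lo b]eq_sym lo_hi// !mulr0 addr0 add0r.
rewrite -[a == star b](inj_eq (inv_inj (starK hn))) starK [star a == b]eq_sym.
case: (b =P star a) => [->|/eqP bs].
  rewrite orbT null_sign_star //=; transitivity (1 + null_sign a ^+ 4); first by ring.
  by rewrite null_sign4.
rewrite orbF; case: (a =P b) => [<-|/eqP ab] /=; last by rewrite !mulr0 addr0.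
transitivity (1 - null_sign a ^+ 4 : C); first by ring.
by rewrite null_sign4 subrr.
Qed.

Lemma null_invK : null_inv *m null_mx = 1%:M.
Proof.
apply/matrixP => a b.
have := congr1 (fun M : matC => M (star a) b) gram_null_mx.
rewrite /null_gram [X in _ = X]mxE starK -mulmxA mxE => H.
rewrite mxE (eq_bigr (fun i => (null_pair a)^-1 * (null_mx^T (star a) i * (Ups *m null_mx) i b))).
  rewrite -mulr_sumr H mxE eq_sym; have -> : null_pair (star a) = null_pair a.
    by rewrite /null_pair star_ord0.
  by case: eqP => _; rewrite ?mulr0// mulVf// null_pair_neq0.
by move=> i _; rewrite mul_ups !mxE !mulrA.
Qed.

Lemma null_mxK : null_mx *m null_inv = 1%:M.
Proof. exact: mulmx1C null_invK. Qed.

Lemma conj_i : (('i%C : C)^*)%C = - 'i%C.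
Proof. by apply/eqP; rewrite eq_complex /= oppr0 !eqxx. Qed.

Lemma conjN (x : C) : ((- x)^*)%C = - (x^*)%C.
Proof. exact: rmorphN. Qed.

(** Conjugation changes the sign of u = i and fixes u = 1. *)
Lemma conj_null_mx i a : ((null_mx i a)^*)%C = null_mx i (cj a).
Proof.
rewrite !mxE -[cj a == ord0]val_eqE /= -[cjn n a == 0%N]/(cj a == 0%N :> nat).
rewrite (cj_eq0 hn a) -[a == 0%N :> nat]/(a == ord0).
case: (a =P ord0) => [->|/eqP a0].
  rewrite conjc_nat; congr (_ == _)%:R; apply: val_inj.
  by rewrite /= /cjn /starn; ilia.
rewrite rmorphD rmorphM /= !conjc_nat.
have [ca|ca] := boolP (a < n.*2.-1)%N.
  have -> : cj a = star a by apply: val_inj; rewrite /= /cjn ca.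
  rewrite lo_star// hi_star// null_sign_star//; congr (_ + _ * _).
  rewrite /null_sign /null_unit; have -> : (uphalf a == n) = false.
    by apply/negbTE; move: ca; clear; lia.
  by case: (odd a); rewrite ?conjN conj_i.
have -> : cj a = a by apply: val_inj; rewrite /= /cjn (negbTE ca).
congr (_ + _ * _); rewrite /null_sign /null_unit; have -> : (uphalf a == n) = true.
  by apply/eqP; move: ca (ltn_ord a); lia.
by case: (odd a); rewrite ?conjN conjc1.
Qed.

Lemma null_pair_cj a : null_pair (cj a) = null_pair a.
Proof. by rewrite /null_pair -!val_eqE /= (cj_eq0 hn a). Qed.

Lemma conj_ups_sign i : ((ups_sign i)^*)%C = ups_sign i.
Proof. by rewrite /ups_sign; case: ifP; rewrite ?conjN conjc1. Qed.

Lemma conj_null_pair a : ((null_pair a)^*)%C = null_pair a.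
Proof. by rewrite /null_pair; case: ifP; rewrite ?conjc1 ?conjc_nat. Qed.

Lemma conj_null_inv a i : ((null_inv a i)^*)%C = null_inv (cj a) i.
Proof.
rewrite /null_inv [in LHS]mxE [in RHS]mxE -star_cj -conj_null_mx !rmorphM /=.
by rewrite conj_ups_sign conjc_inv conj_null_pair null_pair_cj.
Qed.

Definition to_null (X : matC) : matC := null_inv *m X *m null_mx.

Lemma to_nullM X Y : to_null (X *m Y) = to_null X *m to_null Y.
Proof. by rewrite /to_null !mulmxA -[_ *m null_mx *m null_inv]mulmxA null_mxK mulmx1. Qed.

Lemma to_nullD X Y : to_null (X + Y) = to_null X + to_null Y.
Proof. by rewrite /to_null mulmxDr mulmxDl. Qed.

Lemma to_nullZ c X : to_null (c *: X) = c *: to_null X.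
Proof. by rewrite /to_null -scalemxAr -scalemxAl. Qed.

Lemma to_null1 : to_null 1%:M = 1%:M.
Proof. by rewrite /to_null mulmx1 null_invK. Qed.

Lemma to_nullK X : null_mx *m to_null X *m null_inv = X.
Proof. by rewrite /to_null !mulmxA null_mxK mul1mx -mulmxA null_mxK mulmx1. Qed.

Lemma to_nullK' X : to_null (null_mx *m X *m null_inv) = X.
Proof. by rewrite /to_null !mulmxA null_invK mul1mx -mulmxA null_invK mulmx1. Qed.

Lemma to_null_inj : injective to_null.
Proof. by move=> X Y E; rewrite -[X]to_nullK E to_nullK. Qed.

Lemma to_null_sum (J : Type) (s : seq J) (F : J -> matC) :
  to_null (\sum_(j <- s) F j) = \sum_(j <- s) to_null (F j).
Proof. by rewrite /to_null mulmx_sumr mulmx_suml. Qed.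

Lemma to_null_conj X a b : to_null (conj_cmx X) a b = ((to_null X (cj a) (cj b))^*)%C.
Proof.
rewrite /to_null -mulmxA mxE -[in RHS]mulmxA [in RHS]mxE rmorph_sum /=.
apply: eq_bigr => i _; rewrite rmorphM /= conj_null_inv cjK; congr (_ * _).
rewrite !mxE rmorph_sum /=; apply: eq_bigr => k _.
by rewrite rmorphM /= conj_null_mx cjK mxE.
Qed.

Lemma null_mx_ups : null_mx^T *m Ups = null_gram *m null_inv.
Proof. by rewrite -gram_null_mx -!mulmxA null_mxK mulmx1. Qed.

Lemma mul_null_gram p (A : 'M[C]_(n.*2.+1, p)) a b : (null_gram *m A) a b = null_pair a * A (star a) b.
Proof.
rewrite mxE (bigD1 (star a)) //= big1 ?addr0 => [|k ka]; first by rewrite mxE eqxx.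
by rewrite mxE (negbTE ka) mul0r.
Qed.

Lemma mulr_null_gram p (A : 'M[C]_(p, n.*2.+1)) a b : (A *m null_gram) a b = A a (star b) * null_pair b.
Proof.
rewrite mxE (bigD1 (star b)) //= big1 ?addr0 => [|k ka].
  by rewrite mxE starK eqxx /null_pair star_ord0.
rewrite mxE; case: eqP => [E|_]; last by rewrite mulr0.
by rewrite E starK eqxx in ka.
Qed.

(** Antisymmetry of the form in the basis in which its Gram matrix is the
    pairing. *)
Lemma so_to_null X : so1 X -> forall a b,
  null_pair a * to_null X (star a) b + null_pair b * to_null X (star b) a = 0.
Proof.
move=> H a b.
have E : null_gram *m to_null X + (null_gram *m to_null X)^T = 0.
  have E1 : null_gram *m to_null X = null_mx^T *m (Ups *m X) *m null_mx.
    by rewrite [null_mx^T *m _]mulmxA null_mx_ups /to_null -!mulmxA.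
  have E2 : (null_gram *m to_null X)^T = null_mx^T *m (X^T *m Ups) *m null_mx.
    by rewrite E1 !trmx_mul trmxK [Ups^T]tr_diag_mx !mulmxA.
  by rewrite E2 E1 -mulmxDl -mulmxDr addrC H mulmx0 mul0mx.
have := congr1 (fun M : matC => M a b) E.
by rewrite mxE [X in _ + X]mxE !mul_null_gram [X in _ = X]mxE.
Qed.

End AdaptedBasis.

End NullBasis.

(** * Root vectors in the null basis *)

Module Import RootVectors.

Section RootVectors.
Variables (R : realType) (n : nat).
Hypothesis hn : (1 <= n)%N.
Notation C := R[i].
Notation I := 'I_(n.*2.+1).
Notation matC := 'M[C]_(n.*2.+1).
Notation star := (star hn).
Notation pk := (pk hn).
Notation qk := (qk hn).
Notation grade1 := (@grade1 n).
Notation gr := (@gr n).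
Notation Ups := (ups C n.*2).
Notation null_mx := (null_mx R hn).
Notation null_gram := (null_gram R hn).
Notation to_null := (@to_null R n hn).
Notation null_sign := (@null_sign R n).
Notation null_pair := (@null_pair R n).
Notation ups_sign := (@ups_sign R n).
Notation lo := (lo hn).
Notation hi := (hi hn).
Notation brk := (@brk R n).

Definition basis_vec (a : I) : 'cV[C]_(n.*2.+1) := delta_mx a ord0.

(** The infinitesimal isometry of the plane of x and y; all root vectors are of
    this form, which makes their matrix in the null basis immediate. *)
Definition wedge (x y : 'cV[C]_(n.*2.+1)) : matC := (x *m y^T - y *m x^T) *m Ups.

Lemma wedgeDl x y w : wedge (x + y) w = wedge x w + wedge y w.
Proof.
have Et : (x + y)^T = x^T + y^T by apply/matrixP => i j; rewrite !mxE.
have E : (x + y) *m w^T - w *m (x + y)^T =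
    (x *m w^T - w *m x^T) + (y *m w^T - w *m y^T).
  by rewrite Et mulmxDl mulmxDr opprD addrACA.
by rewrite /wedge E mulmxDl.
Qed.

Lemma wedgeZl c x w : wedge (c *: x) w = c *: wedge x w.
Proof.
have Et : (c *: x)^T = c *: x^T by apply/matrixP => i j; rewrite !mxE.
by rewrite /wedge Et -scalemxAr -scalemxAl -scalerBr -scalemxAl.
Qed.

Lemma wedgeC x y : wedge x y = - wedge y x.
Proof. by rewrite /wedge -[RHS]mulNmx opprB. Qed.

Lemma wedgeDr x y w : wedge w (x + y) = wedge w x + wedge w y.
Proof.
have E := wedgeDl x y w.
by rewrite (wedgeC w) E opprD (wedgeC w x) (wedgeC w y).
Qed.

Lemma wedgeZr c x w : wedge w (c *: x) = c *: wedge w x.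
Proof. by rewrite wedgeC wedgeZl -scalerN -wedgeC. Qed.

Lemma brk_wedge (j k : I) : (j < k)%N -> brk j.+1 k.+1 = wedge (basis_vec k) (basis_vec j).
Proof.
move=> jk; apply/matrixP => a b; rewrite mulr_ups.
rewrite !trmx_delta !mul_delta_mx !mxE /brk eqSS -!val_eqE /=.
have -> : ups_sign b = if b == n.*2 :> nat then -1 else 1 by rewrite /ups_sign -val_eqE.
case: eqP => Ek; rewrite !mxE !eqSS.
  case: (b =P n.*2 :> nat) => Eb.
    rewrite Ek Eb eqxx andbT; have -> : (n.*2 == j) = false by lia.
    by rewrite andbF add0r sub0r mulrN1 opprK.
  have -> : (b == k :> nat) = false by lia.
  by rewrite andbF addr0 subr0 mulr1.
case: (b =P n.*2 :> nat) => Eb; last by rewrite mulr1.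
have -> : (b == k :> nat) = false by lia.
have -> : (b == j :> nat) = false by move: (ltn_ord k); lia.
by rewrite !andbF subr0 mul0r.
Qed.

Lemma col_null_mx (a : I) : col a null_mx =
  if a == ord0 then basis_vec ord0 else basis_vec (lo a) + null_sign a *: basis_vec (hi a).
Proof.
apply/matrixP => i j; rewrite ord1 !mxE; case: ifP => [/eqP ->|_]; rewrite !mxE.
  by rewrite andbT.
by rewrite !andbT.
Qed.

Lemma to_null_wedge (p q : I) a b : to_null (wedge (col p null_mx) (col q null_mx)) a b =
  null_pair b *+ ((a == p) && (star b == q)) - null_pair b *+ ((a == q) && (star b == p)).
Proof.
have colE (x : I) : col x null_mx = null_mx *m basis_vec x by rewrite colE.
have E : wedge (col p null_mx) (col q null_mx) =
    null_mx *m (delta_mx p q - delta_mx q p) *m null_mx^T *m Ups.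
  rewrite /wedge !colE !trmx_mul !trmx_delta.
  rewrite [_ *m (_ *m _) - _](_ : _ = null_mx *m (basis_vec p *m delta_mx ord0 q) *m null_mx^T
      - null_mx *m (basis_vec q *m delta_mx ord0 p) *m null_mx^T); last by rewrite !mulmxA.
  by rewrite !mul_delta_mx -mulmxBl -mulmxBr.
have -> : to_null (wedge (col p null_mx) (col q null_mx)) = (delta_mx p q - delta_mx q p) *m null_gram.
  rewrite E -gram_null_mx /to_null; rewrite !mulmxA null_invK mul1mx.
  by rewrite -!mulmxA.
rewrite mulr_null_gram !mxE mulrBl !mulr_natl.
by rewrite ![star b == _]eq_sym.
Qed.

Lemma wedge_cols (p q : I) (m : nat) : (2 <= m)%N -> uphalf p = m -> (q = m.*2.-2 :> nat) ->
  wedge (col p null_mx) (col q null_mx) = brk (m.*2 - 2) m.*2 + null_sign p *: brk (m.*2 - 2) m.*2.+1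
   - 'i%C *: brk (m.*2 - 1) m.*2 - (null_sign p * 'i%C) *: brk (m.*2 - 1) m.*2.+1.
Proof.
move=> m2 pm qm.
have p0 : p != ord0 by rewrite -val_eqE /=; lia.
have q0 : q != ord0 by rewrite -val_eqE /=; lia.
rewrite !col_null_mx (negbTE p0) (negbTE q0) wedgeDl !wedgeDr !wedgeZl !wedgeZr.
have pn := ltn_ord p.
have sq : null_sign q = - 'i%C.
  rewrite /null_sign /null_unit; have -> : odd q = false by rewrite qm; lia.
  by have -> : (uphalf q == n) = false by apply/negbTE; rewrite qm; lia.
have lp : lo p = m.*2.-1 :> nat by rewrite val_lo /starn; ilia.
have hp : hi p = m.*2 :> nat by rewrite val_hi /starn; ilia.
have lq : lo q = (m.*2 - 3)%N :> nat by rewrite val_lo /starn qm; ilia.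
have hq : hi q = m.*2.-2 :> nat by rewrite val_hi /starn qm; ilia.
rewrite -!brk_wedge; try by rewrite ?lp ?hp ?lq ?hq; lia.
rewrite lp hp lq hq sq.
have -> : (m.*2 - 3).+1 = (m.*2 - 2)%N by lia.
have -> : m.*2.-1.+1 = m.*2 by lia.
have -> : m.*2.-2.+1 = (m.*2 - 1)%N by lia.
rewrite scalerA mulrN !scaleNr addrA; congr (_ - _).
by rewrite addrAC.
Qed.

Lemma wedge_cols1 (p : I) : uphalf p = 1%N ->
  wedge (col p null_mx) (col ord0 null_mx) = brk 1 2 + null_sign p *: brk 1 3.
Proof.
move=> pm; have p0 : p != ord0 by rewrite -val_eqE /=; lia.
rewrite !col_null_mx (negbTE p0) eqxx wedgeDl !wedgeZl.
have pn := ltn_ord p.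
have lp : lo p = 1%N :> nat by rewrite val_lo /starn; ilia.
have hp : hi p = 2%N :> nat by rewrite val_hi /starn; ilia.
by rewrite -!brk_wedge ?lp ?hp.
Qed.

(** Expanding the wedge of two null vectors by bilinearity gives the brackets
    of the definition, with coefficients products of the units u. *)
Lemma rootvec_wedge k : @rootvec R n k = wedge (col (pk k) null_mx) (col (qk k) null_mx).
Proof.
have kn := ltn_ord k.
have sgE (p : I) : null_sign p = if odd p then null_unit R n (uphalf p) else - null_unit R n (uphalf p) by [].
rewrite /rootvec; case: eqP => n1.
  have q0 : qk k = ord0 by apply: val_inj; rewrite /= /qn; ilia.
  rewrite q0 wedge_cols1; last by rewrite /= /pn; ilia.
  rewrite sgE /null_unit /=; case: eqP => k0.
    have -> : pn n k = 2%N by rewrite /pn; ilia.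
    by rewrite /= n1 /= scaleN1r.
  have -> : pn n k = 1%N by rewrite /pn; ilia.
  by rewrite /= n1 /= scale1r.
case: eqP => k0.
  rewrite (wedge_cols (m := n)); [|by lia|by rewrite /= /pn; ilia|by rewrite /= /qn; ilia].
  have -> : null_sign (pk k) = 1.
    rewrite sgE /=; have -> : pn n k = n.*2.-1 by rewrite /pn; ilia.
    have -> : odd n.*2.-1 by lia.
    by rewrite /null_unit; have -> : uphalf n.*2.-1 == n by lia.
  by rewrite scale1r mul1r.
case: eqP => kk.
  rewrite (wedge_cols (m := n)); [|by lia|by rewrite /= /pn; ilia|by rewrite /= /qn; ilia].
  have -> : null_sign (pk k) = -1.
    rewrite sgE /=; have -> : pn n k = n.*2 by rewrite /pn; ilia.
    have -> : odd n.*2 = false by lia.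
    by rewrite /null_unit; have -> : uphalf n.*2 == n by lia.
  by rewrite mulN1r scaleN1r scaleNr opprK.
have spk : null_sign (pk k) = 'i%C.
  rewrite sgE /=; have -> : pn n k = k.*2.-1 by rewrite /pn; ilia.
  have -> : odd k.*2.-1 by lia.
  by rewrite /null_unit; have -> : (uphalf k.*2.-1 == n) = false by apply/negbTE; lia.
case: eqP => k1.
  have -> : qk k = ord0 by apply: val_inj; rewrite /= /qn; ilia.
  by rewrite wedge_cols1 ?spk// /= /pn; ilia.
rewrite (wedge_cols (m := k)); [|by lia|by rewrite /= /pn; ilia|by rewrite /= /qn; ilia].
by rewrite spk -expr2 sqr_i scaleN1r opprK.
Qed.

Lemma to_null_rootvec k a b : to_null (@rootvec R n k) a b =
  null_pair b *+ ((a == pk k) && (star b == qk k)) - null_pair b *+ ((a == qk k) && (star b == pk k)).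
Proof. by rewrite rootvec_wedge to_null_wedge. Qed.

Definition root_sum (c : 'I_n.+1 -> C) : matC := to_null (\sum_k c k *: @rootvec R n k).

Lemma root_sumE c a b : root_sum c a b = \sum_k c k *
  (null_pair b *+ ((a == pk k) && (star b == qk k)) - null_pair b *+ ((a == qk k) && (star b == pk k))).
Proof.
rewrite /root_sum to_null_sum summxE; apply: eq_bigr => k _.
by rewrite to_nullZ mxE to_null_rootvec.
Qed.

Lemma root_sum_low c k : root_sum c (pk k) (star (qk k)) = c k * null_pair (qk k).
Proof.
rewrite root_sumE (bigD1 k) //= big1 ?addr0.
  rewrite !eqxx starK eqxx; have -> : (pk k == qk k) = false by apply/eqP/pk_neq_qk.
  by rewrite /= mulr0n subr0 mulr1n /null_pair star_ord0.
move=> l lk; rewrite starK (inj_eq (pk_inj (hn := hn))) [k == l]eq_sym (negbTE lk).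
by have -> : (pk k == qk l) = false by [apply/eqP/pk_neq_qk]; rewrite !mulr0n subr0 mulr0.
Qed.

Lemma root_sum_high c k : root_sum c (qk k) (star (pk k)) = - (c k * null_pair (pk k)).
Proof.
have pq l : (qk k == pk l) = false by apply/eqP => /esym; exact: pk_neq_qk.
rewrite root_sumE (bigD1 k) //= big1 ?addr0.
  by rewrite !eqxx starK eqxx pq /= mulr0n sub0r mulr1n mulrN /null_pair star_ord0.
move=> l lk; rewrite pq starK.
rewrite [pk k == pk l](inj_eq (pk_inj (hn := hn))) [k == l]eq_sym (negbTE lk) andbF.
by rewrite !mulr0n subr0 mulr0.
Qed.

Lemma root_sum_0 c a b : ~~ grade1 a b -> root_sum c a b = 0.
Proof.
move=> H; rewrite root_sumE big1 // => k _.
have -> : (a == pk k) && (star b == qk k) = false.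
  apply/negbTE; apply: contra H => /andP[/eqP -> /eqP/(canRL (starK hn)) ->].
  exact: grade1_pk.
have -> : (a == qk k) && (star b == pk k) = false.
  apply/negbTE; apply: contra H => /andP[/eqP -> /eqP/(canRL (starK hn)) ->].
  by rewrite -(grade1_star hn) starK grade1_pk.
by rewrite !mulr0n subr0 mulr0.
Qed.

(** The weight of the torus element with coordinates h at the null vector a:
    the two vectors of a block have opposite weights. *)
Definition lie_wt (h : nat -> C) (a : I) : C :=
  if a == ord0 then 0 else if odd a then h (uphalf a) else - h (uphalf a).

Definition diagm (d : I -> C) : matC := \matrix_(a, b) (d a *+ (a == b)).

Lemma mul_diagm d p (A : 'M[C]_(n.*2.+1, p)) a b : (diagm d *m A) a b = d a * A a b.
Proof.
rewrite mxE (bigD1 a) //= big1 ?addr0 => [|k ka]; first by rewrite mxE eqxx.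
by rewrite mxE eq_sym (negbTE ka) mul0r.
Qed.

Lemma mulr_diagm d p (A : 'M[C]_(p, n.*2.+1)) a b : (A *m diagm d) a b = A a b * d b.
Proof.
rewrite mxE (bigD1 b) //= big1 ?addr0 => [|k kb]; first by rewrite mxE eqxx.
by rewrite mxE (negbTE kb) mulr0.
Qed.

Definition antisymS (B : matC) := forall a b, null_pair a * B (star a) b + null_pair b * B (star b) a = 0.

Definition degree01 (B : matC) :=
  forall a b, gr a <> gr b -> ~~ grade1 a b -> B a b = 0.

Lemma antisymS_diag B a : antisymS B -> B (star a) a = 0.
Proof.
move=> /(_ a a)/eqP; rewrite -mulrDr mulf_eq0 (negbTE (null_pair_neq0 R a)) /=.
by rewrite -mulr2n mulrn_eq0 /= => /eqP.
Qed.

Lemma antisymS_E B a b : antisymS B -> null_pair b * B (star b) a = - (null_pair a * B (star a) b).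
Proof. by move=> /(_ a b)/eqP; rewrite addrC addr_eq0 => /eqP. Qed.

(** In degree 0 antisymmetry leaves only the diagonal, which it makes a weight;
    the degree 1 positions are those of the root vectors, and antisymmetry
    matches the two entries belonging to the same root vector. *)
Lemma degree01_decomp B : antisymS B -> degree01 B ->
  exists h c, (forall k, c k = B (pk k) (star (qk k)) / null_pair (qk k)) /\
    B = diagm (lie_wt h) + root_sum c.
Proof.
move=> aB pB.
pose h j := B (inord j.*2.-1) (inord j.*2.-1).
pose c k := B (pk k) (star (qk k)) / null_pair (qk k).
exists h, c; split=> //.
have B00 a : a = ord0 -> B a a = 0.
  by move=> ->; rewrite -{1}(star0 hn) antisymS_diag.
have Bdiag a : B a a = lie_wt h a.
  rewrite /lie_wt; case: (a =P ord0) => [/B00//|/eqP a0].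
  have E (x : I) : odd x -> inord (uphalf x).*2.-1 = x :> I.
    by move=> ox; apply: val_inj; rewrite /= inordK; move: (ltn_ord x); lia.
  case: ifP => oa; first by rewrite /h E.
  have os : odd (star a) by rewrite odd_star// oa.
  rewrite /h -uphalf_star E//.
  have := antisymS_E a (star a) aB; rewrite starK.
  have -> : null_pair (star a) = null_pair a by rewrite /null_pair star_ord0.
  by rewrite -mulrN => /(mulfI (null_pair_neq0 R a)).
have gdiag a : ~~ grade1 a a.
  rewrite /RootIndices.grade1 /nextg; have := grn_lt hn (ltn_ord a).
  by rewrite -/(gr a); ilia.
apply/matrixP => a b; rewrite [RHS]mxE [diagm (lie_wt h) a b]mxE.
have [g1|g1] := boolP (grade1 a b).
  have -> : (a == b) = false.
    by apply/negbTE; apply: contraTneq g1 => ->; exact: gdiag.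
  rewrite mulr0n add0r; have [k [[-> ->]|[-> ->]]] := grade1_form hn g1.
    by rewrite root_sum_low /c divfK// null_pair_neq0.
  rewrite root_sum_high /c; have spk : null_pair (star (pk k)) = null_pair (pk k) by rewrite /null_pair star_ord0.
  have := antisymS_E (star (pk k)) (star (qk k)) aB; rewrite !starK spk.
  have -> : null_pair (star (qk k)) = null_pair (qk k) by rewrite /null_pair star_ord0.
  move=> H; apply: (mulfI (null_pair_neq0 R (qk k))); rewrite H.
  by move: (B _ _) (null_pair_neq0 R (qk k)) => x q0; field.
rewrite root_sum_0// addr0; case: (a =P b) => [<-|ab]; first by rewrite mulr1n Bdiag.
rewrite mulr0n; case: (gr a =P gr b) => [/(gr_eq hn)[//|->]|gab].
  exact: antisymS_diag.
exact: pB.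
Qed.

Lemma root_sum_degree01 h c : degree01 (diagm (lie_wt h) + root_sum c).
Proof.
move=> a b gab g1; rewrite mxE root_sum_0// addr0 [diagm _ _ _]mxE.
by case: eqP gab => // ->.
Qed.

End RootVectors.

End RootVectors.

(** * The torus and its Lie algebra in the null basis *)

Module Import Torus.

Section Torus.
Variables (R : realType) (n : nat).
Hypothesis hn : (1 <= n)%N.
Notation C := R[i].
Notation I := 'I_(n.*2.+1).
Notation matR := 'M[R]_(n.*2.+1).
Notation star := (star hn).
Notation null_mx := (null_mx R hn).
Notation to_null := (@to_null R n hn).
Notation null_sign := (@null_sign R n).
Notation lo := (lo hn).
Notation hi := (hi hn).
Notation diagm := (@diagm R n).
Notation lie_wt := (@lie_wt R n).

(** The square of the unit u of block j. *)
Definition usq (j : nat) : R := if j == n then 1 else -1.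

(** The common shape of the elements of the torus and of its Lie algebra. For a
    2 x 2 block, membership in the orthogonal group or its Lie algebra amounts,
    apart from the determinant, to linear relations between the entries, in
    which only the sign u^2 distinguishes the last block. *)
Definition block_mx2 (x0 : R) (al be : nat -> R) : matR := \matrix_(a, b)
  if a == b then (if a == ord0 then x0 else al (uphalf a))
  else if uphalf a == uphalf b then
    (if odd b then be (uphalf a) else usq (uphalf a) * be (uphalf a))
  else 0.

(** The eigenvalue of such a matrix at the null vector a. *)
Definition block_eig (x0 : R) (al be : nat -> R) (a : I) : C :=
  if a == ord0 then x0%:C%C
  else (al (uphalf a))%:C%C + null_sign a * (usq (uphalf a) * be (uphalf a))%:C%C.

Lemma null_sign2 (a : I) : null_sign a * null_sign a = (usq (uphalf a))%:C%C.
Proof.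
have -> : null_sign a * null_sign a = null_unit R n (uphalf a) ^+ 2.
  by rewrite /NullBasis.null_sign; case: ifP => _; rewrite -expr2 ?sqrrN.
rewrite /null_unit /usq; case: ifP => _; first by rewrite expr1n.
by rewrite sqr_i rmorphN.
Qed.

Lemma usq2 j : usq j * usq j = 1.
Proof. by rewrite /usq; case: ifP => _; ring. Qed.

Lemma val_lo' (a : I) : a != ord0 -> lo a = (uphalf a).*2.-1 :> nat.
Proof. rewrite -val_eqE /= val_lo /starn; ilia. Qed.

Lemma val_hi' (a : I) : a != ord0 -> hi a = (uphalf a).*2 :> nat.
Proof. rewrite -val_eqE /= val_hi /starn; ilia. Qed.

Lemma uph_lo (a : I) : a != ord0 -> uphalf (lo a) = uphalf a.
Proof. by move=> a0; rewrite val_lo'//; lia. Qed.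

Lemma uph_hi (a : I) : a != ord0 -> uphalf (hi a) = uphalf a.
Proof. by move=> a0; rewrite val_hi'//; lia. Qed.

Lemma block_mx2_lo x0 al be (i b : I) : b != ord0 -> block_mx2 x0 al be i (lo b) =
  if i == lo b then al (uphalf b) else if i == hi b then be (uphalf b) else 0.
Proof.
move=> b0; have l0 := lo_neq0 hn b0; rewrite mxE.
have ul : uphalf (lo b) = uphalf b by rewrite val_lo'//; lia.
have ol : odd (lo b) by rewrite val_lo'//; move: b0; rewrite -val_eqE /=; lia.
case: (i =P lo b) => [->|il]; first by rewrite (negbTE l0) ul.
rewrite ul ol; case: (i =P hi b) => [->|ih]; first by rewrite uph_hi// eqxx.
rewrite ifF //; apply/negbTE/eqP => E.
have : i = lo b \/ i = hi b; last by case.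
have [il'|ih'] : (i = lo b :> nat) \/ (i = hi b :> nat).
  by rewrite val_lo'// val_hi'//; lia.
  by left; apply: val_inj.
by right; apply: val_inj.
Qed.

Lemma block_mx2_hi x0 al be (i b : I) : b != ord0 -> block_mx2 x0 al be i (hi b) =
  if i == hi b then al (uphalf b) else
  if i == lo b then usq (uphalf b) * be (uphalf b) else 0.
Proof.
move=> b0; have h0 := hi_neq0 hn b0; rewrite mxE.
have uh : uphalf (hi b) = uphalf b by rewrite val_hi'//; lia.
have oh : odd (hi b) = false by rewrite val_hi'//; lia.
case: (i =P hi b) => [->|ih]; first by rewrite (negbTE h0) uh.
rewrite uh oh; case: (i =P lo b) => [->|il].
  by rewrite uph_lo// eqxx.
rewrite ifF //; apply/negbTE/eqP => E.
have : i = lo b \/ i = hi b; last by case.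
have [il'|ih'] : (i = lo b :> nat) \/ (i = hi b :> nat).
  by rewrite val_lo'// val_hi'//; lia.
  by left; apply: val_inj.
by right; apply: val_inj.
Qed.

Lemma block_mx2_0 x0 al be (i : I) : block_mx2 x0 al be i ord0 = if i == ord0 then x0 else 0.
Proof.
rewrite mxE; case: (i =P ord0) => [//|i0].
rewrite ifF //; apply/negbTE/eqP => E; apply: i0; apply: val_inj => /=.
by move: E => /=; lia.
Qed.

Lemma to_null_block_mx2 x0 al be : to_null (cmx (block_mx2 x0 al be)) = diagm (block_eig x0 al be).
Proof.
suff E : cmx (block_mx2 x0 al be) *m null_mx = null_mx *m diagm (block_eig x0 al be).
  by rewrite /NullBasis.to_null -mulmxA E mulmxA null_invK mul1mx.
apply/matrixP => i b; rewrite mulr_diagm mxE.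
rewrite (eq_bigr (fun l => null_mx l b * (block_mx2 x0 al be i l)%:C%C)); last first.
  by move=> l _; rewrite [cmx _ i l]mxE mulrC.
rewrite sum_null_mx /block_eig; case: (b =P ord0) => [->|/eqP b0].
  rewrite block_mx2_0 mxE eqxx; case: (i =P ord0) => _; first by rewrite mul1r.
  by rewrite mul0r.
rewrite block_mx2_lo// block_mx2_hi// mxE (negbTE b0).
have E2 := null_sign2 b; have E4 : (usq (uphalf b))%:C%C * (usq (uphalf b))%:C%C = 1 :> C.
  by rewrite -rmorphM usq2.
have hl : (hi b == lo b) = false by rewrite eq_sym lo_hi.
case: (i =P lo b) => [->|il].
  rewrite lo_hi// mulr0 addr0 mul1r rmorphM; congr (_ + _).
case: (i =P hi b) => [_|ih]; last by rewrite !rmorph0 !mulr0 addr0 mul0r.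
rewrite rmorphM mulr1 add0r mulrDr; rewrite addrC; congr (_ + _).
by rewrite !mulrA E2 E4 mul1r.
Qed.

Lemma block_mx2_intro (A : matR) x0 : block_diagonal A -> A ord0 ord0 = x0 ->
  (forall k, (1 <= k <= n)%N ->
     block k A (inord 0) (inord 0) = block k A (inord 1) (inord 1) /\
     block k A (inord 0) (inord 1) = usq k * block k A (inord 1) (inord 0)) ->
  A = block_mx2 x0 (fun k => block k A (inord 0) (inord 0))
            (fun k => block k A (inord 1) (inord 0)).
Proof.
move=> bd A0 H; apply/matrixP => a b; rewrite mxE.
have bE k i j (i2 : (i < 2)%N) (j2 : (j < 2)%N) :
    block k A (inord i) (inord j) = A (inord (k.*2.-1 + i)) (inord (k.*2.-1 + j)).
  by rewrite mxE !inordK.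
have aE (x : I) (m : nat) : x = m :> nat -> inord m = x.
  by move=> <-; exact: inord_val.
case: (a =P b) => [<-|ab].
  case: (a =P ord0) => [->//|/eqP a0].
  have an := ltn_ord a; rewrite -val_eqE /= in a0.
  have ka : (1 <= uphalf a <= n)%N by lia.
  have [oa|oa] := boolP (odd a).
    by rewrite bE// !(aE a)//; lia.
  by rewrite (H _ ka).1 bE// !(aE a)//; lia.
case: eqP => [uab|/eqP uab]; last exact: bd.
have a0 : a <> 0%N :> nat by move=> a0; apply: ab; apply: val_inj => /=; lia.
have an := ltn_ord a; have bn := ltn_ord b.
have ka : (1 <= uphalf a <= n)%N by lia.
have ab' : a <> b :> nat by move=> /val_inj.
case: ifP => ob.
  by rewrite bE// (aE a) ?(aE b)//; lia.
by rewrite -(H _ ka).2 bE// (aE a) ?(aE b)//; lia.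
Qed.

Lemma block_block_mx2 x0 al be k (i j : 'I_2) : (1 <= k <= n)%N -> block k (block_mx2 x0 al be) i j =
  if i == j then al k else if j == 0%N :> nat then be k else usq k * be k.
Proof.
move=> kn; rewrite !mxE; have := ltn_ord i; have := ltn_ord j => j2 i2.
rewrite -!val_eqE /= !inordK; try lia.
have -> : uphalf (k.*2.-1 + i) = k by lia.
have -> : uphalf (k.*2.-1 + j) = k by lia.
have -> : (k.*2.-1 + i == k.*2.-1 + j)%N = (i == j :> nat) by lia.
have -> : (k.*2.-1 + i == 0)%N = false by lia.
have -> : odd (k.*2.-1 + j) = (j == 0%N :> nat) by lia.
by rewrite eqxx.
Qed.

Lemma block_mx2_block_diagonal x0 al be : block_diagonal (block_mx2 x0 al be).
Proof.
move=> a b ab; rewrite mxE ifF; first by rewrite ifF//; exact/negbTE.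
by apply/negbTE; apply: contra ab => /eqP ->.
Qed.

Local Notation i0 := (inord 0 : 'I_2).
Local Notation i1 := (inord 1 : 'I_2).

Lemma sum2 (K : nmodType) (F : 'I_2 -> K) : \sum_i F i = F i0 + F i1.
Proof.
rewrite big_ord_recl big_ord1; congr (F _ + F _); apply: val_inj;
  by rewrite /= inordK.
Qed.

Lemma i01 : (i0 == i1) = false. Proof. by rewrite -val_eqE /= !inordK. Qed.
Lemma i10 : (i1 == i0) = false. Proof. by rewrite -val_eqE /= !inordK. Qed.

Lemma det2 (M : 'M[R]_2) : \det M = M i0 i0 * M i1 i1 - M i0 i1 * M i1 i0.
Proof.
rewrite (expand_det_row _ i0) sum2 /cofactor !det_mx11 !mxE /= !inordK//.
rewrite addn0 expr0 mul1r add0n expr1 mulN1r mulrN.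
congr (M _ _ * M _ _ - M _ _ * M _ _); apply: val_inj; rewrite /= ?inordK//.
Qed.

Lemma mx2P (M N : 'M[R]_2) : M i0 i0 = N i0 i0 -> M i0 i1 = N i0 i1 ->
  M i1 i0 = N i1 i0 -> M i1 i1 = N i1 i1 -> M = N.
Proof.
move=> H1 H2 H3 H4; apply/matrixP => i j.
have c (x : 'I_2) : x = i0 \/ x = i1.
  have : (x = 0%N :> nat) \/ (x = 1%N :> nat) by have := ltn_ord x; lia.
  by case=> E; [left|right]; apply: val_inj; rewrite /= inordK.
by case: (c i) => ->; case: (c j) => ->.
Qed.

Lemma mul2E (M N : 'M[R]_2) i j : (M *m N) i j = M i i0 * N i0 j + M i i1 * N i1 j.
Proof. by rewrite mxE sum2. Qed.

Lemma ups2E : [/\ ups R 1 i0 i0 = 1, ups R 1 i0 i1 = 0, ups R 1 i1 i0 = 0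
  & ups R 1 i1 i1 = -1].
Proof. by split; rewrite !mxE -!val_eqE /= !inordK. Qed.

Lemma tr2E (M : 'M[R]_2) i j : M^T i j = M j i. Proof. by rewrite mxE. Qed.
Lemma add2E (M N : 'M[R]_2) i j : (M + N) i j = M i j + N i j. Proof. by rewrite mxE. Qed.
Lemma zero2E i j : (0 : 'M[R]_2) i j = 0. Proof. by rewrite mxE. Qed.
Lemma one2E : [/\ (1%:M : 'M[R]_2) i0 i0 = 1, (1%:M : 'M[R]_2) i0 i1 = 0,
  (1%:M : 'M[R]_2) i1 i0 = 0 & (1%:M : 'M[R]_2) i1 i1 = 1].
Proof. by split; rewrite !mxE -!val_eqE /= !inordK. Qed.

Lemma so2P (M : 'M[R]_2) : so M <->
  [/\ M i0 i0 = 0, M i1 i1 = 0 & M i0 i1 = - M i1 i0].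
Proof.
split=> [H|[H1 H2 H3]].
  have E i j := congr1 (fun M : 'M[R]_2 => M i j) H.
  have := E i0 i0; have := E i1 i1; have := E i0 i1.
  rewrite !add2E !tr2E !zero2E => E1 E2 E3; split; lra.
by apply: mx2P; rewrite !add2E !tr2E !zero2E; lra.
Qed.

Lemma so12P (M : 'M[R]_2) : so1 (m := 1) M <->
  [/\ M i0 i0 = 0, M i1 i1 = 0 & M i0 i1 = M i1 i0].
Proof.
have [u00 u01 u10 u11] := ups2E; split=> [H|[H1 H2 H3]].
  have E i j := congr1 (fun M : 'M[R]_2 => M i j) H.
  have := E i0 i0; have := E i1 i1; have := E i0 i1.
  rewrite !add2E !mul2E !tr2E !zero2E u00 u01 u10 u11 => E1 E2 E3; split; lra.
by apply: mx2P; rewrite !add2E !mul2E !tr2E !zero2E ?u00 ?u01 ?u10 ?u11; lra.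
Qed.

Lemma SO2P (M : 'M[R]_2) : SO M <->
  [/\ M i1 i1 = M i0 i0, M i0 i1 = - M i1 i0 & M i0 i0 ^+ 2 + M i1 i0 ^+ 2 = 1].
Proof.
have [e00 e01 e10 e11] := one2E; rewrite /SO det2; split=> [[H D]|[H1 H2 H3]].
  have E i j := congr1 (fun M : 'M[R]_2 => M i j) H.
  have := E i0 i0; have := E i1 i1; have := E i0 i1.
  rewrite !mul2E !tr2E e00 e01 e11; move: D.
  move: (M i0 i0) (M i0 i1) (M i1 i0) (M i1 i1) => a b c d D E1 E2 E3.
  have S : (a - d) ^+ 2 + (b + c) ^+ 2 = 0 by nra.
  have [S1 S2] : a - d = 0 /\ b + c = 0.
    move/eqP: S; rewrite paddr_eq0 ?sqr_ge0// !sqrf_eq0.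
    by move=> /andP[/eqP -> /eqP ->].
  by split; [lra|lra|rewrite -E3; ring].
split; last by rewrite H1 H2 -H3; ring.
apply: mx2P; rewrite !mul2E !tr2E ?e00 ?e01 ?e10 ?e11 ?H1 ?H2 -?H3; ring.
Qed.

Lemma SO12P (M : 'M[R]_2) : SO1 (m := 1) M <->
  [/\ M i1 i1 = M i0 i0, M i0 i1 = M i1 i0 & M i0 i0 ^+ 2 - M i1 i0 ^+ 2 = 1].
Proof.
have [u00 u01 u10 u11] := ups2E; rewrite /SO1 det2; split=> [[H D]|[H1 H2 H3]].
  have E i j := congr1 (fun M : 'M[R]_2 => M i j) H.
  have := E i0 i0; have := E i1 i1; have := E i0 i1.
  rewrite !mul2E !tr2E u00 u01 u10 u11; move: D.
  move: (M i0 i0) (M i0 i1) (M i1 i0) (M i1 i1) => a b c d D E1 E2 E3.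
  have N : a ^+ 2 - c ^+ 2 = 1 by rewrite -E3; ring.
  have X : a * b = c * d by lra.
  split=> //.
    rewrite -[LHS]mulr1 -N; have -> : d * (a ^+ 2 - c ^+ 2) =
      a * (a * d - b * c) + c * (a * b - c * d) by ring.
    by rewrite D X; ring.
  rewrite -[LHS]mulr1 -N; have -> : b * (a ^+ 2 - c ^+ 2) =
    a * (a * b - c * d) + c * (a * d - b * c) by ring.
  by rewrite D X; ring.
split; last by rewrite H1 H2 -H3; ring.
apply: mx2P; rewrite !mul2E !tr2E ?u00 ?u01 ?u10 ?u11 ?H1 ?H2; try ring.
  by transitivity (M i0 i0 ^+ 2 - M i1 i0 ^+ 2); [ring|exact: H3].
by transitivity (- (M i0 i0 ^+ 2 - M i1 i0 ^+ 2)); [ring|rewrite H3].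
Qed.

Lemma Lie_t_block_mx2 X : Lie_t X -> exists be, X = block_mx2 0 (fun=> 0) be.
Proof.
move=> [bd X0 Hso Hso1]; exists (fun k => block k X i1 i0).
have key k : (1 <= k <= n)%N -> [/\ block k X i0 i0 = 0, block k X i1 i1 = 0 &
    block k X i0 i1 = usq k * block k X i1 i0].
  move=> kn; rewrite /usq; case: (k =P n) => [->|/eqP nk].
    by rewrite mul1r; apply/so12P.
  by rewrite mulN1r; apply/so2P; apply: Hso; lia.
rewrite {1}(block_mx2_intro (x0 := 0) bd X0); last first.
  by move=> k /key[-> -> ->].
apply/matrixP => a b; rewrite ![block_mx2 _ _ _ _ _]mxE; have an := ltn_ord a.
case: (a =P b) => // _; case: (a =P ord0) => // /eqP a0.
have ka : (1 <= uphalf a <= n)%N by move: a0; rewrite -val_eqE /=; lia.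
by case: (key _ ka).
Qed.

Lemma usq_lt k : (1 <= k < n)%N -> usq k = -1.
Proof. by move=> kn; rewrite /usq ifF//; lia. Qed.

Lemma usq_n : usq n = 1. Proof. by rewrite /usq eqxx. Qed.

Lemma block_block_mx2E x0 al be k : (1 <= k <= n)%N ->
  let B := block k (block_mx2 x0 al be) in
  [/\ B i0 i0 = al k, B i1 i1 = al k, B i1 i0 = be k & B i0 i1 = usq k * be k].
Proof. by move=> kn; rewrite /= !block_block_mx2// !eqxx i01 i10 !inordK. Qed.

Lemma block_mx2_Lie_t be : Lie_t (block_mx2 0 (fun=> 0) be).
Proof.
split; first exact: block_mx2_block_diagonal.
- by rewrite block_mx2_0.
- move=> k kn; have kn' : (1 <= k <= n)%N by lia.
  have [b00 b11 b10 b01] := block_block_mx2E 0 (fun=> 0) be kn'.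
  by apply/so2P; rewrite b00 b11 b10 b01 usq_lt// mulN1r.
- have nn : (1 <= n <= n)%N by lia.
  have [b00 b11 b10 b01] := block_block_mx2E 0 (fun=> 0) be nn.
  by apply/so12P; rewrite b00 b11 b10 b01 usq_n mul1r.
Qed.

Lemma block_mx2_torus al be :
  (forall k, (1 <= k <= n)%N -> al k ^+ 2 - usq k * be k ^+ 2 = 1) ->
  torus (block_mx2 1 al be).
Proof.
move=> H; split; first exact: block_mx2_block_diagonal.
- by rewrite block_mx2_0.
- move=> k kn; have kn' : (1 <= k <= n)%N by lia.
  have [b00 b11 b10 b01] := block_block_mx2E 1 al be kn'.
  apply/SO2P; rewrite b00 b11 b10 b01 -(H _ kn') usq_lt// mulN1r; split=> //.
  by ring.
- have nn : (1 <= n <= n)%N by lia.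
  have [b00 b11 b10 b01] := block_block_mx2E 1 al be nn.
  by apply/SO12P; rewrite b00 b11 b10 b01 -(H _ nn) usq_n !mul1r.
Qed.

Lemma torus_block_mx2 t : torus t -> exists al be, t = block_mx2 1 al be /\
  forall k, (1 <= k <= n)%N -> al k ^+ 2 - usq k * be k ^+ 2 = 1.
Proof.
move=> [bd t0 Hso Hso1].
exists (fun k => block k t i0 i0), (fun k => block k t i1 i0).
have key k : (1 <= k <= n)%N -> [/\ block k t i1 i1 = block k t i0 i0,
    block k t i0 i1 = usq k * block k t i1 i0 &
    block k t i0 i0 ^+ 2 - usq k * block k t i1 i0 ^+ 2 = 1].
  move=> kn; rewrite /usq; case: (k =P n) => [->|/eqP nk].
    by rewrite !mul1r; apply/SO12P.
  rewrite !mulN1r opprK; apply/SO2P; apply: Hso; lia.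
split; last by move=> k /key[].
by apply: block_mx2_intro => // k /key[-> -> _].
Qed.

(** The multiplicative analogue of [lie_wt], on characters. *)
Definition torus_wt (s : nat -> C) (a : I) : C :=
  if a == ord0 then 1 else if odd a then s (uphalf a) else (s (uphalf a))^-1.

Lemma torus_wt_star s a : torus_wt s (star a) = (torus_wt s a)^-1.
Proof.
rewrite /torus_wt star_ord0; case: (a =P ord0) => [|/eqP a0]; first by rewrite invr1.
by rewrite odd_star// uphalf_star; case: (odd a); rewrite /= ?invrK.
Qed.

Lemma block_eig_torus_wt al be s : (forall k, (1 <= k <= n)%N ->
    al k ^+ 2 - usq k * be k ^+ 2 = 1 /\
    s k = (al k)%:C%C + null_unit R n k * (usq k * be k)%:C%C) ->
  forall a, block_eig 1 al be a = torus_wt s a.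
Proof.
move=> H a; rewrite /block_eig /torus_wt; case: (a =P ord0) => // /eqP a0.
have an := ltn_ord a.
have ka : (1 <= uphalf a <= n)%N by move: a0; rewrite -val_eqE /=; lia.
have [N ->] := H _ ka; rewrite /NullBasis.null_sign; case: ifP => _ //.
have uuE j : null_unit R n j * null_unit R n j = (usq j)%:C%C.
  by rewrite /null_unit /usq; case: ifP => _; [rewrite mul1r|rewrite -expr2 sqr_i rmorphN].
set u := null_unit _ _ _; have {uuE} uuE : u * u = (usq (uphalf a))%:C%C by exact: uuE.
have P : ((al (uphalf a))%:C%C + u * (usq (uphalf a) * be (uphalf a))%:C%C) *
    ((al (uphalf a))%:C%C - u * (usq (uphalf a) * be (uphalf a))%:C%C) = 1.
  transitivity ((al (uphalf a) ^+ 2)%:C%C -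
     (u * u) * ((usq (uphalf a) * be (uphalf a)) ^+ 2)%:C%C).
    by rewrite !rmorphXn /=; ring.
  rewrite uuE -rmorphM -rmorphB /=; congr (_%:C%C); rewrite -N.
  congr (_ - _); have := usq2 (uphalf a) => ups_sign2.
  transitivity ((usq (uphalf a) * usq (uphalf a)) * (usq (uphalf a) * be (uphalf a) ^+ 2)).
    by ring.
  by rewrite ups_sign2 mul1r.
have nz : (al (uphalf a))%:C%C + u * (usq (uphalf a) * be (uphalf a))%:C%C != 0.
  by apply/eqP => E; move/eqP: P; rewrite E mul0r eq_sym oner_eq0.
by apply: (mulfI nz); rewrite mulNr P mulfV.
Qed.

Lemma diagm_ext d d' : d =1 d' -> diagm d = diagm d'.
Proof. by move=> E; apply/matrixP => a b; rewrite !mxE E. Qed.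

(** The reality condition on characters: those of the compact blocks have
    modulus one, that of SO(1,1) is real. Both signs occur, SO(1,1) being
    disconnected. *)
Definition torus_char (s : nat -> C) :=
  [/\ forall k, (1 <= k <= n)%N -> s k != 0,
      forall k, (1 <= k < n)%N -> s k * ((s k)^*)%C = 1 &
      ((s n)^*)%C = s n].

Lemma conj_real (x : R) : ((x%:C%C)^*)%C = x%:C%C :> C.
Proof. exact: conjc_real. Qed.

Lemma torus_to_null t : torus t -> exists2 s, torus_char s & to_null (cmx t) = diagm (torus_wt s).
Proof.
move=> /torus_block_mx2[al [be [-> H]]].
pose s k : C := (al k)%:C%C + null_unit R n k * (usq k * be k)%:C%C.
have sE k : (k < n)%N -> s k = (al k)%:C%C - 'i%C * (be k)%:C%C.
  move=> kn; rewrite /s /null_unit /usq; have -> : (k == n) = false by lia.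
  by rewrite mulN1r rmorphN mulrN.
have P k : (1 <= k < n)%N -> s k * ((s k)^*)%C = 1.
  move=> kn; rewrite sE; last by lia.
  have := H k; rewrite /usq ifF; last by lia.
  move=> N; transitivity ((al k ^+ 2 - -1 * be k ^+ 2)%:C%C : C); last by rewrite N//; lia.
  by apply: complex_ext => /=; ring.
have Qn : s n = (al n + be n)%:C%C.
  by rewrite /s /null_unit /usq eqxx !mul1r -rmorphD.
exists s; last first.
  rewrite to_null_block_mx2; apply: diagm_ext; apply: block_eig_torus_wt => k kn; split => //; exact: H.
split=> //; last by rewrite Qn conj_real.
move=> k kn; case: (k =P n) => [->|nk].
  rewrite Qn; apply/eqP => -[] E; have := H n; rewrite /usq eqxx => N.
  have : al n ^+ 2 - 1 * be n ^+ 2 = 1 by apply: N; lia.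
  have -> : al n ^+ 2 - 1 * be n ^+ 2 = (al n + be n) * (al n - be n) by ring.
  by rewrite E mul0r => /eqP; rewrite eq_sym oner_eq0.
apply/eqP => E; have := P k; rewrite E mul0r => /(_ _)/eqP; rewrite eq_sym oner_eq0 => P0.
by have : false by apply: P0; lia.
Qed.

(** Solve s = al + u^3 be and 1/s = al - u^3 be: the reality condition makes al
    and be real, and the product of the two equations is the determinant
    condition of the block. *)
Lemma to_null_torus s : torus_char s -> exists2 t, torus t & to_null (cmx t) = diagm (torus_wt s).
Proof.
move=> [s0 s1 sn].
pose al k := if k == n then (complex.Re (s n) + (complex.Re (s n))^-1) / 2
  else complex.Re (s k).
pose be k := if k == n then (complex.Re (s n) - (complex.Re (s n))^-1) / 2
  else - complex.Im (s k).
have In : s n = (complex.Re (s n))%:C%C.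
  by apply: complex_ext => //=; move: sn; case: (s n) => a b [] /= h; lra.
have rn : complex.Re (s n) != 0.
  by apply/eqP => E; have := s0 n; rewrite In E eqxx => /(_ _); rewrite leqnn hn => /(_ isT).
have H k : (1 <= k <= n)%N -> al k ^+ 2 - usq k * be k ^+ 2 = 1 /\
    s k = (al k)%:C%C + null_unit R n k * (usq k * be k)%:C%C.
  move=> kn; rewrite /al /be /usq /null_unit; case: (k =P n) => [->|nk].
    split; first by field.
    by rewrite !mul1r -rmorphD {1}In; congr (_%:C%C); field.
  have := s1 k; have kn' : (1 <= k < n)%N by lia.
  move=> /(_ kn'); case: (s k) => a b /= E; split.
    have E' : a * a - b * - b = 1 := congr1 (@complex.Re R) E.
    by rewrite -[RHS]E'; ring.
  by apply: complex_ext => /=; ring.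
exists (block_mx2 1 al be); first by apply: block_mx2_torus => k /H[].
by rewrite to_null_block_mx2; apply: diagm_ext; exact: block_eig_torus_wt.
Qed.

Lemma cmx_inj p q : injective (@cmx R p q).
Proof.
by move=> A B /matrixP E; apply/matrixP => a b; have := E a b; rewrite !mxE => -[].
Qed.

Lemma torusP t : torus t <-> exists2 s, torus_char s & to_null (cmx t) = diagm (torus_wt s).
Proof.
split; first exact: torus_to_null.
move=> [s /to_null_torus[t' tt' E'] E].
by have -> : t = t' by apply/cmx_inj/(@to_null_inj R n hn); rewrite E E'.
Qed.

Lemma block_eig_lie_wt be h : (forall k, h k = null_unit R n k * (usq k * be k)%:C%C) ->
  forall a, block_eig 0 (fun=> 0) be a = lie_wt h a.
Proof.
move=> H a; rewrite /block_eig /RootVectors.lie_wt; case: ifP => // _.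
by rewrite add0r /NullBasis.null_sign H; case: ifP => _ //; rewrite mulNr.
Qed.

Lemma diagm_lie_wtD h h' : diagm (lie_wt (fun k => h k + h' k)) = diagm (lie_wt h) + diagm (lie_wt h').
Proof.
apply/matrixP => a b; rewrite !mxE /RootVectors.lie_wt -mulrnDl; congr (_ *+ _).
by case: ifP => _; [rewrite addr0|case: ifP => _ //; rewrite opprD].
Qed.

Lemma diagm_lie_wtZ c h : diagm (lie_wt (fun k => c * h k)) = c *: diagm (lie_wt h).
Proof.
apply/matrixP => a b; rewrite !mxE /RootVectors.lie_wt mulrnAr; congr (_ *+ _).
by case: ifP => _; [rewrite mulr0|case: ifP => _ //; rewrite mulrN].
Qed.

Lemma Lie_tC_to_null H : Lie_tC H -> exists h, to_null H = diagm (lie_wt h).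
Proof.
move=> [X [Y [/Lie_t_block_mx2[be ->] /Lie_t_block_mx2[be' ->] ->]]].
pose h k := null_unit R n k * (usq k * be k)%:C%C.
pose h' k := null_unit R n k * (usq k * be' k)%:C%C.
exists (fun k => h k + 'i%C * h' k); rewrite diagm_lie_wtD diagm_lie_wtZ to_nullD to_nullZ !to_null_block_mx2.
by congr (_ + _ *: _); apply: diagm_ext; apply: block_eig_lie_wt.
Qed.

Lemma to_null_Lie_tC H h : to_null H = diagm (lie_wt h) -> Lie_tC H.
Proof.
move=> E.
pose g k : C := (if k == n then 1 else 'i%C) * h k.
pose be k := complex.Re (g k); pose be' k := complex.Im (g k).
exists (block_mx2 0 (fun=> 0) be), (block_mx2 0 (fun=> 0) be'); split; [exact: block_mx2_Lie_t|exact: block_mx2_Lie_t|].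
apply: (@to_null_inj R n hn); rewrite E to_nullD to_nullZ !to_null_block_mx2.
pose h1 k := null_unit R n k * (usq k * be k)%:C%C.
pose h2 k := null_unit R n k * (usq k * be' k)%:C%C.
rewrite (diagm_ext (block_eig_lie_wt (h := h1) _))// (diagm_ext (block_eig_lie_wt (h := h2) _))//.
rewrite -diagm_lie_wtZ -diagm_lie_wtD; congr (diagm (lie_wt _)); apply/funext => k.
rewrite /h1 /h2 /be /be' /g /null_unit /usq; case: ifP => _.
  by case: (h k) => a b; apply: complex_ext => /=; ring.
by case: (h k) => a b; apply: complex_ext => /=; ring.
Qed.

Lemma to_null_Lie_it H h : to_null H = diagm (lie_wt h) ->
  (forall k, (k < n)%N -> complex.Im (h k) = 0) -> complex.Re (h n) = 0 -> Lie_it H.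
Proof.
move=> E Hk Hn.
pose be k := if k == n then complex.Im (h k) else complex.Re (h k).
exists (block_mx2 0 (fun=> 0) be); first exact: block_mx2_Lie_t.
apply: (@to_null_inj R n hn); rewrite E to_nullZ to_null_block_mx2.
pose h1 k := null_unit R n k * (usq k * be k)%:C%C.
rewrite (diagm_ext (block_eig_lie_wt (h := h1) _))// -diagm_lie_wtZ.
apply/matrixP => a b; rewrite !mxE /RootVectors.lie_wt.
case: (a =P ord0) => // /eqP a0; have an := ltn_ord a.
suff <- : h (uphalf a) = 'i%C * h1 (uphalf a) by [].
have : (uphalf a <= n)%N by lia.
move: (uphalf a) => k kn; rewrite /h1 /be /null_unit /usq; case: (k =P n) => [->|nk].
  by move: Hn; case: (h n) => x y /= ->; apply: complex_ext => /=; ring.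
have := Hk k; have kn' : (k < n)%N by lia.
by move=> /(_ kn'); case: (h k) => x y /= ->; apply: complex_ext => /=; ring.
Qed.

End Torus.

End Torus.

(** * Maurer-Cartan forms of frames *)

Module Import FrameForms.

Section Frames.
Variables (R : realType) (n : nat).
Hypothesis hn : (1 <= n)%N.
Notation C := R[i].
Notation matC := 'M[C]_(n.*2.+1).
Notation matR := 'M[R]_(n.*2.+1).
Notation star := (star hn).
Notation pk := (pk hn).
Notation qk := (qk hn).
Notation null_mx := (null_mx R hn).
Notation null_inv := (null_inv R hn).
Notation to_null := (@to_null R n hn).
Notation null_pair := (@null_pair R n).
Notation Ups := (ups C n.*2).
Notation diagm := (@diagm R n).
Notation lie_wt := (@lie_wt R n).
Notation grade1 := (@grade1 n).
Notation gr := (@gr n).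
Notation antisymS := (@antisymS R n hn).
Notation degree01 := (@degree01 R n).
Notation dCm := (mx_der (@dC R)).
Notation dbm := (mx_der (@dbC R)).

Lemma cmx_tr p q (A : 'M[R]_(p, q)) : (cmx A)^T = cmx A^T.
Proof. by apply/matrixP => a b; rewrite !mxE. Qed.

Lemma cmx_ups : cmx (ups R n.*2) = Ups.
Proof.
apply/matrixP => a b; rewrite !mxE; case: (a == b); rewrite ?mulr0n ?rmorph0//.
by rewrite !mulr1n; case: ifP => _; rewrite ?rmorphN ?rmorph1.
Qed.

Lemma SO1_cmx (g : matR) : SO1 g -> (cmx g)^T *m Ups *m cmx g = Ups.
Proof. by case=> E _; rewrite cmx_tr -cmx_ups -!cmxM E. Qed.

Lemma isometry_inv (G : matC) : G^T *m Ups *m G = Ups ->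
  (Ups *m G^T *m Ups) *m G = 1%:M.
Proof. by move=> E; rewrite -!mulmxA [G^T *m _]mulmxA E ups2. Qed.

Lemma isometry_unit (G : matC) : G^T *m Ups *m G = Ups -> G \in unitmx.
Proof. by move=> /isometry_inv/mulmx1_unit[]. Qed.

Lemma isometry_invmx (G : matC) : G^T *m Ups *m G = Ups ->
  invmx G = Ups *m G^T *m Ups.
Proof.
move=> E; have E1 := isometry_inv E; have u := isometry_unit E.
by rewrite -[RHS]mulmx1 -(mulmxV u) mulmxA E1 mul1mx.
Qed.

Lemma cancel_unit (G A B X Y : matC) : G \in unitmx ->
  (G *m B) *m A + G *m X = (G *m A) *m B + G *m Y -> X + B *m A = Y + A *m B.
Proof.
move=> uG; rewrite -!mulmxA -!mulmxDr => /(congr1 (mulmx (invmx G))).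
by rewrite !mulKmx// addrC [in RHS]addrC.
Qed.

Section OneFrame.
Variable F : R * R -> matR.
Hypothesis sF : smooth_mx F.
Hypothesis oF : forall z, SO1 (F z).
Let G z := cmx (F z).
Let A := MC F.

(** F^-1 F_z, in the null basis. *)
Definition null_form z : matC := to_null (MC F z).

Let oG z : (G z)^T *m Ups *m G z = Ups. Proof. exact: SO1_cmx (oF z). Qed.
Let uG z : G z \in unitmx. Proof. exact: isometry_unit (oG z). Qed.
Let sG : smooth_cmat G. Proof. exact: smooth_cmat_cmx. Qed.

Lemma smooth_cmat_MC : smooth_cmat (MC F).
Proof.
apply: (@smooth_cmat_ext _ _ _ (fun z => Ups *m (G z)^T *m Ups *m dCm G z)).
  by move=> z; rewrite /MC -/(G z) (isometry_invmx (oG z)).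
apply: smooth_cmat_mul; last exact: (smooth_cmat_mx_der (derivation_dC R) sG).
apply: (smooth_cmat_mul _ (smooth_cmat_cst Ups)); apply: (smooth_cmat_mul (smooth_cmat_cst Ups)).
exact: smooth_cmat_tr.
Qed.

Lemma dz_frame z : dCm G z = G z *m MC F z.
Proof. by rewrite /MC mulKVmx// uG. Qed.

Lemma conj_G z : conj_cmx (G z) = G z. Proof. exact: conj_cmx_cmx. Qed.

Lemma dzbar_frame z : dbm G z = G z *m conj_cmx (MC F z).
Proof.
have [_ E] := mx_der_conj z sG.
have EG : (fun z => conj_cmx (G z)) = G by apply/funext => y; exact: conj_G.
by rewrite EG dz_frame conj_cmxM conj_G in E.
Qed.

Lemma so1_MC z : so1 (MC F z).
Proof.
rewrite /so1.
have E : (fun z => (G z)^T *m (Ups *m G z)) = cst Ups.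
  by apply/funext => y; rewrite mulmxA oG.
have sUG : smooth_cmat (fun z => Ups *m G z) by exact: (smooth_cmat_mul (smooth_cmat_cst Ups) sG).
have := mx_der_mul (derivation_dC R) z (smooth_cmat_tr sG) sUG.
rewrite (mx_der_mull (derivation_dC R) _ z sG) (mx_der_tr (@dC R) G z) E.
rewrite (mx_der_cst (derivation_dC R)) dz_frame trmx_mul => H.
have E1 : ((MC F z)^T *m (G z)^T) *m (Ups *m G z) = (MC F z)^T *m Ups.
  by rewrite -mulmxA [(G z)^T *m _]mulmxA oG.
have E2 : (G z)^T *m (Ups *m (G z *m MC F z)) = Ups *m MC F z.
  by rewrite !mulmxA oG.
by rewrite E1 E2 in H; rewrite -H.
Qed.

Lemma antisym_null_form z : antisymS (null_form z).
Proof. exact: (so_to_null hn (so1_MC z)). Qed.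

Lemma smooth_cmat_to_null (X : R * R -> matC) : smooth_cmat X -> smooth_cmat (fun z => to_null (X z)).
Proof.
move=> sX; apply: (smooth_cmat_mul _ (smooth_cmat_cst null_mx)).
exact: (smooth_cmat_mul (smooth_cmat_cst null_inv) sX).
Qed.

Lemma mx_der_to_null D (X : R * R -> matC) z : derivation D -> smooth_cmat X ->
  mx_der D (fun z => to_null (X z)) z = to_null (mx_der D X z).
Proof.
move=> der sX; have s1 := smooth_cmat_mul (smooth_cmat_cst null_inv) sX.
by rewrite (mx_der_mulr der null_mx z s1) (mx_der_mull der null_inv z sX).
Qed.

Lemma smooth_cmat_null_form : smooth_cmat null_form. Proof. exact: smooth_cmat_to_null smooth_cmat_MC. Qed.

(** Equality of the mixed derivatives of F. As F is real, F^-1 F_zbar is the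
    conjugate of F^-1 F_z. *)
Lemma flatness z :
  dbm (MC F) z + conj_cmx (MC F z) *m MC F z =
  dCm (fun z => conj_cmx (MC F z)) z + MC F z *m conj_cmx (MC F z).
Proof.
have sA := smooth_cmat_MC; have sA' := smooth_cmat_conj sA.
have E1 : dCm G = (fun z => G z *m MC F z) by apply/funext => y; exact: dz_frame.
have E2 : dbm G = (fun z => G z *m conj_cmx (MC F z)).
  by apply/funext => y; exact: dzbar_frame.
have S := mx_der_swap z sG; rewrite E1 E2 in S.
have L := mx_der_mul (derivation_dbC R) z sG sA; rewrite dzbar_frame in L.
have L' := mx_der_mul (derivation_dC R) z sG sA'; rewrite dz_frame in L'.
exact: (cancel_unit (uG z) (etrans (esym L) (etrans S L'))).
Qed.

(** Defined for every frame as an entry of its form, hence smooth at once; for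
    primitive frames these are the root space coefficients. *)
Definition root_coef (k : 'I_n.+1) z : C := null_form z (pk k) (star (qk k)) / null_pair (qk k).

Lemma smooth_root_coef k : smoothC (root_coef k).
Proof. exact: (smoothCM (smooth_cmat_null_form (pk k) (star (qk k))) (smoothC_cst (null_pair (qk k))^-1)). Qed.

Lemma root_coefs_decomp c z : root_coefs (@rootvec R n) F c ->
  exists h, null_form z = diagm (lie_wt h) + root_sum hn (c^~ z).
Proof.
move=> /(_ z)[H /(Lie_tC_to_null hn)[h Eh] E]; exists h.
by rewrite /null_form E to_nullD Eh.
Qed.

Lemma root_coefs_degree01 c z : root_coefs (@rootvec R n) F c -> degree01 (null_form z).
Proof. by move=> /(root_coefs_decomp z)[h ->]; exact: root_sum_degree01. Qed.

Lemma root_coefsE c k z : root_coefs (@rootvec R n) F c -> c k z = root_coef k z.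
Proof.
move=> /(root_coefs_decomp z)[h E]; rewrite /root_coef E mxE root_sum_low mxE.
have -> : (pk k == star (qk k)) = false.
  apply/negbTE/eqP => H; have := grade1_pk hn k; rewrite -H /RootIndices.grade1 /nextg.
  by have := grn_lt hn (ltn_ord (pk k)); rewrite -/(gr _); ilia.
by rewrite mulr0n add0r mulfK// null_pair_neq0.
Qed.

Lemma degree01_root_coefs : (forall z, degree01 (null_form z)) ->
  root_coefs (@rootvec R n) F root_coef.
Proof.
move=> H z; have [h [c [cE E]]] := degree01_decomp (antisym_null_form z) (H z).
exists (null_mx *m diagm (lie_wt h) *m null_inv).
  by apply: (to_null_Lie_tC (h := h)); rewrite to_nullK'.
apply: (@to_null_inj R n hn); rewrite to_nullD to_nullK' -/(null_form z) E; congr (_ + _).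
rewrite /root_sum; congr (to_null _); apply: eq_bigr => k _.
by rewrite cE.
Qed.

End OneFrame.

End Frames.

End FrameForms.

(** * Changes of frame and derivatives of the map *)

Module Import FrameChange.

Section FrameChange.
Variables (R : realType) (n : nat).
Hypothesis hn : (1 <= n)%N.
Notation C := R[i].
Notation I := 'I_(n.*2.+1).
Notation matC := 'M[C]_(n.*2.+1).
Notation matR := 'M[R]_(n.*2.+1).
Notation null_mx := (null_mx R hn).
Notation null_inv := (null_inv R hn).
Notation to_null := (@to_null R n hn).
Notation Ups := (ups C n.*2).
Notation diagm := (@diagm R n).
Notation torus_wt := (@torus_wt R n).
Notation grade1 := (@grade1 n).
Notation gr := (@gr n).
Notation degree01 := (@degree01 R n).
Notation dCm := (mx_der (@dC R)).
Notation null_form := (null_form hn).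

Lemma smooth_cmat_transition (F F' : R * R -> matR) (t : R * R -> matR) :
  smooth_mx F -> smooth_mx F' -> (forall z, SO1 (F z)) ->
  (forall z, F' z = F z *m t z) -> smooth_cmat (fun z => cmx (t z)).
Proof.
move=> sF sF' oF E; have sG := smooth_cmat_cmx sF; have sG' := smooth_cmat_cmx sF'.
apply: (@smooth_cmat_ext _ _ _ (fun z => (Ups *m (cmx (F z))^T *m Ups) *m cmx (F' z))).
  by move=> z; rewrite E cmxM mulmxA isometry_inv ?mul1mx//; exact: SO1_cmx.
apply: (smooth_cmat_mul _ sG'); apply: (smooth_cmat_mul _ (smooth_cmat_cst Ups)).
exact: (smooth_cmat_mul (smooth_cmat_cst Ups) (smooth_cmat_tr sG)).
Qed.

Lemma cancel_unit2 (G T A A' X : matC) : G \in unitmx ->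
  (G *m T) *m A' = (G *m A) *m T + G *m X -> T *m A' = A *m T + X.
Proof.
move=> uG; rewrite -!mulmxA -!mulmxDr => /(congr1 (mulmx (invmx G))).
by rewrite !mulKmx.
Qed.

Local Opaque MC.

Lemma frame_change (F F' : R * R -> matR) (t : R * R -> matR) z :
  smooth_mx F -> smooth_mx F' -> (forall z, SO1 (F z)) -> (forall z, SO1 (F' z)) ->
  (forall z, F' z = F z *m t z) ->
  to_null (cmx (t z)) *m null_form F' z = null_form F z *m to_null (cmx (t z)) +
    dCm (fun z => to_null (cmx (t z))) z.
Proof.
move=> sF sF' oF oF' E.
have sT := smooth_cmat_transition sF sF' oF E; have sG := smooth_cmat_cmx sF.
have EG : (fun z => cmx (F' z)) = (fun z => cmx (F z) *m cmx (t z)).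
  by apply/funext => y; rewrite E cmxM.
have L := mx_der_mul (derivation_dC R) z sG sT; rewrite -EG in L.
have A1 := dz_frame oF z; have A2 := dz_frame oF' z.
rewrite A1 A2 (E z) cmxM in L.
have uG := isometry_unit (SO1_cmx (oF z)).
have {}L := cancel_unit2 uG L.
rewrite (mx_der_to_null hn z (derivation_dC R) sT) /null_form -!to_nullM -to_nullD.
by rewrite L.
Qed.

Local Opaque FrameForms.null_form.

Lemma offdiag (g : I -> C) (B B' D : matC) a b :
  diagm g *m B' = B *m diagm g + D -> B a b = 0 -> D a b = 0 -> g a * B' a b = 0.
Proof.
move=> /(congr1 (fun M : matC => M a b)) + B0 D0.
by rewrite mul_diagm [X in _ = X]mxE mulr_diagm B0 D0 mul0r addr0.
Qed.

(** Conjugation by a diagonal matrix and addition of a diagonal one do not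
    change the positions of the nonzero entries. *)
Lemma frame_change_degree01 (F F' : R * R -> matR) (t : R * R -> matR) z :
  smooth_mx F -> smooth_mx F' -> (forall z, SO1 (F z)) -> (forall z, SO1 (F' z)) ->
  (forall z, F' z = F z *m t z) -> (forall z, torus (t z)) ->
  degree01 (null_form F z) -> degree01 (null_form F' z).
Proof.
move=> sF sF' oF oF' E tt H a b gab g1.
have ab : (a == b) = false by apply/negbTE/eqP => ab; apply: gab; rewrite ab.
have off y : to_null (cmx (t y)) a b = 0.
  by have [s _ ->] := torus_to_null hn (tt y); rewrite mxE ab.
have [s [s0 _ _] Es] := torus_to_null hn (tt z).
have D0 : dCm (fun z => to_null (cmx (t z))) z a b = 0.
  by rewrite (mx_der_entry _ z (f := cst 0) off) (der_cst (derivation_dC R)).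
have FC := frame_change z sF sF' oF oF' E.
have {}FC := eq_ind _ (fun T : matC => T *m null_form F' z = null_form F z *m T +
  dCm (fun z => to_null (cmx (t z))) z) FC _ Es.
have /eqP := offdiag FC (H a b gab g1) D0.
rewrite mulf_eq0 => /orP[/eqP ga|/eqP //].
exfalso; move: ga; rewrite /Torus.torus_wt.
case: (a =P ord0) => [_ /eqP|/eqP a0]; first by rewrite oner_eq0.
have sa : s (uphalf a) != 0.
  by apply: s0; move: a0 (ltn_ord a); rewrite -val_eqE /=; lia.
by case: ifP => _ /eqP; rewrite ?invr_eq0 (negbTE sa).
Qed.

Lemma basis_vecE (a i : I) : basis_vec R a i ord0 = (i == a)%:R.
Proof. by rewrite mxE andbT. Qed.

Lemma null_mx_e0 : null_mx *m basis_vec R ord0 = basis_vec R ord0.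
Proof. by rewrite -colE col_null_mx eqxx. Qed.

Lemma null_inv_e0 : null_inv *m basis_vec R ord0 = basis_vec R ord0.
Proof. by rewrite -{1}null_mx_e0 mulmxA null_invK mul1mx. Qed.

Lemma zeta_alg (G A : matC) (x y : 'cV[C]_(n.*2.+1)) : G^T *m Ups *m G = Ups ->
  null_inv *m (Ups *m G^T *m Ups) *m (G *m A *m (null_mx *m x) + G *m (null_mx *m y)) =
  to_null A *m x + y.
Proof.
move=> /isometry_inv E; rewrite -[G *m A *m _]mulmxA -mulmxDr.
rewrite -[null_inv *m _ *m _]mulmxA [Ups *m _ *m _ *m (G *m _)]mulmxA E mul1mx mulmxDr.
by rewrite [null_inv *m (null_mx *m y)]mulmxA null_invK mul1mx /NullBasis.to_null -!mulmxA.
Qed.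

Lemma grade1_next (a b : I) : grade1 a b -> (gr b < n.*2.-1)%N -> gr a = (gr b).+1.
Proof. by rewrite /RootIndices.grade1 /nextg => /eqP ->; case: eqP => // ->; rewrite ltnn. Qed.

Lemma dC0 (g : R * R -> C) z : (forall y, g y = 0) -> dC g z = 0.
Proof.
by move=> g0; have -> : g = cst 0 by [apply/funext => y; exact: g0]; exact: dC_cst.
Qed.

Lemma gr_ord0 : gr ord0 = 0%N. Proof. by []. Qed.

Section Chain.
Variables (F : R * R -> matR) (f : R * R -> 'cV[R]_(n.*2.+1)).
Hypothesis sF : smooth_mx F.
Hypothesis oF : forall z, SO1 (F z).
Hypothesis Ff : forall z, F z *m @e1 R n = f z.

Let sG : smooth_cmat (fun z => cmx (F z)). Proof. exact: smooth_cmat_cmx. Qed.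

(** The coordinates of the j-th derivative of f in the null basis carried by
    the frame; the inverse of an isometry is written through the form, which
    keeps smoothness evident. *)
Definition zeta (j : nat) z : 'cV[C]_(n.*2.+1) :=
  null_inv *m (Ups *m (cmx (F z))^T *m Ups) *m dzn j f z.

Lemma smooth_f : smooth_cmat (cplx f).
Proof.
apply: (@smooth_cmat_ext _ _ _ (fun z => cmx (F z) *m cmx (@e1 R n))).
  by move=> z; rewrite -cmxM Ff.
exact: (smooth_cmat_mul sG (smooth_cmat_cst _)).
Qed.

Lemma smooth_dzn j : smooth_cmat (dzn j f).
Proof.
elim: j => [|j IH]; first exact: smooth_f.
exact: (smooth_cmat_mx_der (derivation_dC R) IH).
Qed.

Lemma smooth_zeta j : smooth_cmat (zeta j).
Proof.
apply: (smooth_cmat_mul _ (smooth_dzn j)); apply: (smooth_cmat_mul (smooth_cmat_cst null_inv)).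
apply: (smooth_cmat_mul _ (smooth_cmat_cst Ups)); exact: (smooth_cmat_mul (smooth_cmat_cst Ups) (smooth_cmat_tr sG)).
Qed.

Lemma frame_right_inv (g : matR) : SO1 g ->
  cmx g *m (Ups *m (cmx g)^T *m Ups) = 1%:M.
Proof. by move=> og; apply: mulmx1C; exact: isometry_inv (SO1_cmx og). Qed.

Lemma dzn_zeta j z : dzn j f z = cmx (F z) *m null_mx *m zeta j z.
Proof.
rewrite /zeta -!mulmxA [null_mx *m (null_inv *m _)]mulmxA null_mxK mul1mx.
have := frame_right_inv (oF z); rewrite -!mulmxA => E.
transitivity (cmx (F z) *m (Ups *m (cmx (F z))^T *m Ups) *m dzn j f z); last first.
  by rewrite -!mulmxA.
by rewrite frame_right_inv ?mul1mx.
Qed.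

Lemma zeta0 z : zeta 0 z = basis_vec R ord0.
Proof.
rewrite /zeta /dzn /= /cplx -Ff cmxM -!mulmxA.
have E : Ups *m ((cmx (F z))^T *m (Ups *m (cmx (F z) *m cmx (@e1 R n)))) = cmx (@e1 R n).
  by rewrite !mulmxA isometry_inv ?mul1mx//; exact: SO1_cmx.
rewrite E -[RHS]null_inv_e0; congr (_ *m _); apply/matrixP => i j; rewrite !mxE.
by case: (_ && _).
Qed.

(** The product rule, applied to d^j f = F (null basis) zeta_j. *)
Lemma zetaS j z : zeta j.+1 z = null_form F z *m zeta j z + dCm (zeta j) z.
Proof.
have E1 : dzn j f = (fun z => cmx (F z) *m (null_mx *m zeta j z)).
  by apply/funext => y; rewrite dzn_zeta mulmxA.
have sz := smooth_zeta j.
have L := mx_der_mul (derivation_dC R) z sG (smooth_cmat_mul (smooth_cmat_cst null_mx) sz).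
rewrite (mx_der_mull (derivation_dC R) null_mx z sz) (dz_frame oF z) in L.
have L1 : dzn j.+1 f z = cmx (F z) *m MC F z *m (null_mx *m zeta j z)
    + cmx (F z) *m (null_mx *m dCm (zeta j) z).
  by rewrite -L -E1.
have Z := zeta_alg (MC F z) (zeta j z) (dCm (zeta j) z) (SO1_cmx (oF z)).
have L2 := congr1 (mulmx (null_inv *m (Ups *m (cmx (F z))^T *m Ups))) L1.
exact: (etrans L2 Z).
Qed.

Lemma zetaSE j z a : zeta j.+1 z a ord0 =
  \sum_b null_form F z a b * zeta j z b ord0 + dC (fun w => zeta j w a ord0) z.
Proof.
have E := congr1 (fun M : 'cV[C]_(n.*2.+1) => M a ord0) (zetaS j z).
apply: etrans E _; rewrite mxE; congr (_ + _); first by rewrite mxE.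
by rewrite mxE.
Qed.

Hypothesis pF : forall z, degree01 (null_form F z).

Lemma null_form_support z a b : null_form F z a b != 0 -> gr a = gr b \/ grade1 a b.
Proof.
move=> H; case: (gr a =P gr b) => [|gab]; first by left.
right; apply: contraNT H => g1; apply/eqP; exact: pF.
Qed.

Lemma gr0 (a : I) : gr a = 0%N -> a = ord0.
Proof. by move=> E; apply: val_inj; rewrite /= (gr_low (n := n)) ?E//; lia. Qed.

(** Multiplication by the form of a primitive frame raises degrees by at most
    1. The degree 0 component disappears in the first step, the corresponding
    diagonal entry being 0, and does not come back as long as the degrees are
    below 2n - 1. *)
Lemma zeta_support j z a : (1 <= j <= n)%N -> zeta j z a ord0 != 0 ->
  (1 <= gr a <= j)%N.
Proof.
elim: j z a => [//|j IH] z a jn.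
have [->|j0] := eqVneq j 0%N.
  rewrite zetaSE => H.
  have d0 : dC (fun w => zeta 0 w a ord0) z = 0.
    have -> : (fun w => zeta 0 w a ord0) = cst (basis_vec R ord0 a ord0).
      by apply/funext => y; rewrite zeta0.
    exact: dC_cst.
  rewrite d0 addr0 zeta0 in H.
  have {}H : null_form F z a ord0 != 0.
    apply: contra H => /eqP H; apply/eqP; rewrite big1// => i _.
    by rewrite basis_vecE; case: eqP => [->|_]; rewrite ?H ?mul0r ?mulr0.
  have a0 : a != ord0.
    apply: contra H => /eqP ->; have := antisymS_diag ord0 (antisym_null_form hn sF oF z).
    by rewrite star0 => /eqP.
  have ga : gr a != 0%N by apply: contra a0 => /eqP/gr0 ->.
  case: (null_form_support H); first by rewrite gr_ord0 => E; rewrite E in ga.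
  by move=> /grade1_next; rewrite gr_ord0 => -> //; lia.
have jn' : (1 <= j <= n)%N by lia.
rewrite zetaSE => H; apply: contraNT H => H.
(* outside the allowed degrees zeta_j vanishes identically, and so does its
   derivative *)
have z0 y : zeta j y a ord0 = 0.
  by apply/eqP; apply: contraNT H => /(IH y a jn'); lia.
rewrite (dC0 _ z0) addr0.
rewrite big1// => b _; apply/eqP; rewrite mulf_eq0; apply: contraNT H.
rewrite negb_or => /andP[/null_form_support Hab /(IH z b jn') gb].
case: Hab => [->|/grade1_next ->]; by lia.
Qed.

(** The index of the first vector of block j, and 0 for j = 0: the unique index
    of degree j when j < n. *)
Definition low_idx (j : nat) : I := inord j.*2.-1.

Lemma val_low_idx j : (j <= n)%N -> low_idx j = j.*2.-1 :> nat.
Proof. by move=> jn; rewrite /low_idx inordK//; lia. Qed.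

Lemma gr_low_idx j : (j <= n)%N -> gr (low_idx j) = j.
Proof. by move=> jn; rewrite /RootIndices.gr val_low_idx// /grn; ilia. Qed.

Lemma low_idx_uniq (a : I) j : (j < n)%N -> gr a = j -> a = low_idx j.
Proof.
move=> jn E; apply: val_inj; rewrite -E in jn *.
have H := gr_low hn jn; by rewrite [RHS]val_low_idx; [exact: H|exact: ltnW].
Qed.

(** In degree j + 1 the derivative of zeta_j contributes nothing, zeta_j
    vanishing there, and only one entry of the form leads from degree at most j
    to degree j + 1. *)
Lemma zeta_lead j z a : (j < n)%N -> gr a = j.+1 ->
  zeta j.+1 z a ord0 = null_form F z a (low_idx j) * zeta j z (low_idx j) ord0.
Proof.
move=> jn ga; rewrite zetaSE.
have z0 y : zeta j y a ord0 = 0.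
  have [j0|j0] := eqVneq j 0%N.
    rewrite j0 zeta0 basis_vecE; case: eqP => // E; move: ga; rewrite E.
    by rewrite gr_ord0.
  by apply/eqP; apply: contraTT isT => /zeta_support; rewrite ga; lia.
rewrite (dC0 _ z0) addr0.
rewrite (bigD1 (low_idx j)) //= big1 ?addr0// => b bb.
apply/eqP; rewrite mulf_eq0; apply: contraNT bb.
rewrite negb_or => /andP[/null_form_support Hab Hb]; apply/eqP; apply: low_idx_uniq => //.
have gb : (gr b <= j)%N.
  have [j0|j0] := eqVneq j 0%N.
    move: Hb; rewrite j0 zeta0 basis_vecE; case: (b =P ord0) => [->|_]; last by rewrite eqxx.
    by rewrite gr_ord0.
  by have := zeta_support _ Hb; lia.
case: Hab; first by lia.
by move=> /grade1_next; rewrite ga => H; apply/esym/eq_add_S/H; lia.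
Qed.

End Chain.

End FrameChange.

End FrameChange.

(** * The root product as a scalar product of derivatives *)

Module Import RootProducts.

Section RootProduct.
Variables (R : realType) (n : nat).
Hypothesis hn : (1 <= n)%N.
Notation C := R[i].
Notation matC := 'M[C]_(n.*2.+1).
Notation matR := 'M[R]_(n.*2.+1).
Notation star := (star hn).
Notation pk := (pk hn).
Notation qk := (qk hn).
Notation null_mx := (null_mx R hn).
Notation null_gram := (null_gram R hn).
Notation null_pair := (@null_pair R n).
Notation Ups := (ups C n.*2).
Notation gr := (@gr n).
Notation degree01 := (@degree01 R n).
Notation null_form := (null_form hn).
Notation root_coef := (root_coef hn).
Notation zeta := (zeta hn).
Notation low_idx := (low_idx n).

Local Opaque MC FrameForms.null_form.

Lemma ip_isometry (G : matC) (x y : 'cV[C]_(n.*2.+1)) : G^T *m Ups *m G = Ups ->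
  ip (G *m null_mx *m x) (G *m null_mx *m y) = \sum_a null_pair a * (x a ord0 * y (star a) ord0).
Proof.
move=> E; rewrite /ip.
have -> : (G *m null_mx *m x)^T *m Ups *m (G *m null_mx *m y) = x^T *m (null_gram *m y).
  by rewrite -gram_null_mx -{2}E !trmx_mul !mulmxA.
rewrite mxE; apply: eq_bigr => a _.
by rewrite (mul_null_gram hn y a ord0) [x^T _ _]mxE mulrCA.
Qed.

Lemma root_productM (c d : 'I_n.+1 -> C) :
  root_product (fun k => c k * d k) = root_product c * root_product d.
Proof. by rewrite /root_product -big_split /=; apply: eq_bigr => k _; rewrite exprMn. Qed.

Lemma root_product_neq0 (c : 'I_n.+1 -> C) :
  (root_product c != 0) <-> (forall k, c k != 0).
Proof.
rewrite /root_product; split=> [H k|H].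
  apply: contra H => /eqP ck; rewrite (bigD1 k)//= ck expr0n.
  by case: ifP; rewrite /= mul0r.
by apply/prodf_neq0 => k _; rewrite expf_neq0.
Qed.

Lemma root_product_split (g : nat -> C) :
  root_product (fun k : 'I_n.+1 => g k) =
  g 0%N * g n * (\prod_(0 <= i < n.-1) g i.+1) ^+ 2.
Proof.
rewrite /root_product.
rewrite (eq_bigr (fun k : 'I_n.+1 => (fun k : nat => g k ^+ (if (k == 0%N) || (k == n)
   then 1 else 2)%N) k)) //.
rewrite -(big_mkord xpredT (fun k : nat => g k ^+ (if (k == 0%N) || (k == n)
   then 1 else 2)%N)).
case: n hn => // m _; rewrite big_nat_recl// big_nat_recr//= eqxx !expr1.
have -> : \prod_(0 <= i < m) g i.+1 ^+ (if i.+1 == m.+1 then 1 else 2)%N =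
    (\prod_(0 <= i < m) g i.+1) ^+ 2.
  by rewrite -prodrXl; apply: eq_big_nat => i im; rewrite ifF//; lia.
by rewrite mulrA mulrAC.
Qed.

Section OneFrame.
Variables (F : R * R -> matR) (f : R * R -> 'cV[R]_(n.*2.+1)).
Hypothesis sF : smooth_mx F.
Hypothesis oF : forall z, SO1 (F z).
Hypothesis Ff : forall z, F z *m @e1 R n = f z.
Hypothesis pF : forall z, degree01 (null_form F z).

(** The entry of the form belonging to R_k, which is the root coefficient up to
    the constant [null_pair]. *)
Definition step (z : R * R) (k : nat) : C := null_form F z (pk (inord k)) (star (qk (inord k))).

Lemma pk_low_idx k : (1 <= k < n)%N -> pk (inord k) = low_idx k /\ star (qk (inord k)) = low_idx k.-1.
Proof.
move=> kn; have ik : (inord k : 'I_n.+1) = k :> nat by rewrite inordK//; lia.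
split; apply: low_idx_uniq => //; try lia.
  by rewrite gr_pk ik; ilia.
by rewrite gr_qk_star ik; ilia.
Qed.

Lemma qk_top k : (k == 0%N) || (k == n) -> star (qk (inord k)) = low_idx n.-1.
Proof.
move=> kn; have ik : (inord k : 'I_n.+1) = k :> nat by rewrite inordK//; lia.
by apply: low_idx_uniq => //; [lia|rewrite gr_qk_star ik; ilia].
Qed.

Lemma gr_pk_top k : (k == 0%N) || (k == n) -> gr (pk (inord k)) = n.
Proof.
move=> kn; have ik : (inord k : 'I_n.+1) = k :> nat by rewrite inordK//; lia.
by rewrite gr_pk ik; ilia.
Qed.

Lemma pk_top_star : pk (inord n) = star (pk (inord 0)).
Proof.
have := gr_pk_top (k := n); rewrite eqxx orbT => /(_ isT) g1.
have := gr_pk_top (k := 0); rewrite eqxx => /(_ isT) g0.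
have : gr (pk (inord n)) = gr (pk (inord 0)) by rewrite g1 g0.
case/(gr_eq hn) => // /(pk_inj (hn := hn)) /(congr1 val); rewrite /= !inordK//.
by move: hn => + E; rewrite E.
Qed.

Lemma zeta_lead_prod z j : (j < n)%N ->
  zeta F f j z (low_idx j) ord0 = \prod_(0 <= i < j) step z i.+1.
Proof.
elim: j => [|j IH] jn.
  rewrite big_nil (zeta0 hn oF Ff) basis_vecE; case: eqP => // [[]].
  by apply: val_inj; rewrite /= val_low_idx.
rewrite big_nat_recr//= -IH; last by lia.
rewrite (zeta_lead sF oF Ff pF); [|by lia|by rewrite gr_low_idx//; lia].
rewrite mulrC /step; have [| -> ->] := @pk_low_idx j.+1; first by lia.
by [].
Qed.

(** d^n f has degrees 1 to n and the pairing sends degree d to 2n - d, so only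
    the two null vectors of degree n contribute. Their coefficients are c_0 and
    c_n times the same product c_1 ... c_(n-1), up to constants. *)
Lemma top_ip z : ip (dzn n f z) (dzn n f z) = 4 * root_product (fun k : 'I_n.+1 => step z k).
Proof.
rewrite (dzn_zeta hn f oF n z) ip_isometry; last exact: SO1_cmx (oF z).
pose p := pk (inord 0).
have gp : gr p = n by apply: gr_pk_top.
have p0 : p != ord0 by apply: contraTneq hn => E; rewrite -gp E.
have gs : gr (star p) = n.
  by rewrite -pk_top_star; apply: gr_pk_top; rewrite eqxx orbT.
(* all other terms vanish by the degrees of the two factors *)
rewrite (bigD1 p)//= (bigD1 (star p)); last exact: star_neq.
rewrite big1 => [|a /andP[ap asp]]; last first.
  apply/eqP; rewrite mulf_eq0 (negbTE (null_pair_neq0 R a)) /=.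
  apply/negP => /negP; rewrite mulf_eq0 negb_or => /andP[H1 H2].
  have nn : (1 <= n <= n)%N by rewrite hn leqnn.
  have := zeta_support sF oF Ff pF nn H1; have := zeta_support sF oF Ff pF nn H2.
  have gsa : gr (star a) = if gr a == 0%N then 0%N else (n.*2 - gr a)%N.
    exact: (grn_star hn (ltn_ord a)).
  rewrite gsa => g1 g2; have ga : gr a = n by move: g1 g2; ilia.
  have : gr a = gr p by rewrite ga gp.
  by case/(gr_eq hn) => E; [move: ap|move: asp]; rewrite E eqxx.
have ssp : null_pair p = 2 by rewrite /NullBasis.null_pair (negbTE p0).
have sssp : null_pair (star p) = 2 by rewrite /NullBasis.null_pair star_ord0 (negbTE p0).
rewrite ssp sssp starK root_product_split -zeta_lead_prod; last by lia.
have zl a : gr a = n -> zeta F f n z a ord0 = null_form F z a (low_idx n.-1) * zeta F f n.-1 z (low_idx n.-1) ord0.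
  move=> ga; have L := zeta_lead sF oF Ff pF (j := n.-1) z (a := a).
  by rewrite prednK// in L; apply: L => //; lia.
rewrite !zl// /step -pk_top_star !qk_top ?eqxx ?orbT// -/p.
by rewrite /= addr0; ring.
Qed.

Definition top_cst : C := 4 * root_product (fun k : 'I_n.+1 => null_pair (qk k)).

Lemma top_cst_neq0 : top_cst != 0.
Proof.
rewrite /top_cst mulf_neq0 ?pnatr_eq0//; apply/root_product_neq0 => k; exact: null_pair_neq0.
Qed.

(** The left-hand side only involves f: this is why the root product does not
    depend on the frame or on the lift. *)
Lemma top_ip_coef z :
  ip (dzn n f z) (dzn n f z) = top_cst * root_product (fun k => root_coef F k z).
Proof.
rewrite top_ip /top_cst -mulrA -root_productM; congr (_ * _); congr root_product.
by apply/funext => k; rewrite /step /root_coef inord_val mulrC divfK// null_pair_neq0.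
Qed.

End OneFrame.

End RootProduct.

End RootProducts.

(** * Isometries preserving a flag *)

Module Import TorusRecognition.

Section TorusRecognition.
Variables (R : realType) (n : nat).
Hypothesis hn : (1 <= n)%N.
Notation C := R[i].
Notation I := 'I_(n.*2.+1).
Notation matC := 'M[C]_(n.*2.+1).
Notation matR := 'M[R]_(n.*2.+1).
Notation star := (star hn).
Notation cj := (cj hn).
Notation null_gram := (null_gram R hn).
Notation null_pair := (@null_pair R n).
Notation gr := (@gr n).
Notation low_idx := (low_idx n).
Notation diagm := (@diagm R n).
Notation torus_wt := (@torus_wt R n).

Lemma null_pair_star a : null_pair (star a) = null_pair a.
Proof. by rewrite /NullBasis.null_pair star_ord0. Qed.

Lemma gr_star a : gr (star a) = if gr a == 0%N then 0%N else (n.*2 - gr a)%N.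
Proof. exact: (grn_star hn (ltn_ord a)). Qed.

Lemma gr_cj a : gr (cj a) = gr (star a).
Proof. exact: (grn_star_cjn hn (ltn_ord a)). Qed.

Lemma gr_max a : (gr a < n.*2)%N. Proof. exact: (grn_lt hn (ltn_ord a)). Qed.

Lemma cj_low a : gr a != n -> cj a = star a.
Proof.
move=> ga; apply: val_inj; rewrite /= /cjn ifT//.
by move: ga (ltn_ord a); rewrite /RootIndices.gr /grn; ilia.
Qed.

Lemma cj_top a : gr a = n -> cj a = a.
Proof.
move=> ga; apply: val_inj; rewrite /= /cjn ifF//.
by move: ga (ltn_ord a); rewrite /RootIndices.gr /grn; ilia.
Qed.

Lemma low_idx0 : low_idx 0 = ord0.
Proof. by apply: val_inj; rewrite /= val_low_idx. Qed.

(** With square roots of the characters the product splits into two copies of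
    one product, and reindexing one of them by the pairing inverts it. *)
Lemma prod_torus_wt (s : nat -> C) : (forall a : I, torus_wt s a != 0) -> \prod_a torus_wt s a = 1.
Proof.
move=> s0.
pose r k := sqrtc (s k).
have rE (a : I) : torus_wt s a = torus_wt r a * torus_wt r a.
  rewrite /Torus.torus_wt /r; case: ifP => _; first by rewrite mulr1.
  by case: ifP => _; rewrite -expr2 ?exprVn sqr_sqrtc.
have r0 (a : I) : torus_wt r a != 0 by apply: contra (s0 a) => /eqP E; rewrite rE E mul0r.
rewrite (eq_bigr _ (fun a _ => rE a)) big_split /=.
(* pairs each square root with its inverse *)
rewrite {2}(reindex_inj (inv_inj (starK hn))) /= -big_split /=.
by rewrite big1// => a _; rewrite torus_wt_star mulfV.
Qed.

Lemma det_diagm (d : I -> C) : \det (diagm d) = \prod_a d a.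
Proof.
have -> : diagm d = diag_mx (\row_a d a).
  by apply/matrixP => a b; rewrite !mxE.
by rewrite det_diag; apply: eq_bigr => a _; rewrite mxE.
Qed.

Variable T : matC.
Hypothesis orthT : forall a b, \sum_c null_pair c * (T c a * T (star c) b) = null_gram a b.
Hypothesis conjT : forall a b, T a b = ((T (cj a) (cj b))^*)%C.
Hypothesis detT : \det T = 1.
Hypothesis colT : forall j a, (j < n)%N -> T a (low_idx j) != 0 -> (gr a <= j)%N.
Hypothesis rowT : forall j a, (j < n)%N -> T (low_idx j) a != 0 -> (gr a <= j)%N.

Lemma low_col a b : (gr b < n)%N -> T a b != 0 -> a = b.
Proof.
move=> gb; have Eb := low_idx_uniq hn gb (erefl (gr b)); rewrite Eb => Tab.
have ga := colT gb Tab; have ga' : (gr a < n)%N by lia.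
have Ea := low_idx_uniq hn ga' (erefl (gr a)); rewrite Ea in Tab.
have := rowT ga' Tab; rewrite (gr_low_idx hn); last by lia.
by move=> gba; rewrite Ea; congr (FrameChange.low_idx n _); lia.
Qed.

Lemma low_row a b : (gr a < n)%N -> T a b != 0 -> a = b.
Proof.
move=> ga; have Ea := low_idx_uniq hn ga (erefl (gr a)) => Tab.
have gb : (gr b <= gr a)%N by apply: (rowT ga); rewrite -Ea.
by apply: low_col => //; lia.
Qed.

Lemma conj_neq0 a b : (T a b != 0) = (T (cj a) (cj b) != 0).
Proof. by rewrite conjT conjc_eq0. Qed.

(** Below degree n the two flag conditions force T to be diagonal; conjugation
    exchanges degrees d and 2n - d, so T is also diagonal above degree n. *)
Lemma off_top a b : a != b -> T a b != 0 -> gr a = n /\ gr b = n.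
Proof.
move=> ab Tab.
have key x y : T x y != 0 -> x != y -> (n <= gr x)%N && (n <= gr y)%N.
  move=> Txy xy; apply/andP; split; rewrite leqNgt; apply/negP => h.
    by have := low_row h Txy => E; rewrite E eqxx in xy.
  by have := low_col h Txy => E; rewrite E eqxx in xy.
have /andP[h1 h2] := key _ _ Tab ab.
have cab : cj a != cj b by rewrite (inj_eq (inv_inj (cjK hn))).
have Tc : T (cj a) (cj b) != 0 by rewrite -conj_neq0.
have /andP[] := key _ _ Tc cab; rewrite !gr_cj !gr_star.
have := gr_max a; have := gr_max b => h3 h4 h5 h6.
by move: h5 h6; ilia.
Qed.

Lemma top_cases a b : gr a = n -> gr b = n -> a != b -> a = star b.
Proof.
move=> ga gb ab; have : gr a = gr b by rewrite ga gb.
by case/(gr_eq hn) => // E; rewrite E eqxx in ab.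
Qed.

Let m := low_idx n.

Lemma gr_m : gr m = n. Proof. by rewrite (gr_low_idx hn). Qed.
Lemma m0 : m != ord0.
Proof. by apply: contraTneq hn => E; rewrite -gr_m E. Qed.
Lemma gr_sm : gr (star m) = n.
Proof. by rewrite gr_star gr_m; ilia. Qed.
Lemma smm : star m != m. Proof. exact: star_neq m0. Qed.

Lemma off_cases a b : a != b -> T a b != 0 ->
  (a = m /\ b = star m) \/ (a = star m /\ b = m).
Proof.
move=> ab Tab; have [ga gb] := off_top ab Tab.
have E := top_cases ga gb ab; case: (b =P m) => bm; first by right; rewrite E bm.
left; have bm' : b = star m by apply: top_cases; [|exact: gr_m|apply/eqP].
by rewrite E bm' starK.
Qed.

Lemma orth_top a b : (a == m) || (a == star m) -> (b == m) || (b == star m) ->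
  2 * (T m a * T (star m) b) + 2 * (T (star m) a * T m b) = null_gram a b.
Proof.
move=> ha hb; rewrite -orthT (bigD1 m)//= (bigD1 (star m)); last exact: smm.
have ssm : null_pair m = 2 by rewrite /NullBasis.null_pair (negbTE m0).
have sssm : null_pair (star m) = 2 by rewrite null_pair_star ssm.
rewrite ssm sssm starK /= big1 ?addr0// => c /andP[cm csm].
apply/eqP; rewrite !mulf_eq0; apply/orP; right; apply/orP; left.
apply/negPn/negP => Tca.
have ca : c != a by case/orP: ha => /eqP ->.
by have [[E _]|[E _]] := off_cases ca Tca; rewrite E eqxx in cm csm.
Qed.

Lemma null_gram_top : [/\ null_gram m m = 0, null_gram (star m) (star m) = 0 & null_gram m (star m) = 2].
Proof.
have ssm : null_pair m = 2 by rewrite /NullBasis.null_pair (negbTE m0).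
split; rewrite mxE ?starK.
- by rewrite eq_sym (negbTE smm).
- by rewrite (negbTE smm).
- by rewrite eqxx ssm.
Qed.

Lemma orth_diag a : (forall c, c != a -> T c a = 0) -> T a a * T (star a) (star a) = 1.
Proof.
move=> H; have := orthT a (star a); rewrite (bigD1 a)//= big1 ?addr0; last first.
  by move=> c ca; rewrite H// mul0r mulr0.
rewrite mxE eqxx mulr1n => E; apply: (mulfI (null_pair_neq0 R a)).
by rewrite mulr1 -[RHS]E.
Qed.

End TorusRecognition.

Section TorusRecognition2.
Variables (R : realType) (n : nat).
Hypothesis hn : (1 <= n)%N.
Notation C := R[i].
Notation I := 'I_(n.*2.+1).
Notation matC := 'M[C]_(n.*2.+1).
Notation matR := 'M[R]_(n.*2.+1).
Notation star := (star hn).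
Notation cj := (cj hn).
Notation null_gram := (null_gram R hn).
Notation null_pair := (@null_pair R n).
Notation gr := (@gr n).
Notation low_idx := (low_idx n).
Notation diagm := (@diagm R n).
Notation torus_wt := (@torus_wt R n).

Lemma diag_torus_wt (M : matC) : (forall a b, a != b -> M a b = 0) -> M ord0 ord0 = 1 ->
  (forall a, M a a * M (star a) (star a) = 1) ->
  M = diagm (torus_wt (fun k => M (low_idx k) (low_idx k))) /\ \det M = 1.
Proof.
move=> off M0 inv.
have nz a : M a a != 0.
  by apply/eqP => E; have := inv a; rewrite E mul0r => /eqP; rewrite eq_sym oner_eq0.
have E a : M a a = torus_wt (fun k => M (low_idx k) (low_idx k)) a.
  rewrite /Torus.torus_wt; case: (a =P ord0) => [->//|/eqP a0].
  have bjE (x : I) : odd x -> low_idx (uphalf x) = x.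
    by move=> ox; apply: val_inj; rewrite /= val_low_idx; have := ltn_ord x; lia.
  case: ifP => oa; first by rewrite bjE.
  have os : odd (star a) by rewrite odd_star// oa.
  rewrite -(uphalf_star hn a) bjE//; apply: (mulIf (nz (star a))).
  by rewrite inv mulVf// nz.
have ME : M = diagm (torus_wt (fun k => M (low_idx k) (low_idx k))).
  apply/matrixP => a b; rewrite mxE; case: (a =P b) => [<-|/eqP ab].
    by rewrite mulr1n -E.
  by rewrite off.
split=> //; rewrite ME det_diagm (prod_torus_wt hn)// => a.
by rewrite -E; exact: nz.
Qed.

(** The flag conditions and reality make T diagonal outside the two null
    vectors of degree n. On their plane T either is diagonal or exchanges the
    two null lines; an exchange composed with the transposition would be a
    diagonal isometry, of determinant 1, so T would have determinant -1.
    Finally a diagonal isometry is given by characters, and reality is the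
    condition on those. *)
Lemma torus_recognition (T : matC) :
  (forall a b, \sum_c null_pair c * (T c a * T (star c) b) = null_gram a b) ->
  (forall a b, T a b = ((T (cj a) (cj b))^*)%C) -> \det T = 1 -> T ord0 ord0 = 1 ->
  (forall j a, (j < n)%N -> T a (low_idx j) != 0 -> (gr a <= j)%N) ->
  (forall j a, (j < n)%N -> T (low_idx j) a != 0 -> (gr a <= j)%N) ->
  exists2 s, @torus_char R n s & T = diagm (torus_wt s).
Proof.
move=> orthT conjT detT T00 colT rowT.
pose m := low_idx n; have sm := smm hn; have gm := gr_m hn; have gsm := gr_sm hn.
have mm0 := m0 hn.
have [S1 S2 S3] := null_gram_top R hn.
have top1 : (m == m) || (m == star m) by rewrite eqxx.
have top2 : (star m == m) || (star m == star m) by rewrite eqxx orbT.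
have e1 := orth_top orthT conjT colT rowT top1 top1.
have e2 := orth_top orthT conjT colT rowT top2 top2.
have e3 := orth_top orthT conjT colT rowT top1 top2.
rewrite S1 in e1; rewrite S2 in e2; rewrite S3 in e3.
have n2 : (2 : C) != 0 by rewrite pnatr_eq0.
have n4 : (4 : C) != 0 by rewrite pnatr_eq0.
have {}e1 : T m m * T (star m) m = 0.
  by apply: (mulfI n4); rewrite mulr0 -[RHS]e1; ring.
have {}e2 : T m (star m) * T (star m) (star m) = 0.
  by apply: (mulfI n4); rewrite mulr0 -[RHS]e2; ring.
have {}e3 : T m m * T (star m) (star m) + T (star m) m * T m (star m) = 1.
  by apply: (mulfI n2); rewrite mulr1 -[RHS]e3; ring.
have off a b := off_cases conjT colT rowT (a := a) (b := b).
have [Tsm|Tsm] := eqVneq (T (star m) m) 0; last first.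
  (* the two null lines are exchanged *)
  exfalso.
  have Tmm : T m m = 0 by move/eqP: e1; rewrite mulf_eq0 (negbTE Tsm) orbF => /eqP.
  rewrite Tmm mul0r add0r in e3.
  have Tms : T m (star m) != 0.
    by apply/eqP => E; move/eqP: e3; rewrite E mulr0 eq_sym oner_eq0.
  have Tss : T (star m) (star m) = 0.
    by move/eqP: e2; rewrite mulf_eq0 (negbTE Tms) => /eqP.
  (* undoing the exchange leaves a diagonal isometry *)
  pose M : matC := col_perm (tperm m (star m)) T.
  have ME a b : M a b = T a (tperm m (star m) b) by rewrite mxE.
  have tp b : b != m -> b != star m -> tperm m (star m) b = b.
    by move=> b1 b2; rewrite tpermD// eq_sym.
  have [] := @diag_torus_wt M.
  - move=> a b ab; rewrite ME.
    have [Eb|bm] := eqVneq b m.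
      rewrite Eb tpermL; apply/eqP/negPn/negP => H.
      have [am|am] := eqVneq a (star m); first by rewrite am Tss eqxx in H.
      by have [[E _]|[E _]] := off _ _ am H; [rewrite E Eb eqxx in ab|rewrite E eqxx in am].
    have [Eb|bsm] := eqVneq b (star m).
      rewrite Eb tpermR; apply/eqP/negPn/negP => H.
      have [am|am] := eqVneq a m; first by rewrite am Tmm eqxx in H.
      by have [[E _]|[E _]] := off _ _ am H; [rewrite E eqxx in am|rewrite E Eb eqxx in ab].
    rewrite tp//; apply/eqP/negPn/negP => H.
    by have [[_ E]|[_ E]] := off _ _ ab H; [rewrite E eqxx in bsm|rewrite E eqxx in bm].
  - by rewrite ME tp ?T00// eq_sym ?star_ord0// mm0.
  - move=> a; rewrite !ME; have [->|am] := eqVneq a m.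
      by rewrite tpermL tpermR mulrC.
    have [->|asm] := eqVneq a (star m); first by rewrite starK tpermL tpermR.
    have sa1 : star a != m by apply: contra asm => /eqP <-; rewrite starK.
    have sa2 : star a != star m by rewrite (inj_eq (inv_inj (starK hn))).
    rewrite !tp//; apply: (orth_diag orthT) => c ca.
    apply/eqP/negPn/negP => H.
    by have [[_ E]|[_ E]] := off _ _ ca H; [rewrite E eqxx in asm|rewrite E eqxx in am].
  move=> _; rewrite /M col_permE det_mulmx detT mul1r det_perm odd_permV odd_tperm.
  rewrite eq_sym sm expr1 => /eqP; rewrite -subr_eq0 -opprD oppr_eq0 -mulr2n.
  by rewrite pnatr_eq0.
rewrite Tsm mul0r addr0 in e3.
have Tss : T (star m) (star m) != 0.
  by apply/eqP => E; move/eqP: e3; rewrite E mulr0 eq_sym oner_eq0.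
have Tms : T m (star m) = 0.
  by move/eqP: e2; rewrite mulf_eq0 (negbTE Tss) orbF => /eqP.
have offd a b : a != b -> T a b = 0.
  move=> ab; apply/eqP/negPn/negP => H.
  by have [[E1 E2]|[E1 E2]] := off _ _ ab H; rewrite E1 E2 ?Tsm ?Tms eqxx in H.
have inv a : T a a * T (star a) (star a) = 1.
  by apply: (orth_diag orthT) => c ca; exact: offd.
have [ET _] := diag_torus_wt offd T00 inv.
exists (fun k => T (low_idx k) (low_idx k)) => //.
have nz a : T a a != 0.
  by apply/eqP => E; have := inv a; rewrite E mul0r => /eqP; rewrite eq_sym oner_eq0.
split.
- by move=> k kn; exact: nz.
- move=> k kn; have gk : gr (low_idx k) != n by rewrite (gr_low_idx hn); lia.
  have E := congr1 (@conjc R) (conjT (low_idx k) (low_idx k)).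
  rewrite conjcK (cj_low hn gk) in E.
  by have := inv (low_idx k); rewrite -E.
- have E := conjT (low_idx n) (low_idx n).
  by rewrite (cj_top hn (gr_low_idx hn (leqnn n))) in E; rewrite -E.
Qed.

End TorusRecognition2.

End TorusRecognition.

(** * Cosets of the torus *)

Module Import Cosets.

Section Cosets.
Variables (R : realType) (n : nat).
Hypothesis hn : (1 <= n)%N.
Notation C := R[i].
Notation I := 'I_(n.*2.+1).
Notation matC := 'M[C]_(n.*2.+1).
Notation matR := 'M[R]_(n.*2.+1).
Notation star := (star hn).
Notation cj := (cj hn).
Notation null_gram := (null_gram R hn).
Notation null_mx := (null_mx R hn).
Notation null_inv := (null_inv R hn).
Notation gr := (@gr n).
Notation low_idx := (low_idx n).
Notation diagm := (@diagm R n).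
Notation torus_wt := (@torus_wt R n).
Notation to_null := (@to_null R n hn).
Notation coset := (@Defs.coset R n).

Lemma diagmM (d d' : I -> C) : diagm d *m diagm d' = diagm (fun a => d a * d' a).
Proof.
by apply/matrixP => a b; rewrite mul_diagm !mxE; case: eqP => _; rewrite ?mulr1n// !mulr0n mulr0.
Qed.

Lemma diagm1 : diagm (fun=> 1) = 1%:M.
Proof. by apply/matrixP => a b; rewrite !mxE. Qed.

Lemma torus_wtM s s' a : torus_wt s a * torus_wt s' a = torus_wt (fun k => s k * s' k) a.
Proof.
rewrite /Torus.torus_wt; case: ifP => _; first by rewrite mul1r.
by case: ifP => _ //; rewrite invfM.
Qed.

Lemma torus_mul (t t' : matR) : torus t -> torus t' -> torus (t *m t').
Proof.
move=> /(torusP hn)[s [s0 s1 s2] E] /(torusP hn)[s' [s0' s1' s2'] E'].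
apply/(torusP hn); exists (fun k => s k * s' k).
  split=> [k kn|k kn|]; first by rewrite mulf_neq0 ?s0 ?s0'.
    by rewrite rmorphM /= mulrACA s1// s1'// mulr1.
  by rewrite rmorphM /= s2 s2'.
by rewrite cmxM to_nullM E E' diagmM; apply: diagm_ext => a; rewrite torus_wtM.
Qed.

Lemma cmx1 : cmx (1%:M : matR) = 1%:M.
Proof. by apply/matrixP => a b; rewrite !mxE; case: (a == b). Qed.

Lemma torus_inv (t : matR) : torus t -> exists2 t' : matR, torus t' & t *m t' = 1%:M.
Proof.
move=> /(torusP hn)[s [s0 s1 s2] E].
have ts : torus_char n (fun k => (s k)^-1).
  split=> [k kn|k kn|]; first by rewrite invr_eq0 s0.
    by rewrite conjc_inv -invfM s1// invr1.
  by rewrite conjc_inv s2.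
have [t' tt' E'] := to_null_torus hn ts; exists t' => //.
apply/cmx_inj/(@to_null_inj R n hn); rewrite cmxM to_nullM E E' cmx1 to_null1 diagmM -diagm1.
apply/matrixP => a b; rewrite !mxE; case: (a =P b) => // _; congr (_ *+ _).
rewrite torus_wtM /Torus.torus_wt; case: (a =P ord0) => // /eqP a0.
have an := ltn_ord a; have ka : (1 <= uphalf a <= n)%N by move: a0; rewrite -val_eqE /=; lia.
by case: ifP => _; rewrite mulfV ?s0// ?invr1.
Qed.

Lemma torus1 : torus (1%:M : matR).
Proof.
apply/(torusP hn); exists (fun=> 1); first by split=> *; rewrite ?oner_eq0 ?conjc1 ?mulr1.
rewrite cmx1 to_null1 -diagm1; apply: diagm_ext => a.
by rewrite /Torus.torus_wt; case: ifP => _ //; case: ifP => _; rewrite ?invr1.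
Qed.

Lemma coset_torus (g t : matR) : torus t -> coset (g *m t) = coset g.
Proof.
move=> tt; apply/seteqP; split=> h [t' tt' ->].
  by exists (t *m t'); [exact: torus_mul|rewrite mulmxA].
have [t'' tt'' E] := torus_inv tt.
exists (t'' *m t'); first exact: torus_mul.
by rewrite -mulmxA [t *m _]mulmxA E mul1mx.
Qed.

Lemma coset_eq (g g' : matR) : coset g = coset g' -> exists2 t, torus t & g = g' *m t.
Proof.
move=> E; have : coset g g by exists 1%:M; [exact: torus1|rewrite mulmx1].
by rewrite E => -[t tt ->]; exists t.
Qed.

Lemma transition (g g' : matR) : SO1 g -> SO1 g' -> exists2 t : matR, SO1 t & g' = g *m t.
Proof.
move=> og og'.
pose t := ups R n.*2 *m g^T *m ups R n.*2 *m g'.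
have E : g' = g *m t.
  apply/cmx_inj; rewrite !cmxM -cmx_tr cmx_ups.
  by rewrite !mulmxA; have := frame_right_inv og; rewrite !mulmxA => ->; rewrite mul1mx.
exists t => //; split.
  have H := og'.1; rewrite E trmx_mul in H.
  have H2 : t^T *m g^T *m ups R n.*2 *m (g *m t) =
    t^T *m (g^T *m ups R n.*2 *m g) *m t by rewrite !mulmxA.
  by rewrite H2 og.1 in H.
by have := og'.2; rewrite E det_mulmx og.2 mul1r.
Qed.

(** By induction the lower columns of T have the right support; as the leading
    coefficient of y_j is nonzero, x_j = T y_j then gives that of column j. *)
Lemma flag_col (T : matC) (x y : nat -> 'cV[C]_(n.*2.+1)) :
  (forall j, (j < n)%N -> x j = T *m y j) ->
  (forall j b, (j < n)%N -> x j b ord0 != 0 -> (gr b <= j)%N) ->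
  (forall j b, (j < n)%N -> y j b ord0 != 0 -> (gr b <= j)%N) ->
  (forall j, (j < n)%N -> y j (low_idx j) ord0 != 0) ->
  forall j a, (j < n)%N -> T a (low_idx j) != 0 -> (gr a <= j)%N.
Proof.
move=> xy sx sy ly; elim/ltn_ind => j IH a jn; apply: contraNT => ga.
have xa : x j a ord0 = 0 by apply/eqP; apply: contraNT ga => /(sx j a jn).
have := congr1 (fun M : 'cV[C]_(n.*2.+1) => M a ord0) (xy j jn).
rewrite /= xa mxE (bigD1 (low_idx j))//= big1 ?addr0.
  by move=> /esym/eqP; rewrite mulf_eq0 (negbTE (ly j jn)) orbF.
move=> b bb; apply/eqP; rewrite mulf_eq0; apply: contraNT ga.
rewrite negb_or => /andP[Tab yb]; have gb := sy j b jn yb.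
have Eb := low_idx_uniq hn (leq_ltn_trans gb jn) (erefl (gr b)).
have gbj : (gr b < j)%N.
  by rewrite ltn_neqAle gb andbT; apply: contra bb => /eqP <-; apply/eqP.
have := IH (gr b) gbj a (ltn_trans gbj jn); rewrite -Eb => /(_ Tab) h.
exact: (leq_trans h gb).
Qed.

Lemma congruence_conj (S0 P U X T : matC) : U^T *m P *m U = S0 -> X^T *m P *m X = P ->
  U *m T = X *m U -> T^T *m S0 *m T = S0.
Proof.
move=> E1 E2 E3.
have -> : T^T *m S0 *m T = (U *m T)^T *m P *m (U *m T) by rewrite -E1 trmx_mul !mulmxA.
rewrite E3.
have -> : (X *m U)^T *m P *m (X *m U) = U^T *m (X^T *m P *m X) *m U.
  by rewrite trmx_mul !mulmxA.
by rewrite E2.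
Qed.

Lemma null_mx_to_null (X : matC) : null_mx *m to_null X = X *m null_mx.
Proof. by rewrite /NullBasis.to_null !mulmxA null_mxK mul1mx. Qed.

Lemma orth_to_null (t : matR) : SO1 t -> (to_null (cmx t))^T *m null_gram *m to_null (cmx t) = null_gram.
Proof.
move=> ot; exact: (congruence_conj (gram_null_mx R hn) (SO1_cmx ot) (null_mx_to_null (cmx t))).
Qed.

Lemma det_to_null (X : matC) : \det (to_null X) = \det X.
Proof.
rewrite /NullBasis.to_null !det_mulmx mulrAC -det_mulmx null_invK det1 mul1r //.
Qed.

(** The transition matrix T and its inverse preserve the flag of low degrees.
    The inverse of an isometry is its adjoint, so the second condition is one
    on the rows of T, after conjugation. *)
Lemma flags_torus (g g' : matR) (x y : nat -> 'cV[C]_(n.*2.+1)) : SO1 g -> SO1 g' ->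
  (forall j, (j < n)%N -> cmx g *m null_mx *m x j = cmx g' *m null_mx *m y j) ->
  x 0%N = basis_vec R ord0 -> y 0%N = basis_vec R ord0 ->
  (forall j b, (j < n)%N -> x j b ord0 != 0 -> (gr b <= j)%N) ->
  (forall j b, (j < n)%N -> y j b ord0 != 0 -> (gr b <= j)%N) ->
  (forall j, (j < n)%N -> x j (low_idx j) ord0 != 0) ->
  (forall j, (j < n)%N -> y j (low_idx j) ord0 != 0) ->
  exists2 t, torus t & g' = g *m t.
Proof.
move=> og og' E x0 y0 sx sy lx ly.
have [t ot Et] := transition og og'; exists t => //.
pose T := to_null (cmx t).
have uG := isometry_unit (SO1_cmx og).
have xy j : (j < n)%N -> x j = T *m y j.
  move=> /E; rewrite Et cmxM -!mulmxA => /(congr1 (mulmx (invmx (cmx g)))).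
  rewrite !mulKmx// => /(congr1 (mulmx null_inv)).
  by rewrite mulmxA null_invK mul1mx /T /NullBasis.to_null !mulmxA.
have oT := orth_to_null ot.
have dT : \det T = 1.
  rewrite det_to_null; have -> : \det (cmx t) = (\det t)%:C%C by exact: det_map_mx.
  by rewrite ot.2.
have uT : T \in unitmx by rewrite unitmxE dT unitr1.
have yx j : (j < n)%N -> y j = invmx T *m x j.
  by move=> /xy ->; rewrite mulKmx.
have colT := flag_col xy sx sy ly.
have colT' := flag_col yx sy sx lx.
(* the inverse of T is its adjoint for the Gram matrix *)
have SV : null_gram *m invmx T = T^T *m null_gram by rewrite -{1}oT mulmxK.
have conjT a b : T a b = ((T (cj a) (cj b))^*)%C.
  by rewrite -to_null_conj conj_cmx_cmx.
have row' j a : (j < n)%N -> T (star (low_idx j)) a != 0 -> (gr (star a) <= j)%N.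
  move=> jn H; apply: (colT' j (star a) jn).
  have := congr1 (fun M : matC => M a (low_idx j)) SV.
  rewrite mul_null_gram mulr_null_gram [T^T _ _]mxE => SVE.
  by apply: contra H => /eqP H; rewrite H mulr0 in SVE; move/esym/eqP: SVE;
     rewrite mulf_eq0 (negbTE (null_pair_neq0 R _)) orbF.
have rowT j a : (j < n)%N -> T (low_idx j) a != 0 -> (gr a <= j)%N.
  move=> jn; rewrite conjT conjc_eq0 (cj_low hn); last by rewrite (gr_low_idx hn); lia.
  by move=> /(row' j (cj a) jn); rewrite -star_cj gr_cj starK.
have [] := torus_recognition _ conjT dT _ colT rowT.
- move=> a b; have H : (T^T *m (null_gram *m T)) a b = null_gram a b by rewrite mulmxA oT.
  rewrite mxE in H; rewrite -H; apply: eq_bigr => c _.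
  by rewrite mul_null_gram [T^T _ _]mxE mulrCA.
- have := xy 0%N hn; rewrite x0 y0 => /(congr1 (fun M : 'cV[C]_(n.*2.+1) => M ord0 ord0)).
  rewrite /= basis_vecE eqxx mxE (bigD1 ord0)//= big1 ?addr0 ?basis_vecE ?eqxx ?mulr1// => b b0.
  by rewrite basis_vecE (negbTE b0) mulr0.
by move=> s ts Es; apply/(torusP hn); exists s.
Qed.

End Cosets.

End Cosets.

(** * Periodicity of lifts *)

Module Import PeriodicLifts.

Section Periodic.
Variables (R : realType).
Notation C := R[i].

Lemma dC_periodic L (g : R * R -> C) : smoothC g -> lattice_periodic L g ->
  lattice_periodic L (dC g) /\ lattice_periodic L (dbC g).
Proof.
move=> [s1 s2] gL.
have pr u : smooth u -> lattice_periodic L u ->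
    lattice_periodic L ('D_(1, 0) u) /\ lattice_periodic L ('D_(0, 1) u).
  move=> su uL; split.
    exact: (periodic_derive uL (fun z => (smooth_derivable z su).1)).
  exact: (periodic_derive uL (fun z => (smooth_derivable z su).2)).
have L1 : lattice_periodic L (fun z => complex.Re (g z)).
  by move=> z w Lw; rewrite gL.
have L2 : lattice_periodic L (fun z => complex.Im (g z)).
  by move=> z w Lw; rewrite gL.
have [a1 a2] := pr _ s1 L1; have [b1 b2] := pr _ s2 L2.
by split=> z w Lw; rewrite /dC /dbC /partialC (a1 z w Lw) (a2 z w Lw) (b1 z w Lw) (b2 z w Lw).
Qed.

Lemma mx_der_periodic L p q (G : R * R -> 'M[C]_(p, q)) : smooth_cmat G -> lattice_periodic L G ->
  lattice_periodic L (mx_der (@dC R) G).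
Proof.
move=> sG GL z w Lw; apply/matrixP => a b; rewrite !mxE.
have E : lattice_periodic L (fun z => G z a b) by move=> y v Lv; rewrite GL.
have [H _] := dC_periodic (sG a b) E; exact: H.
Qed.

Variable n : nat.
Hypothesis hn : (1 <= n)%N.
Notation matR := 'M[R]_(n.*2.+1).
Notation degree01 := (@degree01 R n).
Notation null_form := (null_form hn).
Notation root_coef := (root_coef hn).
Notation coset := (@Defs.coset R n).

Local Opaque MC FrameForms.null_form.

Section OneFrame.
Variables (F : R * R -> matR) (f : R * R -> 'cV[R]_(n.*2.+1)).
Hypothesis sF : smooth_mx F.
Hypothesis oF : forall z, SO1 (F z).
Hypothesis Ff : forall z, F z *m @e1 R n = f z.
Hypothesis pF : forall z, degree01 (null_form F z).

Lemma dzn_periodic L j : lattice_periodic L f -> lattice_periodic L (dzn j f).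
Proof.
move=> fL; elim: j => [|j IH]; first by move=> z w Lw; rewrite /dzn /= /cplx fL.
exact: (mx_der_periodic (smooth_dzn sF Ff j) IH).
Qed.

(** The frames at z and z + w carry the same derivatives of f, whose leading
    coefficients are products of the root coefficients. *)
Lemma coset_periodic L : (forall z k, root_coef F k z != 0) ->
  lattice_periodic L f -> lattice_periodic L (fun z => coset (F z)).
Proof.
move=> c0 fL z w Lw.
have supp y j b : (j < n)%N -> zeta hn F f j y b ord0 != 0 -> (gr b <= j)%N.
  move=> jn; have [->|j0] := eqVneq j 0%N.
    by rewrite (zeta0 hn oF Ff) basis_vecE; case: (b =P ord0) => [->|_]; rewrite ?eqxx.
  by move=> H; have := zeta_support sF oF Ff pF (j := j) (z := y) (a := b) _ H; lia.
have lead y j : (j < n)%N -> zeta hn F f j y (low_idx n j) ord0 != 0.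
  move=> jn; rewrite (zeta_lead_prod sF oF Ff pF)//.
  elim: (j) => [|i IH]; first by rewrite big_nil oner_eq0.
  rewrite big_nat_recr//= mulf_neq0//.
  have H := c0 y (inord i.+1); apply: contra H => /eqP H.
  apply/eqP; rewrite /FrameForms.root_coef; rewrite /step in H; by rewrite H mul0r.
have [] := flags_torus (hn := hn) (oF z) (oF (z + w)) (x := fun j => zeta hn F f j z)
  (y := fun j => zeta hn F f j (z + w)).
- move=> j jn; rewrite -!(dzn_zeta hn f oF).
  by rewrite (dzn_periodic j fL).
- exact: (zeta0 hn oF Ff).
- exact: (zeta0 hn oF Ff).
- by move=> j b; exact: supp.
- by move=> j b; exact: supp.
- by move=> j; exact: lead.
- by move=> j; exact: lead.
move=> t tt E; have := coset_torus hn (F z) tt; by rewrite -E.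
Qed.

End OneFrame.

End Periodic.

End PeriodicLifts.

(** * The complex exponential and smooth logarithms *)

Module Import ComplexExponential.

Section ComplexExp.
Variables (R : realType).
Notation C := R[i].
Implicit Types (g h : R * R -> C) (z v : R * R).

Definition cexp (w : C) : C :=
  (expR (complex.Re w))%:C%C * (cos (complex.Im w) +i* sin (complex.Im w))%C.

Lemma Re_cexp w : complex.Re (cexp w) = expR (complex.Re w) * cos (complex.Im w).
Proof. by rewrite /cexp /= mul0r subr0. Qed.

Lemma Im_cexp w : complex.Im (cexp w) = expR (complex.Re w) * sin (complex.Im w).
Proof. by rewrite /cexp /= mul0r addr0. Qed.

Lemma cexpD (w w' : C) : cexp (w + w') = cexp w * cexp w'.
Proof.
apply: complex_ext.
  by rewrite Re_cexp [RHS]complex_ReM !Re_cexp !Im_cexp complex_ReD complex_ImD expRD cosD; ring.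
by rewrite Im_cexp [RHS]complex_ImM !Re_cexp !Im_cexp complex_ReD complex_ImD expRD sinD; ring.
Qed.

Lemma cexp0 : cexp 0 = 1.
Proof. by apply: complex_ext; rewrite ?Re_cexp ?Im_cexp /= expR0 ?cos0 ?sin0 mul1r. Qed.

Lemma cexpN w : cexp (- w) = (cexp w)^-1.
Proof.
have E : cexp w * cexp (- w) = 1 by rewrite -cexpD subrr cexp0.
have w0 : cexp w != 0.
  by apply: contra_eq_neq E => ->; rewrite mul0r eq_sym oner_eq0.
by apply: (mulfI w0); rewrite E mulfV.
Qed.

Lemma cexp_neq0 w : cexp w != 0.
Proof.
have E : cexp w * cexp (- w) = 1 by rewrite -cexpD subrr cexp0.
by apply: contra_eq_neq E => ->; rewrite mul0r eq_sym oner_eq0.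
Qed.

Lemma conj_cexp w : ((cexp w)^*)%C = cexp (w^*)%C.
Proof.
have R1 (x : C) : complex.Re (x^*)%C = complex.Re x by case: x.
have I1 (x : C) : complex.Im (x^*)%C = - complex.Im x by case: x.
apply: complex_ext; first by rewrite R1 !Re_cexp R1 I1 cosN.
by rewrite I1 !Im_cexp R1 I1 sinN mulrN.
Qed.

Lemma smooth_cexp g : smoothC g -> smoothC (fun z => cexp (g z)).
Proof.
move=> [s1 s2]; have se := smooth_expR s1; have [ss sc] := smooth_sincos s2; split.
  by apply: smooth_ext (smoothM se sc) => z; rewrite Re_cexp.
by apply: smooth_ext (smoothM se ss) => z; rewrite Im_cexp.
Qed.

Local Opaque derive derivable.

Lemma partialC_cexp v g z : partC_ok v -> smoothC g ->
  partialC v (fun z => cexp (g z)) z = partialC v g z * cexp (g z).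
Proof.
move=> ok [s1 s2]; have se := smooth_expR s1; have [ss sc] := smooth_sincos s2.
have E1 : (fun z => complex.Re (cexp (g z))) =
    (expR \o (fun z => complex.Re (g z))) \* (@cos R \o (fun z => complex.Im (g z))).
  by apply/funext => y; rewrite Re_cexp.
have E2 : (fun z => complex.Im (cexp (g z))) =
    (expR \o (fun z => complex.Re (g z))) \* (@sin R \o (fun z => complex.Im (g z))).
  by apply/funext => y; rewrite Im_cexp.
have D1 := deriveM_pw (ok _ z se) (ok _ z sc).
have D2 := deriveM_pw (ok _ z se) (ok _ z ss).
have [_ De] := is_derive_comp1 (ok _ z s1) (is_derive_expR (complex.Re (g z))).
have [_ Dc] := is_derive_comp1 (ok _ z s2) (is_derive_cos (complex.Im (g z))).
have [_ Ds] := is_derive_comp1 (ok _ z s2) (is_derive_sin (complex.Im (g z))).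
rewrite De Dc in D1; rewrite De Ds in D2.
have alg (a b c d x y e : R) (W : C) : complex.Re W = e * x -> complex.Im W = e * y ->
    a = e * c * x + e * (- y * d) -> b = e * c * y + e * (x * d) ->
    (a +i* b)%C = (c +i* d)%C * W.
  case: W => u v' /= -> -> -> ->; apply: complex_ext => /=; ring.
apply: (alg _ _ _ _ _ _ _ _ (Re_cexp (g z)) (Im_cexp (g z))).
  by rewrite E1; exact: D1.
by rewrite E2; exact: D2.
Qed.

Lemma dC_cexp g z : smoothC g -> dC (fun z => cexp (g z)) z = dC g z * cexp (g z).
Proof.
move=> sg; rewrite /dC (partialC_cexp z (@partC_ok1 R) sg) (partialC_cexp z (@partC_ok2 R) sg).
move: (partialC _ _ _) (partialC _ _ _) (cexp _) => a b c; ring.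
Qed.

Lemma dbC_cexp g z : smoothC g -> dbC (fun z => cexp (g z)) z = dbC g z * cexp (g z).
Proof.
move=> sg; rewrite /dbC (partialC_cexp z (@partC_ok1 R) sg) (partialC_cexp z (@partC_ok2 R) sg).
move: (partialC _ _ _) (partialC _ _ _) (cexp _) => a b c; ring.
Qed.

(** The modulus has a logarithm, and the unit complex part a smooth argument
    because the plane is simply connected. *)
Lemma smooth_log g : smoothC g -> (forall z, g z != 0) ->
  exists2 l, smoothC l & forall z, g z = cexp (l z).
Proof.
move=> sg g0; have [s1 s2] := sg.
pose N z := complex.Re (g z) * complex.Re (g z) + complex.Im (g z) * complex.Im (g z).
have sN : smooth N by exact: (smoothD (smoothM s1 s1) (smoothM s2 s2)).
have N0 z : 0 < N z.
  rewrite lt_neqAle addr_ge0 ?sqr_ge0 -?expr2 ?sqr_ge0// andbT eq_sym.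
  rewrite /N -!expr2 paddr_eq0 ?sqr_ge0// !sqrf_eq0.
  by apply: contra (g0 z) => /andP[a b]; rewrite eq_complex a b.
pose x z := 2^-1 * ln (N z).
have sx : smooth x by exact: (smoothM (smooth_cst 2^-1) (smooth_ln sN N0)).
have xE z : expR (x z) ^+ 2 = N z.
  rewrite expr2 -expRD -mulrDl [2^-1 + _](_ : _ = 1); last by lra.
  by rewrite mul1r lnK// posrE.
(* the inverse of the modulus *)
pose r z := expR (- x z).
have sr : smooth r by exact: (smooth_expR (smoothN sx)).
have rx z : r z * expR (x z) = 1 by rewrite /r -expRD addNr expR0.
have [z|t st tE] := smooth_argument (smoothM s1 sr) (smoothM s2 sr).
  have -> : (complex.Re (g z) * r z) ^+ 2 + (complex.Im (g z) * r z) ^+ 2 =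
      N z * r z ^+ 2 by rewrite /N; ring.
  by rewrite -xE -exprMn mulrC rx expr1n.
exists (fun z => (x z +i* t z)%C); first by split.
move=> z; have [c s] := tE z; rewrite /= in c s.
apply: complex_ext; rewrite ?Re_cexp ?Im_cexp /= -?c -?s mulrC -mulrA rx mulr1//.
Qed.

Lemma lim_exp (x : R) : (fun N => \sum_(k < N) (k`!%:R)^-1 * x ^+ k) @ \oo --> expR x.
Proof.
have H : series (exp_coeff x) @ \oo --> expR x.
  exact: is_cvg_series_exp_coeff.
have E : series (exp_coeff x) = (fun N => \sum_(k < N) (k`!%:R)^-1 * x ^+ k).
  apply/funext => N; rewrite /series /= big_mkord; apply: eq_bigr => k _.
  by rewrite /exp_coeff /= mulrC.
by rewrite -E.
Qed.

(** The exponential series at i y is term by term the cosine and sine series. *)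
Lemma exp_i (y : R) k : (('i%C : C) * y%:C%C) ^+ k / (k`!)%:R =
  (cos_coeff y k +i* sin_coeff y k)%C.
Proof.
have i2 : ('i%C : C) ^+ 2 = -1 by exact: sqr_i.
have E1 : (('i%C : C)) ^+ k = if odd k then ((-1) ^+ k.-1./2)%:C%C * 'i%C else ((-1) ^+ k./2)%:C%C.
  have H j : (('i%C : C)) ^+ j.*2 = ((-1) ^+ j)%:C%C.
    by rewrite -mul2n exprM i2 rmorphXn /= rmorphN1.
  case: ifP => ok; last by rewrite -{1}(even_halfK (negbT ok)) H.
  by case: k ok => // j ok; rewrite exprSr -{1}(even_halfK ok) H.
have -> : ((k`!)%:R : C)^-1 = ((k`!%:R : R)^-1)%:C%C.
  by rewrite fmorphV rmorph_nat.
rewrite exprMn E1 -rmorphXn /= /cos_coeff /sin_coeff /=.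
rewrite -[(-1 : R) ^ k./2]/((-1 : R) ^+ k./2).
move: ((-1 : R) ^+ k./2) ((-1 : R) ^+ k.-1./2) (y ^+ k) ((k`!)%:R^-1 : R) => c s' x m.
by case: (odd k); apply: complex_ext; rewrite /=; ring.
Qed.

(** Real and imaginary arguments suffice, because the eigenvalues of the
    elements of i t are of these two kinds. *)
Lemma lim_cexp (w : C) : complex.Im w = 0 \/ complex.Re w = 0 ->
  (fun N => complex.Re (\sum_(k < N) (k`!%:R)^-1 * w ^+ k)) @ \oo --> complex.Re (cexp w) /\
  (fun N => complex.Im (\sum_(k < N) (k`!%:R)^-1 * w ^+ k)) @ \oo --> complex.Im (cexp w).
Proof.
rewrite Re_cexp Im_cexp; case: w => a b /= [->|->].
  rewrite cos0 sin0 mulr1 mulr0.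
  have E N : \sum_(k < N) (k`!%:R)^-1 * (a%:C%C : C) ^+ k =
      (\sum_(k < N) (k`!%:R)^-1 * a ^+ k)%:C%C.
    rewrite rmorph_sum; apply: eq_bigr => k _.
    by rewrite rmorphM fmorphV rmorph_nat rmorphXn.
  split.
    rewrite (_ : (fun N => _) = (fun N => \sum_(k < N) (k`!%:R)^-1 * a ^+ k)); last first.
      by apply/funext => N; rewrite E.
    exact: lim_exp.
  rewrite (_ : (fun N => _) = cst 0); first exact: cvg_cst.
  by apply/funext => N; rewrite E.
rewrite expR0 !mul1r.
have -> : (0 +i* b)%C = 'i%C * b%:C%C :> C by apply: complex_ext; rewrite /=; ring.
have E N : \sum_(k < N) (k`!%:R)^-1 * (('i%C : C) * b%:C%C) ^+ k =
    (series (cos_coeff b) N +i* series (sin_coeff b) N)%C.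
  rewrite /series /= !big_mkord.
  under eq_bigr => k _ do rewrite mulrC exp_i.
  by apply: complex_ext; rewrite ?(raddf_sum (@complex.Re R)) ?(raddf_sum (@complex.Im R)).
split.
  rewrite (_ : (fun N => _) = series (cos_coeff b)); last by apply/funext => N; rewrite E.
  by rewrite unlock; exact: is_cvg_series_cos_coeff.
rewrite (_ : (fun N => _) = series (sin_coeff b)); last by apply/funext => N; rewrite E.
by rewrite unlock; exact: is_cvg_series_sin_coeff.
Qed.

End ComplexExp.

End ComplexExponential.

(** * Exponentials of torus elements *)

Module Import DiagonalExponential.

Section ExpDiag.
Variables (R : realType) (n : nat).
Hypothesis hn : (1 <= n)%N.
Notation C := R[i].
Notation I := 'I_(n.*2.+1).
Notation matC := 'M[C]_(n.*2.+1).
Notation null_mx := (null_mx R hn).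
Notation null_inv := (null_inv R hn).
Notation to_null := (@to_null R n hn).
Notation diagm := (@diagm R n).

Lemma diagmX (d : I -> C) k : diagm d ^+ k = diagm (fun a => d a ^+ k).
Proof.
elim: k => [|k IH]; first by rewrite expr0 -[1]/(1%:M) -(diagm1 R n); exact: diagm_ext.
rewrite exprS IH -[_ * _]/(_ *m _) diagmM; apply: diagm_ext => a; by rewrite exprS.
Qed.

Lemma to_nullX (X : matC) k : to_null (X ^+ k) = to_null X ^+ k.
Proof.
elim: k => [|k IH]; first by rewrite !expr0 -[1]/(1%:M) to_null1.
by rewrite !exprS -[in LHS]/(X *m _) to_nullM IH.
Qed.

Lemma exp_partial (H : matC) d N a b : to_null H = diagm d ->
  (\sum_(k < N) (k`!%:R : C)^-1 *: H ^+ k) a b =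
  \sum_c (null_mx a c * null_inv c b) * \sum_(k < N) (k`!%:R)^-1 * d c ^+ k.
Proof.
move=> E.
have -> : \sum_(k < N) (k`!%:R : C)^-1 *: H ^+ k =
    null_mx *m diagm (fun c => \sum_(k < N) (k`!%:R)^-1 * d c ^+ k) *m null_inv.
  apply/(@to_null_inj R n hn); rewrite to_nullK' to_null_sum.
  apply/matrixP => i j; rewrite summxE !mxE -sumrMnl; apply: eq_bigr => k _.
  by rewrite to_nullZ to_nullX E diagmX !mxE mulrnAr.
rewrite mxE; apply: eq_bigr => c _.
by rewrite mulr_diagm -!mulrA [null_inv c b * _]mulrC.
Qed.

Lemma cvg_sum_ord (T : finType) (u : T -> nat -> R) (l : T -> R) :
  (forall c, u c @ \oo --> l c) ->
  (fun N => \sum_c u c N) @ \oo --> \sum_c l c.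
Proof.
move=> H; elim: (index_enum T) => [|c s IH].
  rewrite big_nil (_ : (fun N => _) = cst 0); first exact: cvg_cst.
  by apply/funext => N; rewrite big_nil.
rewrite big_cons (_ : (fun N => _) = (u c) \+ (fun N => \sum_(c <- s) u c N)).
  by apply: cvgD; [exact: H|exact: IH].
by apply/funext => N; rewrite big_cons.
Qed.

(** The matrix exponential is defined entrywise by its series, whose partial
    sums are linear combinations of the scalar partial sums at the eigenvalues. *)
Lemma expmx_diag (H : matC) d : to_null H = diagm d ->
  (forall a, complex.Im (d a) = 0 \/ complex.Re (d a) = 0) ->
  to_null (expmx H) = diagm (fun a => cexp (d a)).
Proof.
move=> E dH.
suff -> : expmx H = null_mx *m diagm (fun a => cexp (d a)) *m null_inv by rewrite to_nullK'.
apply/matrixP => a b; rewrite [LHS]mxE.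
have -> : (null_mx *m diagm (fun a => cexp (d a)) *m null_inv) a b =
    \sum_c (null_mx a c * null_inv c b) * cexp (d c).
  by rewrite mxE; apply: eq_bigr => c _; rewrite mulr_diagm mulrAC.
have cR c := (lim_cexp (dH c)).1; have cI c := (lim_cexp (dH c)).2.
set P := fun c => null_mx a c * null_inv c b.
apply: complex_ext; rewrite /=.
  apply/cvg_lim => //; rewrite (raddf_sum (@complex.Re R)).
  rewrite (_ : (fun N => _) = (fun N => \sum_c (complex.Re (P c) *
    complex.Re (\sum_(k < N) (k`!%:R)^-1 * d c ^+ k) - complex.Im (P c) *
    complex.Im (\sum_(k < N) (k`!%:R)^-1 * d c ^+ k)))); last first.
    apply/funext => N; rewrite (exp_partial _ _ _ E) (raddf_sum (@complex.Re R)).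
    by apply: eq_bigr => c _; exact: complex_ReM.
  apply: cvg_sum_ord => c; rewrite [X in _ --> X](complex_ReM (P c)).
  by apply: cvgB; apply: cvgMl_tmp.
apply/cvg_lim => //; rewrite (raddf_sum (@complex.Im R)).
rewrite (_ : (fun N => _) = (fun N => \sum_c (complex.Re (P c) *
  complex.Im (\sum_(k < N) (k`!%:R)^-1 * d c ^+ k) + complex.Im (P c) *
  complex.Re (\sum_(k < N) (k`!%:R)^-1 * d c ^+ k)))); last first.
  apply/funext => N; rewrite (exp_partial _ _ _ E) (raddf_sum (@complex.Im R)).
  by apply: eq_bigr => c _; exact: complex_ImM.
apply: cvg_sum_ord => c; rewrite [X in _ --> X](complex_ImM (P c)).
by apply: cvgD; apply: cvgMl_tmp.
Qed.

End ExpDiag.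

End DiagonalExponential.

(** * The structure equations of a primitive frame *)

Module Import DbarEquations.

Section DbarEquation.
Variables (R : realType) (n : nat).
Hypothesis hn : (1 <= n)%N.
Notation C := R[i].
Notation I := 'I_(n.*2.+1).
Notation matC := 'M[C]_(n.*2.+1).
Notation matR := 'M[R]_(n.*2.+1).
Notation star := (star hn).
Notation cj := (cj hn).
Notation pk := (pk hn).
Notation qk := (qk hn).
Notation null_mx := (null_mx R hn).
Notation to_null := (@to_null R n hn).
Notation null_pair := (@null_pair R n).
Notation gr := (@gr n).
Notation grade1 := (@grade1 n).
Notation degree01 := (@degree01 R n).
Notation null_form := (null_form hn).
Notation root_coef := (root_coef hn).
Notation dCm := (mx_der (@dC R)).
Notation dbm := (mx_der (@dbC R)).

Variables (F : R * R -> matR).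
Hypothesis sF : smooth_mx F.
Hypothesis oF : forall z, SO1 (F z).
Hypothesis pF : forall z, degree01 (null_form F z).

(** F^-1 F_zbar, in the null basis. *)
Definition null_form_conj z : matC := to_null (conj_cmx (MC F z)).

Lemma null_form_conjE z a b : null_form_conj z a b = ((null_form F z (cj a) (cj b))^*)%C.
Proof. exact: to_null_conj. Qed.

Lemma sMC : smooth_cmat (MC F). Proof. exact: smooth_cmat_MC. Qed.

Lemma to_nullDM (P Q S : matC) : to_null (P + Q *m S) = to_null P + to_null Q *m to_null S.
Proof. by rewrite to_nullD to_nullM. Qed.

Lemma flatness_null z : dbm (null_form F) z + null_form_conj z *m null_form F z = dCm null_form_conj z + null_form F z *m null_form_conj z.
Proof.
have E1 := mx_der_to_null hn z (derivation_dbC R) sMC.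
have E2 := mx_der_to_null hn z (derivation_dC R) (smooth_cmat_conj sMC).
have E := congr1 to_null (flatness sF oF z).
have L (P P' Q S : matC) : P' = to_null P -> P' + to_null Q *m to_null S = to_null (P + Q *m S).
  by move=> ->; rewrite to_nullDM.
exact: (etrans (L _ _ _ _ E1) (etrans E (esym (L _ _ _ _ E2)))).
Qed.

Local Opaque MC FrameForms.null_form null_form_conj.

Lemma flatness_nullE z a b : dbC (fun z => null_form F z a b) z + \sum_c null_form_conj z a c * null_form F z c b =
  dC (fun z => null_form_conj z a b) z + \sum_c null_form F z a c * null_form_conj z c b.
Proof.
have L D (G : R * R -> matC) (Q S : matC) : (mx_der D G z + Q *m S) a b =
    D (fun w => G w a b) z + \sum_c Q a c * S c b.
  by rewrite [LHS]mxE [X in X + _]mxE [X in _ + X]mxE.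
have E := congr1 (fun M : matC => M a b) (flatness_null z).
exact: (etrans (esym (L (@dbC R) (null_form F) (null_form_conj z) (null_form F z)))
  (etrans E (L (@dC R) null_form_conj (null_form F z) (null_form_conj z)))).
Qed.

Lemma null_form_same z a b : gr a = gr b -> a != b -> null_form F z a b = 0.
Proof.
move=> gab ab; case: (gr_eq hn gab) => E; first by rewrite E eqxx in ab.
by rewrite E; apply: antisymS_diag; exact: antisym_null_form.
Qed.

Lemma null_form_off z a b : null_form F z a b != 0 -> a = b \/ grade1 a b.
Proof.
move=> H; case: (null_form_support pF H) => [gab|]; last by right.
by left; apply/eqP; apply: contraNT H => ab; rewrite null_form_same.
Qed.

Lemma null_form_conj_off z a b : null_form_conj z a b != 0 -> a = b \/ grade1 b a.
Proof.
rewrite null_form_conjE conjc_eq0 => /null_form_off[/(inv_inj (cjK hn))|H]; first by left.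
by right; rewrite -(grade1_star hn) /RootIndices.grade1 -!gr_cj; exact: H.
Qed.

(** The conjugate form has degrees 0 and -1. For n at least 2 these differ from
    1 modulo 2n, so the degree 1 part of the flatness equation only involves
    the torus part of the conjugate form. *)
Lemma dbar_null_form_flat z a b : (2 <= n)%N -> grade1 a b ->
  dbC (fun z => null_form F z a b) z = (null_form_conj z b b - null_form_conj z a a) * null_form F z a b.
Proof.
move=> n2 ab; have E := flatness_nullE z a b.
have la := gr_max hn a; have lb := gr_max hn b.
have Bc0 y : null_form_conj y a b = 0.
  apply/eqP; apply: contraTT ab => /null_form_conj_off[->|];
    rewrite /RootIndices.grade1 /nextg; last by move: la lb; ilia.
  by apply/negP => /eqP; move: lb; ilia.
rewrite (dC0 _ Bc0) add0r in E.
rewrite (bigD1 a)//= [X in _ + (_ + X)]big1 ?addr0 in E; last first.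
  move=> c ca; apply/eqP; rewrite mulf_eq0; apply: contraTT ab.
  rewrite negb_or => /andP[/null_form_conj_off[ac|H1] /null_form_off H2]; first by rewrite ac eqxx in ca.
  have lc := gr_max hn c; move: H1 H2; rewrite /RootIndices.grade1 /nextg => /eqP H1.
  by case=> [H2|/eqP H2]; [rewrite -?H2 in la lb *|];
    apply/negP => /eqP; move: H1; rewrite ?H2; move: la lb lc H2; ilia.
rewrite [X in _ = X](bigD1 b)//= [X in _ = _ + X]big1 ?addr0 in E; last first.
  move=> c cb; apply/eqP; rewrite mulf_eq0; apply: contraTT ab.
  rewrite negb_or => /andP[/null_form_off H2 /null_form_conj_off[ac|H1]]; first by rewrite ac eqxx in cb.
  have lc := gr_max hn c; move: H1 H2; rewrite /RootIndices.grade1 /nextg => /eqP H1.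
  by case=> [H2|/eqP H2]; [rewrite ?H2 in la lb *|];
    apply/negP => /eqP; move: H1; rewrite ?H2; move: la lb lc H2; ilia.
by rewrite mulrBl [null_form_conj z b b * _]mulrC -E addrK.
Qed.

(** For n = 1 the degrees 1 and -1 agree modulo 2 and flatness says less.
    Harmonicity fills the gap: F^-1 of the mixed second derivative of f is a
    multiple of e_1, and its other coordinates give the same equation. *)
Lemma dbar_null_form_harmonic f z a : n = 1%N -> harmonic_map f ->
  (forall z, F z *m @e1 R n = f z) -> a != ord0 ->
  dbC (fun z => null_form F z a ord0) z = (null_form_conj z ord0 ord0 - null_form_conj z a a) * null_form F z a ord0.
Proof.
move=> n1 [_ _ hf] Ff a0.
have z0 y : null_form F y ord0 ord0 = 0.
  by rewrite -{1}(star0 hn); apply: antisymS_diag; exact: antisym_null_form.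
have [l Hl] := hf z.
have sf := smooth_f sF Ff; have sG := smooth_cmat_cmx sF.
have S := mx_der_swap z sf.
have E0 y : zeta hn F f 1 y = null_form F y *m basis_vec R ord0.
  rewrite (zetaS hn sF oF Ff) (zeta0 hn oF Ff).
  have -> : zeta hn F f 0 = cst (basis_vec R ord0) by apply/funext => x; exact: zeta0.
  by rewrite (mx_der_cst (derivation_dC R)) addr0.
have E1 : dCm (cplx f) = (fun y => cmx (F y) *m (null_mx *m (null_form F y *m basis_vec R ord0))).
  by apply/funext => y; rewrite -E0 mulmxA; exact: (dzn_zeta hn f oF 1 y).
have sB : smooth_cmat (fun y => null_form F y *m basis_vec R ord0) := smooth_cmat_mul (smooth_cmat_null_form hn sF oF) (smooth_cmat_cst _).
have L := mx_der_mul (derivation_dbC R) z sG (smooth_cmat_mul (smooth_cmat_cst null_mx) sB).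
rewrite (mx_der_mull (derivation_dbC R) null_mx z sB) (dzbar_frame sF oF z) in L.
rewrite (mx_der_mulr (derivation_dbC R) (basis_vec R ord0) z (smooth_cmat_null_form hn sF oF)) in L.
have Z := zeta_alg hn (conj_cmx (MC F z)) (null_form F z *m basis_vec R ord0)
  (dbm (null_form F) z *m basis_vec R ord0) (SO1_cmx (oF z)).
rewrite -L -E1 S -[dCm _ _]/(dz (dzbar (cplx f)) z) Hl in Z.
have Z0 := zeta0 hn oF Ff z; rewrite /zeta /dzn /= in Z0.
rewrite -scalemxAr Z0 in Z.
have ev_col (A : matC) b : (A *m basis_vec R ord0) b ord0 = A b ord0 by rewrite -colE mxE.
have EZ : 0 = \sum_c null_form_conj z a c * null_form F z c ord0 + dbC (fun y => null_form F y a ord0) z.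
  have L2 (Q P : matC) (G : R * R -> matC) :
      (Q *m (P *m basis_vec R ord0) + mx_der (@dbC R) G z *m basis_vec R ord0) a ord0 =
      \sum_c Q a c * P c ord0 + dbC (fun y => G y a ord0) z.
    rewrite [LHS]mxE ev_col [X in _ + X]mxE; congr (_ + _); rewrite mxE.
    by apply: eq_bigr => c _; rewrite ev_col.
  have L0 : (l *: basis_vec R ord0) a ord0 = 0 by rewrite mxE basis_vecE (negbTE a0) mulr0.
  have E := congr1 (fun M : 'cV[C]_(n.*2.+1) => M a ord0) Z.
  exact: (etrans (esym L0) (etrans E (L2 (null_form_conj z) (null_form F z) (null_form F)))).
have S0 : \sum_c null_form_conj z a c * null_form F z c ord0 = null_form_conj z a a * null_form F z a ord0.
  rewrite (bigD1 a)//= big1 ?addr0//.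
  move=> c ca.
  have [->|c0] := eqVneq c ord0; first by rewrite z0 mulr0.
  have top (x : I) : x != ord0 -> gr x = n.
    by rewrite -val_eqE /= /RootIndices.gr /grn; move: (ltn_ord x) n1; ilia.
  have -> : null_form_conj z a c = 0 by rewrite null_form_conjE !(cj_top hn) ?top// null_form_same ?conjc0 ?top// eq_sym.
  by rewrite mul0r.
have c0 : null_form_conj z ord0 ord0 = 0.
  have -> : null_form_conj z ord0 ord0 = ((null_form F z ord0 ord0)^*)%C.
    by rewrite null_form_conjE; congr ((null_form F z _ _)^*)%C; apply: val_inj; apply/eqP; exact: cj_eq0.
  by rewrite z0 conjc0.
have alg (x y w : C) : 0 = x * y + w -> w = (0 - x) * y.
  by move=> E; have -> : w = (x * y + w) - x * y by [ring]; rewrite -E; ring.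
exact: (etrans (alg _ _ _ (etrans EZ (congr1 (+%R^~ _) S0))) (congr1 (fun x => (x - null_form_conj z a a) * null_form F z a ord0) (esym c0))).
Qed.

Notation low_idx := (low_idx n).
Definition torus_coef (j : nat) z : C := null_form F z (low_idx j) (low_idx j).

Lemma null_form_star z a : null_form F z (star a) (star a) = - null_form F z a a.
Proof.
have E := antisymS_E (star a) a (antisym_null_form hn sF oF z).
by apply: (mulfI (null_pair_neq0 R a)); rewrite E starK null_pair_star mulrN.
Qed.

Lemma null_form_conj_low z j : (j < n)%N -> null_form_conj z (low_idx j) (low_idx j) = - ((torus_coef j z)^*)%C.
Proof. by move=> jn; rewrite null_form_conjE (cj_low hn) ?null_form_star ?conjN// (gr_low_idx hn); lia. Qed.

Lemma null_form_conj_top z : null_form_conj z (low_idx n) (low_idx n) = ((torus_coef n z)^*)%C /\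
  null_form_conj z (star (low_idx n)) (star (low_idx n)) = - ((torus_coef n z)^*)%C.
Proof.
have gn := gr_low_idx hn (leqnn n); rewrite !null_form_conjE !(cj_top hn) ?null_form_star ?conjN//.
by rewrite gr_star gn; ilia.
Qed.

Lemma torus_coef0 z : torus_coef 0 z = 0.
Proof.
rewrite /torus_coef low_idx0// -{1}(star0 hn); apply: antisymS_diag; exact: antisym_null_form.
Qed.

(** The two root vectors leading to the real null vectors of degree n. For n =
    1 they are R_1 and R_0, otherwise R_0 and R_n. *)
Definition top : 'I_n.+1 := inord (if n == 1%N then 1 else 0)%N.
Definition bot : 'I_n.+1 := inord (if n == 1%N then 0 else n)%N.

Lemma pk_top : pk top = low_idx n /\ pk bot = star (low_idx n).
Proof.
have vt : top = (if n == 1%N then 1 else 0)%N :> nat by rewrite inordK//; case: eqP; lia.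
have vb : bot = (if n == 1%N then 0 else n)%N :> nat by rewrite inordK//; case: eqP; lia.
have vj := val_low_idx hn (leqnn n).
split; apply: val_inj; rewrite /= ?vt ?vb ?vj /pn /starn; case: eqP => [->|]; ilia.
Qed.

Hypothesis hF : n = 1%N -> exists2 f, harmonic_map f & forall z, F z *m @e1 R n = f z.

Lemma dbar_null_form k z : dbC (fun z => null_form F z (pk k) (star (qk k))) z =
  (null_form_conj z (star (qk k)) (star (qk k)) - null_form_conj z (pk k) (pk k)) * null_form F z (pk k) (star (qk k)).
Proof.
have [n1|n1] := eqVneq n 1%N; last by apply: dbar_null_form_flat; [lia|exact: grade1_pk].
have [f hf Ff] := hF n1.
have q0 : star (qk k) = ord0.
  by apply: val_inj; rewrite /= /starn /qn; move: n1 (ltn_ord k); ilia.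
by rewrite q0; apply: (dbar_null_form_harmonic _ n1 hf Ff); rewrite -val_eqE (pk_neq0 hn).
Qed.

Lemma dbar_root_coef k z : dbC (root_coef F k) z =
  (null_form_conj z (star (qk k)) (star (qk k)) - null_form_conj z (pk k) (pk k)) * root_coef F k z.
Proof.
have sB : smoothC (fun z => null_form F z (pk k) (star (qk k))) by exact: smooth_cmat_null_form.
have E := dbCM z sB (smoothC_cst (null_pair (qk k))^-1).
have alg (d b w d' X : C) : d = X * b -> d' = 0 -> d * w + b * d' = X * (b * w).
  by move=> -> ->; ring.
exact: (etrans E (alg _ _ _ _ _ (dbar_null_form k z) (dbC_cst _ z))).
Qed.

End DbarEquation.

End DbarEquations.

(** * Ratios of root coefficients as characters *)

Module Import GaugeFunctions.

Section TodaFrame.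
Variables (R : realType) (n : nat).
Hypothesis hn : (1 <= n)%N.
Notation C := R[i].
Notation I := 'I_(n.*2.+1).
Notation matR := 'M[R]_(n.*2.+1).
Notation star := (star hn).
Notation pk := (pk hn).
Notation qk := (qk hn).
Notation null_inv := (null_inv R hn).
Notation null_gram := (null_gram R hn).
Notation to_null := (@to_null R n hn).
Notation Ups := (ups C n.*2).
Notation low_idx := (low_idx n).
Notation diagm := (@diagm R n).
Notation torus_wt := (@torus_wt R n).
Notation lie_wt := (@lie_wt R n).
Notation root_sum := (@root_sum R n hn).
Notation degree01 := (@degree01 R n).
Notation null_form := (null_form hn).
Notation root_coef := (root_coef hn).
Notation torus_coef := (torus_coef hn).
Notation top := (top n).
Notation bot := (bot n).

Lemma torus_wt_cexp (y : nat -> C) a : torus_wt (fun k => cexp (y k)) a = cexp (lie_wt y a).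
Proof.
rewrite /Torus.torus_wt /RootVectors.lie_wt; case: ifP => _; first by rewrite cexp0.
by case: ifP => _ //; rewrite cexpN.
Qed.

Lemma torus_SO1 (t : matR) : torus t -> SO1 t.
Proof.
move=> /(torusP hn)[s [s0 s1 s2] E].
have g0 a : torus_wt s a != 0.
  rewrite /Torus.torus_wt; case: (a =P ord0) => [_|/eqP]; first exact: oner_neq0.
  rewrite -val_eqE /= => a0.
  have ka : (1 <= uphalf a <= n)%N by have := ltn_ord a; lia.
  by case: ifP => _; rewrite ?invr_eq0 s0.
split.
  have VS : null_inv^T *m null_gram *m null_inv = Ups.
    by rewrite -gram_null_mx -!mulmxA null_mxK mulmx1 !mulmxA -trmx_mul null_mxK trmx1 mul1mx.
  have D : (to_null (cmx t))^T *m null_gram *m to_null (cmx t) = null_gram.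
    rewrite E; apply/matrixP => a b; rewrite mulr_diagm.
    have -> : (diagm (torus_wt s))^T = diagm (torus_wt s).
      by apply/matrixP => x y; rewrite !mxE eq_sym; case: (x =P y) => [->|].
    rewrite mul_diagm mxE; case: (b =P star a) => [->|_]; last by rewrite mulr0n mulr0 mul0r.
    by rewrite torus_wt_star mulrAC mulfV// mul1r.
  have H : null_inv *m cmx t = to_null (cmx t) *m null_inv by rewrite /NullBasis.to_null -!mulmxA null_mxK mulmx1.
  have := congruence_conj VS D H; rewrite cmx_tr -cmx_ups -!cmxM.
  exact: cmx_inj.
have : \det (to_null (cmx t)) = 1 by rewrite E det_diagm prod_torus_wt.
rewrite det_to_null; have -> : \det (cmx t) = (\det t)%:C%C by exact: det_map_mx.
by case.
Qed.

Lemma SO1_mul (g t : matR) : SO1 g -> SO1 t -> SO1 (g *m t).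
Proof.
move=> [g1 g2] [t1 t2]; split; last by rewrite det_mulmx g2 t2 mulr1.
have -> : (g *m t)^T *m ups R n.*2 *m (g *m t) = t^T *m (g^T *m ups R n.*2 *m g) *m t.
  by rewrite trmx_mul !mulmxA.
by rewrite g1.
Qed.

Lemma smooth_cmat_real (G : R * R -> matR) : smooth_cmat (fun z => cmx (G z)) -> smooth_mx G.
Proof.
by move=> sG a b; have := (sG a b).1; apply: smooth_ext => z; rewrite !mxE.
Qed.

Lemma smooth_cmat_diagm (d : R * R -> I -> C) : (forall a, smoothC (fun z => d z a)) ->
  smooth_cmat (fun z => diagm (d z)).
Proof.
move=> sd; apply: (smooth_cmat_intro (e := fun a b z => d z a *+ (a == b))).
  by move=> a b z; rewrite mxE.
move=> a b; case: (a == b); first exact: sd.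
exact: smoothC_cst.
Qed.

Lemma smooth_lie_wt (y : nat -> R * R -> C) a : (forall k, smoothC (y k)) ->
  smoothC (fun z => lie_wt (y ^~ z) a).
Proof.
move=> sy; rewrite /RootVectors.lie_wt; case: (a == ord0); first exact: smoothC_cst.
by case: (odd a); [exact: sy|exact: smoothCN].
Qed.

Lemma dC_lie_wt (y : nat -> R * R -> C) a z : (forall k, smoothC (y k)) ->
  dC (fun z => lie_wt (y ^~ z) a) z = lie_wt (fun k => dC (y k) z) a.
Proof.
move=> sy; rewrite /RootVectors.lie_wt; case: (a == ord0); first exact: dC_cst.
by case: (odd a); [|exact: (derN (derivation_dC R))].
Qed.

Lemma torus_wt_low_idx (s : nat -> C) j : s 0%N = 1 -> (j <= n)%N -> torus_wt s (low_idx j) = s j.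
Proof.
move=> s0 jn; have vj := val_low_idx hn jn; rewrite /Torus.torus_wt -val_eqE /= vj.
have [->|j0] := eqVneq j 0%N; first by rewrite eqxx s0.
rewrite ifF; last by lia.
by rewrite ifT; [congr s|]; lia.
Qed.

(** Conjugation by a diagonal matrix multiplies the coefficient of R_k by a
    ratio of characters, and the two entries of R_k give the same ratio since
    paired characters are inverse to each other. *)
Lemma root_sum_gauge (c r : 'I_n.+1 -> C) (K : I -> C) :
  (forall a, K (star a) = (K a)^-1) -> (forall a, K a != 0) ->
  (forall k, c k * K (star (qk k)) = K (pk k) * r k) ->
  root_sum c *m diagm K = diagm K *m root_sum r.
Proof.
move=> Ks K0 rel; apply/matrixP => a b; rewrite mulr_diagm mul_diagm !root_sumE mulr_suml mulr_sumr.
apply: eq_bigr => k _; rewrite !mulrBr mulrBl; congr (_ - _).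
  case: andP => [[/eqP -> /eqP E]|_]; last by rewrite !mulr0n !mulr0 mul0r.
  by rewrite !mulr1n (canRL (starK hn) E) mulrAC rel mulrA.
case: andP => [[/eqP -> /eqP E]|_]; last by rewrite !mulr0n !mulr0 mul0r.
rewrite !mulr1n (canRL (starK hn) E) mulrAC mulrA; congr (_ * _).
have := rel k; rewrite Ks => H.
rewrite Ks; apply: (mulfI (K0 (pk k))); apply: (mulIf (K0 (qk k))).
have ck : c k = K (pk k) * r k * K (qk k) by rewrite -H mulfVK.
by rewrite ck; field; exact: K0.
Qed.

Section Gauge.
Variables (F : R * R -> matR) (rho : 'I_n.+1 -> C).
Hypothesis sF : smooth_mx F.
Hypothesis oF : forall z, SO1 (F z).
Hypothesis pF : forall z, degree01 (null_form F z).
Hypothesis hF : n = 1%N -> exists2 f, harmonic_map f & forall z, F z *m @e1 R n = f z.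
Hypothesis rho0 : forall k, rho k != 0.
Hypothesis norm : forall z, root_product (fun k => root_coef F k z) = root_product rho.

(** The factor by which R_k has to be rescaled. *)
Definition root_ratio k z : C := root_coef F k z / rho k.
Definition ratio_prod j z : C := \prod_(0 <= i < j) root_ratio (inord i.+1) z.

(** The characters that absorb the ratios: R_1, ..., R_(n-1) determine the
    first n - 1 of them successively, and one of the two remaining root vectors
    the last. *)
Definition gauge_char j z : C := if j == n then root_ratio top z * ratio_prod n.-1 z else ratio_prod j z.

Lemma root_coef_neq0 k z : root_coef F k z != 0.
Proof.
have H : root_product (fun k => root_coef F k z) != 0 by rewrite norm; apply/root_product_neq0.
exact: (root_product_neq0 _).1 H k.
Qed.

Lemma root_ratio_neq0 k z : root_ratio k z != 0.
Proof. by rewrite mulf_neq0 ?invr_eq0 ?root_coef_neq0. Qed.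

Lemma smooth_root_ratio k : smoothC (root_ratio k).
Proof. exact: (smoothCM (smooth_root_coef hn sF oF k) (smoothC_cst (rho k)^-1)). Qed.

Lemma smooth_ratio_prod j : smoothC (ratio_prod j).
Proof. by apply: smoothC_prod => i; exact: smooth_root_ratio. Qed.

Lemma ratio_prod_neq0 j z : ratio_prod j z != 0.
Proof.
rewrite /ratio_prod; elim: j => [|j IH]; first by rewrite big_nil oner_eq0.
by rewrite big_nat_recr//= mulf_neq0 ?root_ratio_neq0.
Qed.

Lemma smooth_gauge_char j : smoothC (gauge_char j).
Proof.
rewrite /gauge_char; case: (j == n); last exact: smooth_ratio_prod.
exact: (smoothCM (smooth_root_ratio top) (smooth_ratio_prod n.-1)).
Qed.

Lemma gauge_char_neq0 j z : gauge_char j z != 0.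
Proof.
rewrite /gauge_char; case: (j == n); last exact: ratio_prod_neq0.
by apply: mulf_neq0; [exact: root_ratio_neq0|exact: ratio_prod_neq0].
Qed.

Lemma root_product_root_ratio z : root_ratio top z * root_ratio bot z * ratio_prod n.-1 z ^+ 2 = 1.
Proof.
have E : root_product (fun k => root_ratio k z) = 1.
  rewrite /root_ratio root_productM norm -root_productM.
  rewrite /root_product big1// => k _.
  by rewrite mulfV// expr1n.
have E2 := root_product_split hn (fun k : nat => root_ratio (inord k) z).
rewrite -[RHS]E (_ : (fun k => root_ratio k z) = (fun k : 'I_n.+1 => root_ratio (inord k) z)); last first.
  by apply/funext => k; rewrite inord_val.
rewrite E2 /top /bot; congr (_ * _); case: (n =P 1%N) => [n1|_] //.
by rewrite mulrC; congr (_ * root_ratio (inord _) z); rewrite n1.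
Qed.

(** The relation for the one root vector not used in the definition of the
    characters: it holds because the root products agree. *)
Lemma root_ratio_bot z : root_ratio bot z * ratio_prod n.-1 z = (gauge_char n z)^-1.
Proof.
rewrite /gauge_char eqxx; apply: (mulfI (mulf_neq0 (root_ratio_neq0 top z) (ratio_prod_neq0 n.-1 z))).
rewrite mulfV; last by apply: mulf_neq0; [exact: root_ratio_neq0|exact: ratio_prod_neq0].
rewrite -(root_product_root_ratio z); ring.
Qed.

Local Opaque MC FrameForms.null_form null_form_conj.

Lemma dbar_root_ratio k z : dbC (root_ratio k) z =
  (null_form_conj hn F z (star (qk k)) (star (qk k)) - null_form_conj hn F z (pk k) (pk k)) * root_ratio k z.
Proof.
have E := dbCM z (smooth_root_coef hn sF oF k) (smoothC_cst (rho k)^-1).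
have alg (d b w d' X : C) : d = X * b -> d' = 0 -> d * w + b * d' = X * (b * w).
  by move=> -> ->; ring.
exact: (etrans E (alg _ _ _ _ _ (dbar_root_coef sF oF pF hF k z) (dbC_cst _ z))).
Qed.

Lemma prod_log_deriv (g h : R * R -> C) z (x y : C) : smoothC g -> smoothC h ->
  dbC g z = x * g z -> dbC h z = y * h z ->
  dbC (fun z => g z * h z) z = (x + y) * (g z * h z).
Proof.
move=> sg sh E1 E2; have E := dbCM z sg sh.
have alg (d b w d' : C) : d = x * b -> d' = y * w -> d * w + b * d' = (x + y) * (b * w).
  by move=> -> ->; ring.
exact: (etrans E (alg _ _ _ _ E1 E2)).
Qed.

(** The logarithmic derivatives of the successive ratios telescope. *)
Lemma dbar_ratio_prod j z : (j < n)%N -> dbC (ratio_prod j) z = ((torus_coef F j z)^*)%C * ratio_prod j z.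
Proof.
elim: j => [|j IH] jn.
  have -> : ratio_prod 0 = cst 1 by apply/funext => y; rewrite /ratio_prod big_nil.
  by rewrite dbC_cst (torus_coef0 hn sF oF) conjc0 mul0r.
have EP : ratio_prod j.+1 = (fun z => ratio_prod j z * root_ratio (inord j.+1) z).
  by apply/funext => y; rewrite /ratio_prod big_nat_recr.
have [pE qE] : pk (inord j.+1) = low_idx j.+1 /\ star (qk (inord j.+1)) = low_idx j.
  by have [] := @pk_low_idx n hn j.+1; [lia|].
have Eu := dbar_root_ratio (inord j.+1) z.
rewrite qE pE (null_form_conj_low hn sF oF z (ltnW jn)) (null_form_conj_low hn sF oF z jn) in Eu.
have H := prod_log_deriv (smooth_ratio_prod j) (smooth_root_ratio (inord j.+1)) (IH (ltnW jn)) Eu.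
have -> : ((torus_coef F j.+1 z)^*)%C = ((torus_coef F j z)^*)%C + (- ((torus_coef F j z)^*)%C - - ((torus_coef F j.+1 z)^*)%C).
  by ring.
by rewrite EP; exact: H.
Qed.

Lemma qk_top_idx : star (qk top) = low_idx n.-1 /\ star (qk bot) = low_idx n.-1.
Proof.
by split; apply: qk_top; case: (n =P 1%N) => [->|_]; rewrite ?eqxx ?orbT.
Qed.

(** Here the sign is reversed: the last null vectors are real, so conjugation
    fixes them instead of exchanging them with their partners. *)
Lemma dbar_gauge_char_top z : dbC (gauge_char n) z = - ((torus_coef F n z)^*)%C * gauge_char n z.
Proof.
have ES : gauge_char n = (fun z => root_ratio top z * ratio_prod n.-1 z).
  by apply/funext => y; rewrite /gauge_char eqxx.
have Eu := dbar_root_ratio top z.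
have nn : (n.-1 < n)%N by lia.
rewrite qk_top_idx.1 (pk_top hn).1 (null_form_conj_low hn sF oF z nn) (null_form_conj_top hn sF oF z).1 in Eu.
have H := prod_log_deriv (smooth_root_ratio top) (smooth_ratio_prod n.-1) Eu (dbar_ratio_prod z nn).
have -> : - ((torus_coef F n z)^*)%C =
    (- ((torus_coef F n.-1 z)^*)%C - ((torus_coef F n z)^*)%C) + ((torus_coef F n.-1 z)^*)%C by ring.
by rewrite ES; exact: H.
Qed.

Lemma log_deriv (l : R * R -> C) (g : R * R -> C) z (x : C) : smoothC l ->
  (forall z, g z = cexp (l z)) -> dbC g z = x * g z -> dbC l z = x.
Proof.
move=> sl E Eg; have := dbC_cexp z sl.
have <- : g = (fun z => cexp (l z)) by exact/funext.
by rewrite Eg E => /(mulIf (cexp_neq0 _)).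
Qed.

Lemma gauge_logs : exists l : nat -> R * R -> C, [/\ forall j, smoothC (l j),
  forall j z, gauge_char j z = cexp (l j z),
  forall j z, (1 <= j < n)%N -> dbC (l j) z = ((torus_coef F j z)^*)%C &
  forall z, dbC (l n) z = - ((torus_coef F n z)^*)%C].
Proof.
have ex j : exists l, smoothC l /\ forall z, gauge_char j z = cexp (l z).
  by have [l sl El] := smooth_log (smooth_gauge_char j) (gauge_char_neq0 j); exists l.
have [l Hl] := choice ex; exists l; split.
- by move=> j; case: (Hl j).
- by move=> j; case: (Hl j).
- move=> j z jn; have [sl El] := Hl j; apply: (log_deriv sl El).
  have -> : gauge_char j = ratio_prod j by apply/funext => y; rewrite /gauge_char ifF//; lia.
  by apply: dbar_ratio_prod; lia.
by move=> z; have [sl El] := Hl n; exact: (log_deriv sl El (dbar_gauge_char_top z)).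
Qed.

(** The components of the logarithm in i t and in t. On the compact blocks the
    elements of t have imaginary weights and those of i t real ones; on the
    SO(1,1) block it is the other way round. *)
Definition omega (l : nat -> R * R -> C) k z : C :=
  if k == n then 'i%C * (complex.Im (l k z))%:C%C else (complex.Re (l k z))%:C%C.
Definition gamma (l : nat -> R * R -> C) k z : C :=
  if k == n then (complex.Re (l k z))%:C%C else 'i%C * (complex.Im (l k z))%:C%C.

Lemma omegaD l k z : omega l k z + gamma l k z = l k z.
Proof.
rewrite /omega /gamma; case: (l k z) => a b.
by case: ifP => _; apply: complex_ext => /=; ring.
Qed.

(** Up to sign this is the conjugation of the complexified Lie algebra with
    respect to t; the different signs on the two kinds of blocks are those of
    the dbar equations. *)
Lemma omegaJ l k z : omega l k z - gamma l k z =
  if k == n then - ((l k z)^*)%C else ((l k z)^*)%C.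
Proof.
rewrite /omega /gamma; case: (l k z) => a b.
by case: ifP => _; apply: complex_ext => /=; ring.
Qed.

Lemma smooth_omega l k : smoothC (l k) -> smoothC (omega l k) /\ smoothC (gamma l k).
Proof.
move=> [s1 s2]; rewrite /omega /gamma; case: (k == n); split;
  try exact: smoothC_real; exact: (smoothCM (smoothC_cst 'i%C) (smoothC_real s2)).
Qed.

End Gauge.

End TodaFrame.

End GaugeFunctions.

(** * Existence of Toda frames *)

Module Import TodaFrames.

Section TodaFrame.
Variables (R : realType) (n : nat).
Hypothesis hn : (1 <= n)%N.
Notation C := R[i].
Notation I := 'I_(n.*2.+1).
Notation matC := 'M[C]_(n.*2.+1).
Notation matR := 'M[R]_(n.*2.+1).
Notation star := (star hn).
Notation pk := (pk hn).
Notation qk := (qk hn).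
Notation null_mx := (null_mx R hn).
Notation null_inv := (null_inv R hn).
Notation to_null := (@to_null R n hn).
Notation low_idx := (low_idx n).
Notation diagm := (@diagm R n).
Notation torus_wt := (@torus_wt R n).
Notation lie_wt := (@lie_wt R n).
Notation root_sum := (@root_sum R n hn).
Notation degree01 := (@degree01 R n).
Notation null_form := (null_form hn).
Notation root_coef := (root_coef hn).
Notation torus_coef := (torus_coef hn).
Notation top := (top n).
Notation bot := (bot n).
Notation dCm := (mx_der (@dC R)).
Notation coset := (@Defs.coset R n).

Section Gauge.
Variables (F : R * R -> matR) (rho : 'I_n.+1 -> C) (W : matC).
Hypothesis sF : smooth_mx F.
Hypothesis oF : forall z, SO1 (F z).
Hypothesis pF : forall z, degree01 (null_form F z).
Hypothesis hF : n = 1%N -> exists2 f, harmonic_map f & forall z, F z *m @e1 R n = f z.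
Hypothesis rho0 : forall k, rho k != 0.
Hypothesis norm : forall z, root_product (fun k => root_coef F k z) = root_product rho.
Hypothesis WE : to_null W = root_sum rho.

Notation gauge_char := (gauge_char hn F rho).
Notation root_ratio := (root_ratio hn F rho).
Notation ratio_prod := (ratio_prod hn F rho).

Lemma gauge_char0 z : gauge_char 0 z = 1.
Proof. by rewrite /GaugeFunctions.gauge_char ifF; [rewrite /GaugeFunctions.ratio_prod big_nil|move: hn; lia]. Qed.

Lemma root_gauge z k :
  root_coef F k z * torus_wt (gauge_char ^~ z) (star (qk k)) = torus_wt (gauge_char ^~ z) (pk k) * rho k.
Proof.
have uE : root_coef F k z = root_ratio k z * rho k by rewrite /GaugeFunctions.root_ratio mulfVK.
rewrite uE mulrAC; congr (_ * _).
have [tp tq] := qk_top_idx hn; have [pt pb] := pk_top hn.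
have s0 : gauge_char 0%N z = 1 := gauge_char0 z.
have Sn1 : torus_wt (gauge_char ^~ z) (low_idx n.-1) = ratio_prod n.-1 z.
  rewrite (torus_wt_low_idx hn s0); last by lia.
  by rewrite /GaugeFunctions.gauge_char ifF//; move: hn; lia.
have [kn|kn] := boolP (1 <= k < n)%N.
  have [] := pk_low_idx hn kn; rewrite inord_val => -> ->.
  rewrite !(torus_wt_low_idx hn s0); try lia.
  rewrite /GaugeFunctions.gauge_char !ifF; try lia.
  have -> : root_ratio k z = root_ratio (inord k) z by rewrite inord_val.
  rewrite mulrC /GaugeFunctions.ratio_prod; case: (nat_of_ord k) kn => [//|j] _.
  by rewrite big_nat_recr.
have [->|->] : k = top \/ k = bot.
  have vt : top = (if n == 1%N then 1 else 0)%N :> nat by rewrite inordK//; case: eqP; lia.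
  have vb : bot = (if n == 1%N then 0 else n)%N :> nat by rewrite inordK//; case: eqP; lia.
  have : (k = top :> nat) \/ (k = bot :> nat).
    by rewrite vt vb; move: (ltn_ord k) kn; ilia.
  by case=> /val_inj ->; [left|right].
  by rewrite tp pt Sn1 (torus_wt_low_idx hn s0)// /GaugeFunctions.gauge_char eqxx.
rewrite tq pb Sn1 torus_wt_star (torus_wt_low_idx hn s0)//; exact: root_ratio_bot.
Qed.

Lemma null_form_torus z : exists h, null_form F z = diagm (lie_wt h) + root_sum (fun k => root_coef F k z) /\
  forall a, lie_wt h a = lie_wt (fun k => torus_coef F k z) a.
Proof.
have [h E] := root_coefs_decomp hn z (degree01_root_coefs sF oF pF).
exists h; split => // a; rewrite /RootVectors.lie_wt.
case: (a =P ord0) => // /eqP a0.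
have ka : (1 <= uphalf a <= n)%N by move: a0 (ltn_ord a); rewrite -val_eqE /=; lia.
suff -> : torus_coef F (uphalf a) z = h (uphalf a) by [].
have k0 : low_idx (uphalf a) == ord0 = false.
  by apply/negbTE; rewrite -val_eqE /= (val_low_idx hn); lia.
have L (P Q : matC) b : (P + Q) b b = P b b + Q b b by rewrite mxE.
rewrite /DbarEquations.torus_coef E L root_sum_0; last first.
  by rewrite /RootIndices.grade1 /nextg; have := gr_max hn (low_idx (uphalf a)); ilia.
rewrite mxE eqxx mulr1n addr0 /RootVectors.lie_wt k0 val_low_idx//; last by lia.
by rewrite ifT; [congr h|]; lia.
Qed.

Local Opaque MC FrameForms.null_form null_form_conj.

(** Here g is the change of frame and E the exponential of Omega. The root part
    of the form is conjugated to W by the product E g, so conjugating it back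
    by g leaves Ad(E) W; the torus part is shifted by the logarithmic
    derivative of g. *)
Lemma gauge_alg (g E e : I -> C) (B B' Wu dD dG H rc : matC) :
  (forall a, g a != 0) -> (forall a, E a * e a = 1) ->
  diagm g *m B' = B *m diagm g + dG -> B = H + rc ->
  rc *m diagm (fun a => E a * g a) = diagm (fun a => E a * g a) *m Wu ->
  H *m diagm g + dG = diagm g *m dD ->
  B' = dD + diagm E *m Wu *m diagm e.
Proof.
move=> g0 Ee FC BE RC HG; rewrite BE in FC.
have Eg : diagm E *m diagm e = 1%:M by rewrite diagmM -diagm1; exact: diagm_ext.
have eE : diagm e *m diagm E = 1%:M by rewrite diagmM -diagm1; apply: diagm_ext => a; rewrite mulrC.
have gg : diagm (fun a => (g a)^-1) *m diagm g = 1%:M.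
  by rewrite diagmM -diagm1; apply: diagm_ext => a; rewrite mulVf.
have K1 : diagm (fun a => E a * g a) = diagm g *m diagm E.
  by rewrite diagmM; apply: diagm_ext => a; rewrite mulrC.
have rcg : rc *m diagm g = diagm g *m (diagm E *m Wu *m diagm e).
  have := congr1 (fun M : matC => M *m diagm e) RC.
  by rewrite K1 -!mulmxA Eg mulmx1.
have : diagm g *m B' = diagm g *m (dD + diagm E *m Wu *m diagm e).
  by rewrite FC mulmxDl -addrA [rc *m _ + _]addrC addrA HG rcg -mulmxDr.
by move=> /(congr1 (mulmx (diagm (fun a => (g a)^-1)))); rewrite !mulmxA gg !mul1mx.
Qed.

Lemma invmx_right (A B : matC) : A *m B = 1%:M -> invmx A = B.
Proof.
move=> AB; have [uA _] := mulmx1_unit AB.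
by rewrite -[LHS]mulmx1 -AB mulmxA mulVmx// mul1mx.
Qed.

(** Write the characters as exp(omega + gamma) with omega in i t and gamma in
    t, and change the frame by exp gamma. The dbar equations, conjugated, say
    that the old torus part is the z-derivative of omega - gamma; the change of
    frame adds that of gamma, so what remains is Omega_z. *)
Lemma Toda_frame_exists : exists F', [/\ smooth_mx F', forall z, SO1 (F' z),
  forall z, coset (F' z) = coset (F z) &
  exists Omega : R * R -> matC,
    [/\ smooth_cmx Omega, forall z, Lie_it (Omega z) &
        forall z, MC F' z = dz Omega z
          + expmx (Omega z) *m W *m invmx (expmx (Omega z))]].
Proof.
have [l [sl El dl dln]] := gauge_logs sF oF pF hF rho0 norm.
pose om := omega n l; pose ga := gamma n l.
have so k : smoothC (om k) by have [] := smooth_omega n (sl k).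
have sg k : smoothC (ga k) by have [_] := smooth_omega n (sl k).
have tch z : torus_char n (fun k => cexp (ga k z)).
  split=> [k kn|k kn|]; first exact: cexp_neq0.
    rewrite conj_cexp -cexpD /ga /gamma ifF; last by lia.
    rewrite -[RHS]cexp0; congr cexp; case: (l k z) => a b.
    by apply: complex_ext => /=; ring.
  by rewrite conj_cexp /ga /gamma eqxx conj_real.
have exT z : exists t, torus t /\ to_null (cmx t) = diagm (torus_wt (fun k => cexp (ga k z))).
  by have [t] := to_null_torus hn (tch z); exists t.
have [T HT] := choice exT.
have tT z : torus (T z) by case: (HT z).
have ET z : to_null (cmx (T z)) = diagm (fun a => cexp (lie_wt (ga ^~ z) a)).
  by case: (HT z) => _ ->; apply: diagm_ext => a; rewrite torus_wt_cexp.
pose g z a := cexp (lie_wt (ga ^~ z) a).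
have swg a : smoothC (fun z => lie_wt (ga ^~ z) a) := smooth_lie_wt a sg.
have sgg a : smoothC (fun z => g z a) := smooth_cexp (swg a).
have sTU : smooth_cmat (fun z => to_null (cmx (T z))).
  by apply: smooth_cmat_ext (smooth_cmat_diagm sgg) => z; rewrite ET.
have sT : smooth_cmat (fun z => cmx (T z)).
  have E1 : (fun z => null_mx *m to_null (cmx (T z)) *m null_inv) =1 (fun z => cmx (T z)).
    by move=> z; exact: to_nullK.
  apply: smooth_cmat_ext E1 _; apply: (smooth_cmat_mul _ (smooth_cmat_cst null_inv)).
  exact: (smooth_cmat_mul (smooth_cmat_cst null_mx) sTU).
pose F' z := F z *m T z.
have sF' : smooth_mx F'.
  apply: smooth_cmat_real; have E1 : (fun z => cmx (F z) *m cmx (T z)) =1 (fun z => cmx (F' z)).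
    by move=> z; rewrite cmxM.
  exact: (smooth_cmat_ext E1 (smooth_cmat_mul (smooth_cmat_cmx sF) sT)).
have oF' z : SO1 (F' z) := SO1_mul (oF z) (torus_SO1 hn (tT z)).
exists F'; split => //; first by move=> z; exact: coset_torus.
pose Om z : matC := null_mx *m diagm (lie_wt (om ^~ z)) *m null_inv.
have swo a : smoothC (fun z => lie_wt (om ^~ z) a) := smooth_lie_wt a so.
have sDg : smooth_cmat (fun z => diagm (lie_wt (om ^~ z))) := smooth_cmat_diagm swo.
have sOm : smooth_cmat Om.
  by apply: (smooth_cmat_mul _ (smooth_cmat_cst null_inv)); exact: (smooth_cmat_mul (smooth_cmat_cst null_mx) sDg).
have EOm z : to_null (Om z) = diagm (lie_wt (om ^~ z)) by exact: to_nullK'.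
exists Om; split; first exact: smooth_cmat_smooth_cmx.
  move=> z; apply: (to_null_Lie_it (EOm z)) => [k kn|].
    by rewrite /om /omega ifF//; lia.
  by rewrite /om /omega eqxx /=; ring.
move=> z.
have Eex : to_null (expmx (Om z)) = diagm (fun a => cexp (lie_wt (om ^~ z) a)).
  apply: (expmx_diag (EOm z)) => a; rewrite /RootVectors.lie_wt.
  case: (a == ord0); first by left.
  have H k : complex.Im (om k z) = 0 \/ complex.Re (om k z) = 0.
    by rewrite /om /omega; case: (k == n); [right|left]; rewrite /=; ring.
  case: (odd a); first exact: H.
  by case: (H (uphalf a)) => E; [left|right]; rewrite raddfN /= E oppr0.
pose E a := cexp (lie_wt (om ^~ z) a).
pose Y : matC := null_mx *m diagm (fun a => (E a)^-1) *m null_inv.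
have E0 a : E a != 0 by exact: cexp_neq0.
have XY : expmx (Om z) *m Y = 1%:M.
  apply: (@to_null_inj R n hn); rewrite to_nullM Eex to_nullK' to_null1 diagmM -diagm1.
  by apply: diagm_ext => a; exact: (mulfV (E0 a)).
have Yinv : invmx (expmx (Om z)) = Y by exact: (invmx_right XY).
apply: (@to_null_inj R n hn).
have RH (X P Q : matC) : to_null (X + P *m W *m Q) = to_null X + to_null P *m to_null W *m to_null Q.
  by rewrite to_nullD !to_nullM.
rewrite Yinv RH Eex WE /Y to_nullK'.
have dOm : to_null (dz Om z) = dCm (fun z => diagm (lie_wt (om ^~ z))) z.
  rewrite -[dz Om z]/(dCm Om z) -(mx_der_to_null hn z (derivation_dC R) sOm).
  by congr (mx_der _ _ z); apply/funext => y; exact: EOm.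
rewrite dOm -[to_null (MC F' z)]/(null_form F' z).
have [h [EB Eh]] := null_form_torus z.
have FC := frame_change hn z sF sF' oF oF' (fun z => erefl (F' z)).
have FC2 : diagm (g z) *m null_form F' z = null_form F z *m diagm (g z) + dCm (fun z => diagm (g z)) z.
  have ETf : (fun z => to_null (cmx (T z))) = (fun z => diagm (g z)).
    by apply/funext => y; exact: ET.
  have L (X X' : matC) (GG GG' : R * R -> matC) : X = X' -> GG = GG' ->
      X *m null_form F' z = null_form F z *m X + dCm GG z -> X' *m null_form F' z = null_form F z *m X' + dCm GG' z.
    by move=> -> ->.
  exact: L (ET z) ETf FC.
apply: (gauge_alg (g := g z) _ _ FC2 EB).
- by move=> a; exact: cexp_neq0.
- by move=> a; exact: (mulfV (E0 a)).
(* the two exponentials multiply to the characters themselves *)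
- have KE : diagm (fun a => E a * g z a) = diagm (torus_wt (gauge_char ^~ z)).
    apply: diagm_ext => a; rewrite /E /g -cexpD.
    have -> : lie_wt (om ^~ z) a + lie_wt (ga ^~ z) a = lie_wt (l ^~ z) a.
      rewrite /RootVectors.lie_wt; case: (a == ord0); first by rewrite addr0.
      by case: (odd a); rewrite -?opprD omegaD.
    rewrite -torus_wt_cexp; congr (torus_wt _ a); apply/funext => k; by rewrite El.
  rewrite KE; apply: root_sum_gauge.
  + exact: torus_wt_star.
  + move=> a; rewrite /Torus.torus_wt; case: (a == ord0); first exact: oner_neq0.
    by case: (odd a); rewrite ?invr_eq0; exact: gauge_char_neq0.
  + exact: root_gauge.
(* the conjugated dbar equations *)
have hE k : (1 <= k <= n)%N -> torus_coef F k z = dC (om k) z - dC (ga k) z.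
  move=> kn; have EJ : (fun z => om k z - ga k z) =
      (fun z => if k == n then - ((l k z)^*)%C else ((l k z)^*)%C).
    by apply/funext => y; rewrite omegaJ.
  have E1 : dC (fun z => om k z - ga k z) z = dC (om k) z - dC (ga k) z.
    have E2 := dCD z (so k) (smoothCN (sg k)).
    have E3 := derN (derivation_dC R) z (sg k).
    exact: (etrans E2 (congr1 (fun x => _ + x) E3)).
  rewrite -E1 EJ; case: (k =P n) => [->|/eqP kn'].
    have E2 := derN (derivation_dC R) z (smoothCJ (sl n)).
    have E3 := dCJ z (sl n); rewrite dln in E3.
    by rewrite E2 E3 conjN conjcK opprK.
  have E3 := dCJ z (sl k); rewrite dl in E3; last by lia.
  by rewrite E3 conjcK.
apply/matrixP => a b.
have M D (G : R * R -> matC) : mx_der D G z a b = D (fun w => G w a b) z by rewrite mxE.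
rewrite mul_diagm M.
have L (P Q : matC) : (P *m diagm (g z) + Q) a b = P a b * g z b + Q a b.
  by rewrite mxE mulr_diagm.
rewrite L M mxE.
case: (a =P b) => [<-|ab]; last first.
  have E1 (d : R * R -> I -> C) : dC (fun w => diagm (d w) a b) z = 0.
    by apply: dC0 => y; rewrite mxE; case: eqP ab.
  by rewrite mulr0n mul0r add0r !E1 mulr0.
have E1 (d : R * R -> I -> C) : dC (fun w => diagm (d w) a a) z = dC (fun w => d w a) z.
  by apply: (der_ext (@dC R)) => y; rewrite mxE eqxx.
rewrite !E1 mulr1n Eh.
have E2 := dC_cexp z (swg a); have E3 := dC_lie_wt a z sg; have E4 := dC_lie_wt a z so.
rewrite -[dC (fun w => g w a) z]/(dC (fun w => cexp (lie_wt (ga ^~ w) a)) z) E2 E3 E4.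
rewrite -mulrDl mulrC; congr (_ * _); rewrite /RootVectors.lie_wt.
case: (a =P ord0) => [_|/eqP a0]; first by rewrite addr0.
have ka : (1 <= uphalf a <= n)%N by move: a0 (ltn_ord a); rewrite -val_eqE /=; lia.
by rewrite (hE _ ka); case: (odd a); ring.
Qed.

End Gauge.

End TodaFrame.

End TodaFrames.

(** * The holomorphic scalar product of derivatives *)

Module Import HolomorphicDifferential.

Section Holomorphic.
Variables (R : realType) (n : nat).
Notation C := R[i].
Notation matC := 'M[C]_(n.*2.+1).
Notation vecC := 'cV[C]_(n.*2.+1).
Notation Ups := (ups C n.*2).
Notation dCm := (mx_der (@dC R)).
Notation dbm := (mx_der (@dbC R)).

(** By the Cauchy-Riemann equations the real and imaginary parts are harmonic. *)
Lemma holomorphic_periodic_cst L (g : R * R -> C) : is_lattice L ->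
  lattice_periodic L g -> smoothC g -> (forall z, dbC g z = 0) -> forall z, g z = g 0.
Proof.
move=> Llat gL [s1 s2] g0.
pose u z := complex.Re (g z); pose v z := complex.Im (g z).
have CR z : 'D_(1, 0) u z = 'D_(0, 1) v z /\ 'D_(0, 1) u z = - 'D_(1, 0) v z.
  have := g0 z; rewrite /dbC /partialC -/u -/v.
  move: ('D_(1, 0) u z) ('D_(0, 1) u z) ('D_(1, 0) v z) ('D_(0, 1) v z) => a b c d.
  move=> /eqP; rewrite mulf_eq0 invr_eq0 pnatr_eq0 /= eq_complex /= => /andP[/eqP A /eqP B].
  split; first by apply/eqP; rewrite -subr_eq0 -A; apply/eqP; ring.
  by apply/eqP; rewrite -subr_eq0 opprK -B; apply/eqP; ring.
have CR1 : 'D_(1, 0) u = 'D_(0, 1) v by apply/funext => z; case: (CR z).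
have CR2 : 'D_(0, 1) u = fun z => - 'D_(1, 0) v z by apply/funext => z; case: (CR z).
have CR3 : 'D_(1, 0) v = fun z => - 'D_(0, 1) u z.
  by apply/funext => z; case: (CR z) => _ ->; rewrite opprK.
have dN (w : R * R -> R) x z : smooth w -> derivable w z x -> 'D_x (fun z => - w z) z = - 'D_x w z.
  move=> sw dw; have := deriveM_pw (@derivable_cst _ _ _ (-1 : R) z x) dw.
  rewrite derive_cst_pw mul0r add0r mulN1r => <-; congr ('D_x _ z).
  by apply/funext => y; rewrite /= mulN1r.
have sv1 := smooth_derive1 s2; have sv2 := smooth_derive2 s2.
have su1 := smooth_derive1 s1; have su2 := smooth_derive2 s1.
have lu z : laplacian u z = 0.
  rewrite /laplacian CR1 CR2 (dN _ _ _ sv1 (smooth_derivable z sv1).2).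
  by have := smooth_derive_swap z s2; rewrite -/v => ->; rewrite subrr.
have lv z : laplacian v z = 0.
  rewrite /laplacian -CR1 CR3 (dN _ _ _ su2 (smooth_derivable z su2).1).
  by have := smooth_derive_swap z s1; rewrite -/u => ->; rewrite addNr.
move=> z; apply: complex_ext.
  apply: (periodic_harmonic_cst Llat (g := u) _ s1 lu) => y w Lw.
  by rewrite /u gL.
apply: (periodic_harmonic_cst Llat (g := v) _ s2 lv) => y w Lw.
by rewrite /v gL.
Qed.

Lemma ipC (x y : vecC) : ip x y = ip y x.
Proof.
have E : Ups^T = Ups by apply/matrixP => a b; rewrite !mxE; case: (a =P b) => [->|ab]; [rewrite eqxx|case: (b =P a) ab => [->|]].
have L (P : matC) (a b : vecC) : (a^T *m P *m b)^T = b^T *m P^T *m a.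
  by rewrite !trmx_mul trmxK mulmxA.
have := congr1 (fun M : 'M[C]_1 => M ord0 ord0) (L Ups x y).
by rewrite mxE E.
Qed.

Lemma ipDl (x y w : vecC) : ip (x + y) w = ip x w + ip y w.
Proof. by rewrite /ip linearD /= !mulmxDl mxE. Qed.

Lemma ipZl c (x w : vecC) : ip (c *: x) w = c * ip x w.
Proof. by rewrite /ip linearZ /= -!scalemxAl mxE. Qed.

Lemma ip0l (w : vecC) : ip 0 w = 0.
Proof. by rewrite -(scale0r 0) ipZl mul0r. Qed.

Lemma ipDr (x y w : vecC) : ip w (x + y) = ip w x + ip w y.
Proof. by rewrite ipC ipDl !(ipC w). Qed.

Lemma ipZr c (x w : vecC) : ip w (c *: x) = c * ip w x.
Proof. by rewrite ipC ipZl (ipC w). Qed.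

Lemma ip0r (w : vecC) : ip w 0 = 0.
Proof. by rewrite ipC ip0l. Qed.

Lemma ip_conj (x y : vecC) : ip (conj_cmx x) (conj_cmx y) = ((ip x y)^*)%C.
Proof.
have E : conj_cmx Ups = Ups.
  apply/matrixP => a b; rewrite !mxE; case: (a == b); rewrite ?mulr0n ?conjc0//.
  by rewrite !mulr1n; case: (a == ord_max); rewrite ?conjN conjc1.
rewrite /ip; have -> : (conj_cmx x)^T = conj_cmx x^T.
  by apply/matrixP => a b; rewrite !mxE.
by rewrite -{1}E -!conj_cmxM mxE.
Qed.

Lemma smooth_ip (x y : R * R -> vecC) : smooth_cmat x -> smooth_cmat y -> smoothC (fun z => ip (x z) (y z)).
Proof.
by move=> sx sy; exact: (smooth_cmat_mul (smooth_cmat_mul (smooth_cmat_tr sx) (smooth_cmat_cst Ups)) sy).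
Qed.

Lemma der_ip D (x y : R * R -> vecC) z : derivation D -> smooth_cmat x -> smooth_cmat y ->
  D (fun z => ip (x z) (y z)) z = ip (mx_der D x z) (y z) + ip (x z) (mx_der D y z).
Proof.
move=> der sx sy; have sxt := smooth_cmat_mul (smooth_cmat_tr sx) (smooth_cmat_cst Ups).
have E := mx_der_mul der z sxt sy.
rewrite (mx_der_mulr der Ups z (smooth_cmat_tr sx)) mx_der_tr in E.
have := congr1 (fun M : 'M[C]_1 => M ord0 ord0) E.
have L (M N : 'M[C]_1) : (M + N) ord0 ord0 = M ord0 ord0 + N ord0 ord0 by rewrite mxE.
by rewrite L mxE.
Qed.

Section Combo.
Variable f : R * R -> 'cV[R]_(n.*2.+1).
Hypothesis sf : smooth_cmat (cplx f).

Lemma smooth_cmat_dzn j : smooth_cmat (dzn j f).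
Proof.
elim: j => [|j IH]; first exact: sf.
exact: (smooth_cmat_mx_der (derivation_dC R) IH).
Qed.

(** The harmonic sequence is handled through such combinations: the range of
    orders decides which isotropy relations apply. *)
Inductive combo (lo hi : nat) : (R * R -> vecC) -> Prop :=
| combo0 x : (forall z, x z = 0) -> combo lo hi x
| comboS a g x y : (lo <= a < hi)%N -> smoothC g -> combo lo hi x ->
    (forall z, y z = g z *: dzn a f z + x z) -> combo lo hi y.

Lemma combo_smooth lo hi x : combo lo hi x -> smooth_cmat x.
Proof.
elim=> {x} [x x0|a g x y _ sg _ IH E].
  by apply: smooth_cmat_ext (smooth_cmat_cst 0) => z; rewrite x0.
apply: smooth_cmat_ext (smooth_cmat_add (smooth_cmat_scale sg (smooth_cmat_dzn a)) IH) => z; by rewrite E.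
Qed.

Lemma combo_ext lo hi x y : x =1 y -> combo lo hi x -> combo lo hi y.
Proof. by move=> /funext ->. Qed.

Lemma comboD lo hi x y : combo lo hi x -> combo lo hi y ->
  combo lo hi (fun z => x z + y z).
Proof.
move=> cx cy; elim: cx => {x} [x x0|a g x x' ha sg _ IH E].
  by apply: combo_ext cy => z; rewrite x0 add0r.
by apply: (comboS ha sg IH) => z; rewrite E addrA.
Qed.

Lemma comboZ lo hi x g : smoothC g -> combo lo hi x -> combo lo hi (fun z => g z *: x z).
Proof.
move=> sg; elim=> {x} [x x0|a h x x' ha sh _ IH E].
  by apply: combo0 => z; rewrite x0 scaler0.
apply: (comboS ha (smoothCM sg sh) IH) => z.
by rewrite E scalerDr scalerA.
Qed.

Lemma comboW lo hi lo' hi' x : (lo' <= lo)%N -> (hi <= hi')%N ->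
  combo lo hi x -> combo lo' hi' x.
Proof.
move=> l h; elim=> {x} [x x0|a g x x' ha sg _ IH E]; first exact: combo0.
by apply: (comboS _ sg IH E); lia.
Qed.

Lemma combo_dzn lo hi a : (lo <= a < hi)%N -> combo lo hi (dzn a f).
Proof.
move=> ha; apply: (comboS ha (smoothC_cst 1) (combo0 lo hi (x := fun=> 0) _)) => // z.
by rewrite scale1r addr0.
Qed.

Lemma combo_dC lo hi x : combo lo hi x -> combo lo hi.+1 (dCm x).
Proof.
elim=> {x} [x x0|a g x x' ha sg cx IH E].
  have -> : x = cst 0 by apply/funext.
  by apply: combo0 => z; exact: (mx_der_cst (derivation_dC R)).
have E1 z : dCm x' z = dC g z *: dzn a f z + g z *: dzn a.+1 f z + dCm x z.
  have -> : x' = (fun z => g z *: dzn a f z + x z) by exact/funext.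
  have A := mx_der_add (derivation_dC R) z (smooth_cmat_scale sg (smooth_cmat_dzn a)) (combo_smooth cx).
  have B := mx_der_scale (derivation_dC R) z sg (smooth_cmat_dzn a).
  exact: (etrans A (congr1 (fun M => M + _) B)).
have c1 : combo lo hi.+1 (fun z => g z *: dzn a.+1 f z + dCm x z).
  by apply: (comboS (a := a.+1) _ sg IH) => //; lia.
apply: (comboS (a := a) _ (smooth_dC sg) c1); first by lia.
by move=> z; rewrite E1 addrA.
Qed.

Hypothesis iso : forall a b, (1 <= a + b <= n.-1.*2.+1)%N ->
  forall z, ip (dzn a f z) (dzn b f z) = 0.

(** Only scalar products of derivatives with total order from 1 to 2n - 1
    occur. *)
Lemma combo_ip lo hi lo' hi' x y z : combo lo hi x -> combo lo' hi' y ->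
  (1 <= lo + lo')%N -> (hi + hi' <= n.-1.*2.+3)%N -> ip (x z) (y z) = 0.
Proof.
move=> cx cy l h; elim: cx => {x} [x x0|a g x x' ha sg cx IH E].
  by rewrite x0 ip0l.
rewrite E ipDl ipZl IH addr0.
suff -> : ip (dzn a f z) (y z) = 0 by rewrite mulr0.
clear IH; elim: cy => {y} [y y0|b k y y' hb sk cy IH' E']; first by rewrite y0 ip0r.
by rewrite E' ipDr ipZr IH' addr0 iso ?mulr0//; lia.
Qed.

Hypothesis ipff : forall z, ip (cplx f z) (cplx f z) = 1.
Hypothesis harm : forall z, exists l : C, dz (dzbar (cplx f)) z = l *: cplx f z.

(** One dbar removes one derivative, by harmonicity: the mixed derivative of f
    is a multiple of f, with smooth coefficient. *)
Lemma combo_dbar j : combo 0 j.+1 (dbm (dzn j.+1 f)).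
Proof.
elim: j => [|j IH].
  have sd : smooth_cmat (dCm (dbm (cplx f))).
    exact: (smooth_cmat_mx_der (derivation_dC R) (smooth_cmat_mx_der (derivation_dbC R) sf)).
  have sl := smooth_ip sd sf.
  have E z : dbm (dzn 1 f) z = ip (dCm (dbm (cplx f)) z) (cplx f z) *: dzn 0 f z + 0.
    have [l El] := harm z; have S := mx_der_swap z sf; rewrite -[dCm (dbm _) z]/(dz (dzbar (cplx f)) z) El in S *.
    by rewrite ipZl ipff mulr1 addr0.
  by apply: (comboS _ sl (combo0 0 1 (x := fun=> 0) _) E).
have E z : dbm (dzn j.+2 f) z = dCm (dbm (dzn j.+1 f)) z := mx_der_swap z (smooth_cmat_dzn j.+1).
by apply: combo_ext (combo_dC IH) => z; rewrite E.
Qed.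

(** dbar d^n f is a combination of derivatives of order less than n, whose
    products with d^n f have total order at most 2n - 1. *)
Lemma top_ip_holomorphic z : (1 <= n)%N -> dbC (fun z => ip (dzn n f z) (dzn n f z)) z = 0.
Proof.
move=> n0.
have cn : combo n n.+1 (dzn n f) by apply: combo_dzn; lia.
have cd : combo 0 n (dbm (dzn n f)).
  by have := combo_dbar n.-1; rewrite prednK.
have A := der_ip z (derivation_dbC R) (smooth_cmat_dzn n) (smooth_cmat_dzn n).
have B : ip (dbm (dzn n f) z) (dzn n f z) = 0 by apply: (combo_ip z cd cn); lia.
have B' : ip (dzn n f z) (dbm (dzn n f) z) = 0 by rewrite ipC.
have L (x y : C) : x = 0 -> y = 0 -> x + y = 0 by move=> -> ->; rewrite addr0.
exact: (etrans A (L _ _ B B')).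
Qed.

End Combo.

End Holomorphic.

End HolomorphicDifferential.

(** * Completing orthonormal vectors to a Lorentz frame *)

Module Import LorentzCompletion.

Section Completion.
Variables (R : realType) (n : nat).
Hypothesis hn : (1 <= n)%N.
Notation I := 'I_(n.*2.+1).
Notation vecR := 'cV[R]_(n.*2.+1).
Notation matR := 'M[R]_(n.*2.+1).
Notation UpsR := (ups R n.*2).
Implicit Types (x y w v : vecR).

Definition ups_signR (i : I) : R := if i == ord_max then -1 else 1.
Definition ipR (x y : vecR) : R := \sum_i ups_signR i * (x i ord0 * y i ord0).

Lemma ups_signR2 i : ups_signR i * ups_signR i = 1.
Proof. by rewrite /ups_signR; case: ifP => _; ring. Qed.

Lemma ipR_mx (A B : matR) a b : (A^T *m UpsR *m B) a b = ipR (col a A) (col b B).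
Proof.
rewrite -mulmxA mxE; apply: eq_bigr => i _.
by rewrite [A^T _ _]mxE mul_diag_mx !mxE mulrCA.
Qed.

Lemma ipRE (x y : vecR) : (x^T *m UpsR *m y) ord0 ord0 = ipR x y.
Proof.
rewrite -mulmxA mxE; apply: eq_bigr => i _.
by rewrite [x^T _ _]mxE mul_diag_mx !mxE mulrCA.
Qed.

Lemma ipRC x y : ipR x y = ipR y x.
Proof. by apply: eq_bigr => i _; rewrite [x i _ * _]mulrC. Qed.

Lemma ipRDl x y w : ipR (x + y) w = ipR x w + ipR y w.
Proof. by rewrite /ipR -big_split; apply: eq_bigr => i _; rewrite mxE mulrDl mulrDr. Qed.

Lemma ipRZl a x w : ipR (a *: x) w = a * ipR x w.
Proof. by rewrite /ipR mulr_sumr; apply: eq_bigr => i _; rewrite mxE -mulrA mulrCA. Qed.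

Lemma ipRNl x w : ipR (- x) w = - ipR x w.
Proof. by rewrite -scaleN1r ipRZl mulN1r. Qed.

Lemma ipR_suml (s : seq nat) (G : nat -> vecR) w :
  ipR (\sum_(i <- s) G i) w = \sum_(i <- s) ipR (G i) w.
Proof.
elim: s => [|i s IH]; last by rewrite !big_cons ipRDl IH.
by rewrite !big_nil -(scale0r 0) ipRZl mul0r.
Qed.

(** Weighting the two vectors by each other's time components makes the
    difference purely spacelike. *)
Lemma timelike_orth v w : ipR v v < 0 -> ipR v w = 0 ->
  0 <= ipR w w /\ (ipR w w = 0 -> w = 0).
Proof.
move=> vneg vw; pose tv := v ord_max ord0; pose tw := w ord_max ord0.
have split x y : ipR x y = (\sum_(i < n.*2.+1 | i != ord_max) x i ord0 * y i ord0) -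
    x ord_max ord0 * y ord_max ord0.
  rewrite /ipR (bigD1 ord_max)//= /ups_signR eqxx addrC mulN1r; congr (_ - _).
  by apply: eq_bigr => i /negbTE ->; rewrite mul1r.
have key : 0 <= tw ^+ 2 * ipR v v + tv ^+ 2 * ipR w w.
  have -> : tw ^+ 2 * ipR v v + tv ^+ 2 * ipR w w =
      \sum_(i < n.*2.+1 | i != ord_max) (tw * v i ord0 - tv * w i ord0) ^+ 2.
    have E : \sum_(i < n.*2.+1 | i != ord_max) (tw * v i ord0 - tv * w i ord0) ^+ 2 =
        tw ^+ 2 * (\sum_(i < n.*2.+1 | i != ord_max) v i ord0 * v i ord0)
        - 2 * tw * tv * (\sum_(i < n.*2.+1 | i != ord_max) v i ord0 * w i ord0)
        + tv ^+ 2 * (\sum_(i < n.*2.+1 | i != ord_max) w i ord0 * w i ord0).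
      rewrite !mulr_sumr -sumrB -big_split /=; apply: eq_bigr => i _; ring.
    rewrite E; move: vw; rewrite !split -/tv -/tw => /eqP; rewrite subr_eq0 => /eqP ->.
    move: (\sum_(i < _ | _) _) (\sum_(i < _ | _) _) => a b; ring.
  by apply: sumr_ge0 => i _; exact: sqr_ge0.
have tv0 : 0 < tv ^+ 2.
  have : 0 <= \sum_(i < n.*2.+1 | i != ord_max) v i ord0 * v i ord0.
    by apply: sumr_ge0 => i _; rewrite -expr2 sqr_ge0.
  move: vneg; rewrite split -/tv; move: (\sum_(i < _ | _) _) => a; rewrite -expr2; lra.
have tw0 : 0 <= tw ^+ 2 by exact: sqr_ge0.
split; first by have := mulr_ge0_le0 tw0 (ltW vneg); nra.
move=> ww; have tw00 : tw = 0.
  apply/eqP; rewrite -sqrf_eq0; apply/eqP; rewrite ww mulr0 addr0 in key; nra.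
move: ww; rewrite split -/tw tw00 mulr0 subr0 => /eqP.
rewrite psumr_eq0; last by move=> i _; rewrite -expr2 sqr_ge0.
move=> /allP H; apply/colP => i; rewrite mxE.
have [->|im] := eqVneq i ord_max; first exact: tw00.
by have := H i (mem_index_enum i); rewrite im /= mulf_eq0 orbb => /eqP.
Qed.

Section Columns.
Variable c : nat -> vecR.
Hypothesis oc : forall i j, (i < n.*2.-1)%N -> (j < n.*2.-1)%N -> ipR (c i) (c j) = (i == j)%:R.

Definition last_vec : vecR := delta_mx ord_max ord0.

(** A Gram-Schmidt step applied to the last basis vector, which is timelike, so
    that the construction is smooth in the columns c. *)
Definition time_proj : vecR := last_vec - \sum_(0 <= i < n.*2.-1) ipR last_vec (c i) *: c i.
Definition time_vec : vecR := (Num.sqrt (- ipR time_proj time_proj))^-1 *: time_proj.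

(** The frame with its column of index 2n-1 left open; the timelike vector is
    put last, where the Lorentz form has its negative sign. *)
Definition with_col (x : vecR) : matR := \matrix_(i, a)
  (if a == n.*2.-1 :> nat then x else if a == n.*2 :> nat then time_vec else c a) i ord0.

(** The generalised cross product of the other columns: its product with x is
    the determinant of the matrix completed by x, so it is orthogonal to them. *)
Definition normal_vec : vecR := \col_i (ups_signR i * \det (with_col (delta_mx i ord0))).
Definition frame : matR := with_col normal_vec.

Lemma time_proj_col i : (i < n.*2.-1)%N -> ipR time_proj (c i) = 0.
Proof.
move=> ii; rewrite /time_proj ipRDl ipRNl ipR_suml (bigD1_seq i) /=; last 2 first.
- by rewrite mem_index_iota.
- exact: iota_uniq.
rewrite ipRZl oc// eqxx mulr1 big_nat_cond big1 ?addr0 ?subrr// => j /andP[/andP[_ ji] ij].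
by rewrite ipRZl oc// (negbTE ij) mulr0.
Qed.

(** Removing spacelike components from a timelike vector makes it more
    timelike. *)
Lemma time_proj_sq : ipR time_proj time_proj <= -1.
Proof.
have -> : ipR time_proj time_proj = ipR last_vec time_proj.
  rewrite {1}/time_proj ipRDl ipRNl ipR_suml big_nat_cond big1 ?subr0// => i /andP[ii _].
  by rewrite ipRZl (ipRC (c i)) time_proj_col ?mulr0.
rewrite ipRC /time_proj ipRDl ipRNl ipR_suml.
have -> : ipR last_vec last_vec = -1.
  rewrite /ipR (bigD1 ord_max)//= big1 ?addr0 => [|i im].
    by rewrite /last_vec mxE !eqxx /ups_signR eqxx !mulr1.
  by rewrite /last_vec !mxE (negbTE im) mul0r mulr0.
rewrite lerBlDr lerDl; apply: sumr_ge0 => i _.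
by rewrite ipRZl ipRC -expr2 sqr_ge0.
Qed.

Lemma time_vec_col i : (i < n.*2.-1)%N -> ipR time_vec (c i) = 0.
Proof. by move=> ii; rewrite /time_vec ipRZl time_proj_col// mulr0. Qed.

Lemma time_vec_sq : ipR time_vec time_vec = -1.
Proof.
have p0 := time_proj_sq; have p1 : 0 < - ipR time_proj time_proj by lra.
rewrite /time_vec ipRZl ipRC ipRZl mulrA -invfM -expr2 sqr_sqrtr ?(ltW p1)//.
by rewrite -[X in _ * X]opprK mulrN mulVf// gt_eqF.
Qed.

Lemma col_with_col x a : col a (with_col x) = if a == n.*2.-1 :> nat then x
  else if a == n.*2 :> nat then time_vec else c a.
Proof. by apply/colP => i; rewrite !mxE. Qed.

Definition normal_idx : I := inord n.*2.-1.

Lemma val_normal_idx : normal_idx = n.*2.-1 :> nat. Proof. by rewrite /normal_idx inordK//; lia. Qed.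

Lemma cofactor_with_col x y i : cofactor (with_col x) i normal_idx = cofactor (with_col y) i normal_idx.
Proof.
rewrite /cofactor; congr (_ * \det _); apply/matrixP => a b; rewrite !mxE.
have L : (lift normal_idx b == n.*2.-1 :> nat) = false.
  by rewrite -val_normal_idx; have := neq_lift normal_idx b; rewrite -val_eqE eq_sym => /negbTE.
by rewrite !L.
Qed.

Lemma det_with_colE x : \det (with_col x) = \sum_i x i ord0 * cofactor (with_col 0) i normal_idx.
Proof.
rewrite (expand_det_col _ normal_idx); apply: eq_bigr => i _; rewrite (cofactor_with_col x 0) mxE.
by rewrite val_normal_idx eqxx.
Qed.

Lemma ipR_normal x : ipR normal_vec x = \det (with_col x).
Proof.
rewrite det_with_colE; apply: eq_bigr => i _; rewrite mxE.
have -> : \det (with_col (delta_mx i ord0)) = cofactor (with_col 0) i normal_idx.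
  rewrite det_with_colE (bigD1 i)//= big1 ?addr0 => [|j ji]; first by rewrite !mxE !eqxx mul1r.
  by rewrite !mxE (negbTE ji) mul0r.
by rewrite -mulrA [LHS]mulrA ups_signR2 mul1r mulrC.
Qed.

Lemma det_with_col_rep x (b : I) : b != normal_idx -> x = col b (with_col x) -> \det (with_col x) = 0.
Proof.
move=> bi E; rewrite -det_tr; apply: (determinant_alternate bi) => i.
by rewrite !mxE val_normal_idx eqxx; rewrite [in RHS]E !mxE.
Qed.

Lemma normal_vec_col i : (i < n.*2.-1)%N -> ipR normal_vec (c i) = 0.
Proof.
move=> ii; rewrite ipR_normal; have iv : (inord i : I) = i :> nat by rewrite inordK//; lia.
apply: (@det_with_col_rep _ (inord i)); first by rewrite -val_eqE /= val_normal_idx iv; lia.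
by rewrite col_with_col iv !ifF//; lia.
Qed.

Lemma normal_vec_time : ipR normal_vec time_vec = 0.
Proof.
rewrite ipR_normal; apply: (@det_with_col_rep _ ord_max); first by rewrite -val_eqE /= val_normal_idx; lia.
by rewrite col_with_col /= ifF ?eqxx//; lia.
Qed.

Lemma gram x : (forall i, (i < n.*2.-1)%N -> ipR x (c i) = 0) -> ipR x time_vec = 0 ->
  (with_col x)^T *m UpsR *m with_col x = diag_mx (\row_j (if j == normal_idx then ipR x x
    else if j == ord_max then -1 else 1)).
Proof.
move=> xc xv; apply/matrixP => a b; rewrite ipR_mx !col_with_col mxE [(\row_j _) _ _]mxE.
rewrite -!(val_eqE _ normal_idx) -!(val_eqE _ ord_max) -(val_eqE a b) /= val_normal_idx.
have la := ltn_ord a; have lb := ltn_ord b.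
case: (eqVneq (a : nat) n.*2.-1) => [a1|a1].
  case: (eqVneq (b : nat) n.*2.-1) => [b1|b1]; first by rewrite a1 b1 eqxx mulr1n.
  rewrite (negbTE (_ : (a != b :> nat)%N)) ?mulr0n; last by lia.
  by case: ((b : nat) =P n.*2) => hb; [exact: xv|apply: xc; lia].
case: (eqVneq (a : nat) n.*2) => [a2|a2].
  case: (eqVneq (b : nat) n.*2.-1) => [b1|b1].
    by rewrite (negbTE (_ : (a != b :> nat)%N)) ?mulr0n 1?ipRC//; lia.
  case: (eqVneq (b : nat) n.*2) => [b2|b2].
    by rewrite a2 b2 eqxx mulr1n time_vec_sq.
  rewrite (negbTE (_ : (a != b :> nat)%N)) ?mulr0n; last by lia.
  by apply: time_vec_col; lia.
case: (eqVneq (b : nat) n.*2.-1) => [b1|b1].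
  rewrite (negbTE (_ : (a != b :> nat)%N)) ?mulr0n; last by lia.
  by rewrite ipRC; apply: xc; lia.
case: (eqVneq (b : nat) n.*2) => [b2|b2].
  rewrite (negbTE (_ : (a != b :> nat)%N)) ?mulr0n; last by lia.
  by rewrite ipRC; apply: time_vec_col; lia.
by rewrite oc; [case: (_ == _)|lia|lia].
Qed.

(** The determinant of the Gram matrix, which is diagonal. *)
Lemma gram_det x : (forall i, (i < n.*2.-1)%N -> ipR x (c i) = 0) -> ipR x time_vec = 0 ->
  \det (with_col x) ^+ 2 = ipR x x.
Proof.
move=> xc xv; have := congr1 determinant (gram xc xv).
have ium : normal_idx != ord_max by rewrite -val_eqE /= val_normal_idx; lia.
have D1 : \det UpsR = -1.
  rewrite det_diag (bigD1 ord_max)//= mxE eqxx big1 ?mulr1// => i im.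
  by rewrite mxE (negbTE im).
have D2 : \det (diag_mx (\row_j (if j == normal_idx then ipR x x
    else if j == ord_max then -1 else 1 : R))) = - ipR x x.
  rewrite det_diag (bigD1 ord_max)//= (bigD1 normal_idx)//= !mxE !eqxx eq_sym (negbTE ium).
  rewrite big1 ?mulr1 ?mulN1r// => i /andP[im iu'].
  by rewrite mxE (negbTE iu') (negbTE im).
by rewrite !det_mulmx det_tr D1 D2 => H; rewrite expr2; lra.
Qed.

(** The square q of the normal vector N is both the determinant of the frame
    completed by N and, by the Gram matrix, the square of this determinant; so
    q is 0 or 1. If q = 0 then N, being orthogonal to a timelike vector,
    vanishes. Some nonzero x is orthogonal to the other columns, and its square
    is that of the determinant completed by x, that is of <N, x> = 0:
    impossible for the same reason. *)
Lemma normal_vec_sq : ipR normal_vec normal_vec = 1.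
Proof.
have q2 := gram_det normal_vec_col normal_vec_time; rewrite -ipR_normal in q2.
have [q0|q0] := eqVneq (ipR normal_vec normal_vec) 0; last first.
  by apply: (mulfI q0); rewrite mulr1 -expr2.
have v0 : ipR time_vec time_vec < 0 by rewrite time_vec_sq; lra.
have u0 : normal_vec = 0.
  have [_ H] := timelike_orth v0 (etrans (ipRC time_vec normal_vec) normal_vec_time); exact: H.
have dM0 x : \det (with_col x) = 0 by rewrite -ipR_normal u0 -(scale0r 0) ipRZl mul0r.
(* the equations for x are fewer than its coordinates: the open column may
   be 0 *)
have : \det (UpsR *m with_col 0) == 0 by rewrite det_mulmx dM0 mulr0.
move=> /det0P[w w0 wM]; exfalso; move: w0; apply/negP/negPn.
pose x : vecR := w^T.
have xo a : ipR x (col a (with_col 0)) = 0.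
  have -> : ipR x (col a (with_col 0)) = (w *m (UpsR *m with_col 0)) ord0 a.
    rewrite mxE; apply: eq_bigr => i _.
    by rewrite mul_diag_mx !mxE mulrCA.
  by rewrite wM mxE.
have xc i : (i < n.*2.-1)%N -> ipR x (c i) = 0.
  move=> ii; have := xo (inord i); rewrite col_with_col inordK; last by lia.
  by rewrite !ifF//; lia.
have xv : ipR x time_vec = 0.
  have := xo ord_max; rewrite col_with_col /= eqxx ifF//; lia.
have xx := gram_det xc xv; rewrite dM0 expr0n /= in xx.
have [_ H] := timelike_orth v0 (etrans (ipRC time_vec x) xv).
by rewrite -[w]trmxK -/x H// trmx0.
Qed.

(** The determinant is the square of the normal vector, so it is 1 and not -1. *)
Lemma frame_SO1 : SO1 frame.
Proof.
split.
  rewrite /frame (gram normal_vec_col normal_vec_time) normal_vec_sq; congr diag_mx; apply/rowP => j; rewrite !mxE.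
  case: eqP => // ->; rewrite ifF//; apply/negbTE; rewrite -val_eqE /= val_normal_idx; lia.
by rewrite /frame -ipR_normal normal_vec_sq.
Qed.

Lemma frame_col (a : I) : (a < n.*2.-1)%N -> col a frame = c a.
Proof. by move=> ha; rewrite /frame col_with_col !ifF//; lia. Qed.

End Columns.

End Completion.

End LorentzCompletion.

(** * The harmonic sequence *)

Module Import HarmonicSequence.

Section HarmonicSequence.
Variables (R : realType) (n : nat).
Hypothesis hn : (1 <= n)%N.
Notation C := R[i].
Notation vecC := 'cV[C]_(n.*2.+1).
Notation dCm := (mx_der (@dC R)).
Notation dbm := (mx_der (@dbC R)).

Variable f : R * R -> 'cV[R]_(n.*2.+1).
Hypothesis hf : superconformal f.

Lemma superconformal_smooth : smooth_cmat (cplx f).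
Proof. by case: hf => -[sf _ _] _; exact: smooth_cmat_cmx. Qed.
Let sf := superconformal_smooth.

Lemma isotropic a b : (1 <= a + b <= n.-1.*2.+1)%N ->
  forall z, ip (dzn a f z) (dzn b f z) = 0.
Proof. by case: hf => _ [iso _]; exact: iso. Qed.

Lemma ip_cmx (x y : 'cV[R]_(n.*2.+1)) : ip (cmx x) (cmx y) = (ipR x y)%:C%C.
Proof. by rewrite /ip cmx_tr -cmx_ups -!cmxM mxE ipRE. Qed.

Lemma ip_ff z : ip (cplx f z) (cplx f z) = 1.
Proof. by case: hf => -[_ ds _] _; rewrite ip_cmx -ipRE ds. Qed.

Lemma conj_f z : conj_cmx (cplx f z) = cplx f z.
Proof. exact: conj_cmx_cmx. Qed.

(** Differentiation of the relation <d^a f, d^b f> = 0 of total order 2n - 1. *)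
Lemma ip_shift z a b : a + b = n.*2.-1 ->
  ip (dzn a.+1 f z) (dzn b f z) = - ip (dzn a f z) (dzn b.+1 f z).
Proof.
move=> ab; have A := der_ip z (derivation_dC R) (smooth_cmat_dzn sf a) (smooth_cmat_dzn sf b).
have Z y : ip (dzn a f y) (dzn b f y) = 0 by apply: isotropic; move: hn; lia.
have B : dC (fun z => ip (dzn a f z) (dzn b f z)) z = 0 by exact: dC0.
have L (x y w : C) : w = x + y -> w = 0 -> x = - y.
  by move=> -> /eqP; rewrite addr_eq0 => /eqP.
exact: L A B.
Qed.

Hypothesis top0 : forall z, ip (dzn n f z) (dzn n f z) != 0.

(** By shifting derivatives this is up to sign <d^n f, d^n f>. *)
Lemma ip_dual_neq0 z j : (j <= n)%N -> ip (dzn j f z) (dzn (n.*2 - j) f z) != 0.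
Proof.
move=> jn; have [i Ei] : exists i, i = (n - j)%N by eexists.
elim: i j jn Ei => [|i IH] j jn Ei.
  by have -> : j = n by [lia]; have -> : (n.*2 - n)%N = n by [lia].
have ab : (j + (n.*2 - j.+1) = n.*2.-1)%N by lia.
have := ip_shift z ab; have -> : (n.*2 - j.+1).+1 = (n.*2 - j)%N by lia.
have := IH j.+1; rewrite -oppr_eq0 => H E.
by rewrite -oppr_eq0 -E -oppr_eq0; apply: H; lia.
Qed.

Variable fs : nat -> R * R -> vecC.
Hypothesis hs : harmonic_sequence f fs.
Hypothesis nb : forall j z, (j < n)%N -> ~ (fs j z <> 0 /\ normsq (fs j z) = 0).

Definition proj_coef j z : C := ip (dCm (fs j) z) (conj_cmx (fs j z)) / normsq (fs j z).

Lemma fs0 z : fs 0 z = cplx f z. Proof. by rewrite hs.1. Qed.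

(** The product with d^(2n-j) f only sees the leading term of f_j and is
    nonzero, so f_j does not vanish; as the sequence is everywhere defined,
    neither does its norm. *)
Lemma fs_normsq_lead j x z : (j < n)%N -> combo f 1 j x ->
  (forall z, fs j z = dzn j f z + x z) -> normsq (fs j z) != 0.
Proof.
move=> jn cx E; apply/eqP => N; apply: (nb jn (conj _ N)) => f0.
have D := ip_dual_neq0 z (ltnW jn).
have cd : combo f (n.*2 - j) (n.*2 - j).+1 (dzn (n.*2 - j) f) by apply: combo_dzn; lia.
have xd : ip (x z) (dzn (n.*2 - j) f z) = 0.
  by apply: (combo_ip isotropic z cx cd); move: hn; lia.
have := ipDl (dzn j f z) (x z) (dzn (n.*2 - j) f z).
by rewrite -E f0 ip0l xd addr0 => /esym/eqP; apply/negP.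
Qed.

Lemma smooth_proj_coef j : smooth_cmat (fs j) -> (forall z, normsq (fs j z) != 0) -> smoothC (proj_coef j).
Proof.
move=> sj nz; have sd := smooth_cmat_mx_der (derivation_dC R) sj.
exact: (smoothCM (smooth_ip sd (smooth_cmat_conj sj)) (smoothCV (smooth_ip sj (smooth_cmat_conj sj)) nz)).
Qed.

Lemma fs_next j z : (j < n)%N -> normsq (fs j z) != 0 ->
  fs j.+1 z = dCm (fs j) z - proj_coef j z *: fs j z.
Proof. by move=> jn nz; exact: (hs.2 j jn).1. Qed.

Lemma proj_coef0 z : proj_coef 0 z = 0.
Proof.
have E : fs 0 = cplx f by apply/funext => y; exact: fs0.
by rewrite /proj_coef E conj_f (isotropic (a := 1) (b := 0)) ?mul0r.
Qed.

(** No f_j vanishes, by the nonvanishing of its leading product, so the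
    recursive formula holds at every point and the limits in the definition of
    the sequence never occur. *)
Lemma fs_lead j : (j <= n)%N -> exists2 x, combo f 1 j x &
  forall z, fs j z = dzn j f z + x z.
Proof.
elim: j => [|j IH] jn.
  by exists (fun=> 0); [exact: combo0|move=> z; rewrite fs0 addr0].
have [x cx E] := IH (ltnW jn).
have nz z := fs_normsq_lead z jn cx E.
have sx := combo_smooth sf cx; have sd := smooth_cmat_dzn sf j.
have sj : smooth_cmat (fs j) by apply: smooth_cmat_ext (smooth_cmat_add sd sx) => z; rewrite E.
have sa := smooth_proj_coef sj nz.
have Efs : fs j = fun z => dzn j f z + x z by apply/funext.
have D z : dCm (fs j) z = dzn j.+1 f z + dCm x z.
  have A := mx_der_add (derivation_dC R) z sd sx.
  have L G : G = (fun z => dzn j f z + x z) -> dCm G z = dzn j.+1 f z + dCm x z.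
    by move=> ->; exact: A.
  exact: L Efs.
have [j0|j0] := eqVneq j 0%N.
  exists (fun=> 0); first exact: combo0.
  move=> z; rewrite (fs_next jn (nz z)) D j0 proj_coef0 scale0r subr0; congr (_ + _).
  have -> : x = cst 0.
    apply/funext => y; move: cx; rewrite j0; case=> {x E sx Efs D} [x x0|a g x x' + _ _ _].
      exact: x0.
    by rewrite ltn0 andbF.
  exact: (mx_der_cst (derivation_dC R)).
exists (fun z => dCm x z + - proj_coef j z *: (dzn j f z + x z)).
  apply: comboD; first exact: (combo_dC sf cx).
  apply: (comboZ (smoothCN sa)); apply: comboD; first by apply: combo_dzn; lia.
  by apply: comboW cx => //; lia.
by move=> z; rewrite (fs_next jn (nz z)) D -E scaleNr addrA.
Qed.

Lemma normsq_neq0 j z : (j < n)%N -> normsq (fs j z) != 0.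
Proof.
move=> jn; have [x cx E] := fs_lead (ltnW jn); exact: fs_normsq_lead cx E.
Qed.

Lemma smooth_fs j : (j <= n)%N -> smooth_cmat (fs j).
Proof.
move=> /fs_lead[x cx E].
by apply: smooth_cmat_ext (smooth_cmat_add (smooth_cmat_dzn sf j) (combo_smooth sf cx)) => z; rewrite E.
Qed.

Lemma fs_step j z : (j < n)%N -> dCm (fs j) z = fs j.+1 z + proj_coef j z *: fs j z.
Proof. by move=> jn; rewrite (fs_next jn (normsq_neq0 z jn)) subrK. Qed.

Lemma fs_combo j : (1 <= j <= n)%N -> combo f 1 j.+1 (fs j).
Proof.
move=> /andP[j1 jn]; have [x cx E] := fs_lead jn.
have cd : combo f 1 j.+1 (dzn j f) by apply: combo_dzn; lia.
have cx' := comboW (leqnn 1) (leqnSn j) cx.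
by apply: combo_ext (comboD cd cx') => z; rewrite E.
Qed.

(** f_j is a combination of the derivatives of f of orders at most j. *)
Lemma fs_isotropic i j z : (i <= n)%N -> (j <= n)%N -> (1 <= i + j <= n.*2.-1)%N ->
  ip (fs i z) (fs j z) = 0.
Proof.
wlog ij : i j / (i <= j)%N.
  by move=> H iN jN; case: (leqP i j) => [|/ltnW] ?; [exact: H|rewrite ipC addnC; exact: H].
move=> iN jN h; have cj : combo f 1 j.+1 (fs j) by apply: fs_combo; lia.
have [i0|i0] := eqVneq i 0%N.
  have c0 : combo f 0 1 (fs 0).
    have c0 : combo f 0 1 (dzn 0 f) by apply: combo_dzn.
    by apply: combo_ext c0 => y; rewrite fs0.
  by rewrite i0; apply: (combo_ip isotropic z c0 cj); move: hn; lia.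
have ci : combo f 1 i.+1 (fs i) by apply: fs_combo; lia.
by apply: (combo_ip isotropic z ci cj); move: hn; lia.
Qed.

Lemma harm z : exists l : C, dz (dzbar (cplx f)) z = l *: cplx f z.
Proof. by case: hf => -[_ _ h] _; exact: h. Qed.

Lemma smooth_proj_coef' j : (j < n)%N -> smoothC (proj_coef j).
Proof.
by move=> jn; apply: smooth_proj_coef; [exact: smooth_fs (ltnW jn)|move=> z; exact: normsq_neq0].
Qed.

(** The two properties are proved together, since each feeds the induction step
    of the other. *)
Definition hermitian_step j := (forall i z, (i < j)%N -> ip (fs j z) (conj_cmx (fs i z)) = 0) /\
  exists2 b, smoothC b & forall z, dbm (fs j) z = b z *: fs j.-1 z.

Lemma ip_conj_der j i z : (j <= n)%N -> (i <= n)%N -> (forall y, ip (fs j y) (conj_cmx (fs i y)) = 0) ->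
  ip (dCm (fs j) z) (conj_cmx (fs i z)) = - ip (fs j z) (conj_cmx (dbm (fs i) z)) /\
  ip (dbm (fs j) z) (conj_cmx (fs i z)) = - ip (fs j z) (conj_cmx (dCm (fs i) z)).
Proof.
move=> jn iN Z; have sj := smooth_fs jn; have si := smooth_fs iN.
have [C1 C2] := mx_der_conj z si.
have A1 := der_ip z (derivation_dC R) sj (smooth_cmat_conj si).
have A2 := der_ip z (derivation_dbC R) sj (smooth_cmat_conj si).
have B1 : dC (fun z => ip (fs j z) (conj_cmx (fs i z))) z = 0 by exact: dC0.
have B2 : dbC (fun z => ip (fs j z) (conj_cmx (fs i z))) z = 0.
  have E : (fun z => ip (fs j z) (conj_cmx (fs i z))) = cst 0 by apply/funext.
  have H g : g = cst (0 : C) -> dbC g z = 0 by move=> ->; exact: dbC_cst.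
  exact: H E.
have L (x y y' w : C) : w = x + y -> w = 0 -> y = y' -> x = - y'.
  by move=> -> + <- => /eqP; rewrite addr_eq0 => /eqP.
split; [exact: (L _ _ _ _ A1 B1 (congr1 (ip (fs j z)) C1))|].
exact: (L _ _ _ _ A2 B2 (congr1 (ip (fs j z)) C2)).
Qed.

Lemma conj_scale c (x : vecC) : conj_cmx (c *: x) = (c^*)%C *: conj_cmx x.
Proof. by apply/matrixP => a b; rewrite !mxE rmorphM. Qed.

Lemma conj_add (x y : vecC) : conj_cmx (x + y) = conj_cmx x + conj_cmx y.
Proof. by apply/matrixP => a b; rewrite !mxE rmorphD. Qed.

Lemma hermitian_step1 : hermitian_step 1.
Proof.
have n0 : (0 < n)%N := hn.
have E1 : fs 1 = dCm (cplx f).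
  apply/funext => z; have := fs_step z n0; rewrite proj_coef0 scale0r addr0 => <-.
  by congr (mx_der _ _ z); apply/funext => y; rewrite fs0.
split.
  move=> i z; case: i => // _; rewrite fs0 conj_f -fs0.
  by apply: fs_isotropic => //; move: hn; lia.
have sd : smooth_cmat (dCm (dbm (cplx f))).
  exact: (smooth_cmat_mx_der (derivation_dC R) (smooth_cmat_mx_der (derivation_dbC R) sf)).
exists (fun z => ip (dCm (dbm (cplx f)) z) (cplx f z)); first exact: (smooth_ip sd sf).
move=> z; have [l El] := harm z; have S := mx_der_swap z sf.
rewrite E1 S -[dCm (dbm _) z]/(dz (dzbar (cplx f)) z) El fs0.
by rewrite ipZl ip_ff mulr1.
Qed.

(** Orthogonality to f_j is the definition of the projection, and orthogonality
    to the earlier elements comes by moving the derivative to the other side,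
    where it becomes a dbar. Commuting dbar with the recursion then shows that
    dbar f_(j+1) is a combination of f_j and f_(j-1), where the second
    coefficient vanishes by the orthogonality just proved. *)
Lemma hermitian_stepS j : (1 <= j < n)%N -> (forall i, (1 <= i <= j)%N -> hermitian_step i) ->
  hermitian_step j.+1.
Proof.
move=> /andP[j1 jn] H; have jj : (1 <= j <= j)%N by rewrite j1 leqnn.
have [Hj [b sb Eb]] := H j jj.
have orth i z : (i < j.+1)%N -> ip (fs j.+1 z) (conj_cmx (fs i z)) = 0.
  rewrite ltnS leq_eqVlt => /orP[/eqP ->|ij].
    rewrite (fs_next jn (normsq_neq0 z jn)) ipDl -scaleNr ipZl.
    by rewrite /proj_coef -/(normsq (fs j z)) mulNr divfK ?subrr// normsq_neq0.
  rewrite (fs_next jn (normsq_neq0 z jn)) ipDl -scaleNr ipZl (Hj i z ij) mulr0 addr0.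
  have iN : (i <= n)%N by lia.
  have [-> _] := ip_conj_der z (ltnW jn) iN (fun y => Hj i y ij).
  have [i0|i0] := eqVneq i 0%N.
    have [_ C2] := mx_der_conj z sf.
    have E : conj_cmx (dbm (fs i) z) = fs 1 z.
      have -> : fs i = cplx f by rewrite i0; apply/funext => y; exact: fs0.
      have [C1 _] := mx_der_conj z sf.
      have := fs_step z hn; rewrite proj_coef0 scale0r addr0 => <-.
      rewrite -C1; congr (mx_der _ _ z); apply/funext => y.
      by rewrite fs0 conj_f.
    by rewrite E fs_isotropic ?oppr0//; lia.
  have ii : (1 <= i <= j)%N by lia.
  have [_ [bi _ Ei]] := H i ii.
  rewrite Ei conj_scale ipZr Hj ?mulr0 ?oppr0//; lia.
split; first by move=> i z; exact: orth.
have sj := smooth_fs (ltnW jn).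
have jn' : (j.-1 <= n)%N by lia.
have sj' := smooth_fs jn'; have sa := smooth_proj_coef' jn.
have jn1 : (j.-1 < n)%N by lia.
exists (fun z => b z + - dbC (proj_coef j) z); first exact: (smoothCD sb (smoothCN (smooth_dbC sa))).
move=> z.
have D1 : dbm (fs j.+1) z = dCm (dbm (fs j)) z - (dbC (proj_coef j) z *: fs j z + proj_coef j z *: dbm (fs j) z).
  have E : fs j.+1 = (fun z => dCm (fs j) z - proj_coef j z *: fs j z).
    by apply/funext => y; exact: (fs_next jn (normsq_neq0 y jn)).
  have sdj := smooth_cmat_mx_der (derivation_dC R) sj.
  have A := mx_der_sub (derivation_dbC R) z sdj (smooth_cmat_scale sa sj).
  have B := mx_der_scale (derivation_dbC R) z sa sj.
  have S := mx_der_swap z sj.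
  have L (X X' Y Y' : vecC) : X = X' -> Y = Y' -> X - Y = X' - Y' by move=> -> ->.
  have L2 G : G = (fun z => dCm (fs j) z - proj_coef j z *: fs j z) -> dbm G z =
      dCm (dbm (fs j)) z - (dbC (proj_coef j) z *: fs j z + proj_coef j z *: dbm (fs j) z).
    by move=> ->; exact: (etrans A (L _ _ _ _ S B)).
  exact: L2 E.
have D2 : dCm (dbm (fs j)) z = dC b z *: fs j.-1 z + b z *: (fs j z + proj_coef j.-1 z *: fs j.-1 z).
  have E : dbm (fs j) = (fun z => b z *: fs j.-1 z) by apply/funext.
  have B := mx_der_scale (derivation_dC R) z sb sj'.
  have S := fs_step z jn1; rewrite prednK// in S.
  have L2 G : G = (fun z => b z *: fs j.-1 z) -> dCm G z =
      dC b z *: fs j.-1 z + b z *: (fs j z + proj_coef j.-1 z *: fs j.-1 z).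
    by move=> ->; rewrite -S; exact: B.
  exact: L2 E.
(* the coefficient of f_(j-1), which has to vanish *)
pose c := dC b z + b z * proj_coef j.-1 z - proj_coef j z * b z.
have D3 : dbm (fs j.+1) z = (b z + - dbC (proj_coef j) z) *: fs j z + c *: fs j.-1 z.
  rewrite D1 D2 Eb /c.
  move: (dC b z) (dbC (proj_coef j) z) (b z) (proj_coef j z) (proj_coef j.-1 z) (fs j z) (fs j.-1 z).
  by move=> x y p q r u v; apply/colP => i; rewrite !mxE; ring.
(* pair with f_(j-1) in the hermitian product *)
have c0 : c = 0.
  have P0 : ip (dbm (fs j.+1) z) (conj_cmx (fs j.-1 z)) = 0.
    have jj1 : (j.-1 < j.+1)%N by lia.
    have [_ ->] := ip_conj_der z jn jn' (fun y => orth j.-1 y jj1).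
    by rewrite (fs_step z jn1) prednK// conj_add conj_scale ipDr ipZr !orth ?mulr0 ?addr0 ?oppr0.
  rewrite D3 ipDl !ipZl Hj ?mulr0 ?add0r in P0; last by lia.
  by move/eqP: P0; rewrite mulf_eq0 (negbTE (normsq_neq0 z jn1)) orbF => /eqP.
by rewrite D3 c0 scale0r addr0.
Qed.

Lemma hermitian_steps j : (1 <= j <= n)%N -> hermitian_step j.
Proof.
elim/ltn_ind: j => -[//|[_ _|j IH jn]]; first exact: hermitian_step1.
by apply: hermitian_stepS; [lia|move=> i ij; apply: IH; lia].
Qed.

End HarmonicSequence.

End HarmonicSequence.

(** * Frames adapted to the harmonic sequence *)

Module Import AdaptedFrames.

Section SmoothFrame.
Variables (R : realType) (n : nat).
Hypothesis hn : (1 <= n)%N.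
Notation C := R[i].
Notation I := 'I_(n.*2.+1).
Notation vecR := 'cV[R]_(n.*2.+1).
Notation vecC := 'cV[C]_(n.*2.+1).
Notation matC := 'M[C]_(n.*2.+1).
Notation matR := 'M[R]_(n.*2.+1).

Definition smV (x : R * R -> vecR) := smooth_cmat (fun z => cmx (x z)).

Lemma smV_entry (x : R * R -> vecR) i : smV x -> smooth (fun z => x z i ord0).
Proof. by move=> sx; apply: smooth_ext (sx i ord0).1 => z; rewrite mxE. Qed.

Lemma smV_intro (x : R * R -> vecR) : (forall i, smooth (fun z => x z i ord0)) -> smV x.
Proof.
move=> sx i j; rewrite ord1; apply: (smooth_cmat_intro (e := fun i j z => (x z i ord0)%:C%C)).
  by move=> a b z; rewrite ord1 mxE.
by move=> a b; exact: smoothC_real.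
Qed.

Lemma smooth_ipR (x y : R * R -> vecR) : smV x -> smV y -> smooth (fun z => ipR (x z) (y z)).
Proof.
move=> sx sy; apply: smooth_ext (smooth_ip sx sy).1 => z.
by rewrite ip_cmx.
Qed.

Lemma smV_scale (g : R * R -> R) (x : R * R -> vecR) : smooth g -> smV x ->
  smV (fun z => g z *: x z).
Proof.
move=> sg sx; apply: smV_intro => i.
by apply: smooth_ext (smoothM sg (smV_entry i sx)) => z; rewrite mxE.
Qed.

Lemma smooth_sum (s : seq nat) (g : nat -> R * R -> R) : (forall i, smooth (g i)) ->
  smooth (fun z => \sum_(i <- s) g i z).
Proof.
move=> sg; elim: s => [|i s IH].
  by apply: smooth_ext (smooth_cst 0) => z; rewrite big_nil.
by apply: smooth_ext (smoothD (sg i) IH) => z; rewrite big_cons.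
Qed.

Lemma smoothC_det p (A : R * R -> 'M[C]_p) : smooth_cmat A -> smoothC (fun z => \det (A z)).
Proof.
move=> sA; apply: smoothC_sum => s.
by apply: smoothCM; [exact: smoothC_cst|apply: smoothC_prod => i; exact: sA].
Qed.

Lemma smooth_det p (A : R * R -> 'M[R]_p) : smooth_mx A -> smooth (fun z => \det (A z)).
Proof.
move=> sA; apply: smooth_ext (smoothC_det (smooth_cmat_cmx sA)).1 => z.
have -> : \det (cmx (A z)) = (\det (A z))%:C%C by exact: det_map_mx.
by [].
Qed.

Variable c : R * R -> nat -> vecR.
Hypothesis oc : forall z i j, (i < n.*2.-1)%N -> (j < n.*2.-1)%N ->
  ipR (c z i) (c z j) = (i == j)%:R.
Hypothesis sc : forall i, smV (fun z => c z i).

Lemma smV_cst (x : vecR) : smV (fun=> x).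
Proof. exact: smooth_cmat_cst. Qed.

Lemma smooth_time_proj : smV (fun z => time_proj (c z)).
Proof.
apply: smV_intro => p.
have s1 := smooth_cst (last_vec R n p ord0).
have s2 : smooth (fun z => \sum_(0 <= i < n.*2.-1) (ipR (last_vec R n) (c z i) * c z i p ord0)).
  apply: smooth_sum => i.
  exact: (smoothM (smooth_ipR (smV_cst _) (sc i)) (smV_entry p (sc i))).
apply: smooth_ext (smoothD s1 (smoothN s2)) => z.
rewrite [RHS]mxE [X in _ = _ + X]mxE summxE /=; congr (_ - _).
by apply: eq_bigr => i _; rewrite mxE.
Qed.

Lemma smooth_time_vec : smV (fun z => time_vec (c z)).
Proof.
have sp := smooth_time_proj; have sN := smoothN (smooth_ipR sp sp).
have p0 z : 0 < - ipR (time_proj (c z)) (time_proj (c z)) by have := time_proj_sq (oc z); lra.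
have sq := smooth_sqrt sN p0.
apply: (smV_scale (smoothV sq _) sp) => z.
by rewrite /= gt_eqF// sqrtr_gt0 p0.
Qed.

Lemma smooth_with_col (x : R * R -> vecR) : smV x -> smooth_mx (fun z => with_col (c z) (x z)).
Proof.
move=> sx i a.
have E z : with_col (c z) (x z) i a = (if a == n.*2.-1 :> nat then x z
  else if a == n.*2 :> nat then time_vec (c z) else c z a) i ord0 by rewrite mxE.
apply: (smooth_ext (fun z => esym (E z))).
case: (a == n.*2.-1 :> nat); first exact: (smV_entry i sx).
by case: (a == n.*2 :> nat); [exact: (smV_entry i smooth_time_vec)|exact: (smV_entry i (sc a))].
Qed.

Lemma smooth_frame : smooth_mx (fun z => frame (c z)).
Proof.
apply: smooth_with_col; apply: smV_intro => i.
apply: smooth_ext (smoothM (smooth_cst (ups_signR R i)) (smooth_det (smooth_with_col (smV_cst (delta_mx i ord0))))).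
by move=> z; rewrite mxE.
Qed.

End SmoothFrame.

Section AdaptedFrame.
Variables (R : realType) (n : nat).
Hypothesis hn : (1 <= n)%N.
Notation C := R[i].
Notation I := 'I_(n.*2.+1).
Notation vecR := 'cV[R]_(n.*2.+1).
Notation vecC := 'cV[C]_(n.*2.+1).
Notation matC := 'M[C]_(n.*2.+1).
Notation matR := 'M[R]_(n.*2.+1).

Variable f : R * R -> 'cV[R]_(n.*2.+1).
Hypothesis hf : superconformal f.
Hypothesis top0 : forall z, ip (dzn n f z) (dzn n f z) != 0.
Variable fs : nat -> R * R -> vecC.
Hypothesis hs : harmonic_sequence f fs.
Hypothesis nb : forall j z, (j < n)%N -> ~ (fs j z <> 0 /\ normsq (fs j z) = 0).

Definition ReV (x : vecC) : vecR := map_mx (@complex.Re R) x.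
Definition ImV (x : vecC) : vecR := map_mx (@complex.Im R) x.

Lemma ReImV x : x = cmx (ReV x) + 'i%C *: cmx (ImV x).
Proof.
apply/colP => i; rewrite !mxE; case: (x i ord0) => a b.
by apply: complex_ext => /=; ring.
Qed.

Lemma ip_parts (x y : vecC) : ip x y =
  ((ipR (ReV x) (ReV y) - ipR (ImV x) (ImV y)) +i* (ipR (ReV x) (ImV y) + ipR (ImV x) (ReV y)))%C.
Proof.
rewrite {1}(ReImV x) {1}(ReImV y) !ipDl !ipDr !ipZl !ipZr !ip_cmx.
by apply: complex_ext => /=; ring.
Qed.

Lemma conj_parts (x : vecC) : ReV (conj_cmx x) = ReV x /\ ImV (conj_cmx x) = - ImV x.
Proof. by split; apply/colP => i; rewrite !mxE; case: (x i ord0). Qed.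

Lemma ipRNr (x y : vecR) : ipR x (- y) = - ipR x y.
Proof. by rewrite ipRC ipRNl ipRC. Qed.

Lemma ip_conj_parts (x y : vecC) : ip x (conj_cmx y) =
  ((ipR (ReV x) (ReV y) + ipR (ImV x) (ImV y)) +i* (ipR (ImV x) (ReV y) - ipR (ReV x) (ImV y)))%C.
Proof.
have [E1 E2] := conj_parts y; rewrite ip_parts E1 E2 !ipRNr.
by apply: complex_ext => /=; ring.
Qed.

Lemma fs_hermitian i j z : (i <= n)%N -> (j <= n)%N -> i != j ->
  ip (fs i z) (conj_cmx (fs j z)) = 0.
Proof.
wlog ij : i j / (j < i)%N.
  move=> H iN jN ij; case: (ltngtP i j) => [ji||E]; last by rewrite E eqxx in ij.
    have := H j i ji jN iN; rewrite eq_sym => /(_ ij) E.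
    rewrite -[fs i z]conj_cmxK ip_conj ipC E conjc0 //.
  by move=> ?; exact: H.
move=> iN jN _; have ii : (1 <= i <= n)%N by lia.
by have [H _] := hermitian_steps hn hf top0 hs nb ii; exact: H.
Qed.

Definition re_normsq j z : R := complex.Re (normsq (fs j z)).

Lemma re_normsqE j z : (1 <= j < n)%N -> normsq (fs j z) = (re_normsq j z)%:C%C /\
  [/\ ipR (ReV (fs j z)) (ReV (fs j z)) = re_normsq j z / 2,
      ipR (ImV (fs j z)) (ImV (fs j z)) = re_normsq j z / 2 &
      ipR (ReV (fs j z)) (ImV (fs j z)) = 0].
Proof.
move=> jn.
have I0 : ip (fs j z) (fs j z) = 0 by apply: (fs_isotropic hn hf top0 hs nb); lia.
rewrite ip_parts in I0; move: I0 => /eqP; rewrite eq_complex /= => /andP[/eqP A /eqP B].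
rewrite (ipRC (ImV _)) in B.
rewrite /re_normsq /normsq ip_conj_parts /= (ipRC (ImV _) (ReV _)) subrr; split=> //.
move: A B; move: (ipR _ _) (ipR _ _) (ipR _ _) => p q r A B.
by split; lra.
Qed.

(** f_j is null, so its real and imaginary parts are orthogonal with equal
    squares; two orthogonal timelike vectors are impossible. *)
Lemma re_normsq_gt0 j z : (1 <= j < n)%N -> 0 < re_normsq j z.
Proof.
move=> jn; have [N [A B D]] := re_normsqE z jn.
have jn' : (j < n)%N by lia.
have := normsq_neq0 hn hf top0 hs nb z jn'; rewrite N => H0.
have {}H0 : re_normsq j z != 0 by apply: contra H0 => /eqP ->.
rewrite lt_neqAle eq_sym H0 /= leNgt; apply/negP => neg.
have v0 : ipR (ReV (fs j z)) (ReV (fs j z)) < 0 by rewrite A; lra.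
have [+ _] := timelike_orth v0 D.
by rewrite B; lra.
Qed.

(** Gives the real and imaginary parts unit length, so that the null vector of
    the frame in block j is the multiple of f_j with hermitian norm 2. *)
Definition unit_scale j z : R := Num.sqrt (2 / re_normsq j z).

(** Extended by 0 outside the range, so that smoothness holds for every index. *)
Definition frame_cols z (i : nat) : vecR :=
  if (i < n.*2.-1)%N then
    if i == 0%N then f z
    else unit_scale (uphalf i) z *: (if odd i then ReV else ImV) (fs (uphalf i) z)
  else 0.

Lemma unit_scale2 j z : (1 <= j < n)%N -> unit_scale j z * unit_scale j z * (re_normsq j z / 2) = 1.
Proof.
move=> jn; have H0 := re_normsq_gt0 z jn.
rewrite -expr2 sqr_sqrtr ?divr_ge0// ?ltW//; field; lra.
Qed.

Lemma fs_parts i j z : (1 <= i < n)%N -> (1 <= j < n)%N -> i != j ->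
  [/\ ipR (ReV (fs i z)) (ReV (fs j z)) = 0, ipR (ImV (fs i z)) (ImV (fs j z)) = 0,
      ipR (ReV (fs i z)) (ImV (fs j z)) = 0 & ipR (ImV (fs i z)) (ReV (fs j z)) = 0].
Proof.
move=> iN jN ij.
have I0 : ip (fs i z) (fs j z) = 0 by apply: (fs_isotropic hn hf top0 hs nb); lia.
have I1 : ip (fs i z) (conj_cmx (fs j z)) = 0 by apply: fs_hermitian => //; lia.
rewrite ip_parts in I0; rewrite ip_conj_parts in I1.
move: I0 I1 => /eqP + /eqP; rewrite !eq_complex /=.
move: (ipR _ _) (ipR _ _) (ipR _ _) (ipR _ _) => p q r s.
by move=> /andP[/eqP ? /eqP ?] /andP[/eqP ? /eqP ?]; split; lra.
Qed.

Lemma f_parts j z : (1 <= j < n)%N ->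
  ipR (f z) (ReV (fs j z)) = 0 /\ ipR (f z) (ImV (fs j z)) = 0.
Proof.
move=> jn; have I0 : ip (fs 0 z) (fs j z) = 0.
  by apply: (fs_isotropic hn hf top0 hs nb); lia.
rewrite (fs0 hs) ip_parts in I0.
have E1 : ReV (cplx f z) = f z by apply/colP => i; rewrite !mxE.
have E2 : ImV (cplx f z) = 0 by apply/colP => i; rewrite !mxE.
have r0 y : ipR 0 y = 0 :> R by rewrite -(scale0r 0) ipRZl mul0r.
move: I0; rewrite E1 E2 !r0 subr0 addr0 => /eqP; rewrite eq_complex /=.
by move=> /andP[/eqP -> /eqP ->].
Qed.

Lemma ipRZr a (x y : vecR) : ipR x (a *: y) = a * ipR x y.
Proof. by rewrite ipRC ipRZl ipRC. Qed.

Lemma ipR_ff z : ipR (f z) (f z) = 1.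
Proof. by have := ip_ff hf z; rewrite ip_cmx => -[]. Qed.

Lemma frame_cols_orth z i j : (i < n.*2.-1)%N -> (j < n.*2.-1)%N ->
  ipR (frame_cols z i) (frame_cols z j) = (i == j)%:R.
Proof.
move=> ii jj; rewrite /frame_cols ii jj.
have [i0|i0] := eqVneq i 0%N; have [j0|j0] := eqVneq j 0%N.
- by rewrite i0 j0 eqxx ipR_ff.
- have kj : (1 <= uphalf j < n)%N by lia.
  have [A B] := f_parts z kj.
  by rewrite i0 eq_sym (negbTE j0) ipRZr; case: (odd j); rewrite ?A ?B mulr0.
- have ki : (1 <= uphalf i < n)%N by lia.
  have [A B] := f_parts z ki.
  by rewrite j0 (negbTE i0) ipRZl ipRC; case: (odd i); rewrite ?A ?B mulr0.
have ki : (1 <= uphalf i < n)%N by lia.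
have kj : (1 <= uphalf j < n)%N by lia.
rewrite ipRZl ipRZr.
have [kk|kk] := eqVneq (uphalf i) (uphalf j); last first.
  have [A B D E] := fs_parts z ki kj kk.
  have -> : (i == j) = false by apply/negbTE; apply: contra kk => /eqP ->.
  by case: (odd i); case: (odd j); rewrite ?A ?B ?D ?E !mulr0.
have [_ [A B D]] := re_normsqE z ki; have M := unit_scale2 z ki.
have ij : (i == j) = (odd i == odd j).
  apply/eqP/eqP => [->//|oij]; move: kk oij i0 j0 ii jj; lia.
rewrite ij -kk; case: (odd i); case: (odd j); rewrite /= ?A ?B ?D ?(ipRC (ImV _)) ?D ?mulr0//;
  by rewrite mulrA.
Qed.

Lemma smooth_frame_cols i : smV (fun z => frame_cols z i).
Proof.
rewrite /frame_cols; have [ii|_] := boolP (i < n.*2.-1)%N; last exact: smV_cst.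
have [i0|i0] := eqVneq i 0%N; first exact: superconformal_smooth.
have ki : (1 <= uphalf i < n)%N by lia.
have kn : (uphalf i <= n)%N by lia.
have sk := smooth_fs hn hf top0 hs nb kn.
have sH : smooth (re_normsq (uphalf i)) by exact: (smooth_ip sk (smooth_cmat_conj sk)).1.
have H0 z := re_normsq_gt0 z ki.
have H1 z : re_normsq (uphalf i) z != 0 by rewrite gt_eqF.
have sq : smooth (fun z => 2 * (re_normsq (uphalf i) z)^-1).
  exact: (smoothM (smooth_cst 2) (smoothV sH H1)).
have q0 z : 0 < 2 * (re_normsq (uphalf i) z)^-1 by rewrite divr_gt0.
have sm : smooth (unit_scale (uphalf i)) := smooth_sqrt sq q0.
apply: (smV_scale sm); case: (odd i); apply: smooth_cmat_cmx.
  exact: smooth_cmat_Re.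
exact: smooth_cmat_Im.
Qed.

Definition adapted_frame z : matR := frame (frame_cols z).

Lemma smooth_adapted_frame : smooth_mx adapted_frame.
Proof. exact: (smooth_frame frame_cols_orth smooth_frame_cols). Qed.

Lemma SO1_adapted_frame z : SO1 (adapted_frame z).
Proof. exact: (frame_SO1 hn (frame_cols_orth z)). Qed.

Lemma adapted_frame_e1 z : adapted_frame z *m @e1 R n = f z.
Proof.
have n0 : (@ord0 n.*2 < n.*2.-1)%N by rewrite /=; move: hn; lia.
rewrite -colE; have -> := frame_col hn (frame_cols z) n0.
by rewrite /frame_cols; have -> : (0 < n.*2.-1)%N = true by exact: n0.
Qed.

End AdaptedFrame.

End AdaptedFrames.

(** * The adapted frame is primitive *)

Module Import AdaptedPattern.

Section AdaptedPattern.
Variables (R : realType) (n : nat).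
Hypothesis hn : (1 <= n)%N.
Notation C := R[i].
Notation I := 'I_(n.*2.+1).
Notation vecR := 'cV[R]_(n.*2.+1).
Notation vecC := 'cV[C]_(n.*2.+1).
Notation matC := 'M[C]_(n.*2.+1).
Notation matR := 'M[R]_(n.*2.+1).
Notation dCm := (mx_der (@dC R)).
Notation star := (star hn).
Notation cj := (cj hn).
Notation null_mx := (null_mx R hn).
Notation null_inv := (null_inv R hn).
Notation null_gram := (null_gram R hn).
Notation null_pair := (@null_pair R n).
Notation Ups := (ups C n.*2).
Notation gr := (@gr n).
Notation grade1 := (@grade1 n).
Notation low_idx := (low_idx n).
Notation degree01 := (@degree01 R n).
Notation null_form := (null_form hn).

Lemma ip_cols (A B : matC) a b : (A^T *m Ups *m B) a b = ip (col a A) (col b B).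
Proof.
rewrite /ip [LHS]mxE [RHS]mxE; apply: eq_bigr => k _.
by rewrite !mulr_ups [A^T _ _]mxE [(col a A)^T _ _]mxE !mxE.
Qed.

Section OneFrame.
Variable F : R * R -> matR.
Hypothesis sF : smooth_mx F.
Hypothesis oF : forall z, SO1 (F z).

Definition null_frame z : matC := cmx (F z) *m null_mx.
Notation Phi := null_frame.

Lemma Phi_gram z a b : ip (col a (Phi z)) (col b (Phi z)) = null_gram a b.
Proof.
rewrite -ip_cols; congr ((_ : matC) a b).
have L (G U S P : matC) : G^T *m P *m G = P -> U^T *m P *m U = S ->
    (G *m U)^T *m P *m (G *m U) = S.
  by move=> E1 E2; rewrite trmx_mul -E2 -{2}E1 !mulmxA.
exact: L (SO1_cmx (oF z)) (gram_null_mx R hn).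
Qed.

Lemma Phi_conj z a : conj_cmx (col a (Phi z)) = col (cj a) (Phi z).
Proof.
apply/colP => i; rewrite !mxE rmorph_sum; apply: eq_bigr => k _.
rewrite rmorphM /= -!conj_null_mx; congr (_ * _).
by rewrite mxE conj_real.
Qed.

Local Opaque MC.

(** Reads the entries of F^-1 F_z as scalar products of null vectors with
    derivatives of null vectors. *)
Lemma null_form_ip z a b :
  null_pair a * null_form F z a b = ip (col (star a) (Phi z)) (dCm (fun w => col b (Phi w)) z).
Proof.
have sG := smooth_cmat_cmx sF.
have D : dCm Phi z = Phi z *m null_form F z.
  have A := mx_der_mulr (derivation_dC R) null_mx z sG.
  rewrite (dz_frame oF z) in A.
  have L (G M : matC) : G *m M *m null_mx = G *m null_mx *m (null_inv *m M *m null_mx).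
    by rewrite !mulmxA -[G *m null_mx *m null_inv]mulmxA null_mxK mulmx1.
  exact: (etrans A (L _ _)).
have -> : dCm (fun w => col b (Phi w)) z = col b (dCm Phi z).
  apply/colP => i; rewrite !mxE; congr (dC _ z).
  by apply/funext => w; rewrite mxE.
rewrite D -ip_cols.
have L (G S P B : matC) c : G^T *m P *m G = S -> (G^T *m P *m (G *m B)) c b = (S *m B) c b.
  by move=> <-; rewrite !mulmxA.
have E : (Phi z)^T *m Ups *m Phi z = null_gram.
  by apply/matrixP => x y; rewrite ip_cols Phi_gram.
by rewrite (L _ _ _ _ _ E) mul_null_gram starK null_pair_star.
Qed.

End OneFrame.

Variable f : R * R -> 'cV[R]_(n.*2.+1).
Hypothesis hf : superconformal f.
Hypothesis top0 : forall z, ip (dzn n f z) (dzn n f z) != 0.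
Variable fs : nat -> R * R -> vecC.
Hypothesis hs : harmonic_sequence f fs.
Hypothesis nb : forall j z, (j < n)%N -> ~ (fs j z <> 0 /\ normsq (fs j z) = 0).

Notation adapted_frame := (adapted_frame f fs).
Notation Phi := (null_frame adapted_frame).

Definition unit_scaleC j z : C := if j == 0%N then 1 else (unit_scale fs j z)%:C%C.

Lemma unit_scaleC_neq0 j z : (j < n)%N -> unit_scaleC j z != 0.
Proof.
move=> jn; rewrite /unit_scaleC; have [_|j0] := eqVneq j 0%N; first exact: oner_neq0.
have jn' : (1 <= j < n)%N by lia.
have M := unit_scale2 hn hf top0 hs nb z jn'.
have : unit_scale fs j z != 0 by apply: contra_eq_neq M => ->; rewrite !mul0r eq_sym oner_eq0.
by apply: contra => /eqP[->].
Qed.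

Lemma smooth_unit_scaleC j : (j < n)%N -> smoothC (unit_scaleC j).
Proof.
move=> jn; rewrite /unit_scaleC; have [_|j0] := eqVneq j 0%N; first exact: smoothC_cst.
have ki : (1 <= j < n)%N by lia.
have sk := smooth_fs hn hf top0 hs nb (ltnW jn).
have sH : smooth (re_normsq fs j) by exact: (smooth_ip sk (smooth_cmat_conj sk)).1.
have H0 z := re_normsq_gt0 hn hf top0 hs nb z ki.
have H1 z : re_normsq fs j z != 0 by rewrite gt_eqF.
have sq : smooth (fun z => 2 * (re_normsq fs j z)^-1).
  exact: (smoothM (smooth_cst 2) (smoothV sH H1)).
have q0 z : 0 < 2 * (re_normsq fs j z)^-1 by rewrite divr_gt0.
exact: (smoothC_real (smooth_sqrt sq q0)).
Qed.

(** The choice of the frame columns: the first null vector of block j is a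
    multiple of f_j, and its conjugate the second. *)
Lemma Phi_low j z : (j < n)%N -> col (low_idx j) (Phi z) = unit_scaleC j z *: fs j z.
Proof.
move=> jn; rewrite /null_frame colE -mulmxA -colE col_null_mx.
have fc (a : I) : (a < n.*2.-1)%N -> cmx (adapted_frame z) *m basis_vec R a = cmx (frame_cols f fs z a).
  move=> an; rewrite -(frame_col hn _ an) /basis_vec -colE.
  by apply/colP => i; rewrite !mxE.
have vj := val_low_idx hn (ltnW jn).
have [j0|j0] := eqVneq j 0%N.
  have -> : low_idx j == ord0 by rewrite -val_eqE /= vj j0.
  have n0 : (0 < n.*2.-1)%N by move: hn; lia.
  by rewrite /unit_scaleC j0 eqxx scale1r (fs0 hs) fc// /frame_cols /= n0.
have b0 : (low_idx j == ord0) = false by apply/negbTE; rewrite -val_eqE /= vj; lia.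
rewrite b0 mulmxDr -scalemxAr.
have ob : odd (low_idx j) by rewrite vj; lia.
have ub : uphalf (low_idx j) = j by rewrite vj; lia.
have vl : lo hn (low_idx j) = j.*2.-1 :> nat by rewrite val_lo ob vj.
have vh : hi hn (low_idx j) = j.*2 :> nat by rewrite val_hi ob vj; move: j0; rewrite /starn; ilia.
have sgE : null_sign R (low_idx j) = 'i%C by rewrite /null_sign ob ub /null_unit ifF//; lia.
rewrite sgE !fc ?vl ?vh; try lia.
have l1 : (j.*2.-1 < n.*2.-1)%N by lia.
have l2 : (j.*2 < n.*2.-1)%N by lia.
have l3 : (j.*2.-1 == 0)%N = false by lia.
have l4 : (j.*2 == 0)%N = false by lia.
rewrite /unit_scaleC (negbTE j0) /frame_cols l1 l2 l3 l4.
have -> : odd j.*2.-1 = true by lia.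
have -> : odd j.*2 = false by lia.
have -> : uphalf j.*2.-1 = j by lia.
have -> : uphalf j.*2 = j by lia.
rewrite [in RHS](ReImV (fs j z)).
have cZ (c : R) (x : vecR) : cmx (c *: x) = c%:C%C *: cmx x.
  by apply/colP => i; rewrite !mxE rmorphM.
rewrite !cZ scalerDr !scalerA; congr (_ + _ *: _); exact: mulrC.
Qed.

Let sF := smooth_adapted_frame hn hf top0 hs nb.
Let oF := SO1_adapted_frame hn hf top0 hs nb.

Lemma Phi_low_conj j z : (j < n)%N ->
  col (cj (low_idx j)) (Phi z) = unit_scaleC j z *: conj_cmx (fs j z).
Proof.
move=> jn; rewrite -Phi_conj Phi_low// conj_scale; congr (_ *: _).
by rewrite /unit_scaleC; case: (j == 0%N); [exact: conjc1|exact: conj_real].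
Qed.

Lemma orth_top c j z : gr c = n -> (j < n)%N ->
  ip (col c (Phi z)) (fs j z) = 0 /\ ip (col c (Phi z)) (conj_cmx (fs j z)) = 0.
Proof.
move=> gc jn; have m0 := unit_scaleC_neq0 z jn; have gj := gr_low_idx hn (ltnW jn).
have H b : gr b <> n -> ip (col c (Phi z)) (col b (Phi z)) = 0.
  move=> gb; rewrite (Phi_gram oF) mxE; case: (b =P star c) => [E|_]; last by rewrite mulr0n.
  by exfalso; apply: gb; rewrite E gr_star gc; ilia.
have H1 : gr (low_idx j) <> n by rewrite gj; lia.
have H2 : gr (cj (low_idx j)) <> n by rewrite gr_cj gr_star gj; ilia.
have := H _ H1; have := H _ H2; rewrite Phi_low_conj// Phi_low// !ipZr.
by move=> /eqP + /eqP; rewrite !mulf_eq0 (negbTE m0) /= => /eqP -> /eqP ->.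
Qed.

(** The recursion of the harmonic sequence. *)
Lemma dPhi_low j z : (j < n)%N -> exists x y,
  dCm (fun w => col (low_idx j) (Phi w)) z = x *: fs j z + y *: fs j.+1 z.
Proof.
move=> jn; have sm := smooth_unit_scaleC jn; have sj := smooth_fs hn hf top0 hs nb (ltnW jn).
have E : (fun w => col (low_idx j) (Phi w)) = (fun w => unit_scaleC j w *: fs j w).
  by apply/funext => w; exact: Phi_low.
have A := mx_der_scale (derivation_dC R) z sm sj.
rewrite (fs_step hn hf top0 hs nb z jn) in A.
exists (dC (unit_scaleC j) z + unit_scaleC j z * proj_coef fs j z), (unit_scaleC j z).
rewrite E A; move: (dC _ _) (unit_scaleC j z) (proj_coef _ _ _) (fs j z) (fs j.+1 z) => p q r u v.
by apply/colP => i; rewrite !mxE; ring.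
Qed.

(** The conjugate of dbar f_j, which is a multiple of f_(j-1). *)
Lemma dPhi_high j z : (1 <= j < n)%N -> exists x y,
  dCm (fun w => col (cj (low_idx j)) (Phi w)) z =
  x *: conj_cmx (fs j z) + y *: conj_cmx (fs j.-1 z).
Proof.
move=> jn; have jn' : (j < n)%N by lia.
have sm := smooth_unit_scaleC jn'; have sj := smooth_fs hn hf top0 hs nb (ltnW jn').
have E : (fun w => col (cj (low_idx j)) (Phi w)) = (fun w => unit_scaleC j w *: conj_cmx (fs j w)).
  by apply/funext => w; exact: Phi_low_conj.
have A := mx_der_scale (derivation_dC R) z sm (smooth_cmat_conj sj).
have [C1 _] := mx_der_conj z sj.
have jn2 : (1 <= j <= n)%N by lia.
have [_ [b _ Eb]] := hermitian_steps hn hf top0 hs nb jn2.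
rewrite Eb conj_scale in C1; rewrite C1 in A.
exists (dC (unit_scaleC j) z), (unit_scaleC j z * ((b z)^*)%C).
by rewrite E A scalerA.
Qed.

Lemma gr_class (a : I) : [\/ exists2 j, (j < n)%N & a = low_idx j, gr a = n |
  exists2 j, (1 <= j < n)%N & a = cj (low_idx j)].
Proof.
have [ga|ga] := ltnP (gr a) n.
  by apply: Or31; exists (gr a) => //; exact: low_idx_uniq.
have [ga'|ga'] := eqVneq (gr a) n; first exact: Or32.
apply: Or33; have ma := gr_max hn a.
have gs : gr (star a) = (n.*2 - gr a)%N by rewrite gr_star; ilia.
have gl : (gr (star a) < n)%N by rewrite gs; lia.
exists (gr (star a)); first by rewrite gs; lia.
rewrite -(low_idx_uniq hn gl erefl) (cj_low hn) ?starK// gs; lia.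
Qed.

(** The derivative of f_j is a combination of f_j and its successor, that of
    the conjugate of f_j a combination of the conjugates of f_j and of its
    predecessor. The columns of the two real null vectors follow from the
    others by antisymmetry. *)
Lemma adapted_frame_degree01 z : degree01 (null_form adapted_frame z).
Proof.
move=> a b gab g1.
(* an entry vanishes with the corresponding scalar product *)
have red c d : ip (col (star c) (Phi z)) (dCm (fun w => col d (Phi w)) z) = 0 -> null_form adapted_frame z c d = 0.
  move=> H; have E := null_form_ip sF oF z c d; rewrite H in E.
  by move/eqP: E; rewrite mulf_eq0 (negbTE (null_pair_neq0 R c)) => /eqP.
have low c j : (j < n)%N -> gr c <> j -> gr c <> j.+1 -> null_form adapted_frame z c (low_idx j) = 0.
  move=> jn g0 gS; apply: red; have [x [y ->]] := dPhi_low z jn.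
  rewrite ipDr !ipZr.
  suff [-> ->] : ip (col (star c) (Phi z)) (fs j z) = 0 /\
      ip (col (star c) (Phi z)) (fs j.+1 z) = 0 by rewrite !mulr0 addr0.
  have gc := gr_star hn c; have mc := gr_max hn c.
  case: (gr_class (star c)) => [[i iN E]|gsc|[i iN E]].
  - rewrite E Phi_low// !ipZl.
    have gi := gr_low_idx hn (ltnW iN); rewrite -E in gi.
    rewrite !(fs_isotropic hn hf top0 hs nb) ?mulr0//; try lia.
    by move: gc g0; rewrite gi; ilia.
  - have [H1 _] := orth_top z gsc jn; split=> //.
    have jn1 : (j.+1 < n)%N by move: gc gS; rewrite gsc; ilia.
    by have [] := orth_top z gsc jn1.
  have iN' : (i < n)%N by lia.
  have gi : gr (star c) = (n.*2 - i)%N.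
    by rewrite E gr_cj gr_star (gr_low_idx hn (ltnW iN')); ilia.
  rewrite E Phi_low_conj// !ipZl ![ip (conj_cmx _) _]ipC.
  rewrite !(fs_hermitian hn hf top0 hs nb) ?mulr0//; try lia.
    by move: gc gS; rewrite gi; ilia.
  by move: gc g0; rewrite gi; ilia.
have high c j : (1 <= j < n)%N -> gr c <> (n.*2 - j)%N ->
    gr c <> (if j == 1 then 0 else n.*2 - j.-1)%N -> null_form adapted_frame z c (cj (low_idx j)) = 0.
  move=> jn g0 gS; apply: red; have [x [y ->]] := dPhi_high z jn.
  rewrite ipDr !ipZr.
  suff [-> ->] : ip (col (star c) (Phi z)) (conj_cmx (fs j z)) = 0 /\
      ip (col (star c) (Phi z)) (conj_cmx (fs j.-1 z)) = 0 by rewrite !mulr0 addr0.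
  have gc := gr_star hn c; have mc := gr_max hn c.
  have jn' : (j < n)%N by lia.
  have jn1 : (j.-1 < n)%N by lia.
  case: (gr_class (star c)) => [[i iN E]|gsc|[i iN E]].
  - rewrite E Phi_low// !ipZl.
    have gi := gr_low_idx hn (ltnW iN); rewrite -E in gi.
    rewrite !(fs_hermitian hn hf top0 hs nb) ?mulr0//; try lia.
      by move: gc gS; rewrite gi; ilia.
    by move: gc g0; rewrite gi; ilia.
  - by have [_ H1] := orth_top z gsc jn'; have [_ H2] := orth_top z gsc jn1.
  have iN' : (i < n)%N by lia.
  rewrite E Phi_low_conj// !ipZl !ip_conj.
  by rewrite !(fs_isotropic hn hf top0 hs nb) ?conjc0 ?mulr0//; lia.
have nontop c d : gr c <> gr d -> ~~ grade1 c d -> gr d <> n -> null_form adapted_frame z c d = 0.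
  rewrite /RootIndices.grade1 /nextg => gcd + dn.
  case: (gr_class d) => [[j jn E]|//|[j jn E]].
    move: gcd; rewrite E (gr_low_idx hn (ltnW jn)) => gcd /eqP H; apply: low => //.
    by move: H jn; ilia.
  have jn' : (j < n)%N by lia.
  have gj : gr (cj (low_idx j)) = (n.*2 - j)%N.
    by rewrite gr_cj gr_star (gr_low_idx hn (ltnW jn')); ilia.
  move: gcd; rewrite E gj => gcd /eqP H; apply: high => //.
  by move: H jn; ilia.
(* columns of degree n: the entry is minus that at the paired position *)
have [gb|/eqP gb] := eqVneq (gr b) n; last exact: nontop.
have ga : gr a <> n by move=> E; apply: gab; rewrite gb.
have S := antisymS_E (star a) b (antisym_null_form hn sF oF z).
have B0 : null_form adapted_frame z (star b) (star a) = 0.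
  have ma := gr_max hn a.
  apply: nontop; last by rewrite gr_star; ilia.
    by rewrite !gr_star gb; ilia.
  by rewrite grade1_star.
apply/eqP; have := S; rewrite starK => /esym/eqP; rewrite B0 mulr0 oppr_eq0.
by rewrite mulf_eq0 (negbTE (null_pair_neq0 R _)).
Qed.

End AdaptedPattern.

End AdaptedPattern.

(** * Lifts, frames and the theorem *)

Section Conclusion.
Variables (R : realType) (n : nat).
Hypothesis hn : (1 <= n)%N.
Notation C := R[i].
Notation matC := 'M[C]_(n.*2.+1).
Notation matR := 'M[R]_(n.*2.+1).
Notation degree01 := (@degree01 R n).
Notation null_form := (null_form hn).
Notation root_coef := (root_coef hn).
Notation coset := (@Defs.coset R n).
Notation e1 := (@e1 R n).
Notation rootvec := (@rootvec R n).

(** Modulo 2 every degree is 0 or 1. *)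
Lemma degree01_n1 (B : matC) : n = 1%N -> degree01 B.
Proof.
move=> n1 a b gab /negP[]; rewrite /grade1 /nextg.
by have := gr_max hn a; have := gr_max hn b; move: gab n1; ilia.
Qed.

Lemma torus_e1 (t : matR) : torus t -> t *m e1 = e1.
Proof.
move=> [bd t0 _ _]; rewrite /Defs.e1 -colE; apply/colP => a; rewrite !mxE.
have [->|a0] := eqVneq a ord0; first by rewrite t0 eqxx.
rewrite bd//=; move: a0; rewrite -val_eqE /=; lia.
Qed.

Section Lift.
Variables (psi : R * R -> set matR).

Lemma frames_torus F F' : is_frame psi F -> is_frame psi F' ->
  exists2 t : R * R -> matR, (forall z, torus (t z)) & forall z, F' z = F z *m t z.
Proof.
move=> [_ pF] [_ pF'].
have ex z : exists t, torus t /\ F' z = F z *m t.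
  have [|t tt E] := @coset_eq R n hn (F' z) (F z); last by exists t.
  by rewrite -(pF z).2 -(pF' z).2.
by have [t Ht] := choice ex; exists t => z; case: (Ht z).
Qed.

Lemma primitive_degree01 F : primitive psi -> is_frame psi F -> forall z, degree01 (null_form F z).
Proof.
move=> [F1 fF1 H] fF z; have [n1|n1] := eqVneq n 1%N; first exact: degree01_n1.
move: H; rewrite (negbTE n1) => -[c rc].
have [t tt E] := frames_torus fF1 fF.
have [s1 p1] := fF1; have [s2 p2] := fF.
apply: (frame_change_degree01 s1 s2 (fun z => (p1 z).1) (fun z => (p2 z).1) E tt).
exact: root_coefs_degree01 rc.
Qed.

Lemma frame_e1 f F : is_lift f psi -> is_frame psi F -> forall z, F z *m e1 = f z.
Proof.
move=> lf [_ pF] z; have [g [og E <-]] := lf z.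
have [|t tt ->] := @coset_eq R n hn (F z) g; first by rewrite -E (pF z).2.
by rewrite -mulmxA torus_e1.
Qed.

Lemma lift_top_ip f F z : is_lift f psi -> primitive psi -> is_frame psi F ->
  ip (dzn n f z) (dzn n f z) = top_cst R hn * root_product (fun k => root_coef F k z).
Proof.
move=> lf pp fF; have [sF pF] := fF.
exact: (top_ip_coef sF (fun z => (pF z).1) (frame_e1 lf fF) (primitive_degree01 pp fF)).
Qed.

Lemma cyclic_top_ip f : is_lift f psi -> cyclic_primitive psi ->
  exists z, ip (dzn n f z) (dzn n f z) != 0.
Proof.
move=> lf [pp [F [c [fF rc [z cz]]]]]; exists z.
rewrite (lift_top_ip z lf pp fF) mulf_neq0 ?top_cst_neq0//; apply/root_product_neq0 => k.
by rewrite -(root_coefsE hn k z rc); apply/eqP; exact: cz.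
Qed.

End Lift.

Lemma root_coefs_scale (rv : 'I_n.+1 -> matC) s F c : (forall k, rv k = s k *: rootvec k) ->
  root_coefs rv F c -> root_coefs rootvec F (fun k z => c k z * s k).
Proof.
move=> E rc z; have [H tH ->] := rc z; exists H => //; congr (_ + _).
by apply: eq_bigr => k _; rewrite E scalerA.
Qed.

(** The scale factors of the chosen root vectors are moved into the
    coefficients, both of the frame and of W. *)
Lemma Toda_of_normalised (f : R * R -> 'cV[R]_(n.*2.+1)) psi rv r W : harmonic_map f -> is_lift f psi ->
  cyclic_element rv r W -> normalised_element psi rv r -> exists F, Toda_frame psi W F.
Proof.
move=> hf lf [Hs r0 _ WE] [cp [F [c [fF rc norm]]]].
have ex k : exists s : C, s <> 0 /\ rv k = s *: rootvec k.
  by have [s s0 E] := Hs k; exists s.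
have [s Hs'] := choice ex; have s0 k := (Hs' k).1; have sE k := (Hs' k).2.
have rc' := root_coefs_scale sE rc.
have [sF pF] := fF; have oF z := (pF z).1.
have gp z : degree01 (null_form F z) := root_coefs_degree01 hn z rc'.
have rho0 k : r k * s k != 0 by rewrite mulf_neq0//; apply/eqP; [exact: r0|exact: s0].
have norm' z : root_product (fun k => root_coef F k z) = root_product (fun k => r k * s k).
  rewrite root_productM -(norm z) -root_productM; congr root_product.
  by apply/funext => k; rewrite -(root_coefsE hn k z rc').
have hF : n = 1%N -> exists2 f, harmonic_map f & forall z, F z *m e1 = f z.
  by move=> _; exists f => //; exact: frame_e1 lf fF.
have WE' : to_null hn W = root_sum hn (fun k => r k * s k).
  rewrite /root_sum WE; congr (to_null hn _); apply: eq_bigr => k _.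
  by rewrite sE scalerA.
have [F' [sF' oF' cF' HO]] := Toda_frame_exists sF oF gp hF rho0 norm' WE'.
exists F'; split => //; split=> // z; split; first exact: oF'.
by rewrite cF' (pF z).2.
Qed.

(** As the root product is constant and nonzero at one point, no root
    coefficient vanishes. *)
Lemma lift_periodic (f : R * R -> 'cV[R]_(n.*2.+1)) psi F L : is_lift f psi -> cyclic_primitive psi -> is_frame psi F ->
  constant_root_product F -> lattice_periodic L f -> lattice_periodic L psi.
Proof.
move=> lf cp fF [c rc [K HK]] fL.
have [sF pF] := fF; have oF z := (pF z).1.
have E z : ip (dzn n f z) (dzn n f z) = top_cst R hn * K.
  rewrite (lift_top_ip z lf cp.1 fF) -(HK z); congr (_ * root_product _).
  by apply/funext => k; rewrite -(root_coefsE hn k z rc).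
have [z0 H0] := cyclic_top_ip lf cp.
have c0 z k : root_coef F k z != 0.
  have : ip (dzn n f z) (dzn n f z) != 0 by rewrite E -(E z0).
  rewrite (lift_top_ip z lf cp.1 fF) mulf_eq0 negb_or => /andP[_].
  by move=> /root_product_neq0; exact.
have H := coset_periodic sF oF (frame_e1 lf fF) (primitive_degree01 cp.1 fF) c0 fL.
by move=> z w Lw; rewrite (pF _).2 (pF z).2; exact: H.
Qed.

Section PeriodicMap.
Variable f : R * R -> 'cV[R]_(n.*2.+1).
Hypothesis hf : superconformal f.
Variable L : set (R * R).
Hypothesis Llat : is_lattice L.
Hypothesis fL : lattice_periodic L f.

Let sf := superconformal_smooth hf.

Lemma top_ip_cst : exists2 K : C, K != 0 & forall z, ip (dzn n f z) (dzn n f z) = K.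
Proof.
have dL j : lattice_periodic L (dzn j f).
  elim: j => [|j IH]; first by move=> z w Lw; rewrite /dzn /= /cplx fL.
  exact: (mx_der_periodic (smooth_cmat_dzn sf j) IH).
have sd := smooth_cmat_dzn sf n.
have kL : lattice_periodic L (fun z => ip (dzn n f z) (dzn n f z)).
  by move=> z w Lw; rewrite dL.
have hol z := top_ip_holomorphic sf (isotropic hf) (ip_ff hf) (harm hf) z hn.
have cst := holomorphic_periodic_cst Llat kL (smooth_ip sd sd) hol.
exists (ip (dzn n f 0) (dzn n f 0)) => //.
have [_ [_ [z Hz]]] := hf; rewrite prednK// in Hz.
by rewrite -(cst z); apply/eqP.
Qed.

Lemma periodic_constant_product F : cyclic_primitive_frame f F -> constant_root_product F.
Proof.
move=> [psi [lf [pp _] fF]]; have [sF pF] := fF.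
have [K _ HK] := top_ip_cst.
exists (root_coef F).
  exact: (degree01_root_coefs sF (fun z => (pF z).1) (primitive_degree01 pp fF)).
exists (K / top_cst R hn) => z; have := HK z; rewrite (lift_top_ip z lf pp fF) => <-.
by rewrite mulrAC mulfV ?mul1r// top_cst_neq0.
Qed.

Lemma periodic_frame_exists : sequence_everywhere_defined f ->
  exists F, cyclic_primitive_frame f F.
Proof.
move=> [fs [hs nb]]; have [K K0 HK] := top_ip_cst.
have top0 z : ip (dzn n f z) (dzn n f z) != 0 by rewrite HK.
have sF := smooth_adapted_frame hn hf top0 hs nb.
have oF := SO1_adapted_frame hn hf top0 hs nb.
have Fe := adapted_frame_e1 hn f fs.
have gp := adapted_frame_degree01 hn hf top0 hs nb.
have fF : is_frame (fun z => coset (adapted_frame f fs z)) (adapted_frame f fs) by split.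
have rc := degree01_root_coefs sF oF gp.
exists (adapted_frame f fs), (fun z => coset (adapted_frame f fs z)); split=> //.
  by move=> z; exists (adapted_frame f fs z).
split; last first.
  exists (adapted_frame f fs), (root_coef (adapted_frame f fs)); split=> //; exists 0 => k; apply/eqP.
  have := top0 0; rewrite (top_ip_coef sF oF Fe gp) mulf_eq0 negb_or => /andP[_].
  by move=> /root_product_neq0; exact.
exists (adapted_frame f fs) => //; case: ifP => _; last by exists (root_coef (adapted_frame f fs)).
have -> : (fun z => adapted_frame f fs z *m e1) = f by apply/funext => z; exact: Fe.
by case: hf.
Qed.

End PeriodicMap.

End Conclusion.

Theorem corollary3p2 (R : realType) (n : nat) (f : R * R -> 'cV[R]_(n.*2.+1))
    (hn : (1 <= n)%N) (hf : superconformal f)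
    (hdef : sequence_everywhere_defined f) :
  ((exists2 F, cyclic_primitive_frame f F & constant_root_product F) ->
   exists psi : R * R -> set 'M[R]_(n.*2.+1),
     [/\ is_lift f psi, cyclic_primitive psi,
         forall rv r W, cyclic_element rv r W -> normalised_element psi rv r ->
           exists F, Toda_frame psi W F &
         forall L : set (R * R), is_lattice L -> lattice_periodic L f ->
           lattice_periodic L psi]) /\
  (forall L : set (R * R), is_lattice L -> lattice_periodic L f ->
     (exists F, cyclic_primitive_frame f F) /\
     (forall F, cyclic_primitive_frame f F -> constant_root_product F)).
Proof.
split=> [[F [psi [lf cp fF]] cF]|L Llat fL]; last first.
  split; first exact: (periodic_frame_exists hn hf Llat fL hdef).
  by move=> F; exact: (periodic_constant_product hn hf Llat fL).
exists psi; split=> // [rv r W cW nW|L _ fL].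
  exact: (Toda_of_normalised hn hf.1 lf cW nW).
exact: (lift_periodic hn lf cp fF cF fL).
Qed.
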